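(* Let $\alpha\in(0,1)$. There exists a constant $\bar\sigma^*=\bar\sigma^*(\alpha)\in(0,1)$ such that the following is true. Let the temporal mesh $0=t_0<t_1<\dots<t_M=T$ satisfy $$\tau_1\simeq M^{-r},\qquad \tau_j\simeq t_j/j,\qquad t_j\simeq\tau_1j^r\qquad\forall\,j=1,\dots,M$$ for some $r\ge1$, and also $\sigma_j\ge\sigma_{j+1}\ge0$ for all $j\ge2$ and $\sigma_j\in[0,\bar\sigma^*]$ for all $j\ge K+1$, where $1\le K\lesssim1$ (i.e. $K$ is independent of $M$). Suppose that the solution $u$ of $$D_t^\alpha u+\mathcal Lu=f(x,t)\ \text{ in }\Omega\times(0,T],\qquad u=0\ \text{ on }\partial\Omega\times(0,T],\qquad u(x,0)=u_0(x)\ \text{ for }x\in\Omega$$ satisfies $\|\partial_t^lu(\cdot,t)\|_{L_2(\Omega)}\lesssim1+t^{\alpha-l}$ for $l=1,3$ and $t\in(0,T]$. Then for the solution $\{U^m\}$ of $$\delta_t^\alpha U^j+\mathcal LU^j=f(\cdot,t_j)\ \text{ in }\Omega,\quad U^j=0\ \text{ on }\partial\Omega\quad\forall\,j=1,\dots,M;\qquad U^0=u_0,$$ one has $$\|u(\cdot,t_m)-U^m\|_{L_2(\Omega)}\lesssim\mathcal E^m\qquad\forall\,m=1,\dots,M,$$ where $$\mathcal E^m:=\begin{cases}M^{-r}\,t_m^{\alpha-1}&\text{if }1\le r<3-\alpha,\\[2pt] M^{\alpha-3}\,t_m^{\alpha-1}\,[1+\ln(t_m/t_1)]&\text{if }r=3-\alpha,\\[2pt]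 M^{\alpha-3}\,t_m^{\alpha-(3-\alpha)/r}&\text{if }r>3-\alpha.\end{cases}$$
   Context: $\Omega\subset\mathbb R^d$, $d\in\{1,2,3\}$, is a bounded Lipschitz domain and $\mathcal Lu:=\sum_{k=1}^d\{-\partial_{x_k}(a_k(x)\,\partial_{x_k}u)\}+c(x)\,u$ with sufficiently smooth coefficients $a_k$ and $c$ in $C(\bar\Omega)$, $a_k>0$ and $c\ge0$ in $\bar\Omega$. It is assumed that the continuous problem has a unique solution $u$. For a mesh, $\tau_j:=t_j-t_{j-1}$ for $1\le j\le M$ and $\sigma_j:=\frac{\tau_j-\tau_{j-1}}{\tau_j+\tau_{j-1}}$ for $2\le j\le M$; ''$\sigma_j\ge\sigma_{j+1}\ge0$ for all $j\ge2$'' means $\sigma_2\ge\sigma_3\ge\dots\ge\sigma_M\ge0$. $D_t^\alpha w(t):=\frac1{\Gamma(1-\alpha)}\int_0^t(t-s)^{-\alpha}\partial_sw(s)\,ds$ (Caputo derivative). For mesh values $\{U^j\}_{j=0}^M$ (real- or function-valued), $\Pi^mU$ is the following continuous piecewise polynomial (in time) interpolant on $[0,t_m]$. For $m=1$ it is the linear Lagrange interpolant at $t_0,t_1$. For $m\ge2$, on $(t_{j-1},t_j)$ with $1\le j<m$ it is the quadratic Lagrange interpolant at $t_{j-1},t_j,t_{j+1}$, and on $(t_{m-1},t_m)$ it is the quadratic Lagrange interpolant at $t_{m-2},t_{m-1},t_m$. The discrete fractional-derivative operator is $\delta_t^\alpha U^m:=D_t^\alpha(\Pi^mU)(t_m)$,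 $1\le m\le M$. Conventions: $a\lesssim b$ means $a\le Cb$ with a generic positive constant $C$ which may depend on $\Omega,T,u_0,f$ (and on fixed data such as $\alpha$, $r$, $K$, the coefficients of $\mathcal L$ and the constants in the hypotheses), but not on $M$ or on the indices; $a\simeq b$ means $a\lesssim b$ and $b\lesssim a$. *)

(* Defs.v *)
From HB Require Import structures.
From mathcomp Require Import all_boot all_order all_algebra.
From mathcomp Require Import all_classical all_reals all_analysis.

Set Implicit Arguments.
Unset Strict Implicit.
Unset Printing Implicit Defensive.

Import Order.TTheory GRing.Theory Num.Theory.
Import numFieldNormedType.Exports.

Local Open Scope classical_set_scope.
Local Open Scope ring_scope.


Definition rV_display : measure_display.
Proof. exact: default_measure_display. Qed.

Section rV_measurable.
Context (R : realType) (d : nat).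

Definition rV_coord (i : 'I_d) (x : 'rV[R]_d) : R := x 0 i.

Let rV_set0 : g_sigma_preimage rV_coord set0.
Proof. exact: sigma_algebra0. Qed.

Let rV_setC A : g_sigma_preimage rV_coord A -> g_sigma_preimage rV_coord (~` A).
Proof. exact: sigma_algebraC. Qed.

Let rV_bigcup (F : (set 'rV[R]_d)^nat) :
  (forall i, g_sigma_preimage rV_coord (F i)) ->
  g_sigma_preimage rV_coord (\bigcup_i (F i)).
Proof. exact: sigma_algebra_bigcup. Qed.

(* The sigma-algebra generated by the coordinates: the Borel sets of R^d. *)
HB.instance Definition _ := @isMeasurable.Build rV_display
  'rV[R]_d (g_sigma_preimage rV_coord) rV_set0 rV_setC rV_bigcup.

Lemma measurable_rV_coord (i : 'I_d) :
  measurable_fun setT (fun x : 'rV[R]_d => x 0 i).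
Proof.
move=> _ Y mY; rewrite setTI; apply: sub_sigma_algebra => /=.
rewrite -bigcup_seq/=; exists i => /=; first by rewrite mem_index_enum.
by exists Y => //; rewrite setTI.
Qed.

Lemma measurable_fun_rV d' (T : measurableType d') (g : T -> 'rV[R]_d) :
  (forall i, measurable_fun setT (fun x => g x 0 i)) -> measurable_fun setT g.
Proof.
move=> mg.
have sub : g_sigma_preimage rV_coord `<=` [set A | measurable (g @^-1` A)].
  apply: smallest_sub.
    split=> /=.
    - by rewrite preimage_set0.
    - by move=> A mA; rewrite setTD -preimage_setC; exact: measurableC.
    - by move=> F mF; rewrite preimage_bigcup; exact: bigcup_measurable.
  rewrite -bigcup_seq/=; apply: bigcup_sub => i _ A [B mB <-] /=.
  by rewrite setTI -[X in measurable X]setTI; exact: (mg i).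
by move=> _ A mA; rewrite setTI; exact: (sub A mA).
Qed.

End rV_measurable.

Lemma product_sigma_finite (R : realType) d1 d2 (T1 : measurableType d1)
    (T2 : measurableType d2) (m1 : {sigma_finite_measure set T1 -> \bar R})
    (m2 : {sigma_finite_measure set T2 -> \bar R}) :
  sigma_finite setT (m1 \x m2)%E.
Proof.
have /sigma_finiteP[F [TF ndF Foo]] := sigma_finiteT m1.
have /sigma_finiteP[G [TG ndG Goo]] := sigma_finiteT m2.
exists (fun n => F n `*` G n).
  rewrite -setXTT TF TG predeqE => -[x y]; split.
    move=> [/= [n _ Fnx] [k _ Gky]]; exists (maxn n k) => //; split.
    - by move: x Fnx; exact/subsetPset/ndF/leq_maxl.
    - by move: y Gky; exact/subsetPset/ndG/leq_maxr.
  by move=> [n _ []/= ? ?]; split; exists n.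
move=> k; have [? ?] := Foo k; have [? ?] := Goo k.
split; first exact: measurableX.
by rewrite product_measure1E// lte_mul_pinfty// ge0_fin_numE.
Qed.

Section rV_lebesgue_step.
Context (R : realType) (d : nat) (m : {sigma_finite_measure set 'rV[R]_d -> \bar R}).

Definition rV_cons (p : R * 'rV[R]_d) : 'rV[R]_d.+1 :=
  row_mx (const_mx p.1 : 'rV[R]_1) p.2.

Definition rV_uncons (x : 'rV[R]_d.+1) : R * 'rV[R]_d :=
  (x 0 ord0, rsubmx (x : 'rV[R]_(1 + d))).

Lemma rV_consK : cancel rV_cons rV_uncons.
Proof.
move=> [a x]; rewrite /rV_uncons /rV_cons row_mxKr; congr (_, _).
transitivity (row_mx (const_mx a : 'rV[R]_1) x 0 (lshift d ord0)).
  by congr (row_mx _ _ _ _); exact/val_inj.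
by rewrite row_mxEl mxE.
Qed.

Lemma measurable_rV_cons : measurable_fun setT rV_cons.
Proof.
apply: measurable_fun_rV => i.
rewrite -[i](@splitK 1 d); case: (fintype.split _) => j /=.
  apply: (eq_measurable_fun fst); last exact: measurable_fst.
  move=> [a x] _.
  by rewrite [RHS](row_mxEl (const_mx a : 'rV[R]_1)) mxE.
apply: (eq_measurable_fun ((fun x : 'rV[R]_d => x 0 j) \o snd)).
  by move=> [a x] _; rewrite [RHS](row_mxEr (const_mx a : 'rV[R]_1)).
by apply: measurableT_comp => //; exact: measurable_rV_coord.
Qed.

Lemma measurable_rV_uncons : measurable_fun setT rV_uncons.
Proof.
apply/measurable_fun_pairP; split; first exact: measurable_rV_coord.
apply: measurable_fun_rV => i /=.
apply: (eq_measurable_fun (fun x : 'rV[R]_d.+1 => x 0 (rshift 1 i))).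
  by move=> x _; rewrite /= mxE.
exact: measurable_rV_coord.
Qed.

Definition rV_step : set 'rV[R]_d.+1 -> \bar R :=
  pushforward (@lebesgue_measure R \x m)%E rV_cons.

Let rV_step0 : rV_step set0 = 0%E.
Proof. by rewrite /rV_step /pushforward preimage_set0 measure0. Qed.

Let rV_step_ge0 A : (0 <= rV_step A)%E.
Proof. exact: (measure_ge0 (@lebesgue_measure R \x m)%E). Qed.

Let rV_step_sigma_additive : semi_sigma_additive rV_step.
Proof.
have mpre A : measurable A -> measurable (rV_cons @^-1` A).
  by move=> mA; rewrite -[X in measurable X]setTI; exact: measurable_rV_cons.
move=> F mF tF mUF; rewrite /rV_step /pushforward preimage_bigcup.
apply: (@measure_semi_sigma_additive _ _ _ (@lebesgue_measure R \x m)%E).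
- by move=> n; exact: mpre.
- apply/trivIsetP => /= i j _ _ ij; rewrite -preimage_setI.
  by move/trivIsetP : tF => /(_ _ _ _ _ ij) ->//; rewrite preimage_set0.
- by rewrite -preimage_bigcup; exact: mpre.
Qed.

HB.instance Definition _ := isMeasure.Build _ _ _
  rV_step rV_step0 rV_step_ge0 rV_step_sigma_additive.

Let rV_step_sigma_finite : sigma_finite setT rV_step.
Proof.
have [F FT Ffin] : sigma_finite setT (@lebesgue_measure R \x m)%E.
  exact: product_sigma_finite.
exists (fun k => rV_uncons @^-1` F k).
  by rewrite -preimage_bigcup -FT preimage_setT.
move=> k; have [mF Fk] := Ffin k; split.
  by rewrite -[X in measurable X]setTI; exact: measurable_rV_uncons.
rewrite /rV_step /pushforward -comp_preimage.
suff -> : rV_uncons \o rV_cons = id by rewrite preimage_id.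
by apply/funext => p; exact: rV_consK.
Qed.

HB.instance Definition _ := Measure_isSigmaFinite.Build _ _ _
  rV_step rV_step_sigma_finite.

End rV_lebesgue_step.

Fixpoint lebesgue_rV (R : realType) (d : nat) :
    {sigma_finite_measure set 'rV[R]_d -> \bar R} :=
  match d with
  | 0 => dirac (0 : 'rV[R]_0)
  | d'.+1 => rV_step (lebesgue_rV R d')
  end.


Lemma lebesgue_rV_box (R : realType) (d : nat) (A : 'I_d -> set R) :
  (forall i, measurable (A i)) ->
  lebesgue_rV R d [set x | forall i, A i (x 0 i)] =
  (\prod_(i < d) lebesgue_measure (A i))%E.
Proof.
elim: d A => [|d IH] A mA.
  rewrite big_ord0 /= diracE mem_set// => -[]//.
have mbox : measurable [set x : 'rV[R]_d | forall i, A (lift ord0 i) (x 0 i)].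
  rewrite (_ : [set x : 'rV[R]_d | _] =
    \bigcap_(i in [set: 'I_d]) ((fun x => x 0 i) @^-1` A (lift ord0 i))).
    apply: fin_bigcap_measurable => // i _.
    by rewrite -[X in measurable X]setTI; exact: measurable_rV_coord.
  by apply/seteqP; split => [x Ax i _|x Ax i]; [exact: Ax|exact: (Ax i I)].
rewrite big_ord_recl -IH; last by move=> i; exact: mA.
rewrite -product_measure1E//; last exact: mA.
rewrite [LHS]/= /rV_step /pushforward; congr (_ _).
apply/seteqP; split => -[b x] /=.
  move=> h; have consE : rV_uncons (rV_cons (b, x)) = (b, x) by exact: rV_consK.
  case: consE => bE xE; split; first by rewrite -bE; exact: h.
  move=> i; rewrite -xE mxE; have := h (lift ord0 i).
  by rewrite (_ : lift ord0 i = rshift 1 i)//; exact/val_inj.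
case=> Ab Ax i; have [bE xE] : rV_uncons (rV_cons (b, x)) = (b, x) by exact: rV_consK.
have [j ->|->] := unliftP ord0 i; last by rewrite bE.
have := Ax j; rewrite -{1}xE mxE.
by rewrite (_ : rshift 1 j = lift ord0 j)//; exact/val_inj.
Qed.


Section elliptic.
Context (R : realType) (d : nat).
Local Notation V := 'rV[R]_d.
Local Notation mu := (lebesgue_rV R d).
Implicit Types (Om : set V) (f g v w : V -> R).

(* Near each boundary point, in suitable Cartesian coordinates (given by the
   orthogonal matrix Q), Om is the region above the graph of a Lipschitz
   function of the d.-1 coordinates other than the k-th. *)
Definition lipschitz_boundary Om : Prop :=
  forall x, closure Om x -> ~ Om x ->
  exists (Q : 'M[R]_d) (k : 'I_d) (gam : 'rV[R]_d.-1 -> R) (rho : R),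
    [/\ Q *m Q^T = 1%:M, exists L : R, L.-lipschitz gam, 0 < rho &
        forall y, ball x rho y ->
          (Om y <-> gam (col' k (y *m Q)) < (y *m Q) 0 k)].

Definition bounded_lipschitz_domain Om : Prop :=
  [/\ open Om, connected Om, Om !=set0, bounded_set Om & lipschitz_boundary Om].

(* Elements of L_2(Om) are represented by functions on R^d whose values outside
   Om are irrelevant. *)
Definition in_L2 Om f : Prop := (f \_ Om) \in Lfun mu 2%:E.

Definition L2norm Om f : \bar R := 'N[mu]_2%:E[EFin \o (f \_ Om)].

Definition L2dot Om f g : R := \int[mu]_(x in Om) (f x * g x).

Definition partial (k : 'I_d) f : V -> R := fun x => 'D_(delta_mx 0 k) f x.

Definition test_function Om f : Prop :=
  (forall (s : seq 'I_d) x, differentiable (foldr partial f s) x) /\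
  (exists K : set V, [/\ compact K, K `<=` Om & forall x, ~ K x -> f x = 0]).

(* v belongs to H^1_0(Om), the closure of C_c^oo(Om) in the H^1 norm, and g is
   its gradient. *)
Definition H10 Om v (g : 'I_d -> V -> R) : Prop :=
  [/\ in_L2 Om v, forall k, in_L2 Om (g k) &
      exists phi : nat -> V -> R,
        [/\ forall n, test_function Om (phi n),
            L2norm Om (phi n \- v) @[n --> \oo] --> 0%E &
            forall k, L2norm Om (partial k (phi n) \- g k) @[n --> \oo] --> 0%E]].

(* The weak form of  D + L v = F in Om,  v = 0 on the boundary,  where
   L v = sum_k - d_k (a_k d_k v) + c v. *)
Definition weak_solution Om (a : 'I_d -> V -> R) (c D v F : V -> R) : Prop :=
  exists2 g, H10 Om v g &
    forall w h, H10 Om w h ->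
      L2dot Om D w
      + (\sum_(k < d) \int[mu]_(x in Om) (a k x * g k x * h k x)
         + \int[mu]_(x in Om) (c x * v x * w x))
      = L2dot Om F w.

End elliptic.


Definition Gamma (R : realType) (z : R) : R :=
  \int[lebesgue_measure]_(s in `]0, +oo[) (s `^ (z - 1) * expR (- s)).

Section parabolic.
Context (R : realType) (d : nat).
Local Notation V := 'rV[R]_d.
Local Notation mu := (lebesgue_rV R d).
Local Notation leb := (@lebesgue_measure R).
Implicit Types (Om : set V) (u v w : R -> V -> R).

(* w is the time derivative on ]0, T] of v, as functions of time with values in
   L_2(Om) (one-sided at T). *)
Definition L2_deriv Om (T : R) v w : Prop :=
  forall t, 0 < t <= T -> in_L2 Om (w t) /\
    L2norm Om (fun x => (s - t)^-1 * (v s x - v t x) - w t x)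
      @[s --> within `]0, T] t^'] --> 0%E.

Fixpoint L2_deriv_n Om (T : R) (l : nat) u w : Prop :=
  match l with
  | 0 => forall t, 0 < t <= T ->
           in_L2 Om (w t) /\ (forall x, Om x -> u t x = w t x)
  | l'.+1 => exists2 v, L2_deriv_n Om T l' u v & L2_deriv Om T v w
  end.

(* D is the Caputo derivative at time t of a function whose time derivative is
   du; the L_2(Om)-valued integral is determined by its inner products with the
   elements of L_2(Om). *)
Definition L2_caputo Om (alpha : R) (du : R -> V -> R) (t : R) (D : V -> R) :
    Prop :=
  in_L2 Om D /\
  forall v : V -> R, in_L2 Om v ->
    leb.-integrable `]0, t[
      (fun s => ((t - s) `^ (- alpha) * L2dot Om (du s) v)%:E) /\
    L2dot Om D v = (Gamma (1 - alpha))^-1 *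
      \int[leb]_(s in `]0, t[) ((t - s) `^ (- alpha) * L2dot Om (du s) v).

(* The continuity at t = 0 gives the initial condition its meaning. *)
Definition parabolic_solution Om (a : 'I_d -> V -> R) (c : V -> R) (alpha T : R)
    (f : R -> V -> R) (u0 : V -> R) u : Prop :=
  [/\ in_L2 Om (u 0),
      u 0 = u0 %[ae mu in Om],
      L2norm Om (u s \- u 0) @[s --> 0^'+] --> 0%E &
      exists2 du, L2_deriv_n Om T 1 u du &
        forall t, 0 < t <= T -> exists2 D, L2_caputo Om alpha du t D &
          weak_solution Om a c D (u t) (f t)].

Definition unique_parabolic_solution Om (a : 'I_d -> V -> R) (c : V -> R)
    (alpha T : R) (f : R -> V -> R) (u0 : V -> R) u : Prop :=
  parabolic_solution Om a c alpha T f u0 u /\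
  forall v, parabolic_solution Om a c alpha T f u0 v ->
    forall t, 0 < t <= T -> v t = u t %[ae mu in Om].

End parabolic.


Section discrete.
Context (R : realType).
Local Notation leb := (@lebesgue_measure R).
Implicit Types (t : nat -> R) (M m j : nat).

Definition simeq (C a b : R) : Prop := a <= C * b /\ b <= C * a.

Definition mesh_step t j : R := t j - t j.-1.

Definition mesh_sigma t j : R :=
  (mesh_step t j - mesh_step t j.-1) / (mesh_step t j + mesh_step t j.-1).

Definition graded_mesh (T r C : R) M t : Prop :=
  [/\ t 0%N = 0, t M = T,
      forall j, (1 <= j <= M)%N -> 0 < mesh_step t j,
      simeq C (mesh_step t 1) (M%:R `^ (- r)) &
      forall j, (1 <= j <= M)%N ->
        simeq C (mesh_step t j) (t j / j%:R) /\
        simeq C (t j) (mesh_step t 1 * j%:R `^ r)].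

Definition sigma_monotone M t : Prop :=
  (forall j, (2 <= j <= M)%N -> 0 <= mesh_sigma t j) /\
  (forall j, (2 <= j)%N -> (j.+1 <= M)%N -> mesh_sigma t j.+1 <= mesh_sigma t j).

(* Lagrange interpolant of degree k at t_p, ..., t_{p+k}. *)
Definition lagrange t (U : nat -> R) (p k : nat) (s : R) : R :=
  \sum_(i < k.+1) U (p + i)%N *
    \prod_(l < k.+1 | l != i) ((s - t (p + l)%N) / (t (p + i)%N - t (p + l)%N)).

(* The i below is the one with t_i < s <= t_{i+1} (0 < s <= t_m), so that the
   cases i.+1 < m and i.+1 = m correspond to (t_{j-1}, t_j) with j = i.+1. *)
Definition interpolant t (U : nat -> R) m (s : R) : R :=
  let i := count (fun j => t j < s) (iota 1 m) in
  if (m <= 1)%N then lagrange t U 0 1 s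
  else if (i.+1 < m)%N then lagrange t U i 2 s
  else lagrange t U m.-2 2 s.

Definition caputo (alpha : R) (w : R -> R) (t : R) : R :=
  (Gamma (1 - alpha))^-1 *
  \int[leb]_(s in `]0, t[) ((t - s) `^ (- alpha) * derive1 w s).

Definition delta_t (alpha : R) t (U : nat -> R) m : R :=
  caputo alpha (interpolant t U m) (t m).

Definition discrete_solution d (Om : set 'rV[R]_d) (a : 'I_d -> 'rV[R]_d -> R)
    (c : 'rV[R]_d -> R) (alpha : R) (f : R -> 'rV[R]_d -> R)
    (u0 : 'rV[R]_d -> R) M t (U : nat -> 'rV[R]_d -> R) : Prop :=
  [/\ in_L2 Om (U 0%N),
      U 0%N = u0 %[ae lebesgue_rV R d in Om] &
      forall j, (1 <= j <= M)%N ->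
        weak_solution Om a c (fun x => delta_t alpha t (U ^~ x) j) (U j) (f (t j))].

Definition error_rate (alpha r : R) M t m : R :=
  if r < 3 - alpha then M%:R `^ (- r) * t m `^ (alpha - 1)
  else if r == 3 - alpha then
    M%:R `^ (alpha - 3) * t m `^ (alpha - 1) * (1 + ln (t m / t 1%N))
  else M%:R `^ (alpha - 3) * t m `^ (alpha - (3 - alpha) / r).

End discrete.

(* Main.v *)
Require Import Defs.
From mathcomp Require Import all_boot all_order all_algebra.
From mathcomp Require Import all_classical all_reals all_analysis.
From mathcomp Require Import measurable_realfun.
From mathcomp Require Import ring lra zify.

Set Implicit Arguments.
Unset Strict Implicit.
Unset Printing Implicit Defensive.

Import Order.TTheory GRing.Theory Num.Theory.
Import numFieldNormedType.Exports.

Local Open Scope classical_set_scope.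
Local Open Scope ring_scope.

                                                

(** The error e^j = u(t_j) - U^j vanishes at j = 0 and satisfies the scheme with the truncation
    error of [delta_t] as right-hand side, so the estimate is stability plus consistency. In row m
    the operator is 1/Gamma(1-alpha) times the sum of [row_coef] against the increments of U
    ([delta_t_coef]), the coefficients being moments of the kernel (t_m - s)^(-alpha).

    Stability. The row matrix is not an M-matrix: as in BDF2, its limit for alpha -> 1, the
    coefficient of U^(m-2) may be positive. In the variables v^j = e^j - beta e^(j-1) with beta =
    alpha/2 the coefficients become those of [kappa], and when consecutive steps are nearly equal
    they have the right signs ([row_kappa_signs]): positive on the diagonal, nonpositive elsewhere.
    The only delicate indices are the last three; they reduce to numerical inequalities in alpha
    ([row_top]). Testing row m with v^m produces a cross term between the elliptic energies of e^m
    and e^(m-1). It is absorbed by measuring v^j in [energy_norm], which adds the energy of e^j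
    divided by the stiffness of the step; [energy_row] then is a scalar inequality with the same
    coefficients, to which the maximum principle [comparison] applies.

    Barrier. The comparison function is W_j = t_j^(alpha-1) Phi_j with a slowly varying Phi ([bphi],
    [bw]). Integration by parts replaces t_m times the fractional derivative of w by the integral of
    the kernel against s w' + (1-alpha) w, a combination that annihilates s^(alpha-1). What survives
    is s^alpha Phi', which is positive, and [barrier_row] bounds the discrete derivative of W in row
    m below by a multiple of m^(-dl) / t_m for all m beyond a fixed m0.

    Consistency. Paired with a fixed L2 function, u becomes a real function of time, and its
    truncation error is of order m^(-(r+dl)) with dl = min(3-alpha-r, alpha/4) ([truncation_bound]).
    Since t_m is at most a multiple of t_1 m^r, the function t_1 W dominates it, so the error is
    bounded by a multiple of t_1 t_m^(alpha-1) Phi_m. Phi is bounded, logarithmic or a power as dl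
    is positive, zero or negative, which yields the three cases ([barrier_error_rate]). The rows
    below m0, where neither signs nor barrier are available, are finitely many and are handled by
    induction ([crude_estimate]). All this is assembled in [abstract_error_estimate] for two
    abstract semidefinite forms. *)

(** * Improper integrals over open intervals and the fundamental theorem *)

Section improper_integrals.
Context {R : realType}.
Notation leb := (@lebesgue_measure R).
Implicit Types (F f g : R -> R) (a b : R).

Lemma measurable_itv_continuous f a b : {in `]a, b[, continuous f} ->
  measurable_fun `]a, b[ f.
Proof.
move=> cf; apply: open_continuous_measurable_fun; first exact: interval_open.
by move=> x; rewrite inE/=; exact: cf.
Qed.

(** Monotone convergence along closed intervals exhausting the open one: the ordinary fundamental
    theorem holds on each of them, and the one-sided limits of F identify the value. This covers
    integrands that blow up at an end, such as s^(alpha-1) and (t-s)^(-alpha). *)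
Lemma ge0_improper_FTC F f a b : a < b ->
  (forall x, x \in `]a, b[ -> is_derive x 1 F (f x)) ->
  {in `]a, b[, continuous f} -> {in `]a, b[, forall x, 0 <= f x} ->
  F @ a^'+ --> F a -> F @ b^'- --> F b ->
  (\int[leb]_(x in `]a, b[) (f x)%:E = (F b - F a)%:E)%E.
Proof.
move=> ab dF cf f0 Fa Fb.
have cvc : (b - a) / n.+3%:R @[n --> \oo] --> (0 : R).
  rewrite -[X in _ --> X](mulr0 (b - a)); apply: cvgM; first exact: cvg_cst.
  by have := @cvg_harmonic R; rewrite -2!cvg_shiftS.
(* The denominator starts at 3 so that [a + c n < b - c n] holds already for n = 0. *)
pose c (n : nat) : R := (b - a) / n.+3%:R.
have c0 n : 0 < c n by rewrite divr_gt0// ?subr_gt0.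
have cle n : c n <= (b - a) / 3.
  rewrite ler_pM2l ?subr_gt0// lef_pV2 ?posrE//.
  by rewrite ler_nat.
pose S n := `[a + c n, b - c n]%classic.
have Sab n x : S n x -> x \in `]a, b[.
  rewrite /S/= !in_itv/= => /andP[ax xb].
  by rewrite (lt_le_trans _ ax) ?ltrDl//= (le_lt_trans xb)// gtrBl.
have SU : `]a, b[%classic = \bigcup_n S n.
  apply/seteqP; split=> [x|x [n _ /Sab]//].
  rewrite /= in_itv/= => /andP[ax xb].
  have e0 : 0 < Num.min (x - a) (b - x) by rewrite lt_min !subr_gt0 ax xb.
  have /cvgrPdist_lt /(_ _ e0) [N _ /(_ N (leqnn _))] := cvc.
  rewrite sub0r normrN ger0_norm ?(ltW (c0 N))// -/(c N). rewrite lt_min => /andP[h1 h2].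
  exists N => //; rewrite /S/= in_itv/=; apply/andP; split; lra.
have ndS : nondecreasing_seq S.
  apply/nondecreasing_seqP => n; apply/subsetPset => x; rewrite /S/= !in_itv/=.
  have hc : c n.+1 <= c n.
    rewrite ler_pM2l ?subr_gt0// lef_pV2 ?posrE//.
    by rewrite ler_nat.
  by move=> /andP[h1 h2]; apply/andP; split; lra.
have mf : measurable_fun `]a, b[ f by exact: measurable_itv_continuous.
have cv : (\int[leb]_(x in S i) (f x)%:E)%E @[i --> \oo] -->
    (\int[leb]_(x in `]a, b[) (f x)%:E)%E.
  rewrite SU; apply: ge0_nondecreasing_set_cvg_integral => //.
  - by move=> i; exact: measurable_itv.
  - move=> i; apply/measurable_EFinP; apply: measurable_funS mf => //.
    by move=> x /Sab.
  - by move=> i x /Sab xab; rewrite lee_fin f0.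
have ES n : (\int[leb]_(x in S n) (f x)%:E = (F (b - c n) - F (a + c n))%:E)%E.
  have acbc : a + c n < b - c n.
    have := cle n; have := c0 n; lra.
  have sub x : x \in `[a + c n, b - c n] -> x \in `]a, b[ by move=> /Sab.
  rewrite (@continuous_FTC2 _ f F)//.
  - apply: continuous_in_subspaceT => x; rewrite inE => /sub; exact: cf.
  - have cF x : x \in `]a, b[ -> F @ x --> F x.
      move=> xab; apply: differentiable_continuous; apply/derivable1_diffP.
      by have [] := dF _ xab.
    split.
    + move=> x xi; have [] // := dF x _.
      by apply: sub; exact: subset_itv_oo_cc xi.
    + apply: cvg_at_right_filter; apply: cF; apply: sub.
      by rewrite in_itv/= lexx ltW.
    + apply: cvg_at_left_filter; apply: cF; apply: sub.
      by rewrite in_itv/= lexx ltW.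
  - move=> x xi; rewrite derive1E.
    have xab : x \in `]a, b[ by apply: sub; exact: subset_itv_oo_cc xi.
    by have [_ ->] := dF x xab.
apply/esym; apply: (cvg_unique _ _ cv) => //.
rewrite /= (eq_cvg _ _ ES).
apply: cvg_EFin; first by near=> n.
rewrite /comp/=; apply: cvgB.
- move/cvg_at_leftP : Fb; apply; split; first by move=> n; rewrite gtrBl.
  by rewrite -[X in _ --> X]subr0; apply: cvgB => //; exact: cvg_cst.
- move/cvg_at_rightP : Fa; apply; split; first by move=> n; rewrite ltrDl.
  by rewrite -[X in _ --> X]addr0; apply: cvgD => //; exact: cvg_cst.
Unshelve. all: end_near. Qed.

Lemma ge0_improper_FTC_integrable F f a b : a < b ->
  (forall x, x \in `]a, b[ -> is_derive x 1 F (f x)) ->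
  {in `]a, b[, continuous f} -> {in `]a, b[, forall x, 0 <= f x} ->
  F @ a^'+ --> F a -> F @ b^'- --> F b ->
  leb.-integrable `]a, b[ (EFin \o f).
Proof.
move=> ab dF cf f0 Fa Fb; apply/integrableP; split.
  by apply/measurable_EFinP; exact: measurable_itv_continuous.
have -> : (\int[leb]_(x in `]a, b[) `|(EFin \o f) x| =
    \int[leb]_(x in `]a, b[) (f x)%:E)%E.
  by apply: eq_integral => x; rewrite inE/= => xab; rewrite ger0_norm// f0.
by rewrite (ge0_improper_FTC ab dF cf f0 Fa Fb) ltry.
Qed.

Lemma Rintegral_ge0_improper_FTC F f a b : a < b ->
  (forall x, x \in `]a, b[ -> is_derive x 1 F (f x)) ->
  {in `]a, b[, continuous f} -> {in `]a, b[, forall x, 0 <= f x} ->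
  F @ a^'+ --> F a -> F @ b^'- --> F b ->
  \int[leb]_(x in `]a, b[) f x = F b - F a.
Proof.
by move=> ab dF cf f0 Fa Fb; rewrite /Rintegral (ge0_improper_FTC ab dF cf f0 Fa Fb).
Qed.

Lemma powRD_pos (x r s : R) : 0 < x -> x `^ (r + s) = x `^ r * x `^ s.
Proof. by move=> x0; rewrite powRD//; apply/implyP => _; rewrite gt_eqF. Qed.

Lemma powR_continuous_pos (e : R) (x : R) : 0 < x -> {for x, continuous (@powR R ^~ e)}.
Proof.
move=> x0; apply: differentiable_continuous; apply/derivable1_diffP.
by apply: ex_derive; exact: is_derive1_powR.
Qed.

Lemma powR_right_continuous0 (e : R) : 0 < e -> (@powR R ^~ e) @ 0^'+ --> (0 : R) `^ e.
Proof. by move=> e0; rewrite powR0 ?gt_eqF//; exact: powR_cvg0. Qed.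

Lemma powR_right_continuous (e x : R) : 0 < e -> 0 <= x ->
  (@powR R ^~ e) @ x^'+ --> x `^ e.
Proof.
move=> e0; rewrite le_eqVlt => /predU1P[<-|x0]; first exact: powR_right_continuous0.
by apply: cvg_at_right_filter; exact: powR_continuous_pos.
Qed.

Lemma is_derive_powR_antiderivative (e x : R) : e + 1 != 0 -> 0 < x ->
  is_derive x 1 (fun s => s `^ (e + 1) / (e + 1)) (x `^ e).
Proof.
move=> e1 x0.
have -> : (fun s : R => s `^ (e + 1) / (e + 1)) = (e + 1)^-1 \*: (@powR R ^~ (e + 1)).
  by apply/funext => s /=; rewrite [RHS]mulrC.
have -> : x `^ e = (e + 1)^-1 *: ((e + 1) * x `^ (e + 1 - 1)).
  by rewrite addrK /GRing.scale/= mulrA mulVf// mul1r.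
by apply: is_deriveZ; exact: is_derive1_powR.
Qed.

Lemma powR_primitive_props (e a b : R) : -1 < e -> 0 <= a -> a < b ->
  let F := fun s : R => s `^ (e + 1) / (e + 1) in
  [/\ (forall x, x \in `]a, b[ -> is_derive x 1 F (x `^ e)),
   {in `]a, b[, continuous (@powR R ^~ e)},
   {in `]a, b[, forall x, 0 <= x `^ e},
   F @ a^'+ --> F a & F @ b^'- --> F b].
Proof.
move=> e1 a0 ab F; have ee : 0 < e + 1 by lra.
split.
- move=> x; rewrite in_itv/= => /andP[ax _].
  by apply: is_derive_powR_antiderivative; rewrite ?gt_eqF//; lra.
- move=> x; rewrite in_itv/= => /andP[ax _].
  by apply: powR_continuous_pos; lra.
- by move=> x _; exact: powR_ge0.
- by apply: cvgM; [exact: powR_right_continuous|exact: cvg_cst].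
- apply: cvg_at_left_filter; apply: cvgM; last exact: cvg_cst.
  by apply: powR_continuous_pos; lra.
Qed.

Lemma powR_integrable (e a b : R) : -1 < e -> 0 <= a -> a < b ->
  leb.-integrable `]a, b[ (EFin \o (@powR R ^~ e)).
Proof.
move=> e1 a0 ab; have [h1 h2 h3 h4 h5] := powR_primitive_props e1 a0 ab.
exact: ge0_improper_FTC_integrable h1 h2 h3 h4 h5.
Qed.

Lemma Rintegral_powR (e a b : R) : -1 < e -> 0 <= a -> a < b ->
  \int[leb]_(s in `]a, b[) (s `^ e) =
  (b `^ (e + 1) - a `^ (e + 1)) / (e + 1).
Proof.
move=> e1 a0 ab; have [h1 h2 h3 h4 h5] := powR_primitive_props e1 a0 ab.
by rewrite (Rintegral_ge0_improper_FTC ab h1 h2 h3 h4 h5) mulrBl.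
Qed.

Lemma powR_reflected_props (e t a b : R) : -1 < e -> a < b -> b <= t ->
  let F := fun s : R => - ((t - s) `^ (e + 1) / (e + 1)) in
  [/\ (forall x, x \in `]a, b[ -> is_derive x 1 F ((t - x) `^ e)),
   {in `]a, b[, continuous (fun s => (t - s) `^ e)},
   {in `]a, b[, forall x, 0 <= (t - x) `^ e},
   F @ a^'+ --> F a & F @ b^'- --> F b].
Proof.
move=> e1 ab bt F; have ee : 0 < e + 1 by lra.
have cts (x : R) : {for x, continuous (fun s : R => t - s)}.
  by apply: cvgB; [exact: cvg_cst|exact: cvg_id].
have FE (x : R) : x < t -> is_derive x 1 F ((t - x) `^ e).
  move=> xt; rewrite /F.
  have -> : (t - x) `^ e = - (- (t - x) `^ e) by rewrite opprK.
  apply: is_deriveN.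
  have -> : - (t - x) `^ e = (t - x) `^ e * -1 by rewrite mulrN1.
  have := @is_derive1_comp R (fun s => s `^ (e + 1) / (e + 1)) (fun s => t - s) x
    ((t - x) `^ e) (-1).
  apply.
  - by apply: is_derive_powR_antiderivative; rewrite ?gt_eqF// subr_gt0.
  - by rewrite -sub0r; apply: is_deriveB.
have Fc (x : R) : x < t -> {for x, continuous F}.
  move=> xt; apply: differentiable_continuous; apply/derivable1_diffP.
  by have [] := FE _ xt.
split.
- by move=> x; rewrite in_itv/= => /andP[_ xb]; apply: FE; lra.
- move=> x; rewrite in_itv/= => /andP[_ xb].
  apply: (@continuous_comp _ _ _ (fun s : R => t - s) (@powR R ^~ e)) => //.
  by apply: powR_continuous_pos; lra.
- by move=> x _; exact: powR_ge0.
- by apply: cvg_at_right_filter; apply: Fc; lra.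
- move: bt; rewrite le_eqVlt => /predU1P[bt|bt].
    subst t; apply: cvgN; apply: cvgM; last exact: cvg_cst.
    apply/cvg_at_leftP => u [ub cu].
    have /cvg_at_rightP := powR_right_continuous ee (lexx (0 : R)).
    move=> /(_ (fun n => b - u n)) h.
    rewrite subrr; apply: h; split; first by move=> n; rewrite subr_gt0.
    by rewrite -[X in _ --> X](subrr b); apply: cvgB => //; exact: cvg_cst.
  by apply: cvg_at_left_filter; apply: Fc.
Qed.

Lemma kernel_integrable (e t a b : R) : -1 < e -> a < b -> b <= t ->
  leb.-integrable `]a, b[ (EFin \o (fun s => (t - s) `^ e)).
Proof.
move=> e1 ab bt; have [h1 h2 h3 h4 h5] := powR_reflected_props e1 ab bt.
exact: ge0_improper_FTC_integrable h1 h2 h3 h4 h5.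
Qed.

Lemma Rintegral_kernel (e t a b : R) : -1 < e -> a < b -> b <= t ->
  \int[leb]_(s in `]a, b[) ((t - s) `^ e) =
  ((t - a) `^ (e + 1) - (t - b) `^ (e + 1)) / (e + 1).
Proof.
move=> e1 ab bt; have [h1 h2 h3 h4 h5] := powR_reflected_props e1 ab bt.
by rewrite (Rintegral_ge0_improper_FTC ab h1 h2 h3 h4 h5); ring.
Qed.

                                                                                  
                          
(** Both g and f + g are nonnegative, so the nonnegative version evaluates their integrals; the
    difference is the integral of f. *)
Lemma dominated_improper_FTC F f G g a b : a < b ->
  (forall x, x \in `]a, b[ -> is_derive x 1 F (f x)) ->
  {in `]a, b[, continuous f} ->
  (forall x, x \in `]a, b[ -> is_derive x 1 G (g x)) ->
  {in `]a, b[, continuous g} ->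
  {in `]a, b[, forall x, `|f x| <= g x} ->
  F @ a^'+ --> F a -> F @ b^'- --> F b ->
  G @ a^'+ --> G a -> G @ b^'- --> G b ->
  leb.-integrable `]a, b[ (EFin \o f) /\
  \int[leb]_(x in `]a, b[) f x = F b - F a.
Proof.
move=> ab dF cf dG cg fg Fa Fb Ga Gb.
have g0 : {in `]a, b[, forall x, 0 <= g x}.
  by move=> x xab; apply: le_trans (fg _ xab).
have ig := ge0_improper_FTC_integrable ab dG cg g0 Ga Gb.
have Ig := Rintegral_ge0_improper_FTC ab dG cg g0 Ga Gb.
have if_ : leb.-integrable `]a, b[ (EFin \o f).
  apply: (le_integrable _ _ _ ig) => //.
    by apply/measurable_EFinP; exact: measurable_itv_continuous.
  by move=> x xab; rewrite /= lee_fin (le_trans (fg _ xab))// ler_norm.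
split=> //.
have := @Rintegral_ge0_improper_FTC (fun x => F x + G x) (fun x => f x + g x) a b ab.
rewrite (RintegralD _ if_ ig)// Ig.
move=> H; apply: (addIr (G b - G a)); apply: (eq_trans (H _ _ _ _ _)); last by ring.
- by move=> x xab; apply: is_deriveD; [exact: dF|exact: dG].
- by move=> x xab; apply: cvgD; [exact: cf|exact: cg].
- move=> x xab; have := fg _ xab; rewrite ler_norml => /andP[h _]; lra.
- by apply: cvgD.
- by apply: cvgD.
Qed.

End improper_integrals.

(** * Moments of the kernel (t-s)^(-alpha) *)

Section kernel_moments.
Context {R : realType}.
Notation leb := (@lebesgue_measure R).
Variable al : R.
Hypothesis al01 : 0 < al < 1.

Definition ker_int (t a b : R) (g : R -> R) : R :=
  \int[leb]_(s in `]a, b[) ((t - s) `^ (- al) * g s).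

Let al_lt1 : -1 < - al. Proof. by case/andP: al01 => *; lra. Qed.

Lemma ker_integrable_bounded (t a b M : R) (g : R -> R) : a < b -> b <= t ->
  measurable_fun `]a, b[ g -> {in `]a, b[, forall s, `|g s| <= M} ->
  leb.-integrable `]a, b[ (EFin \o (fun s => (t - s) `^ (- al) * g s)).
Proof.
move=> ab bt mg gM.
have ik := kernel_integrable al_lt1 ab bt.
have iMk : leb.-integrable `]a, b[ (fun s => (M%:E * ((t - s) `^ (- al))%:E)%E).
  exact: integrableZl.
apply: (le_integrable _ _ _ iMk) => //.
- apply/measurable_EFinP; apply: measurable_funM => //.
  by apply/measurable_EFinP; exact: measurable_int ik.
- move=> x xab; rewrite /= lee_fin normrM mulrC normrM ler_wpM2r//.
  exact: le_trans (gM _ xab) (ler_norm _).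
Qed.

Lemma ker_integrable (t a b : R) (g : R -> R) : a < b -> b <= t ->
  continuous g ->
  leb.-integrable `]a, b[ (EFin \o (fun s => (t - s) `^ (- al) * g s)).
Proof.
move=> ab bt cg.
have [M _ gM] : exists2 M, True & {in `[a, b], forall s, `|g s| <= M}.
  have cgn : {within `[a, b], continuous (fun s => `|g s|)}.
    apply: continuous_subspaceT => x; apply: cvg_norm; exact: cg.
  have [c _ hc] := EVT_max (ltW ab) cgn.
  by exists `|g c|.
apply: (@ker_integrable_bounded _ _ _ M) => //.
  by apply: measurable_itv_continuous => x _; exact: cg.
by move=> x xab; apply: gM; exact: subset_itv_oo_cc xab.
Qed.

Lemma ker_intD (t a b : R) (f g : R -> R) : a < b -> b <= t ->
  continuous f -> continuous g ->
  ker_int t a b (fun s => f s + g s) = ker_int t a b f + ker_int t a b g.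
Proof.
move=> ab bt cf cg; rewrite /ker_int -RintegralD//; try exact: ker_integrable.
by apply: eq_Rintegral => x _; rewrite mulrDr.
Qed.

Lemma ker_intZ (t a b k : R) (f : R -> R) : a < b -> b <= t ->
  continuous f ->
  ker_int t a b (fun s => k * f s) = k * ker_int t a b f.
Proof.
move=> ab bt cf; rewrite /ker_int -RintegralZl//; try exact: ker_integrable.
by apply: eq_Rintegral => x _; rewrite mulrCA.
Qed.

Lemma le_ker_int (t a b : R) (f g : R -> R) : a < b -> b <= t ->
  continuous f -> continuous g -> {in `]a, b[, forall s, f s <= g s} ->
  ker_int t a b f <= ker_int t a b g.
Proof.
move=> ab bt cf cg fg; apply: le_Rintegral => //; try exact: ker_integrable.
by move=> x xab; rewrite ler_wpM2l ?powR_ge0//; exact: fg.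
Qed.

Lemma ker_int1 (t a b : R) : a < b -> b <= t ->
  ker_int t a b (fun=> 1) =
  ((t - a) `^ (1 - al) - (t - b) `^ (1 - al)) / (1 - al).
Proof.
move=> ab bt; rewrite /ker_int.
under eq_Rintegral do rewrite mulr1.
by rewrite (Rintegral_kernel al_lt1)// [- al + 1]addrC.
Qed.

Lemma ker_int_dist (t a b : R) : a < b -> b <= t ->
  ker_int t a b (fun s => t - s) =
  ((t - a) `^ (2 - al) - (t - b) `^ (2 - al)) / (2 - al).
Proof.
move=> ab bt.
transitivity (\int[leb]_(s in `]a, b[) ((t - s) `^ (1 - al))).
  apply: eq_Rintegral => x; rewrite inE/= in_itv/= => /andP[_ xb].
  have xt : 0 < t - x by lra.
  by rewrite [1 - al]addrC powRD_pos// powRr1// ltW.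
rewrite (@Rintegral_kernel _ (1 - al))//; last by case/andP: al01 => *; lra.
by have -> : 1 - al + 1 = 2 - al by ring.
Qed.

Lemma ker_int_dist2 (t a b : R) : a < b -> b <= t ->
  ker_int t a b (fun s => (t - s) ^+ 2) =
  ((t - a) `^ (3 - al) - (t - b) `^ (3 - al)) / (3 - al).
Proof.
move=> ab bt.
transitivity (\int[leb]_(s in `]a, b[) ((t - s) `^ (2 - al))).
  apply: eq_Rintegral => x; rewrite inE/= in_itv/= => /andP[_ xb].
  have xt : 0 < t - x by lra.
  by rewrite [2 - al]addrC powRD_pos// powR_mulrn// ltW.
rewrite (@Rintegral_kernel _ (2 - al))//; last by case/andP: al01 => *; lra.
by have -> : 2 - al + 1 = 3 - al by ring.
Qed.

Lemma eq_ker_int (t a b : R) (f g : R -> R) :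
  {in `]a, b[, f =1 g} -> ker_int t a b f = ker_int t a b g.
Proof.
by move=> fg; apply: eq_Rintegral => x; rewrite inE => xab; rewrite fg.
Qed.

Lemma ker_int_poly2 (t a b c0 c1 c2 : R) : a < b -> b <= t ->
  ker_int t a b (fun s => c0 + c1 * (t - s) + c2 * (t - s) ^+ 2) =
  c0 * ker_int t a b (fun=> 1) + c1 * ker_int t a b (fun s => t - s)
  + c2 * ker_int t a b (fun s => (t - s) ^+ 2).
Proof.
move=> ab bt.
have h0 : continuous (fun _ : R => (1 : R)) by move=> x; exact: cvg_cst.
have h1 : continuous (fun s : R => t - s).
  by move=> x; apply: cvgB; [exact: cvg_cst|exact: cvg_id].
have h2 : continuous (fun s : R => (t - s) ^+ 2).
  by under eq_fun do rewrite expr2; move=> x; apply: cvgM; exact: h1.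
have hZ k (f : R -> R) : continuous f -> continuous (fun s => k * f s).
  by move=> cf x; apply: cvgM; [exact: cvg_cst|exact: cf].
have hD (f g : R -> R) : continuous f -> continuous g -> continuous (fun s => f s + g s).
  by move=> cf cg x; apply: cvgD; [exact: cf|exact: cg].
rewrite -(ker_intZ c0 ab bt h0) -(ker_intZ c1 ab bt h1) -(ker_intZ c2 ab bt h2).
rewrite -(ker_intD ab bt (hZ c0 _ h0) (hZ c1 _ h1)).
rewrite -(ker_intD ab bt (hD _ _ (hZ c0 _ h0) (hZ c1 _ h1)) (hZ c2 _ h2)).
by apply: eq_ker_int => s _; rewrite mulr1.
Qed.

(** Split the factor t as s + (t - s) and integrate (t-s)^(1-alpha) w' by parts; [dw] is w', because
    w is expanded in powers of t - s. The derivative is traded for s w' + (1-alpha) w, which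
    vanishes for w = s^(alpha-1): this is what makes the barrier work. For a quadratic w the
    identity is read off from the three explicit moments. *)
Lemma ker_int_by_parts (t a b w0 w1 w2 : R) : a < b -> b <= t ->
  let w := fun s => w0 + w1 * (t - s) + w2 * (t - s) ^+ 2 in
  let dw := fun s => - w1 - 2 * w2 * (t - s) in
  t * ker_int t a b dw =
  ker_int t a b (fun s => s * dw s + (1 - al) * w s)
  + ((t - b) `^ (1 - al) * w b - (t - a) `^ (1 - al) * w a).
Proof.
move=> ab bt w dw.
rewrite (@eq_ker_int t a b dw
  (fun s => - w1 + (- 2 * w2) * (t - s) + 0 * (t - s) ^+ 2)); last first.
  by move=> s _; rewrite /dw; ring.
rewrite (@eq_ker_int t a b (fun s => s * dw s + (1 - al) * w s)
  (fun s => ((1 - al) * w0 - t * w1) + ((2 - al) * w1 - 2 * t * w2) * (t - s)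
     + (3 - al) * w2 * (t - s) ^+ 2)); last first.
  by move=> s _; rewrite /dw /w; ring.
rewrite !ker_int_poly2// ker_int1// ker_int_dist// ker_int_dist2// /w.
have xpos : 0 < t - a by lra.
have pow1 x k : 0 <= x -> 0 < k -> x `^ (k + 1) = x * x `^ k :> R.
  move=> x0 k0; have {1}-> : k = (k + 1) - 1 by ring.
  by rewrite -[X in X + 1]/(k + 1 - 1) subrK -mulr_powRB1 ?addrK//; lra.
have h23 x : 0 <= x -> x `^ (2 - al) = x * x `^ (1 - al) :> R.
  move=> x0; have -> : 2 - al = 1 - al + 1 by ring.
  by rewrite pow1//; case/andP: al01 => *; lra.
have h3 x : 0 <= x -> x `^ (3 - al) = x ^+ 2 * x `^ (1 - al) :> R.
  move=> x0; have -> : 3 - al = 2 - al + 1 by ring.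
  by rewrite pow1// ?h23// ?mulrA ?expr2//; case/andP: al01 => *; lra.
rewrite !h23 ?h3; try lra.
by field; apply/and3P; split; apply: lt0r_neq0; case/andP: al01 => *; lra.
Qed.

End kernel_moments.

(** * Splitting integrals at the mesh nodes *)

Section chasles.
Context {R : realType}.
Notation leb := (@lebesgue_measure R).

Lemma Rintegral_chasles (f : R -> R) (a b c : R) : a < b -> b < c ->
  leb.-integrable `]a, b[ (EFin \o f) -> leb.-integrable `]b, c[ (EFin \o f) ->
  leb.-integrable `]a, c[ (EFin \o f) /\
  \int[leb]_(x in `]a, c[) f x =
  \int[leb]_(x in `]a, b[) f x + \int[leb]_(x in `]b, c[) f x.
Proof.
move=> ab bc i1 i2.
have U : `]a, c[%classic = `]a, b]%classic `|` `]b, c[%classic.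
  by apply: itv_bndbnd_setU; rewrite bnd_simp// ltW.
have D : [disjoint `]a, b]%classic & `]b, c[%classic].
  apply/disj_setPS => x [] /=; rewrite !in_itv/= => /andP[_ xb] /andP[bx _].
  by move: xb; rewrite leNgt bx.
have m1 : measurable_fun `]a, b] f.
  apply/measurable_fun_itv_bndo_bndcP; apply/measurable_EFinP.
  exact: measurable_int i1.
have m2 : measurable_fun `]b, c[ f by apply/measurable_EFinP; exact: measurable_int i2.
have i1' : leb.-integrable `]a, b] (EFin \o f).
  apply/integrableP; split; first exact/measurable_EFinP.
  rewrite -integral_itv_bndo_bndc; first by case/integrableP : i1.
  apply/measurable_EFinP; apply: measurableT_comp => //.
  by apply/measurable_EFinP; exact: measurable_int i1.
have iac : leb.-integrable `]a, c[ (EFin \o f).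
  rewrite U; apply/integrableP; split.
    by apply/measurable_EFinP; apply/measurable_funU.
  rewrite ge0_integral_setU//=; last first.
    apply/measurable_EFinP; apply: measurableT_comp => //.
    by apply/measurable_funU.
  by rewrite lte_add_pinfty//; [case/integrableP : i1'|case/integrableP : i2].
split=> //; rewrite U Rintegral_setU -?U//.
by rewrite -(@Rintegral_itv_bndo_bndc _ _ _ _ i1).
Qed.

Lemma Rintegral_partition (f : R -> R) (t : nat -> R) (m : nat) :
  (forall i, (i <= m)%N -> t i < t i.+1) ->
  (forall i, (i <= m)%N -> leb.-integrable `]t i, t i.+1[ (EFin \o f)) ->
  leb.-integrable `]t 0%N, t m.+1[ (EFin \o f) /\
  \int[leb]_(x in `]t 0%N, t m.+1[) f x =
  \sum_(i < m.+1) \int[leb]_(x in `]t i, t i.+1[) f x.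
Proof.
elim: m => [|m IH] ht hi; first by split; [exact: hi|rewrite big_ord1].
have [ii e] : leb.-integrable `]t 0%N, t m.+1[ (EFin \o f) /\
  \int[leb]_(x in `]t 0%N, t m.+1[) f x =
  \sum_(i < m.+1) \int[leb]_(x in `]t i, t i.+1[) f x.
  by apply: IH => i im; [apply: ht|apply: hi]; exact: leqW.
rewrite big_ord_recr/= -e; apply: Rintegral_chasles => //.
- have : forall k, (k <= m)%N -> t 0%N < t k.+1.
    elim=> [|k IHk] km; first exact: ht.
    by apply: lt_trans (ht k.+1 _); [apply: IHk; exact: ltnW|exact: leqW].
  exact.
- exact: ht.
- exact: hi.
Qed.

End chasles.

                                                       

(** * The discrete derivative as a sum over mesh intervals *)

Section delta_formula.
Context {R : realType}.
Notation leb := (@lebesgue_measure R).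
Implicit Types (t U : nat -> R) (m i : nat).

Definition slope t U i : R := (U i.+1 - U i) / (t i.+1 - t i).

Definition curvature t U i : R := (slope t U i.+1 - slope t U i) / (t i.+2 - t i).

                                                                      
(** The leading coefficient of the interpolating polynomial on the i-th interval in row m. The
    [minn] makes the last interval i = m-1 reuse the parabola through t_(m-2), t_(m-1), t_m; for m =
    1 the interpolant is linear. *)
Definition row_curvature t U m i : R :=
  if (m <= 1)%N then 0 else curvature t U (minn i m.-2).

Definition newton t U i (e s : R) : R :=
  U i + slope t U i * (s - t i) + e * ((s - t i) * (s - t i.+1)).

Lemma count_before t m i (s : R) : (i < m)%N ->
  (forall j, (j < m)%N -> t j < t j.+1) -> t i < s <= t i.+1 ->
  count (fun j => t j < s) (iota 1 m) = i.
Proof.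
move=> im inc /andP[ts st].
have mono j k : (j <= k)%N -> (k <= m)%N -> t j <= t k.
  elim: k => [|k IH]; first by rewrite leqn0 => /eqP ->.
  rewrite leq_eqVlt => /predU1P[->//|jk] km.
  by apply: le_trans (ltW (inc _ km)); apply: IH => //; exact: ltnW.
rewrite -(subnKC (ltnW im)) iotaD count_cat.
have -> : count (fun j => t j < s) (iota 1 i) = i.
  rewrite -[RHS](size_iota 1 i); apply/eqP; rewrite -all_count.
  apply/allP => j; rewrite mem_iota => /andP[_ ji].
  by apply: le_lt_trans ts; apply: mono; [rewrite add1n ltnS in ji|exact: ltnW].
rewrite [X in (_ + X)%N](_ : _ = 0%N) ?addn0//; apply/eqP.
rewrite -leqn0 leqNgt -has_count; apply/hasPn => j.
rewrite mem_iota add1n => /andP[ij jm]; rewrite -leNgt (le_trans st)//.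
by apply: mono => //; lia.
Qed.

Lemma lagrange1E t U i s : t i < t i.+1 ->
  Defs.lagrange t U i 1 s = newton t U i 0 s.
Proof.
move=> h; rewrite /Defs.lagrange /newton /slope !big_ord_recl !big_ord0 /=.
rewrite !(big_mkcond (fun l => l != _)) /= !big_ord_recl !big_ord0 /=.
rewrite /bump/= !addn0 !addn1.
by field; apply/andP; split; apply/eqP; lra.
Qed.

Lemma lagrange2E t U i s : t i < t i.+1 -> t i.+1 < t i.+2 ->
  Defs.lagrange t U i 2 s = newton t U i (curvature t U i) s.
Proof.
move=> h1 h2; rewrite /Defs.lagrange /newton /curvature /slope !big_ord_recl !big_ord0 /=.
rewrite !(big_mkcond (fun l => l != _)) /= !big_ord_recl !big_ord0 /=.
rewrite /bump/= !addn0 !addn1 !addn2.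
by field; do ?(apply/andP; split); apply/eqP; lra.
Qed.

(** One parabola in two Newton forms: moving the base to the middle node leaves the leading
    coefficient unchanged. Thereby the last interval takes the same form as the others. *)
Lemma newton_shift t U i s : t i < t i.+1 -> t i.+1 < t i.+2 ->
  newton t U i (curvature t U i) s = newton t U i.+1 (curvature t U i) s.
Proof.
move=> h1 h2; rewrite /newton /curvature /slope.
by field; do ?(apply/andP; split); apply/eqP; lra.
Qed.

Lemma interpolantE t U m i (s : R) : (i < m)%N ->
  (forall j, (j < m)%N -> t j < t j.+1) -> t i < s <= t i.+1 ->
  interpolant t U m s = newton t U i (row_curvature t U m i) s.
Proof.
move=> im inc ts; rewrite /interpolant (count_before im inc ts) /row_curvature.
case: ifPn => [m1|].
  have -> : i = 0%N by lia.
  by rewrite lagrange1E//; apply: inc; lia.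
rewrite -ltnNge => m1; case: ifPn => [i1|i1].
  have -> : minn i m.-2 = i by lia.
  by rewrite lagrange2E//; apply: inc; lia.
have -> : minn i m.-2 = m.-2 by lia.
have -> : i = m.-2.+1 by lia.
by rewrite lagrange2E ?newton_shift//; apply: inc; lia.
Qed.

Lemma is_derive_newton t U i (e s : R) :
  is_derive s 1 (newton t U i e) (slope t U i + e * (2 * s - t i - t i.+1)).
Proof.
rewrite /newton.
have h c : is_derive s 1 (fun x : R => x - c) 1.
  rewrite -[X in is_derive _ _ _ X]subr0; apply: is_deriveB.
have hc (c : R) : is_derive s 1 (fun=> c) 0 by exact: is_derive_cst.
rewrite (_ : slope t U i + _ = (0 + (slope t U i *: 1 + (s - t i) *: 0)) +
  (e *: ((s - t i) *: 1 + (s - t i.+1) *: 1) + ((s - t i) * (s - t i.+1)) *: 0));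
  last by rewrite /GRing.scale/=; ring.
apply: is_deriveD; first apply: is_deriveD.
  exact: is_deriveM.
apply: is_deriveM; exact: is_deriveM.
Qed.

Lemma derive1_interpolant t U m i (s : R) : (i < m)%N ->
  (forall j, (j < m)%N -> t j < t j.+1) -> s \in `]t i, t i.+1[ ->
  derive1 (interpolant t U m) s =
  slope t U i + row_curvature t U m i * (2 * s - t i - t i.+1).
Proof.
move=> im inc sI.
rewrite derive1E (@near_eq_derive _ _ _ _ (newton t U i (row_curvature t U m i))).
  by have [_ ->] := is_derive_newton t U i (row_curvature t U m i) s.
near=> x; apply: interpolantE => //.
have : x \in `]t i, t i.+1[ by near: x; exact: near_in_itvoo.
by rewrite in_itv/= => /andP[-> /ltW ->].
Unshelve. all: end_near. Qed.

Variable al : R.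
Hypothesis al01 : 0 < al < 1.

Lemma continuous_affine (c0 c1 c2 c3 : R) :
  continuous (fun s : R => c0 + c1 * (2 * s - c2 - c3)).
Proof.
move=> x; apply: cvgD; first exact: cvg_cst.
apply: cvgM; first exact: cvg_cst.
apply: cvgB; last exact: cvg_cst.
apply: cvgB; last exact: cvg_cst.
by apply: cvgM; [exact: cvg_cst|exact: cvg_id].
Qed.

Lemma delta_tE t U m : (0 < m)%N -> t 0%N = 0 ->
  (forall j, (j < m)%N -> t j < t j.+1) ->
  delta_t al t U m = (Gamma (1 - al))^-1 *
  \sum_(i < m) ker_int al (t m) (t i) (t i.+1)
    (fun s => slope t U i + row_curvature t U m i * (2 * s - t i - t i.+1)).
Proof.
case: m => // m _ t0 inc; rewrite /delta_t /caputo; congr (_ * _).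
have le_tm i : (i <= m)%N -> t i.+1 <= t m.+1.
  move=> im; have : forall k, (i <= k)%N -> (k <= m)%N -> t i.+1 <= t k.+1.
    elim=> [|k IH]; first by rewrite leqn0 => /eqP ->.
    rewrite leq_eqVlt => /predU1P[->//|ik] km.
    by apply: le_trans (ltW (inc _ _)); [apply: IH => //; exact: ltnW|].
  exact.
have E (i : nat) : (i <= m)%N -> {in `]t i, t i.+1[, forall s,
    (t m.+1 - s) `^ (- al) * derive1 (interpolant t U m.+1) s =
    (t m.+1 - s) `^ (- al) *
    (slope t U i + row_curvature t U m.+1 i * (2 * s - t i - t i.+1))}.
  by move=> im s si; rewrite (@derive1_interpolant _ _ _ i).
have := @Rintegral_partition R
  (fun s => (t m.+1 - s) `^ (- al) * derive1 (interpolant t U m.+1) s) t m.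
rewrite t0 => /(_ _ _)[||_ ->].
- by move=> i im; exact: inc.
- move=> i im.
  have := @ker_integrable R al al01 (t m.+1) (t i) (t i.+1) _ (inc _ im) (le_tm _ im)
    (@continuous_affine (slope t U i) (row_curvature t U m.+1 i) (t i) (t i.+1)).
  apply: eq_integrable => // s; rewrite inE/= => si.
  by rewrite (E i im).
- apply: eq_bigr => -[i im] _ /=.
  by apply: eq_Rintegral => s; rewrite inE/= => si; rewrite (E i im).
Qed.

End delta_formula.

(** * Bernoulli and tangent inequalities for real powers *)

Section power_inequalities.
Context {R : realType}.
Implicit Types (x y e : R).

Lemma powR_expR x e : 0 < x -> x `^ e = expR (e * ln x).
Proof. by move=> x0; rewrite /powR gt_eqF. Qed.

Lemma bernoulli_neg x e : 0 < x -> e <= 0 -> 1 + e * (x - 1) <= x `^ e.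
Proof.
move=> x0 e0; rewrite powR_expR//; apply: le_trans (expR_ge1Dx _).
rewrite lerD2l; apply: ler_wnM2l => //.
by have := @le_ln1Dx R (x - 1); rewrite addrCA subrr addr0; apply; lra.
Qed.

(** The bound exp y >= 1 + y at y = (1-e) ln x and at y = -e ln x gives two inequalities; with
    weights e and 1-e the logarithms cancel. *)
Lemma bernoulli_concave x e : 0 < x -> 0 <= e <= 1 -> x `^ e <= 1 + e * (x - 1).
Proof.
move=> x0 /andP[e0 e1].
have y0 : 0 < x `^ e by rewrite powR_gt0.
have h1 : x `^ e * (1 + (1 - e) * ln x) <= x.
  have e2 : x = x `^ e * expR ((1 - e) * ln x).
    rewrite -powR_expR// -powRD_pos//.
    by rewrite addrC subrK powRr1// ltW.
  by rewrite [leRHS]e2; apply: ler_wpM2l; [exact: ltW|exact: expR_ge1Dx].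
have h2 : x `^ e * (1 - e * ln x) <= 1.
  have e3 : 1 = x `^ e * expR (- e * ln x).
    rewrite -powR_expR// -powRD_pos//.
    by rewrite subrr powRr0.
  by rewrite [leRHS]e3 -mulNr; apply: ler_wpM2l; [exact: ltW|exact: expR_ge1Dx].
have := ler_wpM2l e0 h1.
have e1' : 0 <= 1 - e by lra.
have := ler_wpM2l e1' h2; lra.
Qed.

Lemma powR_antimono e x y : e <= 0 -> 0 < x -> x <= y -> y `^ e <= x `^ e.
Proof.
move=> e0 x0 xy; have y0 : 0 < y by exact: lt_le_trans xy.
rewrite !powR_expR// ler_expR; apply: ler_wnM2l => //.
by rewrite ler_ln// posrE.
Qed.

Lemma powR_mono e x y : 0 <= e -> 0 <= x -> x <= y -> x `^ e <= y `^ e.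
Proof.
by move=> e0 x0 xy; apply: ge0_ler_powR => //; rewrite nnegrE//; exact: le_trans xy.
Qed.

Lemma powR_tangent e x y : e <= 0 -> 0 < x -> 0 < y ->
  y `^ e + e * y `^ (e - 1) * (x - y) <= x `^ e.
Proof.
move=> e0 x0 y0.
have xy0 : 0 < x / y by rewrite divr_gt0.
have h := bernoulli_neg xy0 e0.
have -> : x `^ e = y `^ e * (x / y) `^ e.
  by rewrite -powRM ?ltW//; congr (_ `^ _); field; rewrite gt_eqF.
have -> : y `^ (e - 1) = y `^ e / y.
  by rewrite powRD_pos// powR_inv1// ltW.
have ye : 0 <= y `^ e by exact: powR_ge0.
apply: le_trans (ler_wpM2l ye h).
rewrite le_eqVlt; apply/orP; left; apply/eqP; field.
by rewrite gt_eqF.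
Qed.

End power_inequalities.

Definition kern {R : realType} (al t s : R) : R := (t - s) `^ (- al).

(** The derivative of [kern] in s. *)
Definition dkern {R : realType} (al t s : R) : R := al * (t - s) `^ (- al - 1).

(** * Convexity bounds for the kernel moments on one interval *)

Section kernel_bounds.
Context {R : realType}.
Notation leb := (@lebesgue_measure R).
Variable al : R.
Hypotheses (al0 : 0 < al) (al1 : al < 1).
Variable t : R.

Local Ltac hlra := move: (al0) (al1) => ? ?; lra.

Local Notation k := (kern al t).
Local Notation dk := (dkern al t).

Let al01 : 0 < al < 1. Proof. by rewrite al0. Qed.

Lemma ker_tangent (x y : R) : x < t -> y < t -> k y + dk y * (x - y) <= k x.
Proof.
move=> xt yt; have := @powR_tangent R (- al) (t - x) (t - y).
move=> H; apply: (le_trans _ (H _ _ _)); [|hlra|hlra|hlra].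
rewrite /kern /dkern le_eqVlt; apply/orP; left; apply/eqP; ring.
Qed.

Lemma ker_mono (x y : R) : x <= y -> y < t -> k x <= k y.
Proof. by move=> xy yt; rewrite /kern; apply: powR_antimono; hlra. Qed.

Lemma dker_mono (x y : R) : x <= y -> y < t -> dk x <= dk y.
Proof. by move=> xy yt; rewrite /dkern ler_pM2l//; apply: powR_antimono; hlra. Qed.

Lemma dker_ge0 (x : R) : 0 <= dk x.
Proof. by rewrite /dkern mulr_ge0 ?powR_ge0// ltW. Qed.

Lemma Rintegral_FTC (F f : R -> R) (a b : R) : a < b ->
  (forall x : R, is_derive x 1 F (f x)) -> continuous f ->
  leb.-integrable `]a, b[ (EFin \o f) /\
  \int[leb]_(x in `]a, b[) f x = F b - F a.
Proof.
move=> ab dF cf.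
have cF x : {for x, continuous F}.
  by apply: differentiable_continuous; apply/derivable1_diffP; have [] := dF x.
have [M gM] : exists M, {in `[a, b], forall s, `|f s| <= M}.
  have cgn : {within `[a, b], continuous (fun s => `|f s|)}.
    apply: continuous_subspaceT => x; apply: cvg_norm; exact: cf.
  have [c _ hc] := EVT_max (ltW ab) cgn.
  by exists `|f c|.
apply: (@dominated_improper_FTC _ F f (fun s => M * s) (fun=> M)) => //.
- move=> x _; have {2}-> : M = M *: 1 :> R by rewrite /GRing.scale/= mulr1.
  by apply: (@is_deriveZ R R^o R^o id M x 1 1).
- by move=> x _; exact: cvg_cst.
- by move=> x xab; apply: gM; exact: subset_itv_oo_cc xab.
- by apply: cvg_at_right_filter; exact: cF.
- by apply: cvg_at_left_filter; exact: cF.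
- by apply: cvg_at_right_filter; apply: cvgM; [exact: cvg_cst|exact: cvg_id].
- by apply: cvg_at_left_filter; apply: cvgM; [exact: cvg_cst|exact: cvg_id].
Qed.

Definition prim2 (a c0 c1 c2 : R) (s : R) : R :=
  c0 * (s - a) + c1 * (s - a) ^+ 2 / 2 + c2 * (s - a) ^+ 3 / 3.

Lemma is_derive_prim2 (a c0 c1 c2 s : R) :
  is_derive s 1 (prim2 a c0 c1 c2) (c0 + c1 * (s - a) + c2 * (s - a) ^+ 2).
Proof.
have h : is_derive s 1 (fun x : R => x - a) 1.
  by rewrite -[X in is_derive _ _ _ X]subr0; apply: is_deriveB.
have -> : prim2 a c0 c1 c2 = (c0 \*: (fun x : R => x - a)) +
   (c1 / 2) \*: ((fun x : R => x - a) ^+ 2) + (c2 / 3) \*: ((fun x : R => x - a) ^+ 3).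
  by apply/funext => x; rewrite /prim2 !fctE/= /GRing.scale/=; field.
have -> : c0 + c1 * (s - a) + c2 * (s - a) ^+ 2 =
   c0 *: 1 + (c1 / 2) *: ((2%:R * (s - a) ^+ 1) *: 1) +
   (c2 / 3) *: ((3%:R * (s - a) ^+ 2) *: 1).
  by rewrite /GRing.scale/=; field.
apply: is_deriveD; first apply: is_deriveD.
- by apply: is_deriveZ; exact: (is_deriveX 2 h).
- by apply: is_deriveZ; exact: (is_deriveX 3 h).
Qed.

Lemma continuous_shift_poly2 (a c0 c1 c2 : R) :
  continuous (fun s : R => c0 + c1 * (s - a) + c2 * (s - a) ^+ 2).
Proof.
move=> x; have c : (fun s : R => s - a) @ x --> x - a.
  by apply: cvgB; [exact: cvg_id|exact: cvg_cst].
apply: cvgD; first apply: cvgD; first exact: cvg_cst.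
- by apply: cvgM => //; exact: cvg_cst.
- apply: cvgM; first exact: cvg_cst.
  by rewrite expr2; apply: cvgM.
Qed.

(** The moment inequalities below compare the weighted integrand with a polynomial of degree at most
    two, obtained from tangents or chords of the convex increasing kernel, and integrate that
    polynomial exactly. *)
Lemma ker_int_le_poly (a b : R) (g : R -> R) (c0 c1 c2 : R) : a < b -> b <= t ->
  continuous g ->
  {in `]a, b[, forall s, k s * g s <= c0 + c1 * (s - a) + c2 * (s - a) ^+ 2} ->
  ker_int al t a b g <=
  c0 * (b - a) + c1 * (b - a) ^+ 2 / 2 + c2 * (b - a) ^+ 3 / 3.
Proof.
move=> ab bt cg h.
have [ip Ip] := Rintegral_FTC ab (is_derive_prim2 a c0 c1 c2)
  (@continuous_shift_poly2 a c0 c1 c2).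
apply: (@le_trans _ _ (prim2 a c0 c1 c2 b - prim2 a c0 c1 c2 a)).
  by rewrite -Ip; apply: le_Rintegral => //; exact: ker_integrable.
by rewrite le_eqVlt; apply/orP; left; apply/eqP; rewrite /prim2 subrr; ring.
Qed.

Lemma ker_int_ge_poly (a b : R) (g : R -> R) (c0 c1 c2 : R) : a < b -> b <= t ->
  continuous g ->
  {in `]a, b[, forall s, c0 + c1 * (s - a) + c2 * (s - a) ^+ 2 <= k s * g s} ->
  c0 * (b - a) + c1 * (b - a) ^+ 2 / 2 + c2 * (b - a) ^+ 3 / 3 <=
  ker_int al t a b g.
Proof.
move=> ab bt cg h.
have [ip Ip] := Rintegral_FTC ab (is_derive_prim2 a c0 c1 c2)
  (@continuous_shift_poly2 a c0 c1 c2).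
apply: (@le_trans _ _ (prim2 a c0 c1 c2 b - prim2 a c0 c1 c2 a)); last first.
  by rewrite -Ip; apply: le_Rintegral => //; exact: ker_integrable.
rewrite le_eqVlt; apply/orP; left; apply/eqP.
by rewrite /prim2 subrr; ring.
Qed.

Local Notation ker1 a b := (ker_int al t a b (fun=> 1)).
Local Notation kerq a b := (ker_int al t a b (fun s => 2 * s - a - b)).

Lemma continuous_twice (a b : R) : continuous (fun s : R => 2 * s - a - b).
Proof.
move=> x; apply: cvgB; last exact: cvg_cst.
apply: cvgB; last exact: cvg_cst.
by apply: cvgM; [exact: cvg_cst|exact: cvg_id].
Qed.

Let cont1 : continuous (fun _ : R => (1 : R)).
Proof. by move=> x; exact: cvg_cst. Qed.

Lemma ker1_le (a b : R) : a < b -> b < t -> ker1 a b <= (b - a) * k b.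
Proof.
move=> ab bt.
apply: le_trans (@ker_int_le_poly a b _ (k b) 0 0 ab (ltW bt) cont1 _) _; last lra.
move=> s; rewrite in_itv/= => /andP[as_ sb].
have := @ker_mono s b (ltW sb) bt; lra.
Qed.

Lemma ker1_ge (a b : R) : a < b -> b <= t -> (b - a) * k a <= ker1 a b.
Proof.
move=> ab bt.
apply: le_trans _ (@ker_int_ge_poly a b _ (k a) 0 0 ab bt cont1 _); first lra.
move=> s; rewrite in_itv/= => /andP[as_ sb].
have st : s < t by lra.
have := @ker_mono a s (ltW as_) st; lra.
Qed.

Lemma ker1_midpoint (a b : R) : a < b -> b <= t ->
  (b - a) * k ((a + b) / 2) <= ker1 a b.
Proof.
move=> ab bt; set c := (a + b) / 2.
have ct : c < t by rewrite /c; lra.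
apply: le_trans _ (@ker_int_ge_poly a b _ (k c + dk c * (a - c)) (dk c) 0 ab bt cont1 _).
  have -> : a - c = (a - b) / 2 by rewrite /c; field.
  by rewrite le_eqVlt; apply/orP; left; apply/eqP; field.
move=> s; rewrite in_itv/= => /andP[as_ sb].
have st : s < t by lra.
have := ker_tangent st ct; lra.
Qed.

Lemma ker1_trapezoid (a b : R) : a < b -> b < t ->
  ker1 a b <= (b - a) * ((k a + k b) / 2).
Proof.
move=> ab bt.
have ba : b - a != 0 by apply/eqP; lra.
apply: le_trans (@ker_int_le_poly a b _ (k a) ((k b - k a) / (b - a)) 0 ab
  (ltW bt) cont1 _) _; last first.
  by rewrite le_eqVlt; apply/orP; left; apply/eqP; field.
move=> s; rewrite in_itv/= => /andP[as_ sb].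
have st : s < t by lra.
have at_ : a < t by lra.
have h1 := ker_tangent at_ st; have h2 := ker_tangent bt st.
have bs : 0 <= b - s by lra.
have sa : 0 <= s - a by lra.
have h3 := ler_wpM2l bs h1; have h4 := ler_wpM2l sa h2.
have ba0 : 0 < b - a by lra.
have : (b - a) * k s <= (b - s) * k a + (s - a) * k b by lra.
rewrite mulr1 mul0r addr0 => h5.
rewrite -(ler_pM2l ba0); apply: le_trans h5 _.
by rewrite le_eqVlt; apply/orP; left; apply/eqP; field.
Qed.

(** The weight 2s-a-b is odd about the midpoint c and the kernel increases, so replacing k(s) by
    k(c) can only decrease the integrand, and the result integrates to zero. *)
Lemma kerq_ge0 (a b : R) : a < b -> b <= t -> 0 <= kerq a b.
Proof.
move=> ab bt; set c := (a + b) / 2.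
have ct : c < t by rewrite /c; lra.
apply: le_trans _ (@ker_int_ge_poly a b _ (k c * (a - b)) (2 * k c) 0 ab bt
  (@continuous_twice a b) _).
  by rewrite le_eqVlt; apply/orP; left; apply/eqP; field.
move=> s; rewrite in_itv/= => /andP[as_ sb].
have st : s < t by lra.
have [sc|sc] := leP s c.
- have h := ker_mono sc ct.
  have : 0 <= (k c - k s) * (2 * (c - s)) by apply: mulr_ge0; lra.
  rewrite /c; lra.
- have h := ker_mono (ltW sc) st.
  have : 0 <= (k s - k c) * (2 * (s - c)) by apply: mulr_ge0; lra.
  rewrite /c; lra.
Qed.

(** Replacing the kernel by the line through its midpoint value with slope k'(b), the largest slope
    on the interval, only increases the integrand; the moment of that line is the right-hand
    side. *)
Lemma kerq_le (a b : R) : a < b -> b < t -> kerq a b <= (b - a) ^+ 3 * dk b / 6.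
Proof.
move=> ab bt; set c := (a + b) / 2; set h := b - a; set B := dk b.
have cb : c < b by rewrite /c; lra.
have ct : c < t by lra.
apply: le_trans (@ker_int_le_poly a b _ (- k c * h + B * h ^+ 2 / 2)
  (2 * k c - 2 * B * h) (2 * B) ab (ltW bt) (@continuous_twice a b) _) _; last first.
  by rewrite le_eqVlt; apply/orP; left; apply/eqP; rewrite -/h; field.
move=> s; rewrite in_itv/= => /andP[as_ sb].
have st : s < t by lra.
have key : (s - c) * (k s - k c - B * (s - c)) <= 0.
  have [sc|sc] := leP s c.
  - have h1 := ker_tangent st ct.
    have h2 := dker_mono (ltW cb) bt.
    have h3 : 0 <= (B - dk c) * (c - s) by apply: mulr_ge0; rewrite /B; lra.
    apply: mulr_le0_ge0; lra.
  - have h1 := ker_tangent ct st.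
    have h2 := dker_mono (ltW sb) bt.
    have h3 : 0 <= (B - dk s) * (s - c) by apply: mulr_ge0; rewrite /B; lra.
    apply: mulr_ge0_le0; lra.
have -> : 2 * s - a - b = 2 * (s - c) by rewrite /c; field.
have -> : - k c * h + B * h ^+ 2 / 2 + (2 * k c - 2 * B * h) * (s - a)
   + 2 * B * (s - a) ^+ 2 = 2 * (s - c) * (k c + B * (s - c)).
  by rewrite /c /h; field.
lra.
Qed.

(** Write 2s-a-b = (2s-2b) + (b-a). The first summand is nonpositive, so there the kernel may be
    replaced by its least value k(a). *)
Lemma kerq_le_ker1 (a b : R) : a < b -> b <= t ->
  kerq a b <= (b - a) * (ker1 a b - (b - a) * k a).
Proof.
move=> ab bt; set h := b - a.
have e : kerq a b = ker_int al t a b (fun s => 2 * s - b - b) + h * ker1 a b.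
  rewrite -ker_intZ// -ker_intD//.
  - by apply: eq_ker_int => s _; rewrite /h; ring.
  - exact: continuous_twice.
  - by move=> x; exact: cvg_cst.
rewrite e.
have : ker_int al t a b (fun s => 2 * s - b - b) <= - (h ^+ 2 * k a).
  apply: le_trans (@ker_int_le_poly a b _ (- 2 * h * k a) (2 * k a) 0 ab bt
    (@continuous_twice b b) _) _; last first.
    by rewrite le_eqVlt; apply/orP; left; apply/eqP; rewrite -/h; field.
  move=> s; rewrite in_itv/= => /andP[as_ sb].
  have st : s < t by lra.
  have h1 := @ker_mono a s (ltW as_) st.
  have : 0 <= (k s - k a) * (2 * (b - s)) by apply: mulr_ge0; lra.
  rewrite /h; lra.
lra.
Qed.

(** The slope of the kernel is at least k'(a) throughout, so k(s) lies below k(b) - k'(a)(b-s). *)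
Lemma ker1_gap (a b : R) : a < b -> b < t ->
  (b - a) ^+ 2 / 2 * dk a <= (b - a) * k b - ker1 a b.
Proof.
move=> ab bt.
have : ker1 a b <= (b - a) * k b - (b - a) ^+ 2 / 2 * dk a; last lra.
apply: le_trans (@ker_int_le_poly a b _ (k b - dk a * (b - a)) (dk a) 0 ab
  (ltW bt) cont1 _) _; last first.
  by rewrite le_eqVlt; apply/orP; left; apply/eqP; field.
move=> s; rewrite in_itv/= => /andP[as_ sb].
have st : s < t by lra.
have h1 := ker_tangent bt st.
have h2 := @dker_mono a s (ltW as_) st.
have : 0 <= (dk s - dk a) * (b - s) by apply: mulr_ge0; lra.
lra.
Qed.

Lemma ker1_last (a : R) : a < t -> ker1 a t = (t - a) * k a / (1 - al).
Proof.
move=> at_; rewrite ker_int1// subrr powR0; last by apply/eqP; hlra.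
by rewrite /kern powRD_pos ?subr_gt0// powRr1 ?subr0// ltW ?subr_gt0.
Qed.

Lemma kerq_last (a : R) : a < t ->
  kerq a t = (t - a) ^+ 2 * k a * al / ((1 - al) * (2 - al)).
Proof.
move=> at_.
have -> : kerq a t = ker_int al t a t
    (fun s => (t - a) + (- 2) * (t - s) + 0 * (t - s) ^+ 2).
  by apply: eq_ker_int => s _; ring.
rewrite ker_int_poly2// ker1_last// ker_int_dist// subrr powR0; last by apply/eqP; hlra.
rewrite /kern powRD_pos ?subr_gt0// powR_mulrn; last by rewrite ltW ?subr_gt0.
by field; apply/andP; split; apply/eqP; hlra.
Qed.

End kernel_bounds.

(** * Row coefficients with respect to the increments of U *)

Section row_coefficients.
Context {R : realType}.
Implicit Types (al : R) (t U : nat -> R) (m i : nat).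

Definition row_p al t m i : R := ker_int al (t m) (t i) (t i.+1) (fun=> 1).

Definition row_q al t m i : R :=
  ker_int al (t m) (t i) (t i.+1) (fun s => 2 * s - t i - t i.+1).

(** The curvature on interval i is the difference of the slopes i+1 and i over t_(i+2) - t_i, so its
    moment moves this amount of weight from slope i to slope i+1. For i+2 = m the last interval
    shares the parabola of interval i, and its moment is added. *)
Definition row_w al t m i : R :=
  if (i.+1 < m)%N then
    (row_q al t m i + (if i.+2 == m then row_q al t m i.+1 else 0)) / (t i.+2 - t i)
  else 0.

                                                                 
                                          
(** The coefficient of [U i.+1 - U i] in row m up to the factor 1/Gamma(1-alpha): the own moment,
    minus the weight given to the next slope, plus the weight received from the previous one, over
    the step. *)
Definition row_coef al t m i : R :=
  (row_p al t m i - row_w al t m i + (if i is i'.+1 then row_w al t m i' else 0))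
  / (t i.+1 - t i).

Lemma increasing_le (t : nat -> R) m i j : (forall j, (j < m)%N -> t j < t j.+1) ->
  (i <= j)%N -> (j <= m)%N -> t i <= t j.
Proof.
move=> inc; elim: j => [|j IH]; first by rewrite leqn0 => /eqP ->.
rewrite leq_eqVlt => /predU1P[->//|ij] jm.
by apply: le_trans (ltW (inc _ jm)); apply: IH => //; exact: ltnW.
Qed.

Lemma ker_int_slope al t U m i : 0 < al < 1 -> (i < m)%N ->
  (forall j, (j < m)%N -> t j < t j.+1) ->
  ker_int al (t m) (t i) (t i.+1)
    (fun s => slope t U i + row_curvature t U m i * (2 * s - t i - t i.+1)) =
  slope t U i * row_p al t m i + row_curvature t U m i * row_q al t m i.
Proof.
move=> al01 im0 inc.
have ii : t i < t i.+1 by exact: inc.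
have im : t i.+1 <= t m by exact: (increasing_le inc).
rewrite /row_p /row_q -!ker_intZ//; first 1 last.
- exact: continuous_twice.
- by move=> x; exact: cvg_cst.
rewrite -ker_intD//; first by apply: eq_ker_int => s _; rewrite mulr1.
- by move=> x; exact: cvg_cst.
- by move=> x; apply: cvgM; [exact: cvg_cst|exact: continuous_twice].
Qed.

Lemma row_sum_coef al t U m : (0 < m)%N -> (forall j, (j < m)%N -> t j < t j.+1) ->
  \sum_(i < m) (slope t U i * row_p al t m i + row_curvature t U m i * row_q al t m i) =
  \sum_(i < m) row_coef al t m i * (U i.+1 - U i).
Proof.
move=> m0 inc.
have E : forall i, (i < m)%N -> row_coef al t m i * (U i.+1 - U i) =
   slope t U i * row_p al t m i - slope t U i * row_w al t m i +
   slope t U i * (if i is i'.+1 then row_w al t m i' else 0).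
  move=> i im; have := inc _ im => h; rewrite /row_coef /slope.
  move: (if i is i'.+1 then _ else _) => W.
  by field; apply/eqP; lra.
rewrite [RHS](eq_bigr (fun i : 'I_m => slope t U i * row_p al t m i -
  slope t U i * row_w al t m i +
   slope t U i * (if (i : nat) is i'.+1 then row_w al t m i' else 0))); last first.
  by move=> i _; exact: E.
rewrite !big_split/= sumrN -addrA; congr (_ + _).
case: m m0 inc {E} => [//|[|k]] _ inc.
  by rewrite !big_ord1 /row_curvature /row_w/= mul0r !mulr0 oppr0 add0r.
rewrite [X in _ = _ + X]big_ord_recl/= mulr0 add0r.
rewrite [X in _ = - X + _]big_ord_recr/= {2}/row_w ltnn mulr0 addr0.
rewrite addrC -sumrB big_ord_recr/= [RHS]big_ord_recr/=.
have W i : (i < k.+1)%N -> t i < t i.+2.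
  by move=> ik; apply: lt_trans (inc _ _) (inc _ _); lia.
have -> : row_curvature t U k.+2 k.+1 = curvature t U k.
  by rewrite /row_curvature/=; congr curvature; lia.
rewrite big_ord_recr/= [in RHS]/row_w ltnS leqnn eqxx -addrA; congr (_ + _).
- apply: eq_bigr => -[i ik] _ /=.
  rewrite /row_w ltnS (leqW ik) ifF; last by apply/eqP; lia.
  have -> : row_curvature t U k.+2 i = curvature t U i.
    by rewrite /row_curvature/=; congr curvature; lia.
  rewrite /bump/= add1n /curvature; have := W i (leqW ik) => h.
  by field; apply/eqP; lra.
- have -> : row_curvature t U k.+2 k = curvature t U k.
    by rewrite /row_curvature/=; congr curvature; lia.
  rewrite /bump/= add1n /curvature; have := W k (leqnn _) => h.
  by field; apply/eqP; lra.
Qed.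

Lemma delta_t_coef al t U m : 0 < al < 1 -> (0 < m)%N -> t 0%N = 0 ->
  (forall j, (j < m)%N -> t j < t j.+1) ->
  delta_t al t U m = (Gamma (1 - al))^-1 *
  \sum_(i < m) row_coef al t m i * (U i.+1 - U i).
Proof.
move=> al01 m0 t0 inc; rewrite delta_tE// -row_sum_coef//; congr (_ * _).
by apply: eq_bigr => i _; rewrite ker_int_slope.
Qed.

End row_coefficients.

(** * Monotonicity of the coefficients away from the diagonal *)

Section row_signs.
Context {R : realType}.
Variables (al : R) (t : nat -> R) (m : nat).
Hypotheses (al0 : 0 < al) (al1 : al < 1).
Hypothesis inc : forall j, (j < m)%N -> t j < t j.+1.
Hypothesis hmono : forall j, (j.+1 < m)%N -> t j.+1 - t j <= t j.+2 - t j.+1.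

Local Notation h i := (t i.+1 - t i).
Local Notation k := (kern al (t m)).
Local Notation dk := (dkern al (t m)).
Local Notation p := (row_p al t m).
Local Notation q := (row_q al t m).
Local Notation w := (row_w al t m).
Local Notation G := (row_coef al t m).

Let al01 : 0 < al < 1. Proof. by rewrite al0. Qed.

Lemma node_lt i : (i < m)%N -> t i < t m.
Proof.
move=> im; apply: lt_le_trans (inc im) _.
exact: (increasing_le inc).
Qed.

Lemma node_le i : (i <= m)%N -> t i <= t m.
Proof. by move=> im; exact: (increasing_le inc). Qed.

Lemma row_w_ge0 i : 0 <= w i.
Proof.
rewrite /row_w; case: ifPn => // im.
have h1 : t i < t i.+1 by apply: inc; lia.
have h2 : t i.+1 < t i.+2 by apply: inc.
apply: divr_ge0; last lra.
apply: addr_ge0; first by apply: kerq_ge0 => //; apply: node_le; exact: ltnW.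
by case: ifPn => // /eqP e; apply: kerq_ge0 => //; apply: node_le; rewrite e.
Qed.

(** The kernel value at the common node t_(i+1) separates the two coefficients. From above, the
    weight received from interval i-1 is at most h^2 k'(t_i)/2, because steps do not decrease, and
    [ker1_gap] leaves exactly that much room. From below, the weight that interval i+1 gives away is
    at most the excess of its moment over h k(t_(i+1)), by [kerq_le_ker1]. The condition on i keeps
    the moment of the last interval out of these weights. *)
Lemma row_coef_le_next i : (i.+4 <= m)%N -> G i <= G i.+1.
Proof.
move=> im.
have h0 : t i < t i.+1 by apply: inc; lia.
have h1 : t i.+1 < t i.+2 by apply: inc; lia.
have h2 : t i.+2 < t i.+3 by apply: inc; lia.
have lt1 : t i.+1 < t m by apply: node_lt; lia.
have lt2 : t i.+2 < t m by apply: node_lt; lia.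
apply: (@le_trans _ _ (k (t i.+1))).
  rewrite /row_coef ler_pdivrMr; last lra.
  have w0 := row_w_ge0 i.
  have gap := ker1_gap al0 al1 h0 lt1.
  have dk0 := dker_ge0 al0 (t m) (t i).
  suff : (if i is i'.+1 then w i' else 0) <= (h i) ^+ 2 / 2 * dk (t i).
    by move: (if i is i'.+1 then _ else _) => W; rewrite /row_p; lra.
  case: i im h0 {h1 h2 lt1 lt2 w0 gap} dk0 => [|i] im h0 dk0.
    by apply: mulr_ge0 => //; apply: divr_ge0 => //; exact: sqr_ge0.
  have hm := @hmono i ltac:(lia).
  have hi : t i < t i.+1 by apply: inc; lia.
  have lti : t i.+1 < t m by apply: node_lt; lia.
  rewrite /row_w ifT; last lia.
  rewrite ifF ?addr0; last by apply/eqP; lia.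
  rewrite ler_pdivrMr; last lra.
  apply: le_trans (kerq_le al0 al1 hi lti) _.
  set a := h i; set b := h i.+1; set D := dk _.
  have a0 : 0 < a by rewrite /a; lra.
  have -> : t i.+2 - t i = a + b by rewrite /a /b; ring.
  have D0 : 0 <= D by exact: dk0.
  have ab : a <= b by [].
  have : 0 <= D * (3 * b ^+ 2 * (a + b) - a ^+ 3).
    apply: mulr_ge0 => //.
    have : a ^+ 3 <= b ^+ 2 * a.
      have : 0 <= (b - a) * (b + a) * a by rewrite !mulr_ge0//; lra.
      lra.
    have : 0 <= b ^+ 2 * (2 * a + 3 * b) by apply: mulr_ge0; [exact: sqr_ge0|lra].
    lra.
  lra.
rewrite /row_coef ler_pdivlMr; last lra.
have w0 := row_w_ge0 i.
suff : w i.+1 <= p i.+1 - (h i.+1) * k (t i.+1) by lra.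
rewrite /row_w ifT; last lia.
rewrite ifF ?addr0; last by apply/eqP; lia.
rewrite ler_pdivrMr; last lra.
apply: le_trans (kerq_le_ker1 al0 al1 h1 (ltW lt2)) _.
have g1 := ker1_ge al0 al1 h1 (ltW lt2).
have : 0 <= h i.+2 * (p i.+1 - h i.+1 * k (t i.+1)) by apply: mulr_ge0; rewrite /row_p; lra.
rewrite /row_p; lra.
Qed.

End row_signs.

(** * Numerical inequalities behind the signs at the last three indices *)

Section top_numerics.
Context {R : realType}.
Variables (al P Q v2 v2' v1 v1' v0 Y1 Y2 p1 p2 : R).
Hypotheses (al0 : 0 < al) (al1 : al < 1).
Hypothesis PE : P * (1 - al) = 1.
Hypothesis QE : Q * (2 - al) = al * P.
Hypotheses (v20 : 0 <= v2) (v2'0 : 0 <= v2') (v2'1 : v2' <= al / 12).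
Hypotheses (v10 : 0 <= v1) (v11 : v1 <= al / 12) (v1'0 : 0 <= v1').
Hypotheses (v00 : 0 <= v0) (v01 : v0 <= al / 24).
Hypotheses (Y1l : Q / 2 <= Y1) (Y1u : Y1 <= 101 / 200 * Q).
Hypotheses (Y2l : Q / 2 <= Y2) (Y2u : Y2 <= 101 / 200 * Q).
Hypotheses (p2u : p2 <= 1).

Let Ppos : 0 < P.
Proof.
rewrite -(@pmulr_lgt0 _ (1 - al)) ?PE//.
by move: al1 => ?; lra.
Qed.

Let Qpos : 0 < Q.
Proof.
have a2 : 0 < 2 - al by move: al1 => ?; lra.
by rewrite -(pmulr_lgt0 _ a2) QE mulr_gt0.
Qed.

(** Everything is divided by X, the last step to the power -alpha. P and Q are the exact moments of
    the last interval, the Y are the shares of its curvature weight, the p are moments and the v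
    small curvature weights of earlier intervals; P + v2 + Y1 and p2 - v2' - Y2 + v1 are the last
    two row coefficients. With beta = alpha/2 the right-hand side is minus the transformed
    coefficient at m-1; the left-hand side is beta times the stiffness, with one percent to spare
    for passing to the stiffness of the preceding step. *)
Lemma top_R2 : al / 2 * (101 / 100) * (P + 101 / 200 * Q + al / 12) <=
  (P + v2 + Y1) - (p2 - v2' - Y2 + v1) - al / 2 * (P + v2 + Y1).
Proof.
move: al0 al1 PE QE v20 v2'0 v11 Y1l Y2l p2u Ppos Qpos.
move=> a0 a1 eP eQ h1 h2 h3 h4 h5 h6 P0 Q0.
have h : 0 <= (1 - al / 2) * (v2 + (Y1 - Q / 2)) by rewrite mulr_ge0//; lra.
                                                             
                                  
(* All nonlinear terms are traded for alpha P: the relation Q(2-alpha) = alpha P removes Q with the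
   factor 1 - alpha/2, and P(1-alpha) = 1 turns alpha^2 P into alpha P - alpha. The rest is
   linear. *)
have e1 : (1 - al / 2) * Q = al / 2 * P by lra.
have e2 : al * (al * P) = al * P - al * (P * (1 - al)) by ring.
rewrite eP mulr1 in e2.
have Q_le : Q <= al * P.
  have : 0 <= (1 - al) * Q by rewrite mulr_ge0//; lra.
  lra.
have alQ : al * Q <= al * P.
  have : 0 <= al * (al * P - Q) by rewrite mulr_ge0//; lra.
  lra.
have aa : al * al <= al by rewrite ler_piMr//; lra.
have aP : al <= al * P.
  rewrite ler_peMr//; first lra.
  have : 0 <= al * P by rewrite mulr_ge0//; lra.
  lra.
lra.
Qed.

Hypothesis p21 : al * (1 / (4 - al) + 33 / 200) <= (p2 - p1) * (1 + al).

(** The transformed coefficient at m-2 is nonpositive because the gap p2 - p1 between neighbouring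
    kernel averages, together with beta times the coefficient at m-1, outweighs the curvature share
    Y2. After clearing denominators a cubic polynomial in alpha remains. *)
Lemma top_R3 : (p1 - v1' + v0) - (p2 - v2' - Y2 + v1) <=
  al / 2 * ((P + v2 + Y1) - (p2 - v2' - Y2 + v1) - al / 2 * (P + v2 + Y1)).
Proof.
move: al0 al1 PE QE v20 v2'0 v2'1 v10 v11 v1'0 v01 Y1l Y2u p2u p21 Ppos Qpos.
move=> a0 a1 eP eQ h1 h2 h3 h4 h5 h6 h7 h8 h9 h10 h11 P0 Q0.
set D := p2 - p1 in h11.
have e1 : (1 - al / 2) * Q = al / 2 * P by lra.
have a2 : 0 <= 1 - al / 2 by lra.
have k1 : 0 <= al / 2 * ((1 - al / 2) * (v2 + (Y1 - Q / 2))).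
  by rewrite !mulr_ge0//; lra.
have k2 : 0 <= (1 - al / 2) * (101 / 200 * Q - Y2) by rewrite mulr_ge0//; lra.
have k3 : 0 <= (1 - al / 2) * (al / 12 - v2') by rewrite mulr_ge0//; lra.
have k4 : 0 <= (1 - al / 2) * v1 by rewrite mulr_ge0//; lra.
have k5 : 0 <= al / 2 * (1 - p2) by rewrite mulr_ge0//; lra.
have aa : 0 <= al * al by rewrite mulr_ge0//; lra.
have k6 : 0 <= D + al * P * (99 / 400 - al / 8) - 5 / 8 * al; last first.
  rewrite /D in k6.
  have e3 : al / 2 * ((1 - al / 2) * Q) = al / 2 * (al / 2 * P) by rewrite e1.
  lra.
have b1 : 0 < 1 - al by lra.
have b2 : 0 < 1 + al by lra.
have b3 : 0 < 4 - al by lra.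
have b : 0 < (1 - al) * (1 + al) * (4 - al) by rewrite !mulr_gt0.
rewrite -(pmulr_rge0 _ b).
have -> : (1 - al) * (1 + al) * (4 - al) *
    (D + al * P * (99 / 400 - al / 8) - 5 / 8 * al) =
  (1 - al) * (4 - al) * (D * (1 + al)) + (1 + al) * (4 - al) * al *
    (P * (1 - al)) * (99 / 400 - al / 8) - 5 / 8 * al *
    ((1 - al) * (1 + al) * (4 - al)) by ring.
rewrite eP.
have c : 0 <= (1 - al) * (4 - al) by rewrite mulr_ge0// ltW.
have h12 := ler_wpM2l c h11.
have e4 : (1 - al) * (4 - al) * (al * (1 / (4 - al) + 33 / 200)) =
  (1 - al) * al * (1 + 33 / 200 * (4 - al)) by field; apply/eqP; lra.
rewrite e4 in h12.
have {h1 h2 h3 h4 h5 h6 h7 h8 h9 h10 k1 k2 k3 k4 k5 e1 a2 eQ eP P0 Q0 b e4} poly :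
    0 <= al * (3 / 20 - 383 / 400 * al + 617 / 400 * (al * al)
    + (1 - al) * (al * al) / 2).
  apply: mulr_ge0; first exact: ltW.
  have : 0 <= (1 - al) * (al * al) by apply: mulr_ge0 => //; exact: ltW.
  (* The quadratic part is only barely positive; 31/100 is close to its minimiser 383/1234. *)
  have : 0 <= (al - 31 / 100) * (al - 31 / 100) by rewrite -expr2 sqr_ge0.
  lra.
rewrite -subr_ge0 in h12.
apply: le_trans (addr_ge0 h12 poly) _.
by rewrite le_eqVlt; apply/orP; left; apply/eqP; field.
Qed.

End top_numerics.

(** * Inequalities for nearly equal consecutive steps *)

Section step_inequalities.
Context {R : realType}.
Implicit Types (al x y z h s c X Q q : R).

Lemma step_cube x y z : 0 < x -> x <= y -> y <= z -> 2 * x ^+ 3 <= (x + y) * y * z.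
Proof.
move=> x0 xy yz.
have e1 : x * x <= y * z by apply: ler_pM; lra.
have e2 : 0 <= (x + y) * (y * z - x * x) by rewrite mulr_ge0//; lra.
have e3 : 0 <= (y - x) * (x * x) by rewrite !mulr_ge0//; lra.
lra.
Qed.

Lemma scaled_moment_le al X h s c y q : 0 < al -> 0 < X -> 0 < h -> 0 < s -> 0 < c ->
  q <= y * (al * X / h) / 6 -> 2 * y <= s * c * h -> q / (s * c * X) <= al / 12.
Proof.
move=> a0 x0 h0 s0 c0 qy ysc; rewrite ler_pdivrMr ?mulr_gt0//; apply: le_trans qy _.
have -> : y * (al * X / h) / 6 = al * X / (12 * h) * (2 * y).
  by field; rewrite gt_eqF.
have -> : al / 12 * (s * c * X) = al * X / (12 * h) * (s * c * h).
  by field; rewrite gt_eqF.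
by apply: ler_wpM2l => //; rewrite divr_ge0// ltW// !mulr_gt0.
Qed.

Lemma curvature_share_low X Q h s c : 0 < X -> 0 < Q -> 0 < s -> 0 < c ->
  s * c <= 2 * h ^+ 2 -> Q / 2 <= h ^+ 2 * X * Q / (s * c * X).
Proof.
move=> x0 q0 s0 c0 sc; rewrite ler_pdivlMr ?mulr_gt0//.
have -> : Q / 2 * (s * c * X) = X * Q * (s * c) / 2 by ring.
have -> : h ^+ 2 * X * Q = X * Q * (2 * h ^+ 2) / 2 by field.
by rewrite ler_pM2r// ler_wpM2l// ltW// mulr_gt0.
Qed.

Lemma curvature_share_up X Q h s c : 0 < X -> 0 < Q -> 0 < s -> 0 < c ->
  200 * h ^+ 2 <= 101 * (s * c) -> h ^+ 2 * X * Q / (s * c * X) <= 101 / 200 * Q.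
Proof.
move=> x0 q0 s0 c0 sc; rewrite ler_pdivrMr ?mulr_gt0//.
have -> : h ^+ 2 * X * Q = X * Q * (200 * h ^+ 2) / 200 by field.
have -> : 101 / 200 * Q * (s * c * X) = X * Q * (101 * (s * c)) / 200 by field.
by rewrite ler_pM2r// ler_wpM2l// ltW// mulr_gt0.
Qed.

Lemma powR_two_low al : 0 < al < 1 -> (1 + al)^-1 <= (2 : R) `^ (- al).
Proof.
move=> /andP[a0 a1]; rewrite powRN lef_pV2 ?posrE ?powR_gt0//; last lra.
have := @bernoulli_concave R 2 al ltac:(lra) ltac:(lra); lra.
Qed.

Lemma powR_ratio al x y : 0 < x -> 0 < y -> x `^ (- al) = y `^ (- al) * (y / x) `^ al.
Proof.
move=> x0 y0.
have xy : 0 < y / x by rewrite divr_gt0.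
rewrite {1}(_ : x = y * (y / x)^-1); last by field; rewrite !gt_eqF.
rewrite powRM ?invr_ge0 ?ltW//; congr (_ * _).
by rewrite -powR_inv1 ?ltW// -powRrM mulN1r opprK.
Qed.

(** The distance is at most 3/2 h3, that is 3/4 of 2 h3, and (3/4)^alpha <= 1 - alpha/4 by
    Bernoulli. Values are expressed relative to 2^(-alpha) so as to be comparable with those of
    [kernel_ratio_up]. *)
Lemma kernel_ratio_low al h2 h3 : 0 < al -> al < 1 -> 0 < h2 -> h2 <= h3 ->
  2 `^ (- al) * (1 - al / 4)^-1 * h3 `^ (- al) <= (h3 + h2 / 2) `^ (- al).
Proof.
move=> a0 a1 h20 h23.
have h30 : 0 < h3 by lra.
apply: (@le_trans _ _ ((3 / 2 * h3) `^ (- al))); last first.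
  by apply: powR_antimono; lra.
rewrite powRM//; [|lra].
rewrite ler_wpM2r ?powR_ge0//.
rewrite (@powR_ratio al (3 / 2) 2)//.
rewrite ler_wpM2l ?powR_ge0//.
have -> : 2 / (3 / 2) = (3 / 4)^-1 :> R by field.
have -> : (3 / 4)^-1 `^ al = ((3 / 4) `^ al)^-1 :> R.
  have h34 : 0 <= 3 / 4 :> R by lra.
  by rewrite -(powR_inv1 h34) -powRrM mulN1r powRN.
have e : (3 / 4) `^ al <= 1 - al / 4 :> R.
  by have := @bernoulli_concave R (3 / 4) al ltac:(lra) ltac:(lra); lra.
by rewrite lef_pV2 ?posrE ?powR_gt0//; lra.
Qed.

Lemma kernel_ratio_up al c d h x : 0 < al -> al < 1 -> 0 < c -> 0 < h ->
  2 <= c * (1 + d) -> c * h <= x ->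
  x `^ (- al) <= 2 `^ (- al) * (1 + al * d) * h `^ (- al).
Proof.
move=> a0 a1 c0 h0 cd chx.
apply: (@le_trans _ _ ((c * h) `^ (- al))).
  by apply: powR_antimono => //; [lra|rewrite mulr_gt0].
rewrite (powRM _ (ltW c0) (ltW h0)).
rewrite ler_wpM2r ?powR_ge0//.
rewrite (@powR_ratio al c 2)// ler_wpM2l ?powR_ge0//.
have a01 : 0 <= al <= 1 by rewrite !ltW.
have c20 : 0 < 2 / c by rewrite divr_gt0.
apply: le_trans (bernoulli_concave c20 a01) _.
rewrite lerD2l ler_pM2l// lerBlDr ler_pdivrMr// [d + 1]addrC.
by rewrite [leRHS]mulrC.
Qed.

(** The inverse of 1 - alpha/4 is 1 + alpha/(4-alpha), the first term of the gap. The two offsets in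
    the bound for p1 average to -33/200, the second term: -53/160 + 1/800 = -33/100, and the terms
    1/4000 cancel. Finally 2^(-alpha) >= 1/(1+alpha). *)
Lemma p_gap al p1 p2 : 0 < al -> al < 1 ->
  2 `^ (- al) * (1 - al / 4)^-1 <= p2 ->
  p1 <= (2 `^ (- al) * (1 + al * - (53 / 160 + 1 / 20 / 20 / 10)) + 2 `^ (- al) * (1 + al * (1 / 40 / 20 + 1 / 20 / 20 / 10))) / 2 ->
  al * (1 / (4 - al) + 33 / 200) <= (p2 - p1) * (1 + al).
Proof.
move=> a0 a1 hp2 hp1.
set B := 2 `^ (- al) in hp1 hp2.
have B0 : 0 < B by rewrite powR_gt0.
have Bl : (1 + al)^-1 <= B by apply: powR_two_low; rewrite a0.
have e : (1 - al / 4)^-1 = 1 + al / (4 - al) by field; do ?(apply/andP; split); apply/eqP; lra.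
have h : B * (al * (1 / (4 - al) + 33 / 200)) <= p2 - p1.
  rewrite {}e in hp2.
  have -> : B * (al * (1 / (4 - al) + 33 / 200)) =
    B * (1 + al / (4 - al)) - B + 33 / 200 * (B * al) by ring.
  set z := B * (1 + _) in hp2 *.
  have : 0 <= B * al by rewrite mulr_ge0// ltW.
  have : p1 <= B - 33 / 200 * (B * al).
    apply: le_trans hp1 _.
    by rewrite le_eqVlt; apply/orP; left; apply/eqP; field.
  lra.
have c : 0 <= al * (1 / (4 - al) + 33 / 200).
  by rewrite mulr_ge0 ?(ltW a0)// addr_ge0// ?divr_ge0//; lra.
have b2 : 0 < 1 + al by lra.
rewrite -ler_pdivrMr//; apply: le_trans h.
by rewrite [leRHS]mulrC ler_wpM2l.
Qed.

End step_inequalities.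

(** * The last three coefficients of a row *)

Section row_top.
Context {R : realType}.

(** Bound for the diagonal coefficient in units of the last step to the power -alpha: the exact
    moment P, at most 101/200 of Q from the last curvature, at most alpha/12 from the interval
    before. *)
Definition stiff (al : R) : R :=
  (1 - al)^-1 + 101 / 200 * (al / ((1 - al) * (2 - al))) + al / 12.

Lemma row_top_abstract (al h0 h1 h2 h3 p1 p2 q0 q1 q2 k1 k2 k3 d1 d2 : R) :
  0 < al -> al < 1 -> 0 < h0 -> h0 <= h1 -> h1 <= h2 -> h2 <= h3 ->
  (1 - 1 / 20 / 20) * h3 <= h2 -> (1 - 1 / 20 / 20) * h2 <= h1 ->
  let X := h3 `^ (- al) in
  let P := (1 - al)^-1 in
  let Q := al / ((1 - al) * (2 - al)) in
  let q3 := h3 ^+ 2 * X * Q in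
  k1 = (h1 + h2 + h3) `^ (- al) -> k2 = (h3 + h2) `^ (- al) ->
  k3 = (h3 + h2 / 2) `^ (- al) ->
  d1 <= al * X / (2 * h3) -> d2 <= al * X / h3 ->
  h2 * k3 <= p2 -> p2 <= h2 * X -> p1 <= h1 * ((k1 + k2) / 2) ->
  0 <= q0 -> q0 <= h0 ^+ 3 * d1 / 6 -> 0 <= q1 -> q1 <= h1 ^+ 3 * d2 / 6 ->
  0 <= q2 -> q2 <= h2 ^+ 3 * (al * X / h3) / 6 ->
  let G3 := (h3 * X * P + (q2 + q3) / (h2 + h3)) / h3 in
  let G2 := (p2 - (q2 + q3) / (h2 + h3) + q1 / (h1 + h2)) / h2 in
  let G1 := (p1 - q1 / (h1 + h2) + q0 / (h0 + h1)) / h1 in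
  [/\ 0 < G3, G3 <= stiff al * X,
      al / 2 * (101 / 100) * (stiff al * X) <= G3 - G2 - al / 2 * G3 &
      G1 - G2 <= al / 2 * (G3 - G2 - al / 2 * G3)].
Proof.
move=> a0 a1 a2 b1 b2 b3 c23 c12 X P Q q3 ek1 ek2 ek3 hd1 hd2 hp2 hp2' hp1.
move=> q00 q0u q10 q1u q20 q2u G3 G2 G1.
have h30 : 0 < h3 by lra.
have h20 : 0 < h2 by lra.
have h10 : 0 < h1 by lra.
have X0 : 0 < X by exact: powR_gt0.
have h23 : 0 < h2 + h3 by lra.
have h12 : 0 < h1 + h2 by lra.
have h01 : 0 < h0 + h1 by lra.
have pos x y z : 0 < y -> 0 < z -> 0 <= x -> 0 <= x / (y * z * X).
  by move=> *; rewrite divr_ge0// ltW// !mulr_gt0.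
have am : 0 < 1 - al by lra.
have am2 : 0 < 2 - al by lra.
have PE : P * (1 - al) = 1 by rewrite mulVf// gt_eqF.
have QE : Q * (2 - al) = al * P by rewrite /Q /P; field; rewrite !gt_eqF.
have Q0 : 0 < Q by rewrite divr_gt0// mulr_gt0.
have u2' : q2 / ((h2 + h3) * h2 * X) <= al / 12.
  apply: (scaled_moment_le a0 X0 h30 h23 h20 q2u).
  have := step_cube h20 (lexx h2) b3.
  have : 0 <= h2 * h3 * (h3 - h2) by rewrite !mulr_ge0//; lra.
  lra.
have u1 : q1 / ((h1 + h2) * h2 * X) <= al / 12.
  apply: (scaled_moment_le a0 X0 h30 h12 h20); last exact: step_cube.
  apply: le_trans q1u _; rewrite ler_pM2r// ler_wpM2l// exprn_ge0//; exact: ltW.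
have u0 : q0 / ((h0 + h1) * h1 * X) <= al / 24.
  have : q0 * 2 / ((h0 + h1) * h1 * X) <= al / 12.
    apply: (@scaled_moment_le _ al X h3 _ _ (h0 ^+ 3)) => //; last first.
      by apply: step_cube => //; lra.
    have := ler_wpM2l (exprn_ge0 3 (ltW a2)) hd1.
    have -> : h0 ^+ 3 * (al * X / h3) / 6 = h0 ^+ 3 * (al * X / (2 * h3)) / 3.
      by field; rewrite gt_eqF.
    by lra.
  rewrite mulrAC; lra.
have Y1l : Q / 2 <= q3 / ((h2 + h3) * h3 * X).
  apply: curvature_share_low => //.
  have : 0 <= h3 * (h3 - h2) by rewrite mulr_ge0//; lra.
  lra.
have Y2l : Q / 2 <= q3 / ((h2 + h3) * h2 * X).
  apply: curvature_share_low => //.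
  have : 0 <= (h3 - h2) * (2 * h3 + h2) by rewrite mulr_ge0//; lra.
  lra.
have Y1u : q3 / ((h2 + h3) * h3 * X) <= 101 / 200 * Q.
  apply: curvature_share_up => //.
  have : 0 <= h3 * (101 * h2 - 99 * h3) by rewrite mulr_ge0//; lra.
  lra.
have Y2u : q3 / ((h2 + h3) * h2 * X) <= 101 / 200 * Q.
  apply: curvature_share_up => //.
  have f : 0 <= h2 - (1 - 1 / 20 / 20) * h3 by lra.
  have : 0 <= (h2 - (1 - 1 / 20 / 20) * h3) * (h2 + h3) by rewrite mulr_ge0//; lra.
  have : 0 <= (h2 - (1 - 1 / 20 / 20) * h3) * h3 by rewrite mulr_ge0//; lra.
  have : 0 <= h3 * h3 by rewrite mulr_ge0// ltW.
  lra.
have p2u : p2 / (h2 * X) <= 1 by rewrite ler_pdivrMr ?mulr_gt0// mul1r.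
have gap : al * (1 / (4 - al) + 33 / 200) <= (p2 / (h2 * X) - p1 / (h1 * X)) * (1 + al).
  apply: p_gap => //.
  - rewrite ler_pdivlMr ?mulr_gt0//; apply: le_trans hp2; rewrite ek3.
    rewrite mulrC -mulrA ler_pM2l// mulrC.
    exact: kernel_ratio_low.
  - rewrite ler_pdivrMr ?mulr_gt0//; apply: le_trans hp1 _.
    rewrite [leRHS]mulrC -[leRHS]mulrA ler_pM2l// [leRHS]mulrC mulrAC ler_pM2r//.
    rewrite mulrDl ek1 ek2 lerD//.
    (* Each step loses at most 1/400 of the next one, so the distances are at least 3 - 3/400 and 2
       - 1/400 times h3. *)
    + by apply: (@kernel_ratio_up _ al (3 - 3 / 20 / 20)) => //; lra.
    + by apply: (@kernel_ratio_up _ al (2 - 1 / 20 / 20)) => //; lra.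
have v20 := pos _ _ _ h23 h30 q20; have v2'0 := pos _ _ _ h23 h20 q20.
have v10 := pos _ _ _ h12 h20 q10; have v1'0 := pos _ _ _ h12 h10 q10.
have v00 := pos _ _ _ h01 h10 q00.
have E3 : G3 = X * (P + q2 / ((h2 + h3) * h3 * X) + q3 / ((h2 + h3) * h3 * X)).
  by rewrite /G3; field; rewrite !gt_eqF.
have E2 : G2 = X * (p2 / (h2 * X) - q2 / ((h2 + h3) * h2 * X)
    - q3 / ((h2 + h3) * h2 * X) + q1 / ((h1 + h2) * h2 * X)).
  by rewrite /G2; field; rewrite !gt_eqF.
have E1 : G1 = X * (p1 / (h1 * X) - q1 / ((h1 + h2) * h1 * X)
    + q0 / ((h0 + h1) * h1 * X)).
  by rewrite /G1; field; rewrite !gt_eqF.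
have v2u : q2 / ((h2 + h3) * h3 * X) <= al / 12.
  apply: le_trans u2'; rewrite ler_wpM2l// lef_pV2 ?posrE ?mulr_gt0//.
  by rewrite ler_pM2r// ler_pM2l.
have P0 : 0 < P by rewrite invr_gt0.
have r2 := @top_R2 R al P Q _ _ _ _ _ _ a0 a1 PE QE v20 v2'0 u1 Y1l Y2l p2u.
have r3 := top_R3 a0 a1 PE QE v20 v2'0 u2' v10 u1 v1'0 u0 Y1l Y2u p2u gap.
split.
- by rewrite E3 mulr_gt0// ltr_wpDr ?ltr_wpDr// (le_trans _ Y1l)// divr_ge0// ltW.
- rewrite E3 mulrC ler_pM2r// /stiff -/P -/Q; lra.
- have -> : al / 2 * (101 / 100) * (stiff al * X) =
    X * (al / 2 * (101 / 100) * stiff al) by ring.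
  rewrite E3 E2 [al / 2 * (X * _)]mulrCA -!mulrBr ler_pM2l//.
- rewrite E3 E2 E1 [al / 2 * (X * _)]mulrCA -!mulrBr [al / 2 * (X * _)]mulrCA ler_pM2l//.
Qed.

End row_top.

Lemma row_top (R : realType) (al : R) (t : nat -> R) (n : nat) :
  0 < al -> al < 1 ->
  (forall j, (j < n.+4)%N -> t j < t j.+1) ->
  (forall j, (j.+1 < n.+4)%N -> t j.+1 - t j <= t j.+2 - t j.+1) ->
  (1 - 1 / 20 / 20) * (t n.+4 - t n.+3) <= t n.+3 - t n.+2 ->
  (1 - 1 / 20 / 20) * (t n.+3 - t n.+2) <= t n.+2 - t n.+1 ->
  let X := (t n.+4 - t n.+3) `^ (- al) in
  let G := row_coef al t n.+4 in
  [/\ 0 < G n.+3, G n.+3 <= stiff al * X,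
      al / 2 * (101 / 100) * (stiff al * X) <= G n.+3 - G n.+2 - al / 2 * G n.+3 &
      G n.+1 - G n.+2 <= al / 2 * (G n.+3 - G n.+2 - al / 2 * G n.+3)].
Proof.
move=> al0 al1 inc hmono c23 c12 X G.
have i0 : t n < t n.+1 by apply: inc; lia.
have i1 : t n.+1 < t n.+2 by apply: inc; lia.
have i2 : t n.+2 < t n.+3 by apply: inc; lia.
have i3 : t n.+3 < t n.+4 by apply: inc.
have m0 : t n.+1 - t n <= t n.+2 - t n.+1 by apply: hmono; lia.
have m1 : t n.+2 - t n.+1 <= t n.+3 - t n.+2 by apply: hmono; lia.
have m2 : t n.+3 - t n.+2 <= t n.+4 - t n.+3 by apply: hmono.
set h0 := t n.+1 - t n in m0; set h1 := t n.+2 - t n.+1 in m0 m1 c12.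
set h2 := t n.+3 - t n.+2 in m1 m2 c23 c12; set h3 := t n.+4 - t n.+3 in m2 c23 X *.
have h0p : 0 < h0 by rewrite subr_gt0.
have h3p : 0 < h3 by rewrite subr_gt0.
have s13 : t n.+4 - t n.+1 = h1 + h2 + h3 by rewrite /h1 /h2 /h3; ring.
have s23 : t n.+4 - t n.+2 = h3 + h2 by rewrite /h2 /h3; ring.
have lt1 : t n.+1 < t n.+4 by lra.
have lt2 : t n.+2 < t n.+4 by lra.
have q3E : row_q al t n.+4 n.+3 = h3 ^+ 2 * X * (al / ((1 - al) * (2 - al))).
  by rewrite /row_q kerq_last// !mulrA.
have p3E : row_p al t n.+4 n.+3 = h3 * X * (1 - al)^-1 by rewrite /row_p ker1_last.
have dk3 : dkern al (t n.+4) (t n.+3) = al * X / h3.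
  by rewrite /dkern -/h3 powRD_pos// powR_inv1 ?mulrA// ltW.
have dk2 : dkern al (t n.+4) (t n.+2) <= al * X / h3.
  by rewrite -dk3; apply: dker_mono => //; exact: ltW.
(* The distance h1 + h2 + h3 exceeds 2 h3 because the steps are nearly equal. *)
have dk1 : dkern al (t n.+4) (t n.+1) <= al * X / (2 * h3).
  rewrite /dkern s13 powRD_pos; last lra.
  rewrite powR_inv1; last lra.
  have f1 : (h1 + h2 + h3) `^ (- al) <= X by apply: powR_antimono; lra.
  have f2 : (h1 + h2 + h3)^-1 <= (2 * h3)^-1 by rewrite lef_pV2 ?posrE; lra.
  rewrite -[leRHS]mulrA ler_pM2l//; apply: ler_pM => //; first exact: powR_ge0.
  by rewrite invr_ge0; lra.
have [] := @row_top_abstract R al h0 h1 h2 h3 (row_p al t n.+4 n.+1) (row_p al t n.+4 n.+2)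
  (row_q al t n.+4 n) (row_q al t n.+4 n.+1) (row_q al t n.+4 n.+2)
  (kern al (t n.+4) (t n.+1)) (kern al (t n.+4) (t n.+2))
  (kern al (t n.+4) ((t n.+2 + t n.+3) / 2))
  (dkern al (t n.+4) (t n.+1)) (dkern al (t n.+4) (t n.+2)) al0 al1 h0p m0 m1 m2 c23 c12.
- by rewrite /kern s13.
- by rewrite /kern s23.
- by rewrite /kern; congr (_ `^ _); rewrite /h2 /h3; field.
- exact: dk1.
- exact: dk2.
- by apply: ker1_midpoint => //; exact: ltW.
- have := @ker1_le R al al0 al1 (t n.+4) (t n.+2) (t n.+3) i2 i3.
  by rewrite /kern -/h2 -/h3.
- exact: ker1_trapezoid.
- by apply: kerq_ge0 => //; exact: ltW.
- exact: kerq_le.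
- by apply: kerq_ge0 => //; exact: ltW.
- exact: kerq_le.
- by apply: kerq_ge0 => //; exact: ltW.
- by rewrite -dk3; exact: kerq_le.
rewrite -/X -p3E -q3E.
have -> : (row_p al t n.+4 n.+3 + (row_q al t n.+4 n.+2 + row_q al t n.+4 n.+3) / (h2 + h3))
    / h3 = G n.+3.
  rewrite /G /row_coef /row_w ltnn ltnSn eqxx subr0 [h2 + h3]addrC -s23.
  by [].
have -> : (row_p al t n.+4 n.+2 - (row_q al t n.+4 n.+2 + row_q al t n.+4 n.+3) / (h2 + h3)
    + row_q al t n.+4 n.+1 / (h1 + h2)) / h2 = G n.+2.
  rewrite /G /row_coef /row_w !ltnS leqnn leqnSn eqxx (ltn_eqF (ltnSn n.+3)) addr0.
  rewrite [h2 + h3]addrC -s23.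
  by have -> : t n.+3 - t n.+1 = h1 + h2 by rewrite /h1 /h2; ring.
have -> : (row_p al t n.+4 n.+1 - row_q al t n.+4 n.+1 / (h1 + h2)
    + row_q al t n.+4 n / (h0 + h1)) / h1 = G n.+1.
  rewrite /G /row_coef /row_w !ltnS leqnSn (leqW (leqnSn n)).
  rewrite (ltn_eqF (ltnSn n.+3)) (ltn_eqF (leqW (ltnSn n.+2))) !addr0.
  have -> : t n.+3 - t n.+1 = h1 + h2 by rewrite /h1 /h2; ring.
  by have -> : t n.+2 - t n = h0 + h1 by rewrite /h0 /h1; ring.
by [].
Qed.

                                                   

(** * Semidefinite forms on a linear domain *)

Section psd_form.
Context {R : realType} {E : lmodType R}.
Variables (D : E -> Prop) (b : E -> E -> R).
Hypothesis D_lin : forall (a : R) x y, D x -> D y -> D (a *: x + y).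
Hypothesis b_lin : forall (a : R) x y z, D x -> D y -> D z ->
  b (a *: x + y) z = a * b x z + b y z.
Hypothesis b_sym : forall x y, D x -> D y -> b x y = b y x.
Hypothesis b_ge0 : forall x, D x -> 0 <= b x x.

(** The quadratic l -> b(lx+y, lx+y) is nonnegative, hence its discriminant is not positive. The
    form is bilinear only on [D] and may degenerate: if b(x,x) = 0 the quadratic is affine and its
    slope has to vanish. *)
Lemma psd_cauchy_schwarz_sq x y : D x -> D y -> b x y ^+ 2 <= b x x * b y y.
Proof.
move=> Dx Dy; set p := b x x; set q := b x y; set r := b y y.
have pos l : 0 <= l ^+ 2 * p + 2 * l * q + r.
  have Dxy : D (l *: x + y) by exact: D_lin.
  have := b_ge0 Dxy; rewrite b_lin// ![b _ (_ + _)]b_sym// !b_lin// -/p -/r.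
  rewrite [b y x]b_sym// -/q; lra.
have p0 : 0 <= p by exact: b_ge0.
have [pE|pn] := eqVneq p 0.
  suff -> : q = 0 by rewrite expr0n/= pE mul0r.
  apply/eqP; apply/negPn/negP => q0.
  (* At this argument the affine function takes the value -1. *)
  have := pos (- (r + 1) / (2 * q)); rewrite pE mulr0 add0r.
  have -> : 2 * (- (r + 1) / (2 * q)) * q = - (r + 1) by field.
  lra.
have pp : 0 < p by rewrite lt_neqAle eq_sym pn.
have := pos (- q / p).
have -> : (- q / p) ^+ 2 * p + 2 * (- q / p) * q + r = (p * r - q ^+ 2) / p by field.
by rewrite pmulr_lge0 ?invr_gt0// subr_ge0.
Qed.

Lemma psd_cauchy_schwarz x y : D x -> D y ->
  b x y <= Num.sqrt (b x x) * Num.sqrt (b y y).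
Proof.
move=> Dx Dy; apply: le_trans (ler_norm _) _.
rewrite -sqrtrM ?b_ge0// -sqrtr_sqr ler_wsqrtr//.
exact: psd_cauchy_schwarz_sq.
Qed.

Lemma psd_triangle (a : R) x y : D x -> D y ->
  Num.sqrt (b (a *: x + y) (a *: x + y)) <=
  `|a| * Num.sqrt (b x x) + Num.sqrt (b y y).
Proof.
move=> Dx Dy.
have Dxy : D (a *: x + y) by exact: D_lin.
have x0 := b_ge0 Dx; have y0 := b_ge0 Dy.
have s0 : 0 <= `|a| * Num.sqrt (b x x) + Num.sqrt (b y y).
  by rewrite addr_ge0 ?mulr_ge0 ?sqrtr_ge0.
rewrite -(ger0_norm s0) -sqrtr_sqr ler_wsqrtr//.
have cs : a * b x y <= `|a| * (Num.sqrt (b x x) * Num.sqrt (b y y)).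
  apply: le_trans (ler_norm _) _; rewrite normrM ler_wpM2l// -sqrtrM// -sqrtr_sqr.
  by rewrite ler_wsqrtr//; exact: psd_cauchy_schwarz_sq.
rewrite b_lin// ![b _ (_ + _)]b_sym// !b_lin// [b y x]b_sym//.
have := real_normK (num_real a).
rewrite sqrrD exprMn !sqr_sqrtr// => ->; lra.
Qed.

End psd_form.

(** * Rewriting a row in the variables e_j - beta e_(j-1) *)

Section kappa_transform.
Context {R : realType}.
Implicit Types (bt : R) (a e : nat -> R).

                                                                                    
                                                                         
(** Backward Horner scheme over the distance d = m+1-j from the end: [kappa bt a m j] is the sum of
    beta^(l-j) a_l over j <= l <= m, the coefficients obtained by inverting the bidiagonal map from
    e to e_j - beta e_(j-1). *)
Fixpoint kappa_aux bt a m d : R :=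
  if d is d'.+1 then a (m - d')%N + bt * kappa_aux bt a m d' else 0.

Definition kappa bt a m j : R := kappa_aux bt a m (m.+1 - j).

Lemma kappa_last bt a m : kappa bt a m m = a m.
Proof. by rewrite /kappa subSnn /= subn0 mulr0 addr0. Qed.

Lemma kappa_rec bt a m j : (j < m)%N -> kappa bt a m j = a j + bt * kappa bt a m j.+1.
Proof.
move=> jm; rewrite /kappa subSS.
have -> : (m.+1 - j = (m - j).+1)%N by rewrite subSn// ltnW.
by rewrite /= subKn// ltnW.
Qed.

(** Adding terms from the last index downwards leaves a single defect proportional to e_(j-1), which
    disappears at e_0 = 0. *)
Lemma kappa_sum (V : lmodType R) bt a m (e : nat -> V) : e 0%N = 0 ->
  \sum_(1 <= j < m.+1) kappa bt a m j *: (- bt *: e j.-1 + e j) =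
  \sum_(1 <= j < m.+1) a j *: e j.
Proof.
move=> e0; case: m => [|m]; first by rewrite !big_nil.
have H : forall d, (d <= m)%N ->
  \sum_((m.+1 - d) <= j < m.+2) kappa bt a m.+1 j *: (- bt *: e j.-1 + e j) =
  \sum_((m.+1 - d) <= j < m.+2) a j *: e j
  - (bt * kappa bt a m.+1 (m.+1 - d)) *: e (m.+1 - d).-1.
  elim=> [|d IH] dm.
    rewrite subn0 !big_nat1 kappa_last scalerDr scalerA addrC; congr (_ + _).
    by rewrite mulrN scaleNr mulrC.
  have e1 : (m.+1 - d.+1).+1 = (m.+1 - d)%N by lia.
  rewrite big_ltn; last lia.
  rewrite [in RHS]big_ltn; last lia.
  rewrite e1 IH ?(ltnW dm)//.
  have e2 : (m.+1 - d).-1 = (m.+1 - d.+1)%N by lia.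
  rewrite e2 (@kappa_rec _ _ m.+1 (m.+1 - d.+1)); last lia.
  rewrite e1.
  set x := e (m.+1 - d.+1).-1; set y := e (m.+1 - d.+1)%N; set s := \sum_(_ <= _ < _) _.
  set k := kappa _ _ _ (_ - d)%N; set c := a _.
  have shuffle (P C K S : V) : (- P + (C + K)) + (S - K) = C + S - P.
    by rewrite -addrA [- P + _]addrC addrACA subrr addr0.
  rewrite scalerDr !scalerA scalerDl -(shuffle _ _ ((bt * k) *: y)); congr (_ + _ + _).
  by rewrite mulrN scaleNr mulrC.
have := H m (leqnn _); rewrite subSnn => ->.
by rewrite /= e0 scaler0 subr0.
Qed.

End kappa_transform.

(** * The energy inequality for one row *)

Section energy.
Context {R : realType} {E : lmodType R}.
Variables (D : E -> Prop) (dot frm : E -> E -> R).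
Hypothesis D_lin : forall (a : R) x y, D x -> D y -> D (a *: x + y).
Hypothesis dot_lin : forall (a : R) x y z, D x -> D y -> D z ->
  dot (a *: x + y) z = a * dot x z + dot y z.
Hypothesis dot_sym : forall x y, D x -> D y -> dot x y = dot y x.
Hypothesis dot_ge0 : forall x, D x -> 0 <= dot x x.
Hypothesis frm_lin : forall (a : R) x y z, D x -> D y -> D z ->
  frm (a *: x + y) z = a * frm x z + frm y z.
Hypothesis frm_sym : forall x y, D x -> D y -> frm x y = frm y x.
Hypothesis frm_ge0 : forall x, D x -> 0 <= frm x x.
Hypothesis D0 : D 0.

Local Notation nrm x := (Num.sqrt (dot x x)).
Local Notation ene x := (Num.sqrt (frm x x)).

Definition energy_norm (kh : R) (v x : E) : R :=
  Num.sqrt (dot v v + frm x x / kh).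

Lemma energy_norm_ge_dot kh v x : 0 < kh -> D x -> nrm v <= energy_norm kh v x.
Proof.
by move=> kh0 Dx; rewrite /energy_norm ler_wsqrtr// lerDl divr_ge0 ?frm_ge0 ?ltW.
Qed.

Lemma two_term_cauchy_schwarz (a b c d : R) : 0 <= a -> 0 <= b -> 0 <= c -> 0 <= d ->
  a * b + c * d <= Num.sqrt (a ^+ 2 + c ^+ 2) * Num.sqrt (b ^+ 2 + d ^+ 2).
Proof.
move=> a0 b0 c0 d0.
have s0 : 0 <= a * b + c * d by rewrite addr_ge0// mulr_ge0.
rewrite -sqrtrM ?addr_ge0 ?sqr_ge0// -(ger0_norm s0) -sqrtr_sqr ler_wsqrtr//.
have := sqr_ge0 (a * d - b * c); lra.
Qed.

                                                                            
                                                            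
(** With s and s' the energies of e_(m+1) and e_m, the form contributes at least s^2 - beta s s'. As
    k_(m+1) <= kh_(m+1), the square s^2 completes k_(m+1) N_(m+1)^2. The cross term beta s s' is
    absorbed together with the inner product of v_m and v_(m+1) into -k_m N_m N_(m+1) by
    Cauchy-Schwarz in the plane; the hypothesis beta^2 kh_(m+1) kh_m <= k_m^2 is precisely what this
    needs. The earlier indices enter only through inner products with nonpositive coefficients. *)
Lemma energy_row (m : nat) (k kh : nat -> R) (e : nat -> E) (bt rho : R) :
  (0 < m)%N -> (forall j, D (e j)) -> 0 <= bt -> 0 <= rho ->
  (forall j, 0 < kh j) -> 0 < k m.+1 -> k m.+1 <= kh m.+1 ->
  (forall j, (j <= m)%N -> k j <= 0) ->
  bt ^+ 2 * (kh m.+1 * kh m) <= k m ^+ 2 ->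
  let v j := - bt *: e j.-1 + e j in
  let N j := energy_norm (kh j) (v j) (e j) in
  \sum_(1 <= j < m.+2) k j * dot (v j) (v m.+1) + frm (e m.+1) (v m.+1) <=
    rho * nrm (v m.+1) ->
  k m.+1 * N m.+1 <= \sum_(1 <= j < m.+1) - k j * N j + rho.
Proof.
move=> m0 De bt0 rho0 kh0 km0 kmkh kneg kbt v N eq.
have Dv j : D (v j) by exact: D_lin.
have N0 j : 0 <= N j by exact: sqrtr_ge0.
have nN j : nrm (v j) <= N j by exact: energy_norm_ge_dot.
have S0 : 0 <= \sum_(1 <= j < m.+1) - k j * N j + rho.
  rewrite addr_ge0// big_nat_cond sumr_ge0// => j /andP[/andP[_ jm] _].
  by rewrite mulr_ge0// oppr_ge0 kneg// -ltnS.
have [Nz|Nz] := eqVneq (N m.+1) 0; first by rewrite Nz mulr0.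
have Np : 0 < N m.+1 by rewrite lt_neqAle eq_sym Nz N0.
rewrite -(ler_pM2r Np).
set s := ene (e m.+1); set s' := ene (e m).
have s_sq : s ^+ 2 = frm (e m.+1) (e m.+1) by rewrite sqr_sqrtr// frm_ge0.
have n_sq : nrm (v m.+1) ^+ 2 = dot (v m.+1) (v m.+1) by rewrite sqr_sqrtr// dot_ge0.
have N_sq : N m.+1 ^+ 2 = nrm (v m.+1) ^+ 2 + s ^+ 2 / kh m.+1.
  rewrite n_sq s_sq /N /energy_norm sqr_sqrtr//.
  by rewrite addr_ge0 ?dot_ge0// divr_ge0 ?frm_ge0// ltW.
have frm_low : s ^+ 2 - bt * (s * s') <= frm (e m.+1) (v m.+1).
  rewrite frm_sym// /v frm_lin// -s_sq/= [frm (e m) _]frm_sym//.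
  have := psd_cauchy_schwarz D_lin frm_lin frm_sym frm_ge0 (De m.+1) (De m).
  rewrite -/s -/s' => /(ler_wpM2l bt0); lra.
have k_low : k m.+1 * N m.+1 ^+ 2 <= k m.+1 * nrm (v m.+1) ^+ 2 + s ^+ 2.
  rewrite N_sq mulrDr lerD2l mulrCA ler_piMr ?sqr_ge0//.
  by rewrite ler_pdivrMr// mul1r.
have cross : - k m * (nrm (v m) * nrm (v m.+1)) + bt * (s * s') <= - k m * N m * N m.+1.
  have km : 0 <= - k m by rewrite oppr_ge0 kneg.
  have bk : bt * (s * s') <= - k m * ((s' / Num.sqrt (kh m)) * (s / Num.sqrt (kh m.+1))).
    have q1 : 0 < Num.sqrt (kh m) by rewrite sqrtr_gt0.
    have q2 : 0 < Num.sqrt (kh m.+1) by rewrite sqrtr_gt0.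
    have -> : - k m * ((s' / Num.sqrt (kh m)) * (s / Num.sqrt (kh m.+1))) =
      (- k m / (Num.sqrt (kh m.+1) * Num.sqrt (kh m))) * (s * s').
      by field; rewrite !gt_eqF.
    rewrite ler_wpM2r ?mulr_ge0 ?sqrtr_ge0// ler_pdivlMr ?mulr_gt0//.
    rewrite -(sqrtrM _ (ltW (kh0 _))) -(ger0_norm bt0) -(ger0_norm km) -!sqrtr_sqr.
    by rewrite -sqrtrM ?sqr_ge0// ler_wsqrtr// sqrrN.
  apply: (@le_trans _ _ (- k m * (nrm (v m) * nrm (v m.+1)
     + (s' / Num.sqrt (kh m)) * (s / Num.sqrt (kh m.+1))))).
    by rewrite mulrDr lerD2l.
  rewrite -[leRHS]mulrA ler_wpM2l//.
  apply: le_trans (two_term_cauchy_schwarz _ _ _ _) _;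
    rewrite ?sqrtr_ge0// ?divr_ge0 ?sqrtr_ge0//.
  rewrite !exprMn !exprVn !sqr_sqrtr ?dot_ge0 ?frm_ge0 ?(ltW (kh0 _))//.
have rest : \sum_(1 <= j < m) - k j * dot (v j) (v m.+1) <=
    (\sum_(1 <= j < m) - k j * N j) * N m.+1.
  rewrite mulr_suml big_nat_cond [leRHS]big_nat_cond ler_sum// => j /andP[/andP[_ jm] _].
  rewrite -mulrA ler_wpM2l ?oppr_ge0 ?kneg 1?ltnW//.
  apply: le_trans (psd_cauchy_schwarz D_lin dot_lin dot_sym dot_ge0 (Dv _) (Dv _)) _.
  by apply: ler_pM; rewrite ?sqrtr_ge0.
set nv := nrm (v m.+1) in n_sq N_sq k_low cross eq *.
move: eq; rewrite big_nat_recr//= big_nat_recr//= -n_sq => eq.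
rewrite big_nat_recr//=.
have cs := psd_cauchy_schwarz D_lin dot_lin dot_sym dot_ge0 (Dv m) (Dv m.+1).
have km : 0 <= - k m by rewrite oppr_ge0 kneg.
rewrite -/nv in cs; have cs' := ler_wpM2l km cs.
have rN := ler_wpM2l rho0 (nN m.+1); rewrite -/nv in rN.
have sN : \sum_(1 <= j < m) - k j * dot (v j) (v m.+1) =
    - \sum_(1 <= j < m) k j * dot (v j) (v m.+1).
  by rewrite -sumrN; apply: eq_bigr => j _; rewrite mulNr.
rewrite sN in rest.
move: rest eq k_low frm_low cross cs' rN.
set A := \sum_(1 <= j < m) _; set B := \sum_(1 <= j < m) _.
clear; lra.
Qed.

(** Testing with e_(m+1) itself requires no sign of the off-diagonal coefficients; the price is
    their absolute values, so iteration makes the constant grow from row to row. It serves a bounded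
    number of rows. *)
Lemma crude_row (m : nat) (a : nat -> R) (e : nat -> E) (rho : R) :
  (forall j, D (e j)) -> 0 <= rho -> 0 < a m.+1 ->
  \sum_(1 <= j < m.+2) a j * dot (e j) (e m.+1) + frm (e m.+1) (e m.+1) <=
    rho * nrm (e m.+1) ->
  let S := \sum_(1 <= j < m.+1) `|a j| * nrm (e j) + rho in
  nrm (e m.+1) <= S / a m.+1 /\ frm (e m.+1) (e m.+1) <= S ^+ 2 / a m.+1.
Proof.
move=> De rho0 am eq S.
have S0 : 0 <= S.
  by rewrite addr_ge0// sumr_ge0// => j _; rewrite mulr_ge0// sqrtr_ge0.
set n := nrm (e m.+1).
have n0 : 0 <= n by exact: sqrtr_ge0.
have n_sq : dot (e m.+1) (e m.+1) = n ^+ 2 by rewrite sqr_sqrtr// dot_ge0.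
have key : a m.+1 * n ^+ 2 + frm (e m.+1) (e m.+1) <= S * n.
  move: eq; rewrite -/n big_nat_recr//= n_sq => eq.
  have : - (\sum_(1 <= j < m.+1) a j * dot (e j) (e m.+1)) <=
      (\sum_(1 <= j < m.+1) `|a j| * nrm (e j)) * n.
    rewrite -sumrN mulr_suml ler_sum// => j _.
    rewrite -mulNr; apply: le_trans (ler_norm _) _.
    rewrite normrM normrN -mulrA ler_wpM2l//.
    have cs := psd_cauchy_schwarz_sq D_lin dot_lin dot_sym dot_ge0 (De j) (De m.+1).
    by rewrite -sqrtr_sqr /n -sqrtrM ?dot_ge0// ler_wsqrtr.
  rewrite /S mulrDl; lra.
have f0 := frm_ge0 (De m.+1).
have nS : n <= S / a m.+1.
  rewrite ler_pdivlMr// mulrC.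
  have [->|nn] := eqVneq n 0; first by rewrite mulr0.
  have np : 0 < n by rewrite lt_neqAle eq_sym nn.
  by rewrite -(ler_pM2r np) -mulrA -expr2; lra.
split=> //.
have an0 : 0 <= a m.+1 * n ^+ 2 by rewrite mulr_ge0 ?sqr_ge0// ltW.
apply: (@le_trans _ _ (S * n)); first lra.
by rewrite expr2 -mulrA ler_wpM2l.
Qed.

End energy.

(** * Discrete maximum principle *)

Section comparison.
Context {R : realType}.

(** Strong induction: as the off-diagonal coefficients are nonpositive, the bounds for earlier
    indices may be inserted into row m, and the row of the barrier absorbs the residual. Rows below
    [m0] are given. *)
Lemma comparison (m0 M : nat) (K : nat -> nat -> R) (N B rho : nat -> R) (C : R) :
  (forall m, (m0 <= m <= M)%N -> 0 < K m m) ->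
  (forall m j, (m0 <= m <= M)%N -> (j < m)%N -> K m j <= 0) ->
  (forall m, (m0 <= m <= M)%N ->
    K m m * N m <= \sum_(1 <= j < m) - K m j * N j + rho m) ->
  (forall m, (m0 <= m <= M)%N -> (0 < m)%N ->
    rho m <= C * \sum_(1 <= j < m.+1) K m j * B j) ->
  (forall m, (0 < m < m0)%N -> (m <= M)%N -> N m <= C * B m) ->
  forall m, (0 < m <= M)%N -> N m <= C * B m.
Proof.
move=> Kpos Kneg row bar init; elim/ltn_ind => m IH /andP[m1 mM].
have [mm0|mm0] := ltnP m m0; first by apply: init => //; rewrite m1.
have mr : (m0 <= m <= M)%N by rewrite mm0.
rewrite -(ler_pM2l (Kpos _ mr)); apply: le_trans (row _ mr) _.
have := bar _ mr m1; rewrite big_nat_recr//= mulrDr => h.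
have : \sum_(1 <= j < m) - K m j * N j <= - (C * \sum_(1 <= j < m) K m j * B j).
  rewrite mulr_sumr -sumrN big_nat_cond [leRHS]big_nat_cond ler_sum//.
  move=> j /andP[/andP[j1 jm] _].
  have -> : - (C * (K m j * B j)) = - K m j * (C * B j) by ring.
  rewrite ler_wpM2l ?oppr_ge0 ?Kneg//.
  by apply: IH => //; rewrite j1 (leq_trans (ltnW jm)).
lra.
Qed.

End comparison.

(** * Power sums and powers of consecutive integers *)

Section power_sums.
Context {R : realType}.

(** From i = 2 on, the tangent of the convex power i^(-eta) bounds each term by a decrement of
    i^(-eta)/eta, and the sum telescopes. *)
Lemma sum_powR_le (eta : R) (n : nat) : 0 < eta ->
  \sum_(1 <= i < n.+1) i%:R `^ (-1 - eta) <= 1 + eta^-1.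
Proof.
move=> eta0.
have e0 : 0 <= eta^-1 by rewrite invr_ge0 ltW.
case: n => [|n]; first by rewrite big_geq// addr_ge0.
have -> : 1 + eta^-1 = 1 + eta^-1 * (1 - n.+1%:R `^ (- eta)) + eta^-1 * n.+1%:R `^ (- eta).
  by ring.
apply: (@le_trans _ _ (1 + eta^-1 * (1 - n.+1%:R `^ (- eta)))); last first.
  by rewrite lerDl mulr_ge0 ?powR_ge0.
elim: n => [|n IH]; first by rewrite big_nat1 !powR1 subrr mulr0 addr0.
rewrite big_nat_recr//=.
have tg := @powR_tangent R (- eta) n.+1%:R n.+2%:R.
have {}tg : n.+2%:R `^ (- eta) + eta * n.+2%:R `^ (- eta - 1) <= n.+1%:R `^ (- eta).
  have := tg; rewrite -[n.+2%:R]natr1 opprD addNKr.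
  rewrite mulrN1 mulNr opprK natr1; apply=> //; by rewrite oppr_le0 ltW.
have -> : -1 - eta = - eta - 1 by ring.
have h : n.+2%:R `^ (- eta - 1) <= eta^-1 * (n.+1%:R `^ (- eta) - n.+2%:R `^ (- eta)).
  rewrite mulrC ler_pdivlMr// mulrC; lra.
rewrite mulrBr in h; rewrite !mulrBr in IH *.
by move: IH h; rewrite [-1 - eta]addrC; set S := \sum_(_ <= _ < _) _; lra.
Qed.

Lemma powR_small_eventually (K e : R) : 0 <= K -> 0 < e ->
  exists p : nat, forall j, (p <= j)%N -> K <= j%:R `^ e.
Proof.
move=> K0 e0; exists (Num.truncn (K `^ e^-1)).+1 => j pj.
have h : K `^ e^-1 <= j%:R.
  apply: ltW; apply: lt_le_trans (truncnS_gt _) _.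
  by rewrite ler_nat.
have {1}-> : K = (K `^ e^-1) `^ e by rewrite -powRrM mulVf ?gt_eqF// powRr1.
by apply: powR_mono => //; [exact: ltW|exact: powR_ge0].
Qed.

(** By Bernoulli q is a lower bound for ((j+1)/j)^(-|e|), which settles exponents of either sign. *)
Lemma powR_nat_succ (e q : R) (j : nat) : (0 < j)%N -> 0 < q < 1 -> `|e| <= (1 - q) * j%:R ->
  q * j%:R `^ e <= j.+1%:R `^ e /\ q * j.+1%:R `^ e <= j%:R `^ e.
Proof.
move=> j0 /andP[q0 q1] ej.
have jp : 0 < j%:R :> R by rewrite ltr0n.
have jp1 : 0 < j.+1%:R :> R by rewrite ltr0n.
have xE : j.+1%:R / j%:R = 1 + j%:R^-1 :> R by rewrite -natr1; field; rewrite gt_eqF.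
have x1 : 1 <= j.+1%:R / j%:R :> R by rewrite xE lerDl invr_ge0 ltW.
have x0 : 0 < j.+1%:R / j%:R :> R by rewrite divr_gt0.
have b1 : q <= (j.+1%:R / j%:R) `^ (- `|e|).
  apply: le_trans (bernoulli_neg x0 _); last by rewrite oppr_le0.
  rewrite xE addrAC subrr add0r mulNr lerBrDl -lerBrDr ler_pdivrMr//.
have b2 : 1 <= (j.+1%:R / j%:R) `^ `|e|.
  apply: (@le_trans _ _ (1 `^ `|e|)); first by rewrite powR1.
  exact: powR_mono.
have E : j.+1%:R `^ e = j%:R `^ e * (j.+1%:R / j%:R) `^ e :> R.
  rewrite -powRM ?ltW// mulrCA divff ?mulr1// gt_eqF//.
have je : 0 < j%:R `^ e :> R by exact: powR_gt0.
have b3 : (j.+1%:R / j%:R) `^ (- `|e|) * (j.+1%:R / j%:R) `^ `|e| = 1 :> R.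
  by rewrite -powRD_pos// addNr powRr0.
rewrite E; set y := (_ / _) `^ e.
have [e0|e0] := leP 0 e.
- rewrite ger0_norm// in b1 b2 b3; rewrite -/y in b2 b3.
  split.
  + rewrite mulrC ler_pM2l//; exact: le_trans (ltW q1) b2.
  + rewrite mulrCA ger_pMr//; rewrite -b3 ler_pM2r//.
    exact: lt_le_trans b2.
- rewrite ltr0_norm// opprK in b1 b2 b3; rewrite -/y in b1 b3.
  split; first by rewrite mulrC ler_pM2l.
  rewrite mulrCA ger_pMr//.
  have y0 : 0 < y by exact: powR_gt0.
  have y1 : y <= 1 by rewrite -b3 ler_peMr// ltW.
  by apply: mulr_ile1 => //; exact: ltW.
Qed.

End power_sums.

                    

(** * The barrier on one interval: algebra of slopes *)

Section barrier_interval.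
Context {R : realType}.
Variables (A Phi u pi_ eps : R).
Hypotheses (A0 : 0 <= A) (A1 : A <= 1) (Phi0 : 0 <= Phi) (u0 : 0 <= u) (pi0 : 0 <= pi_).
Hypotheses (eps0 : 0 <= eps) (eps1 : eps <= 1 / 20).

Let AF0 : 0 <= A * Phi * u. Proof. by rewrite !mulr_ge0. Qed.

(** On an inner interval the derivative of the interpolant is (1-x) S_i + x S_(i+1) with |x| <= 1/2,
    and each slope is a positive part minus a negative part. The negative parts differ little and
    combine to A Phi u up to a relative error of order eps; a quarter of the positive part [pi_]
    survives. [g] is the increment of Phi. *)
Lemma slope_low_inner (x n n' p' g : R) :
  - 1 / 2 <= x <= 1 / 2 -> 0 <= p' -> p' <= 3 / 2 * pi_ ->
  n <= A * Phi * u * (1 + 3 * eps) -> n' <= A * (Phi + g) * u ->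
  A * Phi * u * (1 - eps) <= n' -> 0 <= g -> g * u <= 2 * eps * pi_ ->
  pi_ / 4 - A * Phi * u * (1 + 6 * eps) <= (1 - x) * (pi_ - n) + x * (p' - n').
Proof.
move: A0 A1 Phi0 u0 pi0 eps0 eps1 AF0 => hA0 hA1 hP hu hp he he1 hAF.
move=> /andP[x1 x2] p'0 p'1 n1 n'1 n'2 g0 gu.
set F := A * Phi * u in hAF n1 n'2 *.
have Agu : A * (Phi + g) * u <= F + g * u.
  have -> : A * (Phi + g) * u = F + A * (g * u) by rewrite /F; ring.
  by rewrite lerD2l ler_piMl// mulr_ge0.
have ep : eps * pi_ <= pi_ / 20.
  have : 0 <= (1 / 20 - eps) * pi_ by rewrite mulr_ge0//; lra.
  lra.
have Fe : 0 <= F * eps by rewrite mulr_ge0.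
have [x0|x0] := leP 0 x.
- have a1 : 0 <= (1 - x) * (F * (1 + 3 * eps) - n) by rewrite mulr_ge0//; lra.
  have a2 : 0 <= x * (F + g * u - n') by rewrite mulr_ge0//; lra.
  have a3 : 0 <= x * p' by rewrite mulr_ge0.
  have a4 : 0 <= (1 / 2 - x) * pi_ by rewrite mulr_ge0//; lra.
  have a5 : 0 <= x * (F * eps) by rewrite mulr_ge0.
  have a6 : 0 <= (1 - x) * (2 * eps * pi_ - g * u) by rewrite mulr_ge0//; lra.
  have a7 : 0 <= x * (eps * pi_) by rewrite !mulr_ge0.
  have a8 : 0 <= (1 - x) * (g * u) by rewrite !mulr_ge0//; lra.
  lra.
- have y0 : 0 <= - x by lra.
  have a1 : 0 <= (1 - x) * (F * (1 + 3 * eps) - n) by rewrite mulr_ge0//; lra.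
  have a2 : 0 <= - x * (n' - F * (1 - eps)) by rewrite mulr_ge0//; lra.
  have a3 : 0 <= - x * (3 / 2 * pi_ - p') by rewrite mulr_ge0//; lra.
  have a4 : 0 <= (1 / 2 + x) * pi_ by rewrite mulr_ge0//; lra.
  have a5 : 0 <= (1 / 2 + x) * (F * eps) by rewrite mulr_ge0//; lra.
  lra.
Qed.

(** On the last interval the parabola is fixed by the preceding node, so the combination of slopes
    is the extrapolation (1+x) S_i - x S_(i-1), with |x| <= 1. *)
Lemma slope_low_last (x n n'' p'' g : R) :
  - 1 <= x <= 1 -> pi_ / 2 <= p'' -> p'' <= 3 / 2 * pi_ ->
  n <= A * Phi * u * (1 + 3 * eps) -> n'' <= A * Phi * u * (1 + 3 * eps) ->
  A * (Phi - g) * u <= n'' -> 0 <= g -> g * u <= 2 * eps * pi_ ->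
  pi_ / 4 - A * Phi * u * (1 + 6 * eps) <= (1 + x) * (pi_ - n) - x * (p'' - n'').
Proof.
move: A0 A1 Phi0 u0 pi0 eps0 eps1 AF0 => hA0 hA1 hP hu hp he he1 hAF.
move=> /andP[x1 x2] p'0 p'1 n1 n'1 n'2 g0 gu.
set F := A * Phi * u in hAF n1 n'1 *.
have Agu : F - g * u <= A * (Phi - g) * u.
  have -> : A * (Phi - g) * u = F - A * (g * u) by rewrite /F; ring.
  by rewrite lerD2l lerN2 ler_piMl// mulr_ge0.
have ep : eps * pi_ <= pi_ / 20.
  have : 0 <= (1 / 20 - eps) * pi_ by rewrite mulr_ge0//; lra.
  lra.
have Fe : 0 <= F * eps by rewrite mulr_ge0.
have [x0|x0] := leP 0 x.
- have a1 : 0 <= (1 + x) * (F * (1 + 3 * eps) - n) by rewrite mulr_ge0//; lra.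
  have a2 : 0 <= x * (n'' - (F - g * u)) by rewrite mulr_ge0//; lra.
  have a3 : 0 <= x * (3 / 2 * pi_ - p'') by rewrite mulr_ge0//; lra.
  have a4 : 0 <= (1 - x) * pi_ by rewrite mulr_ge0//; lra.
  have a5 : 0 <= (1 - x) * (F * eps) by rewrite mulr_ge0//; lra.
  have a6 : 0 <= (1 - x) * (g * u) by rewrite !mulr_ge0//; lra.
  lra.
- have y0 : 0 <= - x by lra.
  have a1 : 0 <= (1 + x) * (F * (1 + 3 * eps) - n) by rewrite mulr_ge0//; lra.
  have a2 : 0 <= - x * (F * (1 + 3 * eps) - n'') by rewrite mulr_ge0//; lra.
  have a3 : 0 <= - x * (p'' - pi_ / 2) by rewrite mulr_ge0//; lra.
  have a4 : 0 <= (1 + x) * pi_ by rewrite mulr_ge0//; lra.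
  lra.
Qed.

                                                                              
(** The main terms -s A Phi u and A b u Phi cancel up to a relative error of order eps, since s w' +
    (1-alpha) w annihilates s^(alpha-1); the positive part of the slope remains. *)
Lemma barrier_combine (a b s dw w : R) :
  a <= s -> s <= b -> 0 <= a -> b * (1 - eps) <= a ->
  pi_ / 4 - A * Phi * u * (1 + 6 * eps) <= dw ->
  b * (u * Phi) * (1 - eps) - 5 / 4 * eps * (b * pi_) <= w ->
  b * (pi_ / 8 - 7 * eps * (Phi * u)) <= s * dw + A * w.
Proof.
move: A0 A1 Phi0 u0 pi0 eps0 eps1 AF0 => hA0 hA1 hP hu hp he he1 hAF.
move=> as_ sb a0 ab hdw hw.
have s0 : 0 <= s by lra.
have b0 : 0 <= b by lra.
set F := A * Phi * u in hAF hdw.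
have h1 := ler_wpM2l s0 hdw; have h2 := ler_wpM2l hA0 hw.
have h3 : 0 <= (s - a) * pi_ by rewrite mulr_ge0//; lra.
have h4 : 0 <= (a - b * (1 - eps)) * pi_ by rewrite mulr_ge0//; lra.
have h5 : 0 <= (b - s) * (F * (1 + 6 * eps)) by rewrite !mulr_ge0//; lra.
have e1 : A * (b * (u * Phi) * (1 - eps)) = b * F * (1 - eps) by rewrite /F; ring.
have h6 : 0 <= (1 - A) * (eps * (b * pi_)) by rewrite !mulr_ge0//; lra.
have h7 : 0 <= (1 - A) * (eps * (b * (Phi * u))) by rewrite !mulr_ge0//; lra.
have e2 : A * (eps * (b * (Phi * u))) = eps * (b * F) by rewrite /F; ring.
have h8 : 0 <= (1 / 20 - eps) * (b * pi_) by rewrite !mulr_ge0//; lra.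
have h9 : 0 <= b * pi_ by rewrite mulr_ge0.
lra.
Qed.

End barrier_interval.

(** * The barrier function and its slopes *)

Section barrier_function.
Context {R : realType}.
Implicit Types (al a b eps dl C : R) (t : nat -> R).

Lemma node_power_up al a b eps : 0 < al < 1 -> 0 < b -> 0 <= eps <= 1 / 20 ->
  b * (1 - eps / 2) <= a -> a `^ (al - 2) <= b `^ (al - 2) * (1 + 3 * eps).
Proof.
move=> /andP[al0 al1] b0 /andP[e0 e1] ab.
have c0 : 0 < 1 - eps / 2 by lra.
apply: (@le_trans _ _ ((b * (1 - eps / 2)) `^ (al - 2))).
  by apply: powR_antimono => //; [lra|rewrite mulr_gt0].
rewrite (powRM _ (ltW b0) (ltW c0)) ler_wpM2l ?powR_ge0//.
apply: (@le_trans _ _ ((1 - eps / 2) `^ (- 2))).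
  by apply: ger_powR; [apply/andP; split; lra|lra].
rewrite powRN powR_mulrn; last exact: ltW.
rewrite -[leLHS]mul1r ler_pdivrMr ?exprn_gt0//.
have : 0 <= (1 - 2 * eps) * eps by rewrite mulr_ge0//; lra.
have : 0 <= eps * eps * eps by rewrite !mulr_ge0.
lra.
Qed.

Lemma node_power_low al b b' eps : 0 < al < 1 -> 0 < b -> 0 <= eps <= 1 / 20 ->
  b <= b' -> b' * (1 - eps / 4) <= b -> b `^ (al - 2) * (1 - eps) <= b' `^ (al - 2).
Proof.
move=> /andP[al0 al1] b0 /andP[e0 e1] bb' h.
have b'0 : 0 < b' by lra.
have q0 : 0 < b / b' by rewrite divr_gt0.
have q1 : 1 - eps / 4 <= b / b' by rewrite ler_pdivlMr// mulrC.
have -> : b' `^ (al - 2) = b `^ (al - 2) * (b / b') `^ (2 - al).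
  have -> : 2 - al = - (al - 2) by ring.
  have -> : b `^ (al - 2) = (b' * (b / b')) `^ (al - 2).
    by congr (_ `^ _); field; rewrite gt_eqF.
  rewrite (powRM _ (ltW b'0) (ltW q0)) -mulrA -powRD_pos// subrr powRr0 mulr1//.
rewrite ler_wpM2l ?powR_ge0//.
apply: (@le_trans _ _ ((b / b') `^ 2)).
  rewrite powR_mulrn ?(ltW q0)//.
  have : (1 - eps / 4) ^+ 2 <= (b / b') ^+ 2 by rewrite lerXn2r ?nnegrE//; lra.
  have : 0 <= eps * eps by rewrite mulr_ge0.
  lra.
by apply: ger_powR; [rewrite q0 ler_pdivrMr// mul1r|lra].
Qed.

Lemma decay_bounds al a b : 0 < al < 1 -> 0 < a -> a < b ->
  (1 - al) * b `^ (al - 2) * (b - a) <= a `^ (al - 1) - b `^ (al - 1) /\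
  a `^ (al - 1) - b `^ (al - 1) <= (1 - al) * a `^ (al - 2) * (b - a).
Proof.
move=> /andP[al0 al1] a0 ab.
have b0 : 0 < b by lra.
have e0 : al - 1 <= 0 by lra.
have h1 := powR_tangent e0 a0 b0; have h2 := powR_tangent e0 b0 a0.
have E : al - 1 - 1 = al - 2 by ring.
rewrite E in h1 h2; split; lra.
Qed.

(** A Riemann sum of ds/s with weights i^(-dl): the slowly varying factor of the barrier, whose
    growth is governed by the sign of dl. *)
Definition bphi t dl (j : nat) : R :=
  1 + \sum_(1 <= i < j.+1) (t i - t i.-1) / t i * i%:R `^ (- dl).

(** t_j^(alpha-1) Phi_j, frozen at index p for 1 <= j <= p, where relative steps need not be small.
    The value 0 at j = 0 removes the boundary term of the integration by parts. *)
Definition bw al t dl (p j : nat) : R :=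
  if j is 0 then 0 else t (maxn j p) `^ (al - 1) * bphi t dl (maxn j p).

Lemma bphi_succ t dl j :
  bphi t dl j.+1 = bphi t dl j + (t j.+1 - t j) / t j.+1 * j.+1%:R `^ (- dl).
Proof. by rewrite /bphi big_nat_recr//= addrA. Qed.

Definition bslope_pos al t dl j : R := t j.+1 `^ (al - 2) * j.+1%:R `^ (- dl).

Definition bslope_neg al t dl j : R :=
  bphi t dl j * (t j `^ (al - 1) - t j.+1 `^ (al - 1)) / (t j.+1 - t j).

(** Product rule for differences: the increment of Phi comes with the power at the right node, the
    decrement of the power with Phi at the left node. *)
Lemma bw_slope al t dl p j : (0 < p)%N -> (p <= j)%N -> 0 < t j -> t j < t j.+1 ->
  slope t (bw al t dl p) j = bslope_pos al t dl j - bslope_neg al t dl j.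
Proof.
move=> p0 pj tj tjj; have j0 : (0 < j)%N by exact: leq_trans pj.
have tj1 : 0 < t j.+1 by exact: lt_trans tjj.
rewrite /slope /bw (maxn_idPl (leqW pj)); case: j j0 pj tj tjj tj1 => // j _ pj tj tjj tj1.
rewrite (maxn_idPl pj) bphi_succ /bslope_pos /bslope_neg.
have -> : t j.+2 `^ (al - 1) = t j.+2 `^ (al - 2) * t j.+2.
  rewrite -{3}(powRr1 (ltW tj1)) -powRD_pos//; congr (_ `^ _); ring.
by field; apply/andP; split; apply/eqP; lra.
Qed.

Lemma bphi_ge1 t dl j : (forall i, (1 <= i <= j)%N -> 0 < t i /\ t i.-1 <= t i) ->
  1 <= bphi t dl j.
Proof.
move=> h; rewrite lerDl big_nat_cond sumr_ge0// => i; rewrite andbT => /andP[i1 i2].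
have [|ti tii] := h i; first by rewrite i1.
by rewrite mulr_ge0 ?powR_ge0// divr_ge0 ?subr_ge0// ltW.
Qed.

Lemma bphi_mono t dl i j : (i <= j)%N ->
  (forall i, (1 <= i <= j)%N -> 0 < t i /\ t i.-1 <= t i) -> bphi t dl i <= bphi t dl j.
Proof.
elim: j => [|j IH]; first by rewrite leqn0 => /eqP ->.
rewrite leq_eqVlt => /predU1P[->//|ij] h.
apply: (@le_trans _ _ (bphi t dl j)).
  by apply: IH => // k /andP[k1 kj]; apply: h; rewrite k1 leqW.
have [|tj tjj] := h j.+1; first by rewrite leqnn.
by rewrite bphi_succ lerDl mulr_ge0 ?powR_ge0// divr_ge0 ?subr_ge0// ltW.
Qed.

Lemma bslope_neg_bounds al t dl j : 0 < al < 1 -> 0 <= bphi t dl j -> 0 < t j -> t j < t j.+1 ->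
  (1 - al) * bphi t dl j * t j.+1 `^ (al - 2) <= bslope_neg al t dl j /\
  bslope_neg al t dl j <= (1 - al) * bphi t dl j * t j `^ (al - 2).
Proof.
move=> al01 P0 tj tjj; have [h1 h2] := decay_bounds al01 tj tjj.
have h : 0 < t j.+1 - t j by lra.
rewrite /bslope_neg; split.
  rewrite ler_pdivlMr//; have := ler_wpM2l P0 h1; lra.
rewrite ler_pdivrMr//; have := ler_wpM2l P0 h2; lra.
Qed.

End barrier_function.

Section row_curvature_cases.
Context {R : realType}.
Implicit Types (t U : nat -> R).

Lemma row_curvature_inner t U m i : (i.+1 < m)%N ->
  row_curvature t U m i = curvature t U i.
Proof. by move=> im; rewrite /row_curvature ifF; [congr curvature; lia|lia]. Qed.

Lemma row_curvature_last t U m i : (0 < i)%N -> i.+1 = m ->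
  row_curvature t U m i = curvature t U i.-1.
Proof. by move=> i0 <-; rewrite /row_curvature ifF; [congr curvature; lia|lia]. Qed.

End row_curvature_cases.

Section newton_low.
Context {R : realType}.

                                                                                
                                                                
(** Expanding from the right node, the negative part of the slope acts in favour of the bound, and
    the curvature term costs at most (b-a) Xm because (s-a)(b-s) <= (b-a) H. *)
Lemma newton_right_low (a b s W S pi_ n X H Xm : R) :
  a <= s <= b -> S = pi_ - n -> 0 <= pi_ -> 0 <= n -> X <= Xm -> 0 <= Xm ->
  b - a <= H -> 0 < H ->
  W - (b - a) * pi_ - (b - a) * Xm <= W + S * (s - b) + X / H * ((s - a) * (s - b)).
Proof.
move=> /andP[as_ sb] -> p0 n0 XX Xm0 hH H0.
have h1 : 0 <= (s - a) * pi_ by rewrite mulr_ge0//; lra.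
have h2 : 0 <= (b - s) * n by rewrite mulr_ge0//; lra.
have h3 : X / H * ((s - a) * (b - s)) <= (b - a) * Xm.
  apply: (@le_trans _ _ (Xm / H * ((s - a) * (b - s)))).
    rewrite ler_wpM2r//; first by rewrite mulr_ge0//; lra.
    by rewrite ler_pM2r// invr_gt0.
  rewrite mulrAC ler_pdivrMr//.
  have -> : (b - a) * Xm * H = Xm * ((b - a) * H) by ring.
  rewrite ler_wpM2l//.
  have k1 : 0 <= (b - a) * (H - (b - a)) by rewrite mulr_ge0//; lra.
  have k2 : 0 <= (b - a) * (b - s) by rewrite mulr_ge0//; lra.
  have k3 : 0 <= (s - a) * (s - a) by rewrite -expr2 sqr_ge0.
  have k4 : 0 <= (s - a) * (b - s) by rewrite mulr_ge0//; lra.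
  have k5 : 0 <= (b - s) * (b - s) by rewrite -expr2 sqr_ge0.
  lra.
lra.
Qed.

End newton_low.

Section barrier_value.
Context {R : realType}.

Lemma barrier_value_low (b h eps q X P v g : R) : 0 <= eps -> 0 <= b -> 0 <= q ->
  0 <= P -> 0 <= v -> 0 <= X -> 0 <= g -> h <= eps / 4 * b ->
  X <= 3 / 2 * q + 6 / 5 * (P * v) ->
  b * (v * P) * (1 - eps) - 5 / 4 * eps * (b * q) <= b * (v * (P + g)) - h * q - h * X.
Proof.
move=> e0 b0 q0 P0 v0 X0 g0 hb hX.
have h1 : 0 <= (eps / 4 * b - h) * (q + X) by apply: mulr_ge0; lra.
have h2 : 0 <= (eps * b) * (3 / 2 * q + 6 / 5 * (P * v) - X).
  by apply: mulr_ge0; [exact: mulr_ge0|lra].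
have h3 : 0 <= b * (v * g) by rewrite !mulr_ge0.
have h4 : 0 <= eps * b * (P * v) by rewrite !mulr_ge0.
have h5 : 0 <= eps * b * q by rewrite !mulr_ge0.
lra.
Qed.

End barrier_value.

(** * The barrier on one interval: mesh estimates *)

Section barrier_on_interval.
Context {R : realType}.
Variables (al C dl : R) (t : nat -> R) (p m i : nat).
Hypotheses (al0 : 0 < al) (al1 : al < 1) (C1 : 1 <= C).
Hypotheses (p0 : (0 < p)%N) (pi1 : (p < i)%N) (im : (i < m)%N).
Hypothesis tpos : forall j, (1 <= j <= m)%N -> 0 < t j.
Hypothesis inc : forall j, (j < m)%N -> t j < t j.+1.
Hypothesis hmono : forall j, (j.+1 < m)%N -> t j.+1 - t j <= t j.+2 - t j.+1.
Hypothesis hstep : forall j, (j < m)%N -> t j.+1 - t j <= C * (t j.+1 / j.+1%:R).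
Hypothesis idl : 6 * `|dl| <= i%:R.
Hypothesis iC : 80 * C <= i%:R.

Local Notation W := (bw al t dl p).
Local Notation Phi := (bphi t dl i).
Local Notation u := (t i.+1 `^ (al - 2)).
Local Notation pi_ := (bslope_pos al t dl i).
(** The small parameter: from index i on, one step is at most eps/4 of its right node, so going two
    nodes back from t_(i+1) loses at most eps/2. *)
Let eps := 4 * C / i%:R.

Let i0 : (0 < i)%N. Proof. exact: leq_ltn_trans pi1. Qed.
Let ip : 0 < i%:R :> R. Proof. by rewrite ltr0n. Qed.

Let eps_bounds : 0 <= eps <= 1 / 20.
Proof.
have h := C1; have h' := iC; have h'' := ip.
apply/andP; split; first by rewrite divr_ge0//; lra.
rewrite /eps ler_pdivrMr//; lra.
Qed.

Let step_le j : (i <= j.+1)%N -> (j < m)%N -> t j.+1 - t j <= eps / 4 * t j.+1.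
Proof.
move=> ij jm; apply: le_trans (hstep jm) _.
have tj : 0 < t j.+1 by apply: tpos.
have -> : eps / 4 * t j.+1 = C * (t j.+1 / i%:R) by rewrite /eps; field; rewrite gt_eqF.
have c0 : 0 <= C by have := C1; lra.
rewrite ler_wpM2l// ler_pM2l// lef_pV2 ?posrE// ?ltr0n//.
by rewrite ler_nat.
Qed.

Let Phi1 : 1 <= Phi.
Proof.
apply: bphi_ge1 => j /andP[j1 ji].
have jm : (j <= m)%N by exact: leq_trans ji (ltnW im).
split; first by apply: tpos; rewrite j1.
by case: j j1 ji jm => // j _ ji jm; apply: ltW; exact: inc.
Qed.

Let u_pos : 0 < u. Proof. by apply: powR_gt0; apply: tpos. Qed.

Let pi_pos : 0 < pi_.
Proof. by rewrite /bslope_pos mulr_gt0// powR_gt0// ltr0n. Qed.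

Let al01 : 0 < al < 1. Proof. by rewrite al0. Qed.

Let left_far : t i.+1 * (1 - eps / 2) <= t i.-1.
Proof.
have h1 := step_le (leqnSn i) im.
have h2 : t i - t i.-1 <= t i.+1 - t i.
  case: i i0 im => // k _ km; exact: hmono.
lra.
Qed.

Let neg_i_bounds : 0 <= bslope_neg al t dl i /\
  bslope_neg al t dl i <= (1 - al) * Phi * u * (1 + 3 * eps).
Proof.
have ti : 0 < t i by apply: tpos; rewrite i0 ltnW.
have tl : t i.-1 <= t i by move: i0 im; case: i => // k _ km; apply/ltW/inc/ltnW.
have P0 : 0 <= Phi by have := Phi1; lra.
have [h1 h2] := bslope_neg_bounds al01 P0 ti (inc im).
have a1 : 0 <= 1 - al by have := al1; lra.
split.
  apply: le_trans h1; rewrite !mulr_ge0//; exact: powR_ge0.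
apply: le_trans h2 _; rewrite -[leRHS]mulrA ler_wpM2l ?mulr_ge0//.
apply: node_power_up => //; first exact: tpos.
exact: le_trans left_far tl.
Qed.

Let pi_nonneg j : (j.+1 <= m)%N -> 0 <= bslope_pos al t dl j.
Proof. by move=> jm; rewrite /bslope_pos mulr_ge0// powR_ge0. Qed.

Let idl_succ j : (i <= j)%N -> `|- dl| <= (1 - 5 / 6) * j%:R.
Proof.
move=> ij; have h := idl; rewrite normrN.
have : i%:R <= j%:R :> R by rewrite ler_nat.
lra.
Qed.

Let q56 : 0 < (5 / 6 : R) < 1. Proof. by apply/andP; split; lra. Qed.

Lemma interval_inner (s : R) : (i.+1 < m)%N -> t i <= s <= t i.+1 ->
  pi_ / 4 - (1 - al) * Phi * u * (1 + 6 * eps) <=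
    slope t W i + curvature t W i * (2 * s - t i - t i.+1) /\
  t i.+1 * (u * Phi) * (1 - eps) - 5 / 4 * eps * (t i.+1 * pi_) <=
    newton t W i (curvature t W i) s.
Proof.
move=> im1 si; have /andP[as_ sb] := si; have /andP[e0 e1] := eps_bounds.
have ti : 0 < t i by apply: tpos; rewrite i0 ltnW.
have tb : 0 < t i.+1 by exact: tpos.
have tb' : t i.+1 < t i.+2 by exact: inc.
have tab : t i < t i.+1 by exact: inc.
have hm := hmono im1.
have P0 : 0 <= Phi by have := Phi1; lra.
have a1 : 0 <= 1 - al by have := al1; lra.
have a1' : 1 - al <= 1 by have := al0; lra.
have [n0 n1] := neg_i_bounds.
have st := step_le (leqnSn i) im.
have st' : t i.+2 - t i.+1 <= eps / 4 * t i.+2 by apply: step_le => //; rewrite -addn2 leq_addr.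
have [r1 r2] := powR_nat_succ (ltn0Sn i) q56 (idl_succ (leqnSn i)).
have p'1 : bslope_pos al t dl i.+1 <= 3 / 2 * pi_.
  rewrite /bslope_pos.
  have k1 : t i.+2 `^ (al - 2) <= u by apply: powR_antimono => //; [have := al1; lra|exact: ltW].
  apply: (@le_trans _ _ (u * i.+2%:R `^ (- dl))); first by rewrite ler_wpM2r ?powR_ge0.
  by rewrite mulrCA ler_pM2l//; lra.
have PhiE := bphi_succ t dl i.
set g := (t i.+1 - t i) / t i.+1 * i.+1%:R `^ (- dl) in PhiE.
have g0 : 0 <= g by rewrite mulr_ge0 ?powR_ge0// divr_ge0 ?subr_ge0// ltW.
have gu : g * u <= 2 * eps * pi_.
  have k1 : g <= eps / 4 * i.+1%:R `^ (- dl).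
    by rewrite ler_wpM2r ?powR_ge0// ler_pdivrMr.
  have := ler_wpM2r (ltW u_pos) k1.
  have : 0 <= eps * pi_ by rewrite mulr_ge0// ltW.
  rewrite /bslope_pos; lra.
have P10 : 0 <= bphi t dl i.+1 by rewrite PhiE addr_ge0.
have [n'1 n'2] := bslope_neg_bounds al01 P10 tb tb'.
have n'3 : (1 - al) * Phi * u * (1 - eps) <= bslope_neg al t dl i.+1.
  apply: le_trans n'1; rewrite -[leLHS]mulrA.
  apply: (@le_trans _ _ ((1 - al) * Phi * t i.+2 `^ (al - 2))).
    rewrite ler_wpM2l ?mulr_ge0//; apply: (node_power_low al01 tb eps_bounds (ltW tb')); lra.
  by rewrite ler_wpM2r ?powR_ge0// ler_wpM2l// PhiE lerDl.
rewrite PhiE in n'2.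
have Si := bw_slope al dl p0 (ltnW pi1) ti tab.
have Si1 := bw_slope al dl p0 (leqW (ltnW pi1)) tb tb'.
set H := t i.+2 - t i.
have H0 : 0 < H by rewrite /H; lra.
have hH : t i.+1 - t i <= H by rewrite /H; lra.
have CE : curvature t W i = (slope t W i.+1 - slope t W i) / H by [].
split.
(* The next step is at least as long, so H is at least twice the current step and |x| <= 1/2. *)
- set x := (2 * s - t i - t i.+1) / H.
  have -> : slope t W i + curvature t W i * (2 * s - t i - t i.+1) =
      (1 - x) * slope t W i + x * slope t W i.+1.
    by rewrite CE /x; field; rewrite gt_eqF.
  rewrite Si Si1.
  apply: (slope_low_inner a1 a1' P0 (ltW u_pos) (ltW pi_pos) e0 e1 _ (pi_nonneg im1) p'1 n1 n'2 n'3 g0 gu).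
  by apply/andP; split; rewrite /x ?[_ / H <= _]ler_pdivrMr ?[_ <= _ / H]ler_pdivlMr// /H; lra.
- rewrite /newton.
  have -> : W i + slope t W i * (s - t i) + curvature t W i * ((s - t i) * (s - t i.+1)) =
    W i.+1 + slope t W i * (s - t i.+1) + (slope t W i.+1 - slope t W i) / H *
      ((s - t i) * (s - t i.+1)).
    rewrite -CE; congr (_ + _); rewrite /slope; field; apply/eqP; lra.
  set Xm := 3 / 2 * pi_ + (1 - al) * Phi * u * (1 + 3 * eps).
  have Xm0 : 0 <= Xm.
    have := pi_pos; have := n0; have := n1; rewrite /Xm; lra.
  have XX : slope t W i.+1 - slope t W i <= Xm.
    rewrite Si Si1 /Xm; have := pi_pos.
    have n'0 : 0 <= bslope_neg al t dl i.+1.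
      by apply: le_trans n'1; rewrite !mulr_ge0// powR_ge0.
    lra.
  apply: le_trans _ (newton_right_low (W i.+1) si Si (ltW pi_pos) n0 XX Xm0 hH H0).
  have WE : W i.+1 = t i.+1 * (u * (Phi + g)).
    rewrite /bw (maxn_idPl (leqW (ltnW pi1))) PhiE mulrA; congr (_ * _).
    rewrite -{2}(powRr1 (ltW tb)) -powRD_pos//; congr (_ `^ _); ring.
  rewrite WE.
  have k1 : Xm <= 3 / 2 * pi_ + 6 / 5 * (Phi * u).
    rewrite /Xm lerD2l.
    have z0 : 0 <= Phi * u by rewrite mulr_ge0// ltW.
    have : (1 - al) * (Phi * u) * (1 + 3 * eps) <= Phi * u * (1 + 3 * eps).
      by rewrite ler_wpM2r ?ler_piMl//; lra.
    have : 0 <= (1 / 20 - eps) * (Phi * u) by rewrite mulr_ge0//; lra.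
    lra.
  exact: (barrier_value_low e0 (ltW tb) (ltW pi_pos) P0 (ltW u_pos) Xm0 g0 st k1).
Qed.

Lemma interval_last (s : R) : i.+1 = m -> t i <= s <= t i.+1 ->
  pi_ / 4 - (1 - al) * Phi * u * (1 + 6 * eps) <=
    slope t W i + curvature t W i.-1 * (2 * s - t i - t i.+1) /\
  t i.+1 * (u * Phi) * (1 - eps) - 5 / 4 * eps * (t i.+1 * pi_) <=
    newton t W i (curvature t W i.-1) s.
Proof.
move=> mE si; have /andP[as_ sb] := si; have /andP[e0 e1] := eps_bounds.
set k := i.-1; have ik : k.+1 = i by rewrite prednK.
have pk : (p <= k)%N by rewrite -ltnS ik.
have k0 : (0 < k)%N by exact: leq_trans pk.
have km : (k < m)%N by apply: leq_trans (ltnW im); rewrite ik.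
have tk : 0 < t k by apply: tpos; rewrite k0 ltnW.
have ti : 0 < t i by apply: tpos; rewrite i0 ltnW.
have tb : 0 < t i.+1 by exact: tpos.
have tki : t k < t i by have := @inc k; rewrite ik; apply; exact: ltnW.
have tab : t i < t i.+1 by exact: inc.
have hm : t i - t k <= t i.+1 - t i by have := @hmono k; rewrite ik; apply.
have P0 : 0 <= Phi by have := Phi1; lra.
have a1 : 0 <= 1 - al by have := al1; lra.
have a1' : 1 - al <= 1 by have := al0; lra.
have [n0 n1] := neg_i_bounds.
have st := step_le (leqnSn i) im.
have stk : t i - t k <= eps / 4 * t i by have := @step_le k; rewrite ik; apply => //; exact: ltnW.
have [r1 r2] := powR_nat_succ i0 q56 (idl_succ (leqnn i)).
have lf : t i.+1 * (1 - eps / 2) <= t k by exact: left_far.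
have uk : t i `^ (al - 2) <= u * (1 + 3 * eps) by apply: node_power_up => //; lra.
have uk' : u <= t i `^ (al - 2).
  by apply: powR_antimono => //; [have := al1; lra|exact: ltW].
have posE : bslope_pos al t dl k = t i `^ (al - 2) * i%:R `^ (- dl) by rewrite /bslope_pos ik.
set z := i%:R `^ (- dl) in r1 r2 posE.
set z' := i.+1%:R `^ (- dl) in r1 r2.
have piE : pi_ = u * z' by [].
have z0 : 0 <= z by exact: powR_ge0.
have z'0 : 0 <= z' by exact: powR_ge0.
have u0 := ltW u_pos.
have p'1 : bslope_pos al t dl k <= 3 / 2 * pi_.
  rewrite posE piE.
  have h1 : 0 <= (u * (1 + 3 * eps) - t i `^ (al - 2)) * z by rewrite mulr_ge0//; lra.
  have h2 : 0 <= u * (z' - 5 / 6 * z) by rewrite mulr_ge0//; lra.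
  have h3 : 0 <= (1 / 20 - eps) * (u * z) by rewrite !mulr_ge0//; lra.
  have h4 : 0 <= u * z by rewrite mulr_ge0.
  lra.
have p'0 : pi_ / 2 <= bslope_pos al t dl k.
  rewrite posE piE.
  have h1 : 0 <= (t i `^ (al - 2) - u) * z by rewrite mulr_ge0//; lra.
  have h2 : 0 <= u * (z - 5 / 6 * z') by rewrite mulr_ge0//; lra.
  have h4 : 0 <= u * z' by rewrite mulr_ge0.
  lra.
have PhiE := bphi_succ t dl k; rewrite ik -/z in PhiE.
set g := (t i - t k) / t i * z in PhiE.
have g0 : 0 <= g by rewrite mulr_ge0// divr_ge0 ?subr_ge0// ltW.
have gu : g * u <= 2 * eps * pi_.
  have k1 : g <= eps / 4 * z by rewrite ler_wpM2r// ler_pdivrMr.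
  have h1 : 0 <= (eps / 4 * z - g) * u by rewrite mulr_ge0//; lra.
  have h2 : 0 <= eps * (u * (z' - 5 / 6 * z)).
    by apply: (mulr_ge0 e0); apply: (mulr_ge0 u0); lra.
  have h3 : 0 <= eps * (u * z') by exact: mulr_ge0 e0 (mulr_ge0 u0 z'0).
  have h4 : 0 <= eps * (u * z) by exact: mulr_ge0 e0 (mulr_ge0 u0 z0).
  rewrite piE; lra.
have Pk1 : 0 <= bphi t dl k.
  suff : 1 <= bphi t dl k by lra.
  apply: bphi_ge1 => j /andP[j1 jk].
  have jm : (j <= m)%N by exact: leq_trans jk (ltnW km).
  split; first by apply: tpos; rewrite j1.
  by case: j j1 jk jm => // j _ jk jm; apply: ltW; exact: inc.
have tkk : t k < t k.+1 by rewrite ik.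
have [n'1 n'2] := bslope_neg_bounds al01 Pk1 tk tkk.
rewrite ik in n'1 n'2.
have n'3 : bslope_neg al t dl k <= (1 - al) * Phi * u * (1 + 3 * eps).
  apply: le_trans n'2 _.
  have h1 : t k `^ (al - 2) <= u * (1 + 3 * eps) by apply: node_power_up => //.
  apply: (@le_trans _ _ ((1 - al) * Phi * t k `^ (al - 2))).
    by rewrite ler_wpM2r ?powR_ge0// ler_wpM2l// PhiE lerDl.
  by rewrite -[leRHS]mulrA ler_wpM2l// mulr_ge0.
have n'4 : (1 - al) * (Phi - g) * u <= bslope_neg al t dl k.
  apply: le_trans n'1.
  have -> : Phi - g = bphi t dl k by rewrite PhiE; ring.
  by rewrite ler_wpM2l// mulr_ge0.
have Si := bw_slope al dl p0 (ltnW pi1) ti tab.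
have Sk := bw_slope al dl p0 pk tk tkk.
set H := t i.+1 - t k.
have H0 : 0 < H by rewrite /H; lra.
have hH : t i.+1 - t i <= H by rewrite /H; lra.
have CE : curvature t W k = (slope t W i - slope t W k) / H by rewrite /curvature ik.
split.
(* Here H joins the current step to the shorter preceding one, so only |x| <= 1 is available. *)
- set x := (2 * s - t i - t i.+1) / H.
  have -> : slope t W i + curvature t W k * (2 * s - t i - t i.+1) =
      (1 + x) * slope t W i - x * slope t W k.
    by rewrite CE /x; field; rewrite gt_eqF.
  rewrite Si Sk.
  apply: (slope_low_last a1 a1' P0 u0 (ltW pi_pos) e0 e1 _ p'0 p'1 n1 n'3 n'4 g0 gu).
  by apply/andP; split; rewrite /x ?[_ / H <= _]ler_pdivrMr ?[_ <= _ / H]ler_pdivlMr// /H; lra.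
- rewrite /newton.
  have -> : W i + slope t W i * (s - t i) + curvature t W k * ((s - t i) * (s - t i.+1)) =
    W i.+1 + slope t W i * (s - t i.+1) + (slope t W i - slope t W k) / H *
      ((s - t i) * (s - t i.+1)).
    rewrite -CE; congr (_ + _); rewrite /slope; field; apply/eqP; lra.
  set Xm := 3 / 2 * pi_ + (1 - al) * Phi * u * (1 + 3 * eps).
  have Xm0 : 0 <= Xm.
    have := pi_pos; have := n0; have := n1; rewrite /Xm; lra.
  have XX : slope t W i - slope t W k <= Xm.
    have := pi_nonneg km; rewrite Si Sk /Xm; have := pi_pos; lra.
  apply: le_trans _ (newton_right_low (W i.+1) si Si (ltW pi_pos) n0 XX Xm0 hH H0).
  have PhiE' := bphi_succ t dl i.
  set g' := (t i.+1 - t i) / t i.+1 * i.+1%:R `^ (- dl) in PhiE'.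
  have g'0 : 0 <= g' by rewrite mulr_ge0 ?powR_ge0// divr_ge0 ?subr_ge0// ltW.
  have WE : W i.+1 = t i.+1 * (u * (Phi + g')).
    rewrite /bw (maxn_idPl (leqW (ltnW pi1))) PhiE' mulrA; congr (_ * _).
    rewrite -{2}(powRr1 (ltW tb)) -powRD_pos//; congr (_ `^ _); ring.
  rewrite WE.
  have k1 : Xm <= 3 / 2 * pi_ + 6 / 5 * (Phi * u).
    rewrite /Xm lerD2l.
    have z1 : 0 <= Phi * u by rewrite mulr_ge0.
    have : (1 - al) * (Phi * u) * (1 + 3 * eps) <= Phi * u * (1 + 3 * eps).
      by rewrite ler_wpM2r ?ler_piMl//; lra.
    have : 0 <= (1 / 20 - eps) * (Phi * u) by rewrite mulr_ge0//; lra.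
    lra.
  exact: (barrier_value_low e0 (ltW tb) (ltW pi_pos) P0 u0 Xm0 g'0 st k1).
Qed.

Lemma barrier_on_interval (s : R) : t i <= s <= t i.+1 ->
  t i.+1 * (pi_ / 8 - 7 * eps * (Phi * u)) <=
  s * (slope t W i + row_curvature t W m i * (2 * s - t i - t i.+1))
  + (1 - al) * newton t W i (row_curvature t W m i) s.
Proof.
move=> si; have /andP[as_ sb] := si; have /andP[e0 e1] := eps_bounds.
have ti : 0 < t i by apply: tpos; rewrite i0 ltnW.
have P0 : 0 <= Phi by have := Phi1; lra.
have a1 : 0 <= 1 - al by have := al1; lra.
have a1' : 1 - al <= 1 by have := al0; lra.
have near : t i.+1 * (1 - eps) <= t i.
  have := step_le (leqnSn i) im; have tb : 0 < t i.+1 by exact: tpos.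
  have : 0 <= eps * t i.+1 by rewrite mulr_ge0// ltW.
  lra.
have [im1|im1] := ltnP i.+1 m.
- rewrite row_curvature_inner//.
  have [h1 h2] := interval_inner im1 si.
  exact: (barrier_combine a1 a1' P0 (ltW u_pos) (ltW pi_pos) e0 e1 as_ sb (ltW ti) near).
- have mE : i.+1 = m by apply/eqP; rewrite eqn_leq im.
  rewrite row_curvature_last//.
  have [h1 h2] := interval_last mE si.
  exact: (barrier_combine a1 a1' P0 (ltW u_pos) (ltW pi_pos) e0 e1 as_ sb (ltW ti) near).
Qed.

End barrier_on_interval.

(** * Integration by parts over a whole row *)

Section row_by_parts.
Context {R : realType}.
Variables (al : R) (t U : nat -> R) (m : nat).
Hypotheses (al0 : 0 < al) (al1 : al < 1) (m0 : (0 < m)%N).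
Hypothesis inc : forall j, (j < m)%N -> t j < t j.+1.

Let al01 : 0 < al < 1. Proof. by rewrite al0. Qed.

Definition row_integrand (i : nat) (s : R) : R :=
  s * (slope t U i + row_curvature t U m i * (2 * s - t i - t i.+1))
  + (1 - al) * newton t U i (row_curvature t U m i) s.

Lemma interval_by_parts i : (i < m)%N ->
  t m * (slope t U i * row_p al t m i + row_curvature t U m i * row_q al t m i) =
  ker_int al (t m) (t i) (t i.+1) (row_integrand i) +
  ((t m - t i.+1) `^ (1 - al) * U i.+1 - (t m - t i) `^ (1 - al) * U i).
Proof.
move=> im; have ab := inc im.
have bt : t i.+1 <= t m by exact: (increasing_le inc).
rewrite -ker_int_slope//.
set S := slope t U i; set e := row_curvature t U m i.
set a := t i; set b := t i.+1; set T := t m.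
pose w0 := U i + S * (T - a) + e * ((T - a) * (T - b)).
pose w1 := - S - e * ((T - a) + (T - b)).
have := @ker_int_by_parts R al al01 T a b w0 w1 e ab bt.
have -> : (fun s => - w1 - 2 * e * (T - s)) = (fun s => S + e * (2 * s - a - b)).
  by apply/funext => s; rewrite /w1; ring.
have E : (fun s => s * (S + e * (2 * s - a - b)) +
    (1 - al) * (w0 + w1 * (T - s) + e * (T - s) ^+ 2)) = row_integrand i.
  apply/funext => s; rewrite /row_integrand /newton -/S -/e -/a -/b /w0 /w1; ring.
rewrite /= E => ->; congr (_ + (_ * _ - _ * _)).
- rewrite /w0 /w1; have -> : U i.+1 = U i + S * (b - a).
    by rewrite /S /slope -/a -/b; field; apply/eqP; rewrite /a /b; lra.
  ring.
- by rewrite /w0 /w1; ring.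
Qed.

(** The boundary terms (t_m - s)^(1-alpha) U telescope; they vanish at s = t_m because 1 - alpha > 0
    and at s = 0 because U_0 = 0. *)
Lemma row_sum_by_parts : U 0%N = 0 ->
  t m * \sum_(i < m) row_coef al t m i * (U i.+1 - U i) =
  \sum_(i < m) ker_int al (t m) (t i) (t i.+1) (row_integrand i).
Proof.
move=> U0; rewrite -row_sum_coef// mulr_sumr.
rewrite (eq_bigr (fun i : 'I_m => ker_int al (t m) (t i) (t i.+1) (row_integrand i) +
  ((t m - t i.+1) `^ (1 - al) * U i.+1 - (t m - t i) `^ (1 - al) * U i))); last first.
  by move=> i _; exact: interval_by_parts.
rewrite big_split/= -[RHS]addr0; congr (_ + _).
rewrite -(big_mkord predT (fun i => (t m - t i.+1) `^ (1 - al) * U i.+1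
  - (t m - t i) `^ (1 - al) * U i)) telescope_sumr//.
rewrite U0 mulr0 subr0 subrr powR0 ?mul0r//.
by apply/eqP; move: al1 => ?; lra.
Qed.

Lemma continuous_row_integrand i : continuous (row_integrand i).
Proof.
move=> x; rewrite /row_integrand /newton.
have c1 c : (fun s : R => s - c) @ x --> x - c by apply: cvgB; [exact: cvg_id|exact: cvg_cst].
apply: cvgD.
- by apply: cvgM; [exact: cvg_id|exact: continuous_affine].
- apply: cvgM; first exact: cvg_cst.
  apply: cvgD; last by apply: cvgM; [exact: cvg_cst|exact: cvgM].
  by apply: cvgD; [exact: cvg_cst|apply: cvgM => //; exact: cvg_cst].
Qed.

Lemma ker_int_ge_const i (c : R) : (i < m)%N ->
  (forall s, t i <= s <= t i.+1 -> c <= row_integrand i s) ->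
  c * row_p al t m i <= ker_int al (t m) (t i) (t i.+1) (row_integrand i).
Proof.
move=> im h; have ab := inc im.
have bt : t i.+1 <= t m by exact: (increasing_le inc).
have c1 : continuous (fun _ : R => (1 : R)) by move=> x; exact: cvg_cst.
rewrite /row_p -ker_intZ//; apply: le_ker_int => //.
- by move=> x; exact: cvg_cst.
- exact: continuous_row_integrand.
- by move=> s; rewrite in_itv/= mulr1 => /andP[/ltW a1 /ltW a2]; apply: h; rewrite a1.
Qed.

End row_by_parts.

(** * Regular meshes *)

Section mesh.
Context {R : realType}.

Definition regular_mesh (C r : R) (M : nat) (t : nat -> R) : Prop :=
  [/\ t 0%N = 0, forall j, (j < M)%N -> t j < t j.+1,
      forall j, (j.+1 < M)%N -> t j.+1 - t j <= t j.+2 - t j.+1,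
      forall j, (j < M)%N -> t j.+1 - t j <= C * (t j.+1 / j.+1%:R) &
      forall j, (1 <= j <= M)%N -> t j <= C * (t 1%N * j%:R `^ r) /\
        t 1%N * j%:R `^ r <= C * t j].

Variables (C r : R) (M : nat) (t : nat -> R).
Hypothesis rm : regular_mesh C r M t.

Lemma mesh_pos j : (1 <= j <= M)%N -> 0 < t j.
Proof.
case: rm => t0 inc _ _ _ /andP[j1 jM].
have i0 : t 0%N < t 1%N by apply: inc; exact: leq_trans jM.
rewrite -t0; apply: lt_le_trans i0 _.
exact: (@increasing_le _ t M).
Qed.

Lemma mesh_step_ge i j : (i <= j)%N -> (j < M)%N -> t i.+1 - t i <= t j.+1 - t j.
Proof.
case: rm => _ _ mono _ _; elim: j => [|j IH]; first by rewrite leqn0 => /eqP ->.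
rewrite leq_eqVlt => /predU1P[->//|ij] jM.
by apply: le_trans (mono _ jM); apply: IH => //; exact: ltnW.
Qed.

Lemma mesh_step_ge_first j : (j < M)%N -> t 1%N <= t j.+1 - t j.
Proof.
move=> jM; have := mesh_step_ge (leq0n j) jM.
by case: rm => -> _ _ _ _; rewrite subr0.
Qed.

(** As steps do not decrease, the q steps after t_q cover at least as much as the first q. *)
Lemma mesh_half (q m : nat) : (q.*2 <= m)%N -> (m <= M)%N -> 2 * t q <= t m.
Proof.
move=> qm mM; have q2 : (q.*2 <= M)%N by exact: leq_trans mM.
have inc : forall j, (j < M)%N -> t j < t j.+1 by case: rm.
apply: (@le_trans _ _ (t q.*2)); last exact: (increasing_le inc).
have H : forall k, (k <= q)%N -> t k - t 0%N <= t (q + k)%N - t q.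
  elim=> [|k IH] kq; first by rewrite addn0 !subrr.
  have h1 := IH (ltnW kq).
  have h2 : t k.+1 - t k <= t (q + k).+1 - t (q + k)%N.
    by apply: mesh_step_ge; rewrite ?leq_addl//; apply: leq_trans q2; rewrite -addnn ltn_add2l.
  rewrite addnS; lra.
have := H q (leqnn _); rewrite addnn.
by case: rm => -> _ _ _ _; lra.
Qed.

End mesh.

(** * The barrier on a whole row *)

Section barrier_row.
Context {R : realType}.
Implicit Types (al C r dl : R) (t : nat -> R).

(** The weight l^(-dl) is split into l^(alpha/4-dl), largest at the last index, and l^(-alpha/4),
    which together with tau_l / t_l <= C/l is summable. *)
Lemma bphi_le al C dl t n i : 0 < al -> dl <= al / 4 -> 0 <= C ->
  (forall j, (j < n)%N -> 0 < t j.+1) ->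
  (forall j, (j < n)%N -> t j.+1 - t j <= C * (t j.+1 / j.+1%:R)) ->
  (1 <= i <= n)%N -> bphi t dl i <= (1 + C * (1 + 4 / al)) * i%:R `^ (al / 4 - dl).
Proof.
move=> al0 dla C0 tp hs /andP[i1 iN]; rewrite /bphi.
set X := i%:R `^ (al / 4 - dl).
have e0 : 0 <= al / 4 - dl by lra.
have X1 : 1 <= X.
  have i1' : 1 <= i%:R :> R by rewrite ler1n.
  by have := powR_mono e0 ler01 i1'; rewrite powR1.
have X0 : 0 <= X by lra.
have H : \sum_(1 <= l < i.+1) (t l - t l.-1) / t l * l%:R `^ (- dl) <=
    C * X * \sum_(1 <= l < i.+1) l%:R `^ (-1 - al / 4).
  rewrite mulr_sumr big_seq [leRHS]big_seq; apply: ler_sum => l.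
  rewrite mem_index_iota ltnS => /andP[l1 li].
  case: l l1 li => [//|l] _ li /=.
  have ln : (l < n)%N by exact: leq_trans iN.
  have tl := tp _ ln; have l0 : 0 < l.+1%:R :> R by rewrite ltr0n.
  have h1 : (t l.+1 - t l) / t l.+1 <= C / l.+1%:R.
    by rewrite ler_pdivrMr//; apply: le_trans (hs _ ln) _; rewrite mulrA mulrAC.
  apply: (le_trans (ler_wpM2r (powR_ge0 _ _) h1)).
  have -> : C / l.+1%:R * l.+1%:R `^ (- dl) =
     C * l.+1%:R `^ (al / 4 - dl) * l.+1%:R `^ (-1 - al / 4).
    rewrite -!mulrA -(powR_inv1 (ltW l0)) -!powRD_pos//; congr (_ * _ `^ _); ring.
  apply: ler_wpM2r; first exact: powR_ge0.
  by apply: ler_wpM2l => //; apply: powR_mono => //; rewrite ler_nat.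
have a4 : 0 < al / 4 by lra.
have := @sum_powR_le R (al / 4) i a4; set S := \sum_(_ <= _ < _) _ in H *; move=> hS.
have h2 : C * X * S <= C * X * (1 + (al / 4)^-1).
  by apply: ler_wpM2l => //; exact: mulr_ge0.
have -> : 4 / al = (al / 4)^-1 by field; lra.
apply: (@le_trans _ _ (X + C * X * (1 + (al / 4)^-1))); last first.
  by rewrite le_eqVlt; apply/orP; left; apply/eqP; ring.
by apply: lerD => //; exact: le_trans h2.
Qed.

                                                                                
              
(** Knowing only 0 <= W <= Wm at the three nodes, slopes and curvature are bounded by Wm over powers
    of the step; B bounds the ratio of node to step. This is used on the first intervals. *)
Lemma row_integrand_crude al t (W : nat -> R) m i (Wm B s : R) :
  0 < al < 1 -> (i.+1 < m)%N -> 0 <= t i -> t i < t i.+1 ->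
  t i.+1 - t i <= t i.+2 - t i.+1 -> t i.+1 <= B * (t i.+1 - t i) ->
  (forall j, (i <= j <= i.+2)%N -> 0 <= W j <= Wm) ->
  t i <= s <= t i.+1 ->
  - (Wm * (2 * B + 3)) <= row_integrand al t W m i s.
Proof.
move=> /andP[al0 al1] im ti tii hm bB hW /andP[s0 s1].
have [/andP[w00 w01] /andP[w10 w11] /andP[w20 w21]] : [/\ 0 <= W i <= Wm, 0 <= W i.+1 <= Wm & 0 <= W i.+2 <= Wm].
  by split; apply: hW; rewrite ?leqnn ?leqnSn ?leqW.
have Wm0 : 0 <= Wm by lra.
rewrite /row_integrand row_curvature_inner//.
rewrite /newton /curvature.
set h := t i.+1 - t i; set h' := t i.+2 - t i.+1.
have h0 : 0 < h by rewrite /h; lra.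
have h'0 : h <= h' by [].
have S1 : `|slope t W i| * h <= Wm.
  rewrite /slope normrM normfV (gtr0_norm h0) divfK ?gt_eqF//.
  by rewrite ler_norml; apply/andP; split; lra.
have S2 : `|slope t W i.+1| * h <= Wm.
  apply: (@le_trans _ _ (`|slope t W i.+1| * h')); first exact: ler_wpM2l.
  have h'p : 0 < h' by lra.
  rewrite /slope normrM normfV (gtr0_norm h'p) divfK ?gt_eqF//.
  by rewrite ler_norml; apply/andP; split; lra.
set S := slope t W i in S1 *; set S' := slope t W i.+1 in S2 *.
set e := (S' - S) / _.
have H : 2 * h <= t i.+2 - t i by rewrite /h /h' in h'0 *; lra.
have Hp : 0 < t i.+2 - t i by lra.
have e1 : `|e| * h ^+ 2 <= Wm.
  rewrite /e normrM normfV (gtr0_norm Hp) mulrAC ler_pdivrMr//.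
  apply: (@le_trans _ _ (Wm * (2 * h))); last exact: ler_wpM2l.
  apply: (@le_trans _ _ ((`|S'| + `|S|) * h ^+ 2)).
    by apply: ler_wpM2r; [exact: sqr_ge0|exact: ler_normB].
  have -> : (`|S'| + `|S|) * h ^+ 2 = (`|S'| * h + `|S| * h) * h by ring.
  by rewrite mulrA; apply: ler_wpM2r; [exact: ltW|lra].
have e2 : `|e| * h <= Wm / h.
  by rewrite ler_pdivlMr// -mulrA -expr2.
have S3 : `|S| <= Wm / h by rewrite ler_pdivlMr.
have x0 : 0 <= s - t i by lra.
have xh : s - t i <= h by rewrite /h; lra.
have yh : t i.+1 - s <= h by rewrite /h; lra.
have y0 : 0 <= t i.+1 - s by lra.
have b1 : - (2 * (Wm / h)) <= S + e * (2 * s - t i - t i.+1).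
  have : `|S + e * (2 * s - t i - t i.+1)| <= 2 * (Wm / h).
    apply: le_trans (ler_normD _ _) _.
    rewrite (normrM e); have : `|2 * s - t i - t i.+1| <= h.
      by rewrite ler_norml; apply/andP; split; rewrite /h; lra.
    move=> /(ler_wpM2l (normr_ge0 e)); lra.
  by rewrite ler_norml => /andP[].
have s00 : 0 <= s by lra.
have WB : s * (Wm / h) <= Wm * B.
  rewrite mulrCA; apply: ler_wpM2l => //; rewrite ler_pdivrMr//; apply: le_trans bB; lra.
have b2 : - (Wm * B * 2) <= s * (S + e * (2 * s - t i - t i.+1)).
  have := ler_wpM2l s00 b1; lra.
set N := W i + _ + _.
have b3 : - (3 * Wm) <= N.
  have n1 : `|S * (s - t i)| <= Wm.
    rewrite normrM (ger0_norm x0); apply: le_trans S1; exact: ler_wpM2l.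
  have n2 : `|e * ((s - t i) * (s - t i.+1))| <= Wm.
    rewrite normrM; apply: le_trans e1; apply: ler_wpM2l => //.
    rewrite normrM (ger0_norm x0) distrC (ger0_norm y0) expr2.
    exact: ler_pM.
  move: n1 n2; rewrite !ler_norml => /andP[n1 _] /andP[n2 _]; rewrite /N; lra.
have b4 : - (3 * Wm) <= (1 - al) * N.
  have a1 : 0 <= 1 - al by lra.
  have := ler_wpM2l a1 b3; have : 0 <= al * (3 * Wm) by apply: mulr_ge0; lra.
  lra.
lra.
Qed.

End barrier_row.

Section barrier_sum.
Context {R : realType}.
Variables (al C r dl : R).
Hypotheses (al0 : 0 < al) (al1 : al < 1) (C1 : 1 <= C) (r1 : 1 <= r).
Hypothesis dla : dl <= al / 4.

Let al01 : 0 < al < 1. Proof. by rewrite al0. Qed.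
Let C0 : 0 <= C. Proof. exact: le_trans C1. Qed.
Let CP := 1 + C * (1 + 4 / al).

Variable p : nat.
Hypotheses (p0 : (0 < p)%N) (pdl : 6 * `|dl| <= p%:R) (pC : 80 * C <= p%:R).
Hypothesis pbig : 540 * C * CP <= p%:R `^ (1 - al / 4).

Variables (M m : nat) (t : nat -> R).
Hypotheses (rm : regular_mesh C r M t) (mM : (m <= M)%N) (pm : (p.+1.*2 <= m)%N).
Local Notation W := (bw al t dl p).

Let inc j : (j < m)%N -> t j < t j.+1.
Proof. by case: rm => _ inc _ _ _ jm; apply: inc; exact: leq_trans mM. Qed.
Let tpos j : (1 <= j <= m)%N -> 0 < t j.
Proof. by move=> /andP[j1 jm]; apply: (mesh_pos rm); rewrite j1 (leq_trans jm). Qed.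
Let hmono j : (j.+1 < m)%N -> t j.+1 - t j <= t j.+2 - t j.+1.
Proof. by case: rm => _ _ h _ _ jm; apply: h; exact: leq_trans mM. Qed.
Let hstep j : (j < m)%N -> t j.+1 - t j <= C * (t j.+1 / j.+1%:R).
Proof. by case: rm => _ _ _ h _ jm; apply: h; exact: leq_trans mM. Qed.
Let t0 : t 0%N = 0. Proof. by case: rm. Qed.
Let tge0 j : (j <= m)%N -> 0 <= t j.
Proof. by case: j => [|j] jm; [rewrite t0|exact/ltW/tpos]. Qed.
Let m0 : (0 < m)%N. Proof. exact: leq_trans pm. Qed.
Let tm0 : 0 < t m. Proof. by apply: tpos; rewrite m0 leqnn. Qed.
Let tle i : (i <= m)%N -> t i <= t m. Proof. by move=> im; exact: (increasing_le inc). Qed.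

Let phi_le i : (1 <= i <= m)%N -> bphi t dl i <= CP * i%:R `^ (al / 4 - dl).
Proof.
move=> im; apply: (@bphi_le R al C dl t m) => // j jm.
by apply: tpos.
Qed.

(** The loss 7 eps Phi is at most half of the gain (i+1)^(-dl)/8: by [phi_le] it is 28 C CP i^(-dl)
    divided by i^(1-alpha/4), and 540 in [pbig] is just above 28 times 16 times 6/5. *)
Lemma row_integrand_far i s : (p < i)%N -> (i < m)%N -> t i <= s <= t i.+1 ->
  1 / 16 * (t i.+1 `^ (al - 1) * i.+1%:R `^ (- dl)) <= row_integrand al t W m i s.
Proof.
move=> pi_ im si.
have ip : p%:R <= i%:R :> R by rewrite ler_nat ltnW.
have i0 : 0 < i%:R :> R by rewrite ltr0n (leq_trans _ pi_).
have idl : 6 * `|dl| <= i%:R by exact: le_trans ip.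
have iC : 80 * C <= i%:R by exact: le_trans ip.
apply: le_trans (barrier_on_interval al0 al1 C1 p0 pi_ im tpos inc hmono hstep idl iC si).
rewrite /bslope_pos; set u := t i.+1 `^ (al - 2); set z := i.+1%:R `^ _.
have b0 : 0 < t i.+1 by apply: tpos; rewrite im.
have u0 : 0 < u by exact: powR_gt0.
have -> : t i.+1 `^ (al - 1) = t i.+1 * u.
  by rewrite /u -{2}(powRr1 (ltW b0)) -powRD_pos//; congr (_ `^ _); ring.
have hphi : bphi t dl i <= CP * i%:R `^ (al / 4 - dl).
  by apply: phi_le; rewrite (ltnW im) andbT (leq_trans _ pi_).
have z1 : 5 / 6 * i%:R `^ (- dl) <= z.
  have q56 : 0 < (5 / 6 : R) < 1 by apply/andP; split; lra.
  have := @powR_nat_succ R (- dl) (5 / 6) i _ q56; case=> //.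
  - by rewrite -(@ltr0n R).
  - by rewrite normrN; move: idl; lra.
have CP0 : 0 <= CP.
  by rewrite /CP addr_ge0// mulr_ge0// addr_ge0// divr_ge0// ltW.
have key : 7 * (4 * C / i%:R) * bphi t dl i <= z / 16.
  apply: (@le_trans _ _ (28 * C * CP * (i%:R^-1 * i%:R `^ (al / 4 - dl)))).
    have -> : 7 * (4 * C / i%:R) * bphi t dl i = 28 * C / i%:R * bphi t dl i by ring.
    apply: le_trans (ler_wpM2l _ hphi) _.
      by rewrite mulr_ge0 ?invr_ge0 ?(ltW i0)// mulr_ge0.
    by rewrite le_eqVlt; apply/orP; left; apply/eqP; ring.
  rewrite -(powR_inv1 (ltW i0)) -powRD_pos//.
  have -> : -1 + (al / 4 - dl) = - dl + - (1 - al / 4) by ring.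
  rewrite powRD_pos// (powRN _ (1 - al / 4)).
  have big : 540 * C * CP <= i%:R `^ (1 - al / 4).
    apply: le_trans pbig _; apply: powR_mono => //.
    by move: (al1) => ?; lra.
  have y0 : 0 < i%:R `^ (1 - al / 4) by exact: powR_gt0.
  rewrite mulrA ler_pdivrMr//.
  have x0 : 0 <= i%:R `^ (- dl) by exact: powR_ge0.
  have := ler_wpM2l x0 big; have := ler_wpM2r (ltW y0) z1.
  move: (i%:R `^ (1 - al / 4)) (i%:R `^ (- dl)) x0 y0 => y x x0 y0.
  have : 0 <= x * (C * CP) by rewrite mulr_ge0 ?mulr_ge0.
  lra.
have bu0 : 0 <= t i.+1 * u by rewrite mulr_ge0// ltW.
have := ler_wpM2l bu0 key; lra.
Qed.

Let row_p_ge i : (i < m)%N -> (t i.+1 - t i) * t m `^ (- al) <= row_p al t m i.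
Proof.
move=> im; apply: le_trans (ker1_ge al0 al1 (inc im) (tle im)).
have ti := tge0 (ltnW im).
rewrite ler_pM2l ?subr_gt0 ?inc// /kern; apply: powR_antimono.
- by rewrite oppr_le0 ltW.
- by rewrite subr_gt0; apply: lt_le_trans (inc im) (tle im).
- by rewrite gerBl.
Qed.

Lemma row_far_ge i : (p < i)%N -> (i < m)%N ->
  1 / 16 * (t m `^ (al - 1) * i.+1%:R `^ (- dl)) * ((t i.+1 - t i) * t m `^ (- al)) <=
  ker_int al (t m) (t i) (t i.+1) (row_integrand al t W m i).
Proof.
move=> pi_ im.
have b0 : 0 < t i.+1 by apply: tpos; rewrite im.
apply: le_trans (ker_int_ge_const al0 al1 inc im (fun s => row_integrand_far pi_ im)).
apply: ler_pM => //; last exact: row_p_ge.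
- by rewrite mulr_ge0// mulr_ge0// powR_ge0.
- by rewrite mulr_ge0 ?powR_ge0// subr_ge0 ltW ?inc.
rewrite ler_pM2l; last lra.
apply: ler_wpM2r; first exact: powR_ge0.
by apply: powR_antimono => //; [move: (al1) => ?; lra|exact: tle].
Qed.

Let row_far_ge0 i : (p < i)%N -> (i < m)%N ->
  0 <= ker_int al (t m) (t i) (t i.+1) (row_integrand al t W m i).
Proof.
move=> pi_ im; apply: le_trans (row_far_ge pi_ im).
by rewrite mulr_ge0 ?mulr_ge0 ?powR_ge0// ?subr_ge0 ?ltW ?inc.
Qed.

(** Only the indices i >= m/2 are kept. There (i+1)^(-dl) is comparable with m^(-dl), the kernel is
    at least t_m^(-alpha), and the steps add up to at least t_m/2, so that the powers of t_m
    cancel. *)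
Lemma barrier_far_sum :
  2 `^ (- `|dl|) / 32 * m%:R `^ (- dl) <=
  \sum_(p.+1 <= i < m) ker_int al (t m) (t i) (t i.+1) (row_integrand al t W m i).
Proof.
have pq : (p.+1 <= m./2)%N by rewrite geq_half_double.
have qm : (m./2 <= m)%N by rewrite leq_half_double (leq_trans (leq_addr m m)) ?addnn ?leqnSn.
rewrite (big_cat_nat pq qm)/=.
apply: (@le_trans _ _ (0 + \sum_(m./2 <= i < m)
    ker_int al (t m) (t i) (t i.+1) (row_integrand al t W m i))); last first.
  apply: lerD => //; rewrite big_seq; apply: sumr_ge0 => i; rewrite mem_index_iota => /andP[pi_ iq].
  by apply: row_far_ge0 => //; apply: leq_trans qm.
rewrite add0r.
set A := 2 `^ (- `|dl|) * m%:R `^ (- dl).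
have mp : 0 < m%:R :> R by rewrite ltr0n.
have H i : (m./2 <= i < m)%N -> A <= i.+1%:R `^ (- dl).
  move=> /andP[qi im]; have i1 : 0 < i.+1%:R :> R by rewrite ltr0n.
  have mi : m%:R <= 2 * i.+1%:R :> R.
    by rewrite -natrM ler_nat mul2n doubleS; move: qi; rewrite leq_half_double => /leqW.
  have im' : i.+1%:R <= m%:R :> R by rewrite ler_nat.
  rewrite /A; have [d0|d0] := lerP 0 dl.
    apply: (@le_trans _ _ (m%:R `^ (- dl))); last by apply: powR_antimono => //; rewrite oppr_le0.
    rewrite ler_piMl ?powR_ge0//.
    have n0 : - dl <= 0 by rewrite oppr_le0.
    have l12 : (1 : R) <= 2 by lra.
    by rewrite (ger0_norm d0); have := powR_antimono n0 ltr01 l12; rewrite powR1.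
  rewrite (ltr0_norm d0) opprK -ler_pdivlMl; last by apply: powR_gt0; lra.
  rewrite -powRN -powRM//.
  by apply: powR_mono => //; rewrite ?oppr_ge0 ltW.
apply: (@le_trans _ _ (\sum_(m./2 <= i < m) 1 / 16 * (t m `^ (al - 1) * A) *
    ((t i.+1 - t i) * t m `^ (- al)))); last first.
  rewrite big_seq [leRHS]big_seq; apply: ler_sum => i; rewrite mem_index_iota => iq.
  have /andP[qi im] := iq.
  apply: le_trans (row_far_ge _ im); last exact: leq_trans qi.
  apply: ler_wpM2r; first by rewrite mulr_ge0 ?powR_ge0// subr_ge0 ltW ?inc.
  apply: ler_wpM2l; first lra.
  by apply: ler_wpM2l; [exact: powR_ge0|exact: H].
rewrite -mulr_sumr -mulr_suml telescope_sumr//.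
have half : t m / 2 <= t m - t m./2.
  have qq : (m./2.*2 <= m)%N by rewrite -geq_half_double.
  by have := mesh_half rm qq mM; lra.
have A0 : 0 <= A by rewrite /A mulr_ge0 ?powR_ge0.
have E : t m `^ (al - 1) * t m `^ (- al) * t m = 1.
  rewrite -{3}(powRr1 (ltW tm0)) -!powRD_pos//.
  by rewrite (_ : _ + _ + _ = 0) ?powRr0//; ring.
have X0 : 0 <= t m `^ (al - 1) * t m `^ (- al) * A by rewrite mulr_ge0 ?mulr_ge0 ?powR_ge0.
have := ler_wpM2l X0 half.
have -> : t m `^ (al - 1) * t m `^ (- al) * A * (t m / 2) =
  (t m `^ (al - 1) * t m `^ (- al) * t m) * (A / 2) by ring.
rewrite E /A; set Y := t m - t m./2; lra.
Qed.

Let Bp := C ^+ 2 * p.+1%:R `^ r.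

Let node_ratio i : (i <= p)%N -> t i.+1 <= Bp * t 1%N.
Proof.
move=> ip; have im : (i.+1 <= m)%N by apply: leq_trans pm; rewrite -addnn ltn_addr.
have iM : (1 <= i.+1 <= M)%N by rewrite (leq_trans im).
have [h1 _] : t i.+1 <= C * (t 1%N * i.+1%:R `^ r) /\ t 1%N * i.+1%:R `^ r <= C * t i.+1.
  by case: rm => _ _ _ _; exact.
have t1 : 0 < t 1%N by apply: tpos.
have h2 : i.+1%:R `^ r <= p.+1%:R `^ r :> R.
  by apply: powR_mono => //; [exact: le_trans r1|rewrite ler_nat].
apply: (le_trans h1); rewrite /Bp expr2.
apply: (@le_trans _ _ (C * (t 1%N * p.+1%:R `^ r))).
  by apply: ler_wpM2l => //; apply: ler_wpM2l => //; exact: ltW.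
have -> : C * C * p.+1%:R `^ r * t 1%N = C * (C * (t 1%N * p.+1%:R `^ r)) by ring.
rewrite ler_peMl//; apply: mulr_ge0 => //; apply: mulr_ge0; [exact: ltW|exact: powR_ge0].
Qed.

Let Wm := CP * p.+2%:R `^ (al / 4 - dl) * t 1%N `^ (al - 1).

Lemma bw_crude j : (j <= p.+2)%N -> 0 <= W j <= Wm.
Proof.
have t1 : 0 < t 1%N by apply: tpos.
have p2m : (p.+2 <= m)%N by apply: leq_trans pm; rewrite doubleS !ltnS -addnn leq_addr.
have CP0 : 0 <= CP.
  by rewrite /CP addr_ge0// mulr_ge0// addr_ge0// divr_ge0// ltW.
have Wm0 : 0 <= Wm by rewrite /Wm mulr_ge0 ?mulr_ge0 ?powR_ge0.
case: j => [|j] jp; first by rewrite lexx.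
rewrite /bw; set l := maxn _ _.
have l1 : (1 <= l)%N by rewrite /l leq_max.
have lp : (l <= p.+2)%N by rewrite /l geq_max jp ltnW// ltnW.
have lm : (l <= m)%N by exact: leq_trans p2m.
have phi1 : 1 <= bphi t dl l.
  apply: bphi_ge1 => i /andP[i1 il]; split; first by apply: tpos; rewrite i1 (leq_trans il).
  by case: i i1 il => // i _ il; rewrite ltW// inc// (leq_trans il).
have e0 : 0 <= al / 4 - dl by rewrite subr_ge0.
apply/andP; split; first by rewrite mulr_ge0 ?powR_ge0// (le_trans ler01).
rewrite mulrC /Wm; apply: ler_pM; rewrite ?powR_ge0//.
- exact: le_trans phi1.
- apply: le_trans (phi_le _) _; first by rewrite l1 lm.
  by apply: ler_wpM2l => //; apply: powR_mono => //; rewrite ler_nat.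
- apply: powR_antimono => //; first by move: (al1) => ?; lra.
  exact: (increasing_le inc).
Qed.

(** The first p+1 intervals lie in the first half of [0, t_m], where the kernel is at most 2
    t_m^(-alpha), and their total length is at most a multiple of t_1. *)
Lemma barrier_near_sum :
  - (Wm * (2 * Bp + 3) * (2 * t m `^ (- al) * (Bp * t 1%N))) <=
  \sum_(0 <= i < p.+1) ker_int al (t m) (t i) (t i.+1) (row_integrand al t W m i).
Proof.
have t1 : 0 < t 1%N by apply: tpos.
have Bp0 : 0 <= Bp by rewrite /Bp mulr_ge0 ?powR_ge0// sqr_ge0.
have Wm0 : 0 <= Wm by case/andP: (bw_crude (leq0n p.+2)); exact: le_trans.
set K := Wm * (2 * Bp + 3).
have K0 : 0 <= K by rewrite /K mulr_ge0// addr_ge0// mulr_ge0.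
have p2m : (p.+2 <= m)%N by apply: leq_trans pm; rewrite doubleS !ltnS -addnn leq_addr.
apply: (@le_trans _ _ (\sum_(0 <= i < p.+1) - K * (2 * t m `^ (- al)) * (t i.+1 - t i))).
  rewrite -mulr_sumr telescope_sumr// t0 subr0.
  have := node_ratio (leqnn p); move=> /(ler_wpM2l (mulr_ge0 K0 _)).
  have k0 : 0 <= 2 * t m `^ (- al) by rewrite mulr_ge0 ?powR_ge0.
  by move=> /(_ _ k0); set X := 2 * _; lra.
rewrite big_seq [leRHS]big_seq; apply: ler_sum => i; rewrite mem_index_iota => /= ip.
have im : (i.+1 < m)%N by apply: leq_trans p2m; rewrite !ltnS.
have im' := ltnW im.
apply: le_trans (@ker_int_ge_const R al t W m al0 al1 inc i (- K) im' _); last first.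
  move=> s si; apply: (@row_integrand_crude R al t W m i Wm Bp s) => //.
  - by apply: tge0; rewrite ltnW.
  - exact: inc.
  - exact: hmono.
  - apply: le_trans (node_ratio _) _ => //; apply: ler_wpM2l => //.
    by have := mesh_step_ge_first rm (leq_trans im' mM).
  - by move=> j /andP[_ ji]; apply: bw_crude; apply: (leq_trans ji); rewrite !ltnS.
rewrite -mulrA !mulNr lerN2; apply: ler_wpM2l => //.
have h0 := inc im'.
have far : t m / 2 <= t m - t i.+1.
  have qq : (i.+1.*2 <= m)%N by apply: leq_trans pm; rewrite leq_double.
  by have := mesh_half rm qq mM; lra.
have ti1 : t i.+1 < t m by move: (tm0) => ?; lra.
apply: le_trans (ker1_le al0 al1 h0 ti1) _.
rewrite mulrC; apply: ler_wpM2r; first by rewrite subr_ge0 ltW.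
rewrite /kern; apply: (@le_trans _ _ ((t m / 2) `^ (- al))).
  by apply: powR_antimono => //; [rewrite oppr_le0 ltW|rewrite divr_gt0].
rewrite powRM ?invr_ge0 ?(ltW tm0)// mulrC; apply: ler_wpM2r; first exact: powR_ge0.
rewrite -powR_inv1// -powRrM mulN1r opprK -[leRHS]powRr1//.
by rewrite ler_powR// ?ler1n// ltW.
Qed.

End barrier_sum.

(** The far intervals contribute a multiple of m^(-dl). The loss on the first intervals is of order
    (t_1/t_m)^alpha, hence of order m^(-alpha) at most, and dl <= alpha/4 makes it negligible for
    large m; this determines m0. *)
Theorem barrier_row {R : realType} (al C r dl : R) : 0 < al -> al < 1 -> 1 <= C -> 1 <= r ->
  dl <= al / 4 ->
  exists p m0 : nat, exists2 c : R, 0 < c &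
  [/\ (0 < p)%N, 80 * C <= p%:R, (p < m0)%N & forall M t, regular_mesh C r M t -> forall m, (m0 <= m <= M)%N ->
    c * m%:R `^ (- dl) <=
    t m * \sum_(i < m) row_coef al t m i * (bw al t dl p i.+1 - bw al t dl p i)].
Proof.
move=> al0 al1 C1 r1 dla.
have C0 : 0 <= C by exact: le_trans C1.
set CP := 1 + C * (1 + 4 / al).
have CP0 : 0 <= CP.
  by rewrite /CP addr_ge0// mulr_ge0// addr_ge0// divr_ge0// ltW.
have k0 : 0 <= 540 * C * CP by exact: (mulr_ge0 (mulr_ge0 (ler0n _ _) C0) CP0).
have e0 : 0 < 1 - al / 4 by lra.
have [p1 hp1] := powR_small_eventually k0 e0.
(* Beyond p relative steps are at most 1/80 and consecutive values of i^(-dl) differ by a factor of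
   at most 6/5. *)
have [p2 hp2] := @powR_small_eventually R (6 * `|dl| + 80 * C) 1 ltac:(by rewrite addr_ge0// mulr_ge0) ltr01.
pose p := (p1 + p2).+1.
have p0 : (0 < p)%N by [].
have pbig := hp1 p (ltac:(by rewrite /p leqW// leq_addr)).
have := hp2 p (ltac:(by rewrite /p leqW// leq_addl)); rewrite powRr1// => ps.
have dl0 : 0 <= `|dl| by [].
have pdl : 6 * `|dl| <= p%:R by apply: le_trans ps; lra.
have pC : 80 * C <= p%:R by apply: le_trans ps; lra.
pose Bp := C ^+ 2 * p.+1%:R `^ r.
pose K := CP * p.+2%:R `^ (al / 4 - dl) * (2 * Bp + 3) * (2 * C * Bp).
have Bp0 : 0 <= Bp by rewrite /Bp mulr_ge0 ?powR_ge0// sqr_ge0.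
have K0 : 0 <= K.
  by rewrite /K mulr_ge0// ?mulr_ge0// ?powR_ge0// addr_ge0// mulr_ge0.
pose c1 : R := 2 `^ (- `|dl|) / 32.
have c10 : 0 < c1 by rewrite /c1 divr_gt0// powR_gt0.
have K10 : 0 <= 2 * K / c1 by apply: divr_ge0; [apply: mulr_ge0|exact: ltW].
have adl : 0 < al - dl by lra.
have [m1 hm1] := powR_small_eventually K10 adl.
exists p, (p.+1.*2 + m1)%N, (c1 / 2); first lra.
split=> //; first by apply: leq_trans (leq_addr _ _); rewrite -addnn leq_addr.
move=> M t rm m /andP[mm mM].
have pm : (p.+1.*2 <= m)%N by exact: leq_trans (leq_addr _ _) mm.
have big := hm1 m (leq_trans (leq_addl _ _) mm).
have m0 : (0 < m)%N by exact: leq_trans pm.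
have inc j : (j < m)%N -> t j < t j.+1.
  by case: rm => _ inc _ _ _ jm; apply: inc; exact: leq_trans mM.
rewrite (row_sum_by_parts al0 al1 m0 inc)//.
rewrite -(big_mkord predT (fun i => ker_int al (t m) (t i) (t i.+1) (row_integrand al t _ m i))).
have pm' : (p.+1 <= m)%N by apply: leq_trans pm; rewrite -addnn leq_addr.
rewrite (big_cat_nat (leq0n _) pm')/=.
have far := barrier_far_sum al0 al1 C1 dla p0 pdl pC pbig rm mM pm.
have near := barrier_near_sum al0 al1 C1 r1 dla rm mM pm.
rewrite -/c1 in far.
suff key : CP * p.+2%:R `^ (al / 4 - dl) * t 1%N `^ (al - 1) *
    (2 * Bp + 3) * (2 * t m `^ (- al) * (Bp * t 1%N)) <= c1 / 2 * m%:R `^ (- dl).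
  move: near far; rewrite -/CP -/Bp; lra.
have t1 : 0 < t 1%N by apply: (mesh_pos rm); rewrite (leq_trans m0 mM).
have mp : 0 < m%:R :> R by rewrite ltr0n.
have hm : 1 <= m%:R :> R by rewrite ler1n.
have tmm : t 1%N * m%:R <= C * t m.
  have [_ h] : t m <= C * (t 1%N * m%:R `^ r) /\ t 1%N * m%:R `^ r <= C * t m.
    by case: rm => _ _ _ _; apply; rewrite m0.
  apply: le_trans h; apply: ler_wpM2l; first exact: ltW.
  by rewrite -{1}[m%:R]powRr1// ler_powR.
have tmp : 0 < t m by apply: (mesh_pos rm); rewrite m0.
have tma : t m `^ (- al) <= C * (t 1%N `^ (- al) * m%:R `^ (- al)).
  rewrite -(powRM _ (ltW t1) (ltW mp)).
  have Cp : 0 < C by apply: lt_le_trans C1.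
  apply: (@le_trans _ _ ((t 1%N * m%:R / C) `^ (- al))).
    apply: powR_antimono; first by rewrite oppr_le0 ltW.
      by rewrite divr_gt0 ?mulr_gt0.
    by rewrite ler_pdivrMr// [t m * C]mulrC.
  rewrite powRM ?invr_ge0 ?mulr_ge0 ?(ltW t1) ?(ltW mp)// mulrC.
  apply: ler_wpM2r; first exact: powR_ge0.
  rewrite -powR_inv1// -powRrM mulN1r opprK -[leRHS]powRr1//.
  by rewrite ler_powR// ltW.
have E : t 1%N `^ (al - 1) * t 1%N `^ (- al) * t 1%N = 1.
  rewrite -{3}(powRr1 (ltW t1)) -!powRD_pos//.
  by rewrite (_ : _ + _ + _ = 0) ?powRr0//; ring.
have F0 : 0 <= CP * p.+2%:R `^ (al / 4 - dl) * t 1%N `^ (al - 1) * (2 * Bp + 3) * (2 * (Bp * t 1%N)).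
  rewrite mulr_ge0 ?mulr_ge0 ?powR_ge0 ?(ltW t1)//; lra.
have := ler_wpM2l F0 tma.
set P := p.+2%:R `^ _ in F0 *; set u := t 1%N `^ (al - 1) in E F0 *.
set v := t 1%N `^ (- al) in E *; set z := m%:R `^ (- al).
move=> h; apply: (@le_trans _ _ (K * z)).
  have -> : K * z = CP * P * (2 * Bp + 3) * (2 * C * Bp) * (u * v * t 1%N) * z.
    by rewrite E mulr1.
  by move: h; lra.
have d0 : 0 < m%:R `^ (al - dl) :> R by exact: powR_gt0.
have -> : m%:R `^ (- dl) = z * m%:R `^ (al - dl).
  by rewrite /z -powRD_pos//; congr (_ `^ _); ring.
have z0 : 0 <= z by exact: powR_ge0.
have : K <= c1 / 2 * m%:R `^ (al - dl).
  by move: big; rewrite ler_pdivrMr//; lra.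
move=> /(ler_wpM2r z0); lra.
Qed.

                         

(** * Kernel-weighted integrals of mean-zero errors *)

Section kernel_errors.
Context {R : realType}.
Notation leb := (@lebesgue_measure R).
Implicit Types (k f F : R -> R) (a b : R).

Lemma integrable_scale (c : R) (f : R -> R) (D : set R) : measurable D ->
  leb.-integrable D (EFin \o f) -> leb.-integrable D (EFin \o (fun s => c * f s)).
Proof.
move=> mD i_f.
rewrite (_ : EFin \o _ = (fun x => c%:E * (EFin \o f) x)%E); last exact/funext.
exact: integrableZl.
Qed.

Lemma integrable_sub (f g : R -> R) (D : set R) : measurable D ->
  leb.-integrable D (EFin \o f) -> leb.-integrable D (EFin \o g) ->
  leb.-integrable D (EFin \o (fun s => f s - g s)).
Proof.
move=> mD i_f ig.
rewrite (_ : EFin \o _ = (EFin \o f) \- (EFin \o g))%E; last exact/funext.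
exact: integrableB.
Qed.

                                                                          
(** As f has mean zero, the constant [ka] may be subtracted from the kernel, which leaves a weight
    between 0 and [kb - ka]. *)
Lemma kernel_gap_bound k f F a b ka kb :
  leb.-integrable `]a, b[ (EFin \o f) ->
  leb.-integrable `]a, b[ (EFin \o (fun s => k s * f s)) ->
  leb.-integrable `]a, b[ (EFin \o F) ->
  \int[leb]_(s in `]a, b[) f s = 0 ->
  {in `]a, b[, forall s, ka <= k s <= kb} ->
  {in `]a, b[, forall s, `|f s| <= F s} ->
  `|\int[leb]_(s in `]a, b[) (k s * f s)| <= (kb - ka) * \int[leb]_(s in `]a, b[) F s.
Proof.
move=> i_f ikf iF f0 kk fF.
have ikaf : leb.-integrable `]a, b[ (EFin \o (fun s => ka * f s)).
  exact: integrable_scale.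
have -> : \int[leb]_(s in `]a, b[) (k s * f s) =
    \int[leb]_(s in `]a, b[) (k s * f s - ka * f s).
  by rewrite RintegralB// RintegralZl// f0 mulr0 subr0.
have idf : leb.-integrable `]a, b[ (EFin \o (fun s => k s * f s - ka * f s)).
  exact: integrable_sub.
have iKF : leb.-integrable `]a, b[ (EFin \o (fun s => (kb - ka) * F s)).
  exact: integrable_scale.
apply: le_trans (le_normr_Rintegral _ idf) _ => //.
rewrite -RintegralZl//; apply: le_Rintegral => //.
- by apply: integrable_norm.
- move=> s sab; have /andP[k1 k2] := kk s sab.
  rewrite -mulrBl normrM ger0_norm ?subr_ge0//; apply: ler_pM => //.
  + by rewrite subr_ge0.
  + by rewrite lerD2r.
  + exact: fF.
Qed.

End kernel_errors.

(** * Derivative error of quadratic interpolation *)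

Section quadratic_interpolation.
Context {R : realType}.
Variables (t : nat -> R) (i : nat) (f f1 f2 f3 : R -> R) (B : R).
Hypotheses (t01 : t i < t i.+1) (t12 : t i.+1 < t i.+2).
Hypothesis cf : {within `[t i, t i.+2], continuous f}.
Hypothesis df : forall x : R, x \in `]t i, t i.+2[ -> is_derive x 1 f (f1 x).
Hypothesis df1 : forall x : R, x \in `]t i, t i.+2[ -> is_derive x 1 f1 (f2 x).
Hypothesis df2 : forall x : R, x \in `]t i, t i.+2[ -> is_derive x 1 f2 (f3 x).
Hypothesis f3B : forall x : R, x \in `]t i, t i.+2[ -> `|f3 x| <= B.

Let U j := f (t j).
Let S := slope t U i.
Let c := curvature t U i.
Let chi s := f s - newton t U i c s.
Let chi1 s := f1 s - (S + c * (2 * s - t i - t i.+1)).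
Let chi2 s := f2 s - 2 * c.

Let dchi (x : R) : x \in `]t i, t i.+2[ -> is_derive x 1 chi (chi1 x).
Proof. by move=> xI; apply: is_deriveB; [exact: df|exact: is_derive_newton]. Qed.

Let dchi1 (x : R) : x \in `]t i, t i.+2[ -> is_derive x 1 chi1 (chi2 x).
Proof.
move=> xI; apply: is_deriveB; first exact: df1.
have h : is_derive x 1 (fun s : R => 2 * s - t i - t i.+1) 2.
  rewrite -[X in is_derive _ _ _ X]subr0; apply: is_deriveB.
  rewrite -[X in is_derive _ _ _ X]subr0; apply: is_deriveB.
  rewrite -[X in is_derive _ _ _ X]mulr1; exact: is_deriveZ.
rewrite -[X in is_derive _ _ _ X]add0r; apply: is_deriveD.
by rewrite mulrC; exact: is_deriveZ.
Qed.

Let cchi : {within `[t i, t i.+2], continuous chi}.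
Proof.
have cn : {within `[t i, t i.+2], continuous (newton t U i c)}.
  apply: continuous_subspaceT => x; apply: differentiable_continuous.
  by apply/derivable1_diffP; apply: ex_derive; exact: is_derive_newton.
by move=> x; apply: cvgB; [exact: cf|exact: cn].
Qed.

Let chi_at0 : chi (t i) = 0.
Proof. by rewrite /chi /newton /U; ring. Qed.

Let chi_at1 : chi (t i.+1) = 0.
Proof.
by rewrite /chi /newton /S /slope /U; field; apply/eqP; move: (t01) => ?; lra.
Qed.

Let chi_at2 : chi (t i.+2) = 0.
Proof.
rewrite /chi /newton /c /curvature /S /slope /U; move: (t01) (t12) => ? ?.
by field; do ?(apply/andP; split); apply/eqP; lra.
Qed.

Let sub_itv (a b x : R) : t i <= a -> b <= t i.+2 -> x \in `]a, b[ -> x \in `]t i, t i.+2[.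
Proof.
rewrite !in_itv/= => ta bt /andP[ax xb].
by rewrite (le_lt_trans ta ax) (lt_le_trans xb bt).
Qed.

Let rolle (a b : R) : t i <= a -> b <= t i.+2 -> a < b -> chi a = 0 -> chi b = 0 ->
  exists2 x, x \in `]a, b[ & chi1 x = 0.
Proof.
move=> ta bt ab ca cb.
have d x : x \in `]a, b[ -> is_derive (x : R) 1 chi (chi1 x).
  by move=> xI; apply: dchi; exact: sub_itv xI.
have cc : {within `[a, b], continuous chi}.
  apply: continuous_subspaceW cchi => x /=; rewrite !in_itv/= => /andP[ax xb].
  by rewrite (le_trans ta ax) (le_trans xb bt).
have [x xI] := MVT ab d cc.
rewrite ca cb subrr => /esym/eqP; rewrite mulf_eq0 (subr_eq0 b a) (gt_eqF ab) orbF => /eqP h.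
by exists x.
Qed.

Let cont1 (a b : R) : t i < a -> b < t i.+2 -> a <= b -> {within `[a, b], continuous chi1}.
Proof.
move=> ta bt ab; apply: derivable_within_continuous => x.
rewrite in_itv/= => /andP[ax xb]; apply: ex_derive; apply: dchi1.
by rewrite in_itv/= (lt_le_trans ta ax) (le_lt_trans xb bt).
Qed.

Let cont2 (a b : R) : t i < a -> b < t i.+2 -> a <= b -> {within `[a, b], continuous chi2}.
Proof.
move=> ta bt ab.
have c2 : {within `[a, b], continuous f2}.
  apply: derivable_within_continuous => x.
  rewrite in_itv/= => /andP[ax xb]; apply: ex_derive; apply: df2.
  by rewrite in_itv/= (lt_le_trans ta ax) (le_lt_trans xb bt).
have cst : {within `[a, b], continuous (fun _ : R => 2 * c)}.
  by apply: continuous_subspaceT => x; exact: cvg_cst.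
by move=> x; apply: cvgB; [exact: c2|exact: cst].
Qed.

Let dchi2 (x : R) : x \in `]t i, t i.+2[ -> is_derive x 1 chi2 (f3 x).
Proof.
by move=> xI; rewrite -[X in is_derive _ _ _ X]subr0; apply: is_deriveB; exact: df2.
Qed.

Let vanishing_bound (g g' : R -> R) (K z s : R) :
  (forall x : R, x \in `]t i, t i.+2[ -> is_derive x 1 g (g' x)) ->
  (forall a b, t i < a -> b < t i.+2 -> a <= b -> {within `[a, b], continuous g}) ->
  (forall x : R, x \in `]t i, t i.+2[ -> `|g' x| <= K) ->
  z \in `]t i, t i.+2[ -> s \in `]t i, t i.+2[ -> g z = 0 ->
  `|g s| <= K * (t i.+2 - t i).
Proof.
move=> dg cg gK zI sI gz.
have K0 : 0 <= K by apply: le_trans (gK _ zI); rewrite normr_ge0.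
move: (zI) (sI); rewrite !in_itv/= => /andP[z0 z2] /andP[s0 s2].
suff [x xI E] : exists2 x, x \in `]t i, t i.+2[ & `|g s| = `|g' x| * `|s - z|.
  rewrite E; apply: ler_pM => //; first exact: gK.
  by rewrite ler_norml; apply/andP; split; lra.
have [zs|sz|<-] := ltgtP z s; last by exists z => //; rewrite gz subrr !normr0 mulr0.
- have d x : x \in `]z, s[ -> is_derive (x : R) 1 g (g' x).
    by move=> xI; apply: dg; apply: (sub_itv (ltW z0) (ltW s2) xI).
  have [x xI E] := MVT zs d (cg _ _ z0 s2 (ltW zs)).
  exists x; first exact: (sub_itv (ltW z0) (ltW s2) xI).
  by rewrite -normrM -E gz subr0.
- have d x : x \in `]s, z[ -> is_derive (x : R) 1 g (g' x).
    by move=> xI; apply: dg; apply: (sub_itv (ltW s0) (ltW z2) xI).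
  have [x xI E] := MVT sz d (cg _ _ s0 z2 (ltW sz)).
  exists x; first exact: (sub_itv (ltW s0) (ltW z2) xI).
  by rewrite distrC -normrM -E gz sub0r normrN.
Qed.

(** By Rolle the error vanishes at three nodes, its derivative at two points and its second
    derivative at one. Going back from these zeros with the mean value theorem costs a factor
    t_(i+2) - t_i each time. *)
Lemma quadratic_interpolation_derive (s : R) : s \in `]t i, t i.+2[ ->
  `|f1 s - (S + c * (2 * s - t i - t i.+1))| <= B * (t i.+2 - t i) ^+ 2.
Proof.
move=> sI; rewrite -/(chi1 s).
move: (t01) (t12) => h01 h12.
have [x xI cx] := rolle (lexx _) (ltW h12) h01 chi_at0 chi_at1.
have [y yI cy] := rolle (ltW h01) (lexx _) h12 chi_at1 chi_at2.
have xI' := sub_itv (lexx _) (ltW h12) xI.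
have yI' := sub_itv (ltW h01) (lexx _) yI.
move: (xI) (yI); rewrite !in_itv/= => /andP[x0 x1] /andP[y1 y2].
have xy : x < y by exact: lt_trans y1.
have d z : z \in `]x, y[ -> is_derive (z : R) 1 chi1 (chi2 z).
  by move=> zI; apply: dchi1; apply: (sub_itv (ltW x0) (ltW y2) zI).
have [z zI] := MVT xy d (cont1 x0 y2 (ltW xy)).
rewrite cx cy subrr => /esym/eqP; rewrite mulf_eq0 (subr_eq0 y x) (gt_eqF xy) orbF => /eqP cz.
have zI' := sub_itv (ltW x0) (ltW y2) zI.
rewrite expr2 mulrA; apply: (vanishing_bound dchi1 cont1 _ xI' sI cx) => w wI.
exact: (vanishing_bound dchi2 cont2 f3B zI' wI cz).
Qed.

End quadratic_interpolation.

(** * Paths with a weak singularity at time zero *)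

Section truncation.
Context {R : realType}.
Notation leb := (@lebesgue_measure R).
Variables (al C r : R) (M : nat) (t : nat -> R).
Hypotheses (al0 : 0 < al) (al1 : al < 1) (C1 : 1 <= C) (r1 : 1 <= r).
Hypothesis rm : regular_mesh C r M t.
Variables (A T : R) (f f1 f2 f3 : R -> R).
Hypothesis A0 : 0 <= A.
Hypothesis f_at0 : f @ 0^'+ --> f 0.
Hypothesis f_atT : f @ T^'- --> f T.
Hypothesis df : forall x : R, x \in `]0, T[ -> is_derive x 1 f (f1 x).
Hypothesis df1 : forall x : R, x \in `]0, T[ -> is_derive x 1 f1 (f2 x).
Hypothesis f1A : forall x : R, x \in `]0, T[ -> `|f1 x| <= A * x `^ (al - 1).

Let al01 : 0 < al < 1. Proof. by rewrite al0. Qed.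
Let C0 : 0 <= C. Proof. exact: le_trans C1. Qed.

Let cont_f (x : R) : x \in `]0, T[ -> {for x, continuous f}.
Proof.
move=> xI; apply: differentiable_continuous; apply/derivable1_diffP.
by apply: ex_derive; exact: df.
Qed.

Let cont_f1 (x : R) : x \in `]0, T[ -> {for x, continuous f1}.
Proof.
move=> xI; apply: differentiable_continuous; apply/derivable1_diffP.
by apply: ex_derive; exact: df1.
Qed.

Let right_f (a : R) : 0 <= a -> a < T -> f @ a^'+ --> f a.
Proof.
rewrite le_eqVlt => /predU1P[<- //|a0] aT.
by apply: cvg_at_right_filter; apply: cont_f; rewrite in_itv/= a0.
Qed.

Let left_f (a : R) : 0 < a -> a <= T -> f @ a^'- --> f a.
Proof.
move=> a0; rewrite le_eqVlt => /predU1P[-> //|aT].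
by apply: cvg_at_left_filter; apply: cont_f; rewrite in_itv/= a0.
Qed.

Let sub0T (a b x : R) : 0 <= a -> b <= T -> x \in `]a, b[ -> x \in `]0, T[.
Proof.
rewrite !in_itv/= => a0 bT /andP[ax xb].
by rewrite (le_lt_trans a0 ax) (lt_le_trans xb bT).
Qed.

Lemma within_cont_path (a b : R) : 0 <= a -> a < b -> b <= T -> {within `[a, b], continuous f}.
Proof.
move=> a0 ab bT; apply/(continuous_within_itvP _ ab); split.
- by move=> x xI; apply: cont_f; exact: sub0T xI.
- by apply: right_f => //; exact: lt_le_trans bT.
- by apply: left_f => //; exact: le_lt_trans ab.
Qed.

Lemma path_increment0 (x : R) : 0 < x -> x <= T -> `|f x - f 0| <= A / al * x `^ al.
Proof.
move=> x0 xT.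
have [|h1 h2 h3 h4 h5] := @powR_primitive_props R (al - 1) 0 x _ (lexx _) x0.
  by move: (al0) => ?; lra.
rewrite subrK in h1 h4 h5.
have dG y : y \in `]0, x[ -> is_derive (y : R) 1 (fun s => A * (s `^ al / al)) (A * y `^ (al - 1)).
  by move=> yI; apply: is_deriveZ; exact: h1.
have cg : {in `]0, x[, continuous (fun s => A * s `^ (al - 1))}.
  by move=> y yI; apply: cvgM; [exact: cvg_cst|exact: h2].
have [] := @dominated_improper_FTC R f f1 _ _ 0 x x0 _ _ dG cg _ _ _ _ _.
- by move=> y yI; apply: df; exact: sub0T yI.
- by move=> y yI; apply: cont_f1; exact: sub0T yI.
- by move=> y yI; apply: f1A; exact: sub0T yI.
- exact: f_at0.
- exact: left_f.
- by apply: cvgM; [exact: cvg_cst|exact: h4].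
- by apply: cvgM; [exact: cvg_cst|exact: h5].
move=> i1 <-; apply: le_trans (le_normr_Rintegral _ i1) _ => //.
have iG : leb.-integrable `]0, x[ (EFin \o (fun s => A * s `^ (al - 1))).
  by apply: integrable_scale => //; apply: powR_integrable => //; move: (al0) => ?; lra.
apply: (@le_trans _ _ (\int[leb]_(s in `]0, x[) (A * s `^ (al - 1)))).
  apply: le_Rintegral => //; first exact: integrable_norm.
  by move=> y yI; apply: f1A; exact: sub0T yI.
rewrite RintegralZl//; last by apply: powR_integrable => //; move: (al0) => ?; lra.
rewrite Rintegral_powR//; last by move: (al0) => ?; lra.
rewrite subrK powR0 ?subr0; last by rewrite gt_eqF.
by rewrite mulrA mulrAC.
Qed.

Lemma path_increment (a b : R) : 0 < a -> a < b -> b <= T ->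
  `|f b - f a| <= A * a `^ (al - 1) * (b - a).
Proof.
move=> a0 ab bT.
have d x : x \in `]a, b[ -> is_derive (x : R) 1 f (f1 x).
  by move=> xI; apply: df; exact: sub0T (ltW a0) bT xI.
have [x xI ->] := MVT ab d (within_cont_path (ltW a0) ab bT).
rewrite normrM (ger0_norm (_ : 0 <= b - a)); last by rewrite subr_ge0 ltW.
apply: ler_wpM2r; first by rewrite subr_ge0 ltW.
apply: le_trans (f1A (sub0T (ltW a0) bT xI)) _; apply: ler_wpM2l => //.
move: xI; rewrite in_itv/= => /andP[ax _].
by apply: powR_antimono => //; [move: (al1) => ?; lra|exact: ltW].
Qed.

(** Split at x/2. On the left half the kernel is at most (x/2)^(-alpha) and s^(alpha-1) integrates
    to (x/2)^alpha / alpha; on the right half the two factors exchange roles. *)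
Lemma caputo_integral_bound (x : R) : 0 < x -> x <= T ->
  leb.-integrable `]0, x[ (EFin \o (fun s => (x - s) `^ (- al) * f1 s)) ->
  `|\int[leb]_(s in `]0, x[) ((x - s) `^ (- al) * f1 s)| <= A * (al^-1 + (1 - al)^-1).
Proof.
move=> x0 xT i1.
have hx0 : 0 < x / 2 by rewrite divr_gt0.
have hxx : x / 2 < x by rewrite ltr_pdivrMr// ltr_pMr// ltr1n.
have ia : leb.-integrable `]0, x / 2[ (EFin \o (fun s => (x - s) `^ (- al) * f1 s)).
  apply: integrableS i1 => // y /=; rewrite !in_itv/= => /andP[-> h]; exact: lt_trans hxx.
have ib : leb.-integrable `]x / 2, x[ (EFin \o (fun s => (x - s) `^ (- al) * f1 s)).
  apply: integrableS i1 => // y /=; rewrite !in_itv/= => /andP[h ->]; rewrite andbT; exact: lt_trans h.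
have [_ ->] := Rintegral_chasles hx0 hxx ia ib.
have al1' : -1 < al - 1 by move: (al0) => ?; lra.
have al1'' : -1 < - al by move: (al1) => ?; lra.
have ip := @powR_integrable R (al - 1) 0 (x / 2) al1' (lexx _) hx0.
have ik := kernel_integrable al1'' hxx (lexx x).
apply: le_trans (ler_normD _ _) _; rewrite mulrDr; apply: lerD.
- apply: le_trans (le_normr_Rintegral _ ia) _ => //.
  apply: (@le_trans _ _ (\int[leb]_(s in `]0, x / 2[) (A * (x / 2) `^ (- al) * s `^ (al - 1)))).
    apply: le_Rintegral => //; [exact: integrable_norm|exact: integrable_scale|].
    move=> y yI; have yI' : y \in `]0, T[ by apply: sub0T yI => //; exact: le_trans (ltW hxx) xT.
    move: yI; rewrite /= in_itv/= => /andP[y0 yx].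
    rewrite normrM ger0_norm ?powR_ge0// mulrAC [leRHS]mulrC; apply: ler_pM => //.
    + exact: powR_ge0.
    + apply: powR_antimono; [by rewrite oppr_le0 ltW|by []|].
      have E : x = x / 2 + x / 2 by field.
      by rewrite {2}E lerBrDr lerD2l ltW.
    + exact: f1A.
  rewrite RintegralZl// Rintegral_powR// subrK powR0 ?subr0; last by rewrite gt_eqF.
  have E : (x / 2) `^ (- al) * (x / 2) `^ al = 1 by rewrite -powRD_pos// addNr powRr0.
  by rewrite -mulrA; apply: ler_wpM2l => //; rewrite mulrA E mul1r.
- apply: le_trans (le_normr_Rintegral _ ib) _ => //.
  apply: (@le_trans _ _ (\int[leb]_(s in `]x / 2, x[) (A * (x / 2) `^ (al - 1) * (x - s) `^ (- al)))).
    apply: le_Rintegral => //; [exact: integrable_norm|exact: integrable_scale|].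
    move=> y yI; have yI' : y \in `]0, T[ by apply: sub0T yI => //; exact: ltW.
    move: yI; rewrite /= in_itv/= => /andP[y0 yx].
    rewrite normrM ger0_norm ?powR_ge0// mulrC; apply: ler_wpM2r; first exact: powR_ge0.
    apply: le_trans (f1A yI') _; apply: ler_wpM2l => //.
    by apply: powR_antimono => //; [move: (al1) => ?; lra|exact: ltW].
  rewrite RintegralZl// Rintegral_kernel// subrr [- al + 1]addrC powR0 ?subr0; last first.
    by rewrite subr_eq0 gt_eqF.
  have -> : x - x / 2 = x / 2 by field.
  have E : (x / 2) `^ (al - 1) * (x / 2) `^ (1 - al) = 1.
    by rewrite -powRD_pos// (_ : _ + _ = 0) ?powRr0//; ring.
  by rewrite -mulrA; apply: ler_wpM2l => //; rewrite mulrA E mul1r.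
Qed.

End truncation.

(** * Ratios of nodes and the last step *)

Section mesh_ratios.
Context {R : realType}.
Variables (C r : R) (M : nat) (t : nat -> R).
Hypotheses (C1 : 1 <= C) (r1 : 1 <= r) (rm : regular_mesh C r M t).

Let C0 : 0 <= C. Proof. exact: le_trans C1. Qed.

Lemma node_growth i : (1 <= i)%N -> (i < M)%N -> t i.+1 <= C ^+ 2 * 2 `^ r * t i.
Proof.
move=> i1 iM.
have [h1 _] : t i.+1 <= C * (t 1%N * i.+1%:R `^ r) /\ t 1%N * i.+1%:R `^ r <= C * t i.+1.
  by case: rm => _ _ _ _; exact.
have [_ h2] : t i <= C * (t 1%N * i%:R `^ r) /\ t 1%N * i%:R `^ r <= C * t i.
  by case: rm => _ _ _ _; apply; rewrite i1 ltnW.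
have t1 : 0 < t 1%N by apply: (mesh_pos rm); rewrite (leq_trans _ iM).
have h3 : i.+1%:R `^ r <= 2 `^ r * i%:R `^ r :> R.
  rewrite -powRM//; apply: powR_mono => //; first exact: le_trans r1.
  by rewrite -natrM ler_nat mul2n -addnn -addn1 leq_add2l.
apply: (le_trans h1); apply: (@le_trans _ _ (C * (t 1%N * (2 `^ r * i%:R `^ r)))).
  by apply: ler_wpM2l => //; apply: ler_wpM2l => //; exact: ltW.
have -> : C * (t 1%N * (2 `^ r * i%:R `^ r)) = C * 2 `^ r * (t 1%N * i%:R `^ r) by ring.
have -> : C ^+ 2 * 2 `^ r * t i = C * 2 `^ r * (C * t i) by ring.
by apply: ler_wpM2l => //; apply: mulr_ge0 => //; exact: powR_ge0.
Qed.

Lemma node_power_ratio i m : (1 <= i)%N -> (i <= m)%N -> (m <= M)%N ->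
  t i / t m <= C ^+ 2 * (i%:R / m%:R) `^ r.
Proof.
move=> i1 im mM; have m1 := leq_trans i1 im.
have [h1 _] : t i <= C * (t 1%N * i%:R `^ r) /\ t 1%N * i%:R `^ r <= C * t i.
  by case: rm => _ _ _ _; apply; rewrite i1 (leq_trans im).
have [_ h2] : t m <= C * (t 1%N * m%:R `^ r) /\ t 1%N * m%:R `^ r <= C * t m.
  by case: rm => _ _ _ _; apply; rewrite m1.
have t1 : 0 < t 1%N by apply: (mesh_pos rm); rewrite (leq_trans m1 mM).
have tm : 0 < t m by apply: (mesh_pos rm); rewrite m1.
have mp : 0 < m%:R :> R by rewrite ltr0n.
have mr : 0 < m%:R `^ r :> R by exact: powR_gt0.
rewrite ler_pdivrMr//; apply: (le_trans h1).
have -> : (i%:R / m%:R) `^ r = i%:R `^ r / m%:R `^ r :> R.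
  by rewrite powRM ?invr_ge0 ?ler0n// -(powR_inv1 (ltW mp)) -powRrM mulN1r powRN.
have -> : C ^+ 2 * (i%:R `^ r / m%:R `^ r) * t m = C * (i%:R `^ r / m%:R `^ r) * (C * t m) by ring.
apply: le_trans (ler_wpM2l _ h2); last first.
  by apply: mulr_ge0 => //; apply: divr_ge0; exact: powR_ge0.
rewrite le_eqVlt; apply/orP; left; apply/eqP; field.
exact: lt0r_neq0.
Qed.

(** The last of m nondecreasing steps is at least their average. *)
Lemma last_step_ge m : (1 <= m <= M)%N -> t m / m%:R <= t m - t m.-1.
Proof.
move=> /andP[m1 mM].
have mp : 0 < m%:R :> R by rewrite ltr0n.
rewrite ler_pdivrMr//.
have t0 : t 0%N = 0 by case: rm.
case: m m1 mM mp => [//|m] _ mM _ /=.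
have H k : (k <= m.+1)%N -> t k <= k%:R * (t m.+1 - t m).
  elim: k => [|k IH] km; first by rewrite t0 mul0r.
  have := IH (ltnW km); have := mesh_step_ge rm (km : (k <= m)%N) mM.
  rewrite -natr1 mulrDl mul1r; lra.
by rewrite mulrC; exact: H.
Qed.

Lemma step_le j : (j < M)%N -> t j.+1 - t j <= C * (t j.+1 / j.+1%:R).
Proof. by case: rm => _ _ _ h _; exact: h. Qed.

End mesh_ratios.

Section kernel_increments.
Context {R : realType}.
Variables (al : R) (M : nat) (t : nat -> R) (C r : R).
Hypotheses (al0 : 0 < al) (al1 : al < 1) (rm : regular_mesh C r M t).

(** As t_(i+1) <= t_m/2, the slope of the kernel on the interval is at most (t_m/2)^(-alpha-1), and
    2^(1+alpha) <= 4. *)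
Lemma kernel_increment_early m i : (i.+1.*2 <= m)%N -> (m <= M)%N ->
  kern al (t m) (t i.+1) - kern al (t m) (t i) <=
  4 * t m `^ (- al - 1) * (t i.+1 - t i).
Proof.
move=> im mM; move: (al0) (al1) => ? ?.
have half := mesh_half rm im mM.
have iM : (i < M)%N by apply: leq_trans mM; apply: leq_trans im; rewrite -addnn leq_addl.
have ii : t i < t i.+1 by case: rm => _ inc _ _ _; exact: inc.
have ti0 : 0 < t i.+1 by apply: (mesh_pos rm).
have tm0 : 0 < t m by lra.
have na : - al <= 0 by lra.
have h1 : 0 < t m - t i by lra.
have h2 : 0 < t m - t i.+1 by lra.
have := powR_tangent na h1 h2.
rewrite /kern; set k1 := (t m - t i.+1) `^ (- al); set k0 := (t m - t i) `^ (- al) => H.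
have hq : (t m - t i.+1) `^ (- al - 1) <= 4 * t m `^ (- al - 1).
  apply: (@le_trans _ _ ((t m / 2) `^ (- al - 1))).
    by apply: powR_antimono; [lra|rewrite divr_gt0|lra].
  rewrite powRM ?invr_ge0 ?(ltW tm0)// mulrC; apply: ler_wpM2r; first exact: powR_ge0.
  rewrite -powR_inv1// -powRrM.
  apply: (@le_trans _ _ (2 `^ 2)).
    by apply: ler_powR; [rewrite ler1n|lra].
  by rewrite powR_mulrn//; lra.
have h0 : 0 <= t i.+1 - t i by lra.
have q0 : 0 <= (t m - t i.+1) `^ (- al - 1) by exact: powR_ge0.
apply: (@le_trans _ _ ((t m - t i.+1) `^ (- al - 1) * (t i.+1 - t i))); last exact: ler_wpM2r.
have : 0 <= (1 - al) * ((t m - t i.+1) `^ (- al - 1) * (t i.+1 - t i)).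
  by apply: mulr_ge0; [lra|exact: mulr_ge0].
set q := (t m - t i.+1) `^ (- al - 1) in H *; lra.
Qed.

End kernel_increments.

(** * Truncation error interval by interval *)

Section pieces.
Context {R : realType}.
Notation leb := (@lebesgue_measure R).
Variables (al C r : R) (M : nat) (t : nat -> R).
Hypotheses (al0 : 0 < al) (al1 : al < 1) (C1 : 1 <= C) (r1 : 1 <= r).
Hypothesis rm : regular_mesh C r M t.
Variables (A T : R) (f f1 f2 f3 : R -> R) (m : nat).
Hypothesis A0 : 0 <= A.
Hypothesis f_at0 : f @ 0^'+ --> f 0.
Hypothesis f_atT : f @ T^'- --> f T.
Hypothesis df : forall x : R, x \in `]0, T[ -> is_derive x 1 f (f1 x).
Hypothesis df1 : forall x : R, x \in `]0, T[ -> is_derive x 1 f1 (f2 x).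
Hypothesis df2 : forall x : R, x \in `]0, T[ -> is_derive x 1 f2 (f3 x).
Hypothesis f1A : forall x : R, x \in `]0, T[ -> `|f1 x| <= A * x `^ (al - 1).
Hypothesis f3A : forall x : R, x \in `]0, T[ -> `|f3 x| <= A * x `^ (al - 3).
Hypotheses (m3 : (3 <= m)%N) (mM : (m <= M)%N) (tmT : t m <= T).
Hypothesis ikf : leb.-integrable `]0, t m[ (EFin \o (fun s => (t m - s) `^ (- al) * f1 s)).

Let al01 : 0 < al < 1. Proof. by rewrite al0. Qed.
Let C0 : 0 <= C. Proof. exact: le_trans C1. Qed.
Let inc j : (j < m)%N -> t j < t j.+1.
Proof. by case: rm => _ inc _ _ _ jm; apply: inc; exact: leq_trans mM. Qed.
Let tpos j : (1 <= j <= m)%N -> 0 < t j.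
Proof. by move=> /andP[j1 jm]; apply: (mesh_pos rm); rewrite j1 (leq_trans jm). Qed.
Let t0 : t 0%N = 0. Proof. by case: rm. Qed.
Let tge0 j : (j <= m)%N -> 0 <= t j.
Proof. by case: j => [|j] jm; [rewrite t0|exact/ltW/tpos]. Qed.
Let tle i : (i <= m)%N -> t i <= t m. Proof. by move=> im; exact: (increasing_le inc). Qed.
Let tT i : (i <= m)%N -> t i <= T. Proof. by move=> im; exact: le_trans (tle im) tmT. Qed.

Let U j := f (t j).
Definition piece_slope i (s : R) : R :=
  slope t (fun j => f (t j)) i +
  row_curvature t (fun j => f (t j)) m i * (2 * s - t i - t i.+1).
Definition piece_error i : R :=
  \int[leb]_(s in `]t i, t i.+1[) ((t m - s) `^ (- al) * (f1 s - piece_slope i s)).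

Let itvT i s : (i < m)%N -> s \in `]t i, t i.+1[ -> s \in `]0, T[.
Proof.
move=> im; rewrite !in_itv/= => /andP[s0 s1].
by rewrite (le_lt_trans (tge0 (ltnW im)) s0) (lt_le_trans s1 (tT im)).
Qed.

Let ik_f i : (i < m)%N -> leb.-integrable `]t i, t i.+1[
  (EFin \o (fun s => (t m - s) `^ (- al) * f1 s)).
Proof.
move=> im; apply: integrableS ikf => // s /=; rewrite !in_itv/= => /andP[s0 s1].
by rewrite (le_lt_trans (tge0 (ltnW im)) s0) (lt_le_trans s1 (tle im)).
Qed.

Let ik_g i : (i < m)%N -> leb.-integrable `]t i, t i.+1[
  (EFin \o (fun s => (t m - s) `^ (- al) * piece_slope i s)).
Proof.
by move=> im; apply: ker_integrable => //; [exact: inc|exact: tle|exact: continuous_affine].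
Qed.

Let ik_fg i : (i < m)%N -> leb.-integrable `]t i, t i.+1[
  (EFin \o (fun s => (t m - s) `^ (- al) * (f1 s - piece_slope i s))).
Proof.
move=> im; rewrite (_ : (fun s => _) = (fun s => (t m - s) `^ (- al) * f1 s
    - (t m - s) `^ (- al) * piece_slope i s)); last by apply/funext => s; rewrite mulrBr.
by apply: integrable_sub; [exact: measurable_itv|exact: ik_f|exact: ik_g].
Qed.

Lemma truncation_pieces :
  \int[leb]_(s in `]0, t m[) ((t m - s) `^ (- al) * f1 s) -
  \sum_(i < m) row_coef al t m i * (f (t i.+1) - f (t i)) = \sum_(i < m) piece_error i.
Proof.
have m0 : (0 < m)%N by apply: leq_trans m3.
have := @row_sum_coef R al t U m m0 inc; rewrite /U => <-.
have [_] : leb.-integrable `]t 0%N, t m.-1.+1[ (EFin \o (fun s => (t m - s) `^ (- al) * f1 s)) /\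
  \int[leb]_(s in `]t 0%N, t m.-1.+1[) ((t m - s) `^ (- al) * f1 s) =
  \sum_(i < m.-1.+1) \int[leb]_(s in `]t i, t i.+1[) ((t m - s) `^ (- al) * f1 s).
  apply: Rintegral_partition => i; rewrite -ltnS prednK// => im; first exact: inc.
  exact: ik_f.
rewrite prednK// t0 => ->; rewrite -sumrB; apply: eq_bigr => i _.
rewrite -(@ker_int_slope R al t _ m i al01 (ltn_ord i) inc)//.
have -> : piece_error i = \int[leb]_(s in `]t i, t i.+1[)
    ((t m - s) `^ (- al) * f1 s - (t m - s) `^ (- al) * piece_slope i s).
  by apply: eq_Rintegral => s _; rewrite mulrBr.
by rewrite RintegralB//; [exact: ik_f|exact: ik_g].
Qed.

Let cont_path i : (i < m)%N -> f @ (t i)^'+ --> f (t i) /\ f @ (t i.+1)^'- --> f (t i.+1).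
Proof.
move=> im.
have := within_cont_path f_at0 f_atT df (tge0 (ltnW im)) (inc im) (tT im).
by move=> /(continuous_within_itvP _ (inc im))[_ ? ?].
Qed.

(** The interpolant agrees with f at both ends of the interval, so the error of the derivative has
    mean zero. The majorant g with antiderivative G provides integrability, also on the first
    interval. *)
Let mean_zero i (G g : R -> R) : (i < m)%N ->
  (forall x : R, x \in `]t i, t i.+1[ -> is_derive x 1 G (g x)) ->
  {in `]t i, t i.+1[, continuous g} ->
  {in `]t i, t i.+1[, forall x, `|f1 x - piece_slope i x| <= g x} ->
  G @ (t i)^'+ --> G (t i) -> G @ (t i.+1)^'- --> G (t i.+1) ->
  leb.-integrable `]t i, t i.+1[ (EFin \o (fun s => f1 s - piece_slope i s)) /\
  \int[leb]_(s in `]t i, t i.+1[) (f1 s - piece_slope i s) = 0.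
Proof.
move=> im dG cg fg Gl Gr; have ii := inc im.
set c := row_curvature t (fun j => f (t j)) m i.
have cn (x : R) : {for x, continuous (newton t (fun j => f (t j)) i c)}.
  apply: differentiable_continuous.
  by apply/derivable1_diffP; apply: ex_derive; exact: is_derive_newton.
have [fr fl] := cont_path im.
pose F s := f s - newton t (fun j => f (t j)) i c s.
have d (x : R) : x \in `]t i, t i.+1[ -> is_derive x 1 F (f1 x - piece_slope i x).
  move=> xI; apply: is_deriveB; first by apply: df; exact: itvT xI.
  exact: is_derive_newton.
have cd : {in `]t i, t i.+1[, continuous (fun s => f1 s - piece_slope i s)}.
  move=> x xI; apply: cvgB; last exact: continuous_affine.
  apply: differentiable_continuous; apply/derivable1_diffP.
  by apply: ex_derive; apply: df1; exact: itvT xI.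
have Fl : F @ (t i)^'+ --> F (t i).
  by apply: cvgB => //; apply: cvg_at_right_filter; exact: cn.
have Fr : F @ (t i.+1)^'- --> F (t i.+1).
  by apply: cvgB => //; apply: cvg_at_left_filter; exact: cn.
have [h1 ->] := dominated_improper_FTC ii d cd dG cg fg Fl Fr Gl Gr.
rewrite /F; split=> //; rewrite /newton /slope; field.
by rewrite subr_eq0 gt_eqF.
Qed.

Let const_primitive (E a b : R) : a < b ->
  [/\ forall x : R, x \in `]a, b[ -> is_derive x 1 (fun s => E * s) E,
      {in `]a, b[, continuous (fun _ : R => E)},
      (fun s => E * s) @ a^'+ --> E * a & (fun s => E * s) @ b^'- --> E * b].
Proof.
move=> ab.
have c (x : R) : {for x, continuous (fun s => E * s)}.
  by apply: cvgM; [exact: cvg_cst|exact: cvg_id].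
split.
- by move=> x _; rewrite -[X in is_derive _ _ _ X]mulr1; exact: is_deriveZ.
- by move=> x _; exact: cvg_cst.
- by apply: cvg_at_right_filter; exact: c.
- by apply: cvg_at_left_filter; exact: c.
Qed.

Let const_integral (E a b : R) : a < b ->
  leb.-integrable `]a, b[ (EFin \o (fun=> E)) /\
  \int[leb]_(s in `]a, b[) E = E * (b - a).
Proof.
move=> ab; have [d _ _ _] := const_primitive `|E| ab.
have := @Rintegral_FTC R (fun s => E * s) (fun=> E) a b ab.
case=> [x|x|i1 ->]; last by split=> //; ring.
- by rewrite -[X in is_derive _ _ _ X]mulr1; exact: is_deriveZ.
- exact: cvg_cst.
Qed.

Let kern_range i : (i.+1 < m)%N -> {in `]t i, t i.+1[, forall s,
  kern al (t m) (t i) <= (t m - s) `^ (- al) <= kern al (t m) (t i.+1)}.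
Proof.
move=> im s; rewrite in_itv/= => /andP[s0 s1].
have h : t i.+1 < t m by apply: lt_le_trans (tle im); exact: inc.
by apply/andP; split; apply: ker_mono; rewrite ?ltW// (lt_trans s1 h).
Qed.

Lemma piece_error_inner i E : (i.+1 < m)%N ->
  {in `]t i, t i.+1[, forall x, `|f1 x - piece_slope i x| <= E} ->
  `|piece_error i| <= (kern al (t m) (t i.+1) - kern al (t m) (t i)) * (E * (t i.+1 - t i)).
Proof.
move=> im hE; have im' := ltnW im; have ii := inc im'.
have [dG cg Gl Gr] := const_primitive E ii.
have [i1 i0] := mean_zero im' dG cg hE Gl Gr.
have [iE <-] := const_integral E ii.
apply: kernel_gap_bound => //; [exact: ik_fg|exact: kern_range].
Qed.

(** On the last interval the kernel is unbounded and its oscillation is infinite; the full kernel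
    moment is paid instead. *)
Lemma piece_error_last i E : (i < m)%N ->
  {in `]t i, t i.+1[, forall x, `|f1 x - piece_slope i x| <= E} ->
  `|piece_error i| <= E * row_p al t m i.
Proof.
move=> im hE; have ii := inc im.
have c1 : continuous (fun _ : R => (1 : R)) by move=> x; exact: cvg_cst.
rewrite /row_p -ker_intZ//; last exact: tle.
apply: le_trans (le_normr_Rintegral _ (ik_fg im)) _ => //.
apply: le_Rintegral => //.
- by apply: integrable_norm; exact: ik_fg.
- by apply: ker_integrable => //; [exact: tle|move=> x; exact: cvg_cst].
- move=> s sI; rewrite normrM ger0_norm ?powR_ge0// mulr1.
  by apply: ler_wpM2l; [exact: powR_ge0|exact: hE].
Qed.

(** The bound on the third derivative is singular at 0, so only the first derivative is used: the
    integral of A s^(alpha-1) contributes 1/alpha, and the slopes of the interpolant contribute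
    2/alpha + 1. *)
Lemma piece_error_first :
  `|piece_error 0| <= (kern al (t m) (t 1%N) - kern al (t m) (t 0%N)) *
    ((3 / al + 1) * A * t 1%N `^ al).
Proof.
have m1 : (0 < m)%N by apply: leq_trans m3.
have m2 : (1 < m)%N by apply: leq_trans m3.
set tau := t 1%N; have tau0 : 0 < tau by apply: tpos; rewrite m1.
have t12 := inc m2.
pose u := tau `^ (al - 1).
have u0 : 0 <= u by exact: powR_ge0.
have utau : u * tau = tau `^ al.
  by rewrite /u -{2}(powRr1 (ltW tau0)) -powRD_pos// subrK.
set S0 := slope t (fun j => f (t j)) 0; set S1 := slope t (fun j => f (t j)) 1.
have hS0 : `|S0| <= A / al * u.
  rewrite /S0 /slope t0 subr0 -/tau normrM normfV (ger0_norm (ltW tau0)) ler_pdivrMr//.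
  have -> : A / al * u * tau = A / al * tau `^ al by rewrite -utau; ring.
  by apply: (path_increment0 al0 f_at0 f_atT df df1 f1A) => //; exact: tT.
have hS1 : `|S1| <= A * u.
  have d0 : 0 < t 2%N - t 1%N by rewrite subr_gt0.
  rewrite /S1 /slope normrM normfV (gtr0_norm d0) ler_pdivrMr//.
  by apply: (path_increment al1 A0 f_at0 f_atT df f1A) => //; exact: tT.
(* Bounds |S0| + (|S1| + |S0|), with |S0| <= A u / alpha and |S1| <= A u. *)
pose G0 := (2 / al + 1) * A * u.
pose g s := A * s `^ (al - 1) + G0.
pose G s := A * (s `^ al / al) + G0 * s.
have [|h1 h2 h3 h4 h5] := @powR_primitive_props R (al - 1) 0 tau _ (lexx _) tau0.
  by move: (al0) => ?; lra.
rewrite subrK in h1 h4 h5.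
have [dE _ El Er] := const_primitive G0 tau0.
have dG (y : R) : y \in `]t 0%N, tau[ -> is_derive y 1 G (g y).
  by rewrite t0 => yI; apply: is_deriveD; [apply: is_deriveZ; exact: h1|exact: dE].
have cg : {in `]t 0%N, tau[, continuous g}.
  rewrite t0 => y yI; apply: cvgD; last exact: cvg_cst.
  by apply: cvgM; [exact: cvg_cst|exact: h2].
have fg : {in `]t 0%N, tau[, forall x, `|f1 x - piece_slope 0 x| <= g x}.
  move=> s sI; apply: le_trans (ler_normB _ _) _; apply: lerD.
    by apply: f1A; exact: itvT sI.
  rewrite /piece_slope row_curvature_inner//.
  apply: (@le_trans _ _ (`|S0| + (`|S1| + `|S0|))).
    apply: le_trans (ler_normD _ _) _; rewrite lerD2l.
    rewrite /curvature -/S0 -/S1.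
    have H0 : 0 < t 2%N - t 0%N by rewrite t0 subr0; apply: tpos.
    rewrite normrM normrM normfV (gtr0_norm H0) mulrAC ler_pdivrMr//.
    apply: ler_pM => //; first exact: ler_normB.
    move: sI; rewrite in_itv/= t0 -/tau => /andP[s0 s1].
    by rewrite ler_norml; apply/andP; split; move: t12 tau0; rewrite -/tau; lra.
  move: hS0 hS1; rewrite /G0; set x := `|S0|; set y := `|S1| => hx hy.
  have -> : (2 / al + 1) * A * u = 2 * (A / al * u) + A * u by ring.
  lra.
have Gl : G @ (t 0%N)^'+ --> G (t 0%N).
  by rewrite t0; apply: cvgD => //; apply: cvgM; [exact: cvg_cst|exact: h4].
have Gr : G @ tau^'- --> G tau.
  by apply: cvgD => //; apply: cvgM; [exact: cvg_cst|exact: h5].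
have [i1 i0] := mean_zero m1 dG cg fg Gl Gr.
have al1' : -1 < al - 1 by move: (al0) => ?; lra.
have ip := @powR_integrable R (al - 1) 0 tau al1' (lexx _) tau0.
have [iG IG] := const_integral G0 tau0.
have ig1 : leb.-integrable `]0, tau[ (EFin \o (fun s => A * s `^ (al - 1))).
  exact: integrable_scale.
have ig : leb.-integrable `]t 0%N, tau[ (EFin \o g).
  rewrite t0 (_ : EFin \o g = (EFin \o (fun s => (A * s `^ (al - 1))%R)) \+ (EFin \o (fun=> G0)))%E.
    exact: integrableD.
  exact/funext.
have := @kernel_gap_bound R (fun s => (t m - s) `^ (- al)) _ g (t 0%N) tau
  (kern al (t m) (t 0%N)) (kern al (t m) tau) i1 (ik_fg m1) ig i0 (kern_range m2) fg.
rewrite /piece_error -/tau.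
suff -> : \int[leb]_(s in `]t 0%N, tau[) g s = (3 / al + 1) * A * tau `^ al by [].
rewrite t0 RintegralD// IG RintegralZl// Rintegral_powR// subrK powR0; last by rewrite gt_eqF.
have -> : G0 * (tau - 0) = (2 / al + 1) * A * tau `^ al by rewrite subr0 -utau /G0; ring.
rewrite subr0; field.
by rewrite gt_eqF.
Qed.

End pieces.

(** * Summing the truncation errors of a row *)

Section truncation_sum.
Context {R : realType}.
Notation leb := (@lebesgue_measure R).
Variables (al C r dl : R) (M : nat) (t : nat -> R).
Hypotheses (al0 : 0 < al) (al1 : al < 1) (C1 : 1 <= C) (r1 : 1 <= r).
Hypotheses (dla : dl <= al / 4) (nu3 : r + dl <= 3 - al).
Hypothesis rm : regular_mesh C r M t.
Variable m : nat.
Hypotheses (m3 : (3 <= m)%N) (mM : (m <= M)%N).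

Let C0 : 0 <= C. Proof. exact: le_trans C1. Qed.
Let inc j : (j < m)%N -> t j < t j.+1.
Proof. by case: rm => _ inc _ _ _ jm; apply: inc; exact: leq_trans mM. Qed.
Let tpos j : (1 <= j <= m)%N -> 0 < t j.
Proof. by move=> /andP[j1 jm]; apply: (mesh_pos rm); rewrite j1 (leq_trans jm). Qed.
Let m0 : (0 < m)%N. Proof. exact: leq_trans m3. Qed.
Let mp : 0 < m%:R :> R. Proof. by rewrite ltr0n. Qed.
Let tm0 : 0 < t m. Proof. by apply: tpos; rewrite m0 leqnn. Qed.
Let rho := C ^+ 2 * 2 `^ r.
Let rho1 : 1 <= rho.
Proof.
have h2 : 1 <= 2 `^ r :> R.
  have r0 : 0 <= r by exact: le_trans r1.
  have l12 : (1 : R) <= 2 by lra.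
  by have := powR_mono r0 ler01 l12; rewrite powR1.
rewrite -[leLHS](mulr1 1); apply: ler_pM => //.
by rewrite -[leLHS](expr1n _ 2) lerXn2r// nnegrE.
Qed.

Lemma negative_power_ratio (a b q : R) : 0 < a -> 0 < b -> 1 <= q -> b <= q * a ->
  a `^ (al - 3) <= q ^+ 3 * b `^ (al - 3).
Proof.
move=> a0 b0 q1 bqa; move: (al0) (al1) => ? ?.
have q0 : 0 < q by lra.
apply: (@le_trans _ _ ((b / q) `^ (al - 3))).
  apply: powR_antimono; [lra|exact: divr_gt0|].
  by rewrite ler_pdivrMr// mulrC.
rewrite powRM ?invr_ge0 ?(ltW b0) ?(ltW q0)// mulrC.
apply: ler_wpM2r; first exact: powR_ge0.
rewrite -powR_inv1 ?(ltW q0)// -powRrM mulN1r -powR_mulrn ?(ltW q0)//.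
by apply: ler_powR => //; lra.
Qed.

Lemma inner_remainder_size i : (1 <= i)%N -> (i.+1 < m)%N ->
  t i `^ (al - 3) * (t i.+2 - t i) ^+ 2 * (t i.+1 - t i) <=
  4 * C ^+ 3 * rho ^+ 5 * (t i.+1 `^ al * (i.+1%:R^-1) ^+ 3).
Proof.
move=> i1 im; have im' := ltnW im.
have iM : (i.+1 < M)%N by exact: leq_trans mM.
set a := t i; set b := t i.+1; set n : R := i.+1%:R.
have a0 : 0 < a by apply: tpos; rewrite i1 ltnW.
have b0 : 0 < b by apply: tpos; rewrite im'.
have n0 : 0 < n by rewrite ltr0n.
have ba : b <= rho * a by exact: (node_growth C1 r1 rm i1 (ltnW iM)).
have cb : t i.+2 <= rho * b by exact: (node_growth C1 r1 rm (ltn0Sn i) iM).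
have h1 : b - a <= C * (b / n) by exact: (step_le rm (ltnW iM)).
have h2 : t i.+2 - a <= 2 * (C * rho * (b / n)).
  have hs := step_le rm iM.
  have hm : b - a <= t i.+2 - b by apply: (mesh_step_ge rm) => //.
  have hc : C * (t i.+2 / i.+2%:R) <= C * rho * (b / n).
    rewrite -mulrA; apply: ler_wpM2l => //; rewrite mulrA.
    apply: ler_pM => //.
    - by rewrite ltW//; apply: tpos.
    - by rewrite lef_pV2 ?posrE ?ltr0n// ler_nat.
  have -> : t i.+2 - a = (t i.+2 - b) + (b - a) by ring.
  have -> : 2 * (C * rho * (b / n)) = (C * rho * (b / n)) + (C * rho * (b / n)) by ring.
  move: (le_trans hs hc) => h; apply: lerD => //; exact: le_trans h.
have h20 : 0 <= t i.+2 - a by rewrite subr_ge0 ltW// (lt_trans (inc im') (inc im)).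
have h10 : 0 <= b - a by rewrite subr_ge0 ltW ?inc.
have h3 := negative_power_ratio a0 b0 rho1 ba.
have e0 : 0 <= a `^ (al - 3) by exact: powR_ge0.
have h22 : (t i.+2 - a) ^+ 2 <= (2 * (C * rho * (b / n))) ^+ 2.
  by rewrite lerXn2r// nnegrE//; exact: le_trans h2.
have := ler_pM (mulr_ge0 e0 (sqr_ge0 _)) h10 (ler_pM e0 (sqr_ge0 _) h3 h22) h1.
move=> h; apply: (le_trans h); rewrite le_eqVlt; apply/orP; left; apply/eqP.
have -> : b `^ al = b `^ (al - 3) * b ^+ 3.
  by rewrite -[b ^+ 3]powR_mulrn ?(ltW b0)// -powRD_pos// subrK.
by field; exact: lt0r_neq0.
Qed.

Lemma last_remainder_size i : i.+2 = m -> (1 <= i)%N ->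
  t i `^ (al - 3) * (t i.+2 - t i) ^+ 2 * row_p al t m i.+1 <=
  4 * C ^+ 3 * rho ^+ 6 / (1 - al) * m%:R `^ (al - 3).
Proof.
move=> im i1; move: (al0) (al1) => ha0 ha1.
have iM : (i.+1 < M)%N by move: (mM); rewrite -im.
have imm : (i.+1 < m)%N by rewrite -im.
have a0 : 0 < t i by apply: tpos; rewrite i1 ltnW// ltnW.
have ba : t i.+1 <= rho * t i by exact: (node_growth C1 r1 rm i1 (ltnW iM)).
have cb : t i.+2 <= rho * t i.+1 by exact: (node_growth C1 r1 rm (ltn0Sn i) iM).
have r0 : 0 <= rho by exact: le_trans rho1.
have ca : t m <= rho ^+ 2 * t i.
  by rewrite -im; apply: (le_trans cb); rewrite expr2 -mulrA; exact: ler_wpM2l.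
have r2 : 1 <= rho ^+ 2 by rewrite -[leLHS](expr1n _ 2) lerXn2r// nnegrE.
have h3 := negative_power_ratio a0 tm0 r2 ca.
have hs := step_le rm iM; rewrite im in hs.
have hm : t i.+1 - t i <= t m - t i.+1.
  by rewrite -[in t m]im; apply: (mesh_step_ge rm).
set h := t m - t i.+1 in hs hm *.
have hp : 0 < h by rewrite subr_gt0 -im inc.
rewrite im; have -> : t m - t i = h + (t i.+1 - t i) by rewrite /h; ring.
have h10 : 0 <= t i.+1 - t i by rewrite subr_ge0; apply: (increasing_le inc) => //; exact: ltnW.
have h2 : h + (t i.+1 - t i) <= 2 * (C * (t m / m%:R)) by lra.
have h20 : 0 <= h + (t i.+1 - t i) by lra.
have h22 : (h + (t i.+1 - t i)) ^+ 2 <= (2 * (C * (t m / m%:R))) ^+ 2.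
  by rewrite lerXn2r// nnegrE//; exact: le_trans h2.
have pE : row_p al t m i.+1 = h `^ (1 - al) / (1 - al).
  rewrite /row_p im ker1_last// -/h; last by rewrite -subr_gt0.
  by rewrite /kern -/h powRD_pos// powRr1 ?(ltW hp).
have hpw : h `^ (1 - al) <= C * (t m `^ (1 - al) * m%:R `^ (al - 1)).
  apply: (@le_trans _ _ ((C * (t m / m%:R)) `^ (1 - al))).
    by apply: powR_mono; rewrite ?(ltW hp)//; lra.
  rewrite powRM//; last by rewrite divr_ge0// ltW.
  apply: ler_pM; rewrite ?powR_ge0//.
    by rewrite -[leRHS]powRr1//; apply: ler_powR => //; lra.
  rewrite powRM ?invr_ge0 ?(ltW tm0)//; apply: ler_wpM2l; first exact: powR_ge0.
  rewrite -(powR_inv1 (ltW mp)) -powRrM le_eqVlt; apply/orP; left; apply/eqP.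
  by congr (_ `^ _); ring.
have e0 : 0 <= t i `^ (al - 3) by exact: powR_ge0.
have a10 : 0 < 1 - al by lra.
have pw0 : 0 <= row_p al t m i.+1 by rewrite pE divr_ge0 ?powR_ge0// ltW.
have ple : row_p al t m i.+1 <= C * (t m `^ (1 - al) * m%:R `^ (al - 1)) / (1 - al).
  by rewrite pE ler_pM2r ?invr_gt0.
have := ler_pM (mulr_ge0 e0 (sqr_ge0 _)) pw0 (ler_pM e0 (sqr_ge0 _) h3 h22) ple.
move=> H; apply: (le_trans H); rewrite le_eqVlt; apply/orP; left; apply/eqP.
have E1 : t m `^ (al - 3) * t m ^+ 2 * t m `^ (1 - al) = 1.
  rewrite -[t m ^+ 2]powR_mulrn ?(ltW tm0)// -!powRD_pos//.
  by rewrite (_ : _ + _ + _ = 0) ?powRr0//; ring.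
have E2 : m%:R `^ (al - 3) = (m%:R^-1) ^+ 2 * m%:R `^ (al - 1) :> R.
  rewrite exprVn -powR_mulrn ?(ltW mp)// -powRN -powRD_pos//; congr (_ `^ _); ring.
rewrite E2 -[RHS]mulr1 -[X in _ = _ * X]E1; field.
by rewrite !lt0r_neq0.
Qed.

Let gam_nu : r + dl <= r * (1 + al).
Proof.
have : 1 * al <= r * al by rewrite ler_pM2r.
move: (al0) (dla) => ? ?; lra.
Qed.

(** The ratio t_j/t_m is at most a multiple of (j/m)^r. As j/m <= 1, the exponent r(1+alpha) may be
    lowered to r + dl, because dl <= alpha <= r alpha. *)
Lemma node_ratio_power j : (1 <= j <= m)%N ->
  (t j / t m) `^ (1 + al) <= C ^+ 4 * (j%:R `^ (r + dl) * m%:R `^ (- (r + dl))).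
Proof.
move=> /andP[j1 jm]; move: (al0) (al1) => ha0 ha1.
have jp : 0 < j%:R :> R by rewrite ltr0n.
have x0 : 0 < j%:R / m%:R :> R by exact: divr_gt0.
have x1 : j%:R / m%:R <= 1 :> R by rewrite ler_pdivrMr// mul1r ler_nat.
have tj0 : 0 < t j by apply: tpos; rewrite j1.
have h := node_power_ratio C1 rm j1 jm mM.
have y0 : 0 <= t j / t m by rewrite divr_ge0 ?ltW.
apply: (@le_trans _ _ ((C ^+ 2 * (j%:R / m%:R) `^ r) `^ (1 + al))).
  by apply: powR_mono => //; lra.
rewrite powRM ?exprn_ge0 ?powR_ge0//; apply: ler_pM; rewrite ?powR_ge0//.
  have -> : C ^+ 4 = (C ^+ 2) `^ 2 by rewrite powR_mulrn ?exprn_ge0// -exprM.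
  apply: ler_powR; last lra.
  by rewrite -[leLHS](expr1n _ 2) lerXn2r// nnegrE.
rewrite -powRrM.
have -> : j%:R `^ (r + dl) * m%:R `^ (- (r + dl)) = (j%:R / m%:R) `^ (r + dl) :> R.
  by rewrite powRM ?invr_ge0 ?(ltW jp) ?(ltW mp)// -(powR_inv1 (ltW mp)) -powRrM mulN1r.
have g0 : 0 <= r * (1 + al) - (r + dl) by rewrite subr_ge0.
have -> : (j%:R / m%:R) `^ (r * (1 + al)) =
    (j%:R / m%:R) `^ (r + dl) * (j%:R / m%:R) `^ (r * (1 + al) - (r + dl)) :> R.
  by rewrite -powRD_pos// subrKC.
rewrite ler_piMr ?powR_ge0//.
by have := powR_mono g0 (ltW x0) x1; rewrite powR1.
Qed.

Local Notation D i := (kern al (t m) (t i.+1) - kern al (t m) (t i)).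

Let D_ge0 i : (i.+1 < m)%N -> 0 <= D i.
Proof.
move=> im; rewrite subr_ge0; apply: ker_mono => //.
- by rewrite ltW// inc// ltnW.
- by apply: lt_le_trans (inc im) _; apply: (increasing_le inc).
Qed.

(** For 2(i+1) <= m the kernel increment is at most of order t_m^(-alpha-1) times the step, and
    [node_ratio_power] extracts m^(-(r+dl)), leaving (i+1)^(r+dl-4), at most the summable
    (i+1)^(-1-alpha). For later i the size factor is replaced by its order at i = m and the kernel
    increment is kept. *)
Lemma inner_remainder_split i : (1 <= i)%N -> (i.+1 < m)%N ->
  D i * (t i.+1 `^ al * (i.+1%:R^-1) ^+ 3) <=
  4 * C ^+ 5 * m%:R `^ (- (r + dl)) * i.+1%:R `^ (-1 - al) +
  8 * t m `^ al * (m%:R^-1) ^+ 3 * D i.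
Proof.
move=> i1 im; have im' := ltnW im; move: (al0) (al1) => ha0 ha1.
have d0 := D_ge0 im.
set b := t i.+1; set n : R := i.+1%:R.
have b0 : 0 < b by apply: tpos; rewrite im'.
have n1 : 1 <= n by rewrite ler1n.
have n0 : 0 < n by rewrite ltr0n.
have nv0 : 0 <= n^-1 by rewrite invr_ge0 ltW.
have [early|late] := leqP i.+1.*2 m.
- apply: ler_wpDr.
    by rewrite mulr_ge0// mulr_ge0 ?mulr_ge0 ?powR_ge0// exprn_ge0// invr_ge0 ltW.
  have h1 : b - t i <= C * (b / n) by apply: (step_le rm); exact: leq_trans mM.
  have h2 := kernel_increment_early al0 al1 rm early mM.
  have q0 : 0 <= 4 * t m `^ (- al - 1) by rewrite mulr_ge0 ?powR_ge0.
  have h3 : D i <= 4 * t m `^ (- al - 1) * (C * (b / n)).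
    by apply: (le_trans h2); exact: ler_wpM2l.
  have w0 : 0 <= b `^ al * n^-1 ^+ 3 by rewrite mulr_ge0 ?powR_ge0// exprn_ge0.
  apply: le_trans (ler_wpM2r w0 h3) _.
  have E1 : (b / t m) `^ (1 + al) = t m `^ (- al - 1) * (b `^ al * b).
    rewrite powRM ?invr_ge0 ?(ltW b0) ?(ltW tm0)// -(powR_inv1 (ltW tm0)) -powRrM mulrC.
    rewrite addrC powRD_pos// powRr1 ?(ltW b0)//; congr (_ `^ _ * _); ring.
  have jm : (1 <= i.+1 <= m)%N by rewrite im'.
  have := node_ratio_power jm; rewrite -/b -/n E1 => h4.
  have c0 : 0 <= 4 * C * n^-1 ^+ 4 by rewrite !mulr_ge0 ?exprn_ge0.
  have := ler_wpM2l c0 h4.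
  have -> : 4 * C * n^-1 ^+ 4 * (t m `^ (- al - 1) * (b `^ al * b)) =
     4 * t m `^ (- al - 1) * (C * (b / n)) * (b `^ al * n^-1 ^+ 3) by field; exact: lt0r_neq0.
  move=> h; apply: (le_trans h).
  have -> : 4 * C * n^-1 ^+ 4 * (C ^+ 4 * (n `^ (r + dl) * m%:R `^ (- (r + dl)))) =
     4 * C ^+ 5 * m%:R `^ (- (r + dl)) * (n^-1 ^+ 4 * n `^ (r + dl)) by ring.
  apply: ler_wpM2l; first by rewrite mulr_ge0 ?powR_ge0// mulr_ge0 ?exprn_ge0.
  rewrite exprVn -powR_mulrn ?(ltW n0)// -powRN -powRD_pos//.
  by apply: ler_powR => //; move: (nu3) => ?; lra.
- apply: ler_wpDl.
    by rewrite mulr_ge0 ?mulr_ge0 ?powR_ge0// exprn_ge0.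
  rewrite mulrC; apply: ler_wpM2r => //.
  have -> : 8 * t m `^ al * m%:R^-1 ^+ 3 = t m `^ al * (2 * m%:R^-1) ^+ 3 by ring.
  apply: ler_pM; rewrite ?powR_ge0 ?exprn_ge0//.
    apply: powR_mono; rewrite ?(ltW ha0) ?(ltW b0)//.
    exact: (increasing_le inc).
  have mn : m%:R <= 2 * n by rewrite -natrM ler_nat mul2n ltnW.
  rewrite lerXn2r// ?nnegrE ?mulr_ge0 ?invr_ge0 ?(ltW mp)//.
  by rewrite ler_pdivlMr// mulrC ler_pdivrMr.
Qed.

(** The early part is a convergent power sum. In the late part the kernel increments telescope to at
    most (t_m/m)^(-alpha), as the last step is at least t_m/m; this gives m^(alpha-3), and alpha - 3
    <= -(r+dl). *)
Lemma inner_remainder_sum :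
  \sum_(1 <= i < m.-1) D i * (t i.+1 `^ al * (i.+1%:R^-1) ^+ 3) <=
  (4 * C ^+ 5 * (1 + al^-1) + 8) * m%:R `^ (- (r + dl)).
Proof.
move: (al0) (al1) => ha0 ha1.
have m1 : (1 <= m.-1)%N by rewrite -ltnS prednK// ltnW.
apply: (@le_trans _ _ (\sum_(1 <= i < m.-1)
   (4 * C ^+ 5 * m%:R `^ (- (r + dl)) * i.+1%:R `^ (-1 - al) +
    8 * t m `^ al * (m%:R^-1) ^+ 3 * D i))).
  rewrite big_seq [leRHS]big_seq; apply: ler_sum => i; rewrite mem_index_iota => /andP[i1 im].
  by apply: inner_remainder_split => //; rewrite -ltnS prednK in im.
rewrite big_split/= -!mulr_sumr telescope_sumr//.
rewrite [leRHS]mulrDl; apply: lerD.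
  rewrite mulrAC; apply: ler_wpM2r; first exact: powR_ge0.
  apply: ler_wpM2l; first by rewrite mulr_ge0 ?exprn_ge0.
  apply: (le_trans _ (@sum_powR_le R al m.-2 ha0)).
  rewrite (ltn_predK m1) big_seq [leRHS]big_seq; apply: ler_sum => i.
  rewrite mem_index_iota => /andP[i1 _].
  apply: powR_antimono; [lra|by rewrite ltr0n|by rewrite ler_nat].
have hl : t m / m%:R <= t m - t m.-1 by apply: (last_step_ge rm); rewrite m0.
have hh : 0 < t m / m%:R by exact: divr_gt0.
have k1 : kern al (t m) (t m.-1) - kern al (t m) (t 1%N) <= (t m / m%:R) `^ (- al).
  rewrite lerBlDr ler_wpDr ?powR_ge0//; apply: powR_antimono => //; lra.
have c0 : 0 <= 8 * t m `^ al * m%:R^-1 ^+ 3.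
  by rewrite !mulr_ge0 ?powR_ge0// exprn_ge0// invr_ge0 ltW.
apply: (le_trans (ler_wpM2l c0 k1)).
rewrite powRM ?invr_ge0 ?(ltW tm0) ?(ltW mp)// -(powR_inv1 (ltW mp)) -powRrM mulN1r opprK.
have E1 : t m `^ al * t m `^ (- al) = 1 by rewrite -powRD_pos// subrr powRr0.
have -> : 8 * t m `^ al * (m%:R `^ (-1)) ^+ 3 * (t m `^ (- al) * m%:R `^ al) =
  8 * (t m `^ al * t m `^ (- al)) * ((m%:R `^ (-1)) ^+ 3 * m%:R `^ al) by ring.
rewrite E1 mulr1; apply: ler_wpM2l => //.
rewrite powR_inv1 ?(ltW mp)// exprVn -powR_mulrn ?(ltW mp)// -powRN -powRD_pos//.
by apply: ler_powR; [rewrite ler1n|move: (nu3) => ?; lra].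
Qed.

End truncation_sum.

Theorem truncation_bound {R : realType} (al C r dl : R) : 0 < al -> al < 1 -> 1 <= C -> 1 <= r ->
  dl <= al / 4 -> r + dl <= 3 - al ->
  exists2 K : R, 0 <= K & forall (M m : nat) (t : nat -> R) (A T : R) (f f1 f2 f3 : R -> R),
  regular_mesh C r M t -> (3 <= m <= M)%N -> t m <= T -> 0 <= A ->
  f @ 0^'+ --> f 0 -> f @ T^'- --> f T ->
  (forall x : R, x \in `]0, T[ -> is_derive x 1 f (f1 x)) ->
  (forall x : R, x \in `]0, T[ -> is_derive x 1 f1 (f2 x)) ->
  (forall x : R, x \in `]0, T[ -> is_derive x 1 f2 (f3 x)) ->
  (forall x : R, x \in `]0, T[ -> `|f1 x| <= A * x `^ (al - 1)) ->
  (forall x : R, x \in `]0, T[ -> `|f3 x| <= A * x `^ (al - 3)) ->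
  (@lebesgue_measure R).-integrable `]0, t m[ (EFin \o (fun s => (t m - s) `^ (- al) * f1 s)) ->
  `|\int[lebesgue_measure]_(s in `]0, t m[) ((t m - s) `^ (- al) * f1 s) -
    \sum_(i < m) row_coef al t m i * (f (t i.+1) - f (t i))| <=
  K * A * m%:R `^ (- (r + dl)).
Proof.
move=> al0 al1 C1 r1 dla nu3.
have C0 : 0 <= C by exact: le_trans C1.
set rho := C ^+ 2 * 2 `^ r.
have rho0 : 0 <= rho by rewrite mulr_ge0 ?exprn_ge0 ?powR_ge0.
(* [K1], [K2] and [K3] belong to the first, the inner and the last intervals. *)
pose K1 := 4 * (3 / al + 1) * C ^+ 4.
pose K2 := 4 * C ^+ 3 * rho ^+ 5 * (4 * C ^+ 5 * (1 + al^-1) + 8).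
pose K3 := 4 * C ^+ 3 * rho ^+ 6 / (1 - al).
have a0 : 0 <= al^-1 by rewrite invr_ge0 ltW.
have K10 : 0 <= K1 by rewrite /K1 mulr_ge0 ?exprn_ge0// mulr_ge0// addr_ge0// mulr_ge0.
have K20 : 0 <= K2.
  rewrite /K2; apply: mulr_ge0; first by rewrite !mulr_ge0 ?exprn_ge0.
  by rewrite addr_ge0// !mulr_ge0 ?exprn_ge0// addr_ge0.
have K30 : 0 <= K3 by rewrite /K3 divr_ge0 ?mulr_ge0 ?exprn_ge0// subr_ge0 ltW.
exists (K1 + K2 + K3); first by rewrite !addr_ge0.
move=> M m t A T f f1 f2 f3 rm /andP[m3 mM] tmT A0 f_at0 f_atT df df1 df2 f1A f3A ikf.
rewrite (truncation_pieces al0 al1 rm f m3 mM ikf).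
case: m m3 mM tmT ikf => [|[|[|n]]]// m3 mM tmT ikf.
set m := n.+3 in m3 mM tmT ikf *.
have mp : 0 < m%:R :> R by rewrite ltr0n.
have inc j : (j < m)%N -> t j < t j.+1.
  by case: rm => _ inc _ _ _ jm; apply: inc; exact: leq_trans mM.
have tpos j : (1 <= j <= m)%N -> 0 < t j.
  by move=> /andP[j1 jm]; apply: (mesh_pos rm); rewrite j1 (leq_trans jm).
have t0 : t 0%N = 0 by case: rm.
have tT i : (i <= m)%N -> t i <= T.
  by move=> im; apply: le_trans tmT; exact: (increasing_le inc).
pose pe := piece_error al t f f1 m.
have quad i s : (1 <= i)%N -> (i.+2 <= m)%N -> s \in `]t i, t i.+2[ ->
    `|f1 s - (slope t (fun j => f (t j)) i +
      curvature t (fun j => f (t j)) i * (2 * s - t i - t i.+1))| <=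
    A * t i `^ (al - 3) * (t i.+2 - t i) ^+ 2.
  move=> i1 im.
  have ti : 0 < t i by apply: tpos; rewrite i1 ltnW// ltnW.
  have i01 := inc i (ltnW im); have i12 := inc i.+1 im.
  have sub x : x \in `]t i, t i.+2[ -> x \in `]0, T[.
    rewrite !in_itv/= => /andP[x0 x2].
    by rewrite (lt_trans ti x0) (lt_le_trans x2 (tT _ im)).
  have cf : {within `[t i, t i.+2], continuous f}.
    by apply: (within_cont_path f_at0 f_atT df (ltW ti)); [exact: lt_trans i12|exact: tT].
  have f3B x : x \in `]t i, t i.+2[ -> `|f3 x| <= A * t i `^ (al - 3).
    move=> xI; apply: le_trans (f3A _ (sub _ xI)) _; apply: ler_wpM2l => //.
    move: xI; rewrite in_itv/= => /andP[x0 _].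
    by apply: powR_antimono => //; [lra|exact: ltW].
  exact: (quadratic_interpolation_derive i01 i12 cf (fun x xI => df x (sub x xI))
    (fun x xI => df1 x (sub x xI)) (fun x xI => df2 x (sub x xI)) f3B).
have first : `|pe 0%N| <= K1 * A * m%:R `^ (- (r + dl)).
  apply: le_trans (piece_error_first al0 al1 rm A0 f_at0 f_atT df df1 f1A m3 mM tmT ikf) _.
  have ke := @kernel_increment_early R al M t C r al0 al1 rm m 0 _ mM.
  have {ke} := ke isT; rewrite t0 subr0 => ke.
  have t1 : 0 < t 1%N by apply: tpos.
  have w0 : 0 <= (3 / al + 1) * A * t 1%N `^ al.
    by rewrite !mulr_ge0 ?powR_ge0// addr_ge0// mulr_ge0.
  apply: (le_trans (ler_wpM2r w0 ke)).
  have tm0 : 0 < t m by apply: tpos; rewrite leqnn.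
  have E1 : (t 1%N / t m) `^ (1 + al) = t m `^ (- al - 1) * (t 1%N `^ al * t 1%N).
    rewrite powRM ?invr_ge0 ?(ltW t1) ?(ltW tm0)// -(powR_inv1 (ltW tm0)) -powRrM mulrC.
    rewrite addrC powRD_pos// powRr1 ?(ltW t1)//; congr (_ `^ _ * _); ring.
  have := node_ratio_power al0 al1 C1 r1 dla rm m3 mM (isT : (1 <= 1 <= m)%N).
  rewrite E1 powR1 mul1r => h4.
  have c0 : 0 <= 4 * (3 / al + 1) * A by rewrite !mulr_ge0// addr_ge0// mulr_ge0.
  have := ler_wpM2l c0 h4; rewrite /K1.
  set x := m%:R `^ _; set y := t m `^ _; set z := t 1%N `^ _; lra.
have inner i : (1 <= i < m.-1)%N -> `|pe i| <=
    4 * C ^+ 3 * rho ^+ 5 * A * ((kern al (t m) (t i.+1) - kern al (t m) (t i)) *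
      (t i.+1 `^ al * (i.+1%:R^-1) ^+ 3)).
  move=> /andP[i1 im].
  have im' : (i.+1 < m)%N by [].
  have i12 : t i.+1 < t i.+2 by exact: inc.
  have hE : {in `]t i, t i.+1[, forall x, `|f1 x - piece_slope t f m i x| <=
      A * t i `^ (al - 3) * (t i.+2 - t i) ^+ 2}.
    move=> s; rewrite in_itv/= => /andP[s0 s1].
    rewrite /piece_slope row_curvature_inner//; apply: quad => //.
    by rewrite in_itv/= s0 (lt_trans s1).
  apply: le_trans (piece_error_inner al0 al1 rm f_at0 f_atT df df1 mM tmT ikf im' hE) _.
  have d0 : 0 <= kern al (t m) (t i.+1) - kern al (t m) (t i).
    rewrite subr_ge0; apply: ker_mono => //; first by rewrite ltW// inc// ltnW.
    by apply: lt_le_trans i12 _; exact: (increasing_le inc).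
  have := ler_wpM2l (mulr_ge0 A0 d0) (inner_remainder_size al0 al1 C1 r1 rm mM i1 im').
  by move=> h; apply: le_trans (le_trans _ h) _; rewrite le_eqVlt; apply/orP; left;
    apply/eqP; rewrite /rho; ring.
have last_ : `|pe n.+2| <= K3 * A * m%:R `^ (- (r + dl)).
  have i01 : t n.+1 < t n.+2 by exact: inc.
  have i12 : t n.+2 < t n.+3 by exact: inc.
  have hE : {in `]t n.+2, t n.+3[, forall x, `|f1 x - piece_slope t f m n.+2 x| <=
      A * t n.+1 `^ (al - 3) * (t n.+3 - t n.+1) ^+ 2}.
    move=> s; rewrite in_itv/= => /andP[s0 s1].
    have sI : s \in `]t n.+1, t n.+3[ by rewrite in_itv/= s1 (lt_trans i01).
    have := quad n.+1 s isT (leqnn _) sI.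
    rewrite /piece_slope row_curvature_last//=.
    set e := curvature _ _ _; set S := slope _ _ _; set S' := slope _ _ _.
    suff -> : S' + e * (2 * s - t n.+2 - t n.+3) = S + e * (2 * s - t n.+1 - t n.+2) by [].
    (* The last interval uses the parabola of the preceding stencil; changing the Newton base does
       not alter its derivative. *)
    have -> : S' = S + e * (t n.+3 - t n.+1).
      by rewrite /e /curvature -/S -/S'; field; rewrite subr_eq0 gt_eqF// (lt_trans i01).
    ring.
  apply: le_trans (piece_error_last al0 al1 rm mM ikf (ltnSn _) hE) _.
  have := ler_wpM2l A0 (last_remainder_size al0 al1 C1 r1 rm m3 mM (erefl m : n.+1.+2 = m) isT).
  rewrite -/rho -/K3 => h.
  apply: (@le_trans _ _ (A * (K3 * m%:R `^ (al - 3)))); first by move: h; rewrite -!mulrA.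
  rewrite mulrA [A * K3]mulrC; apply: ler_wpM2l; first exact: mulr_ge0.
  by apply: ler_powR; [rewrite ler1n|lra].
rewrite -(big_mkord predT pe) big_ltn// big_nat_recr//=.
have mid : `|\sum_(1 <= i < n.+2) pe i| <= K2 * A * m%:R `^ (- (r + dl)).
  apply: le_trans (ler_norm_sum _ _ _) _.
  apply: (@le_trans _ _ (\sum_(1 <= i < m.-1) 4 * C ^+ 3 * rho ^+ 5 * A *
      ((kern al (t m) (t i.+1) - kern al (t m) (t i)) *
      (t i.+1 `^ al * (i.+1%:R^-1) ^+ 3)))).
    by rewrite big_seq [leRHS]big_seq; apply: ler_sum => i; rewrite mem_index_iota; exact: inner.
  rewrite -mulr_sumr.
  have c0 : 0 <= 4 * C ^+ 3 * rho ^+ 5 * A by rewrite !mulr_ge0 ?exprn_ge0.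
  apply: (le_trans (ler_wpM2l c0 (inner_remainder_sum al0 al1 C1 r1 dla nu3 rm m3 mM))).
  by rewrite le_eqVlt; apply/orP; left; apply/eqP; rewrite /K2; ring.
have -> : (K1 + K2 + K3) * A * m%:R `^ (- (r + dl)) = K1 * A * m%:R `^ (- (r + dl)) +
  (K2 * A * m%:R `^ (- (r + dl)) + K3 * A * m%:R `^ (- (r + dl))) by ring.
apply: le_trans (ler_normD _ _) _; apply: lerD => //.
by apply: le_trans (ler_normD _ _) _; exact: lerD.
Qed.

(** * Rows in nodal values, and crude bounds for the first rows *)

Section row_matrix.
Context {R : realType}.
Implicit Types (al C r : R) (t x : nat -> R).

(** Coefficient of x_j after Abel summation of the increments, for sequences with x_0 = 0. *)
Definition row_diff al t m j : R :=
  if j is i.+1 then row_coef al t m i - (if (j < m)%N then row_coef al t m j else 0) else 0.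

Lemma row_diff_sum al t m x : x 0%N = 0 -> (0 < m)%N ->
  \sum_(i < m) row_coef al t m i * (x i.+1 - x i) =
  \sum_(1 <= j < m.+1) row_diff al t m j * x j.
Proof.
move=> x0; case: m => [//|m] _.
rewrite -(big_mkord predT (fun i => row_coef al t m.+1 i * (x i.+1 - x i))).
rewrite big_add1/=.
rewrite (eq_bigr (fun i => row_coef al t m.+1 i * x i.+1 - row_coef al t m.+1 i * x i)); last first.
  by move=> i _; rewrite mulrBr.
rewrite sumrB [X in _ - X]big_ltn// x0 mulr0 add0r big_add1/=.
rewrite !big_nat_recr//= ltnn subr0 addrAC -sumrB; congr (_ + _).
rewrite big_seq [RHS]big_seq; apply: eq_bigr => i; rewrite mem_index_iota => /andP[_ im].
by rewrite ltnS im mulrBl.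
Qed.

(** For m below a fixed m0 all steps lie between t_1 and B t_1 with B independent of the mesh, so
    every moment is bounded by its natural scale in t_1. *)
Lemma row_crude al C r (m0 : nat) : 0 < al -> al < 1 -> 1 <= C -> 1 <= r ->
  exists2 K : R, 1 <= K & forall M t, regular_mesh C r M t ->
    forall m, (1 <= m <= M)%N -> (m < m0)%N ->
    [/\ forall i, (i < m)%N -> `|row_coef al t m i| <= K * t 1%N `^ (- al),
        t 1%N `^ (- al) <= K * row_coef al t m m.-1,
        t 1%N `^ (- al) <= K * (t m - t m.-1) `^ (- al) & t m <= K * t 1%N].
Proof.
move=> al0 al1 C1 r1.
have al01 : 0 < al < 1 by rewrite al0.
have C0 : 0 <= C by exact: le_trans C1.
have r0 : 0 <= r by exact: le_trans r1.
pose B := C * m0.+1%:R `^ r.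
have B1 : 1 <= B.
  have h1 : 1 <= m0.+1%:R :> R by rewrite ler1n.
  have := powR_mono r0 ler01 h1; rewrite powR1 => h.
  by rewrite /B -[leLHS](mulr1 1); apply: ler_pM.
have B0 : 0 < B by exact: lt_le_trans B1.
pose P := B `^ (1 - al) / (1 - al).
have a10 : 0 < 1 - al by rewrite subr_gt0.
have P0 : 0 <= P by rewrite divr_ge0 ?powR_ge0// ltW.
have BP : 0 <= B * P by rewrite mulr_ge0// ltW.
exists (B + (1 + 4 * B) * P); first by rewrite mulrDl mul1r -mulrA; lra.
move=> M t rm m /andP[m1 mM] mm0.
have inc j : (j < m)%N -> t j < t j.+1.
  by case: rm => _ inc _ _ _ jm; apply: inc; exact: leq_trans mM.
have t0 : t 0%N = 0 by case: rm.
set tau := t 1%N; have tau0 : 0 < tau by apply: (mesh_pos rm); rewrite (leq_trans m1 mM).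
have tB j : (j <= m)%N -> t j <= B * tau.
  move=> jm; apply: (@le_trans _ _ (t m)); first exact: (increasing_le inc).
  have [h _] : t m <= C * (t 1%N * m%:R `^ r) /\ t 1%N * m%:R `^ r <= C * t m.
    by case: rm => _ _ _ _; apply; rewrite m1.
  apply: (le_trans h); rewrite -/tau /B -mulrA [_ * tau]mulrC.
  apply: ler_wpM2l => //; apply: ler_wpM2l; first exact: ltW.
  by apply: powR_mono => //; rewrite ler_nat ltnW// ltnW.
have hstep j : (j < m)%N -> tau <= t j.+1 - t j <= B * tau.
  move=> jm; rewrite (mesh_step_ge_first rm (leq_trans jm mM)) /=.
  apply: le_trans (tB j.+1 jm); rewrite gerBl.
  by rewrite -t0; apply: (increasing_le inc) => //; exact: ltnW.
have tge0 j : (j <= m)%N -> 0 <= t j by move=> jm; rewrite -t0; exact: (increasing_le inc).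
have tle j : (j <= m)%N -> t j <= t m by move=> jm; exact: (increasing_le inc).
have Bt : (B * tau) `^ (1 - al) = B `^ (1 - al) * (tau `^ (- al) * tau).
  rewrite powRM ?(ltW B0) ?(ltW tau0)//; congr (_ * _).
  by rewrite addrC powRD_pos// powRr1// ltW.
set z := tau `^ (- al) in Bt *; have z0 : 0 <= z by exact: powR_ge0.
have pj j : (j < m)%N -> 0 <= row_p al t m j <= P * (z * tau).
  move=> jm; rewrite /row_p; apply/andP; split.
    by apply: le_trans (ker1_ge al0 al1 (inc _ jm) (tle _ jm)); rewrite mulr_ge0 ?powR_ge0// subr_ge0 ltW// inc.
  rewrite ker_int1//; [|exact: inc|exact: tle].
  rewrite /P mulrAC -Bt ler_pM2r ?invr_gt0// lerBlDr ler_wpDr ?powR_ge0//.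
  apply: powR_mono; [exact: ltW|by rewrite subr_ge0 tle// ltnW|].
  by apply: le_trans (tB m (leqnn _)); rewrite gerBl tge0// ltnW.
have qj j : (j < m)%N -> 0 <= row_q al t m j <= B * tau * (P * (z * tau)).
  move=> jm; rewrite /row_q; apply/andP; split; first by apply: kerq_ge0 => //; [exact: inc|exact: tle].
  have /andP[h1 h2] := hstep j jm; have /andP[p1 p2] := pj j jm.
  apply: (le_trans (kerq_le_ker1 al0 al1 (inc _ jm) (tle _ jm))).
  have h0 : 0 <= t j.+1 - t j by rewrite subr_ge0 ltW// inc.
  apply: (@le_trans _ _ ((t j.+1 - t j) * row_p al t m j)).
    by apply: ler_wpM2l => //; rewrite gerBl mulr_ge0 ?powR_ge0.
  exact: ler_pM.
have wj j : (j < m)%N -> 0 <= row_w al t m j <= 2 * (B * (P * (z * tau))).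
  move=> jm; rewrite row_w_ge0//= /row_w; case: ifPn => [jm1|_]; last first.
    by rewrite mulr_ge0// mulr_ge0 ?(ltW B0)// mulr_ge0// mulr_ge0// ltW.
  have H : tau <= t j.+2 - t j.
    by have /andP[h _] := hstep j jm; apply: (le_trans h); rewrite lerD2r ltW// inc.
  have H0 : 0 < t j.+2 - t j by exact: lt_le_trans H.
  have /andP[_ q1] := qj j jm; have /andP[_ q2] := qj j.+1 jm1.
  have c0 : 0 <= B * (P * (z * tau)).
    by rewrite mulr_ge0 ?(ltW B0)// mulr_ge0// mulr_ge0// ltW.
  rewrite ler_pdivrMr//; apply: (@le_trans _ _ (2 * (B * (P * (z * tau))) * tau)).
    have q20 : 0 <= B * tau * (P * (z * tau)) by have /andP[q _] := qj j jm; exact: le_trans q1.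
    have : (if j.+2 == m then row_q al t m j.+1 else 0) <= B * tau * (P * (z * tau)).
      by case: ifP.
    lra.
  by apply: ler_wpM2l => //; rewrite mulr_ge0.
have Blast : (m.-1 < m)%N by rewrite prednK.
have hlast := hstep _ Blast; rewrite prednK// in hlast.
have zB : z <= B * (t m - t m.-1) `^ (- al).
  have /andP[h1 h2] := hlast; have h0 : 0 < t m - t m.-1 by exact: lt_le_trans h1.
  apply: (@le_trans _ _ (B * (B * tau) `^ (- al))); last first.
    by apply: ler_wpM2l; [exact: ltW|apply: powR_antimono; rewrite ?oppr_le0 ?(ltW al0)].
  rewrite powRM ?(ltW B0) ?(ltW tau0)// mulrA -{1}(powRr1 (ltW B0)) -powRD_pos//.
  have e0 : 0 <= 1 - al by exact: ltW.
  have := powR_mono e0 ler01 B1; rewrite powR1 => q1.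
  by have := ler_wpM2r z0 q1; rewrite mul1r.
have c0 : 0 <= (1 + 4 * B) * P by rewrite mulr_ge0// addr_ge0// mulr_ge0// ltW.
split.
- move=> i im; rewrite /row_coef.
  have /andP[h1 h2] := hstep i im; have h0 : 0 < t i.+1 - t i by exact: lt_le_trans h1.
  rewrite normrM normfV (gtr0_norm h0) ler_pdivrMr//.
  have X0 : 0 <= P * (z * tau) by rewrite mulr_ge0// mulr_ge0// ltW.
  have X1 : 0 <= B * (P * (z * tau)) by rewrite mulr_ge0// ltW.
  apply: (@le_trans _ _ ((1 + 4 * B) * (P * (z * tau)))).
    have /andP[p1 p2] := pj i im; have /andP[w1 w2] := wj i im.
    case: i im p1 p2 w1 w2 {h1 h2 h0} => [|i] im p1 p2 w1 w2.
      by rewrite ler_norml; apply/andP; split; lra.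
    have /andP[w3 w4] := wj i (ltnW im).
    by rewrite ler_norml; apply/andP; split; lra.
  have : 0 <= B * z * (t i.+1 - t i) by rewrite mulr_ge0 ?(ltW h0)// mulr_ge0// ltW.
  have := ler_wpM2l (mulr_ge0 c0 z0) h1.
  set q := t i.+1 - t i.
  have -> : (1 + 4 * B) * (P * (z * tau)) = (1 + 4 * B) * P * z * tau by ring.
  have -> : (B + (1 + 4 * B) * P) * z * q = B * z * q + (1 + 4 * B) * P * z * q by ring.
  lra.
- have h : (t m - t m.-1) `^ (- al) <= row_coef al t m m.-1.
    rewrite /row_coef prednK//.
    have /andP[h1 h2] := hlast; have h0 : 0 < t m - t m.-1 by exact: lt_le_trans h1.
    rewrite ler_pdivlMr//.
    have -> : row_w al t m m.-1 = 0 by rewrite /row_w prednK// ltnn.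
    rewrite subr0; apply: (@le_trans _ _ (row_p al t m m.-1)).
      apply: le_trans (ker1_ge al0 al1 (inc _ Blast) (tle _ _)); last by rewrite prednK.
      by rewrite prednK// mulrC.
    rewrite lerDl; case: (m.-1) (Blast) => [//|k] km.
    by have /andP[] := wj k (ltnW km).
  apply: (le_trans zB); apply: (@le_trans _ _ (B * row_coef al t m m.-1)).
    by apply: ler_wpM2l => //; exact: ltW.
  by apply: ler_wpM2r; [apply: le_trans h; exact: powR_ge0|rewrite lerDl].
- apply: (le_trans zB); apply: ler_wpM2r; first exact: powR_ge0.
  by rewrite lerDl.
- apply: (le_trans (tB m (leqnn _))); apply: ler_wpM2r; first exact: ltW.
  by rewrite lerDl.
Qed.

(** Up to p the barrier is constant; beyond p relative steps are at most 1/80, so W_(j-1) is at most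
    80/79 of W_j. As alpha/2 < 1/2, a quarter of W_j is left. *)
Lemma barrier_diff al C r dl M t p j : 0 < al -> al < 1 -> 1 <= C ->
  regular_mesh C r M t -> (0 < p)%N -> 80 * C <= p%:R -> (p <= M)%N -> (1 <= j <= M)%N ->
  0 < bw al t dl p j /\ bw al t dl p j / 4 <= bw al t dl p j - al / 2 * bw al t dl p j.-1.
Proof.
move=> al0 al1 C1 rm p0 pC pM /andP[j1 jM].
have t0 : t 0%N = 0 by case: rm.
have inc i : (i < M)%N -> t i < t i.+1 by case: rm => _ h _ _ _; exact: h.
have phi1 l : (l <= M)%N -> 1 <= bphi t dl l.
  move=> lM; apply: bphi_ge1 => i /andP[i1 il]; split; first by apply: (mesh_pos rm); rewrite i1 (leq_trans il).
  by case: i i1 il => // i _ il; rewrite ltW// inc// (leq_trans il).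
have bwp i : (1 <= i <= M)%N -> 0 < bw al t dl p i.
  case: i => // i /andP[_ iM]; rewrite /bw.
  have lM : (maxn i.+1 p <= M)%N by rewrite geq_max iM.
  rewrite mulr_gt0 ?powR_gt0//; last exact: lt_le_trans (phi1 _ lM).
  by apply: (mesh_pos rm); rewrite lM leq_max.
have b0 := bwp j ltac:(by rewrite j1).
split=> //.
case: j j1 jM b0 => [//|[|j]] _ jM b0; rewrite /= in b0 *; first lra.
have [jp|pj] := leqP j.+2 p.
  move: b0; rewrite (maxn_idPr jp) (maxn_idPr (ltnW jp)); set W := _ * _ => b0.
  have : al * W <= 1 * W by rewrite ler_pM2r// ltW.
  lra.
have -> : maxn j.+1 p = j.+1 by apply/maxn_idPl.
have tj : 0 < t j.+1 by apply: (mesh_pos rm); rewrite (ltnW jM).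
have tj2 : 0 < t j.+2 by apply: (mesh_pos rm).
have st := step_le rm jM.
have jj : 80 * C <= j.+2%:R by apply: le_trans pC _; rewrite ler_nat ltnW.
have st' : t j.+2 - t j.+1 <= t j.+2 / 80.
  apply: (le_trans st); rewrite mulrCA; apply: ler_wpM2l; first exact: ltW.
  by rewrite ler_pdivrMr ?ltr0n// mulrC ler_pdivlMr// mulrC.
have ratio : t j.+1 `^ (al - 1) <= 80 / 79 * t j.+2 `^ (al - 1).
  apply: (@le_trans _ _ ((79 / 80 * t j.+2) `^ (al - 1))).
    by apply: powR_antimono; lra.
  rewrite powRM ?(ltW tj2)//; apply: ler_wpM2r; first exact: powR_ge0.
  have q0 : 0 <= 80 / 79 :> R by lra.
  have -> : (79 / 80 : R) = (80 / 79) `^ (-1) by rewrite powR_inv1// invf_div.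
  rewrite -powRrM -[leRHS](powRr1 q0); apply: ler_powR; lra.
have pm : bphi t dl j.+1 <= bphi t dl j.+2.
  apply: bphi_mono => // i /andP[i1 il]; split; first by apply: (mesh_pos rm); rewrite i1 (leq_trans il).
  by case: i i1 il => // i _ il; rewrite ltW// inc// (leq_trans il).
have p1 := phi1 j.+1 (ltnW jM).
have h : t j.+1 `^ (al - 1) * bphi t dl j.+1 <= 80 / 79 * (t j.+2 `^ (al - 1) * bphi t dl j.+2).
  rewrite mulrA; apply: ler_pM => //; [exact: powR_ge0|exact: le_trans p1].
have w0 : 0 <= t j.+1 `^ (al - 1) * bphi t dl j.+1.
  by rewrite mulr_ge0 ?powR_ge0//; exact: le_trans p1.
have w1 : 0 <= t j.+2 `^ (al - 1) * bphi t dl j.+2.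
  by rewrite mulr_ge0 ?powR_ge0//; apply: le_trans (le_trans p1 pm).
move: h w0 w1; set W := t j.+1 `^ _ * _; set W' := t j.+2 `^ _ * _ => h w0 w1.
have : al * W <= 1 * W by exact: ler_wpM2r (ltW al1).
lra.
Qed.

End row_matrix.

(** * Sign pattern of the transformed rows *)

Section row_signs.
Context {R : realType}.
Variables (al C r : R) (K M : nat) (t : nat -> R).
Hypotheses (al0 : 0 < al) (al1 : al < 1) (rm : regular_mesh C r M t).

Definition steps_close (K M : nat) (t : nat -> R) : Prop :=
  forall j, (K < j <= M)%N -> (1 < j)%N ->
    (1 - 1 / 20 / 20) * (t j - t j.-1) <= t j.-1 - t j.-2.

Hypothesis close : steps_close K M t.

Definition row_kappa m j : R := kappa (al / 2) (row_diff al t m) m j.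

                                                                         
(** Bound for the diagonal coefficient of row j, used as weight in the energy norm. The value 1
    outside the mesh keeps it positive at every index. *)
Definition stiffness j : R :=
  if (0 < j <= M)%N then stiff al * (t j - t j.-1) `^ (- al) else 1.

Lemma stiff_ge1 : 1 <= stiff al.
Proof.
move: (al0) (al1) => h0 h1; have h2 : 0 < 1 - al by lra.
have h3 : 1 <= (1 - al)^-1 by rewrite invf_ge1//; lra.
have h4 : 0 <= al / ((1 - al) * (2 - al)).
  by rewrite divr_ge0 ?(ltW h0)// mulr_ge0 ?(ltW h2)//; lra.
by rewrite /stiff; lra.
Qed.

Lemma stiffness_gt0 j : 0 < stiffness j.
Proof.
rewrite /stiffness; case: ifPn => // /andP[j0 jM].
rewrite mulr_gt0//; first exact: lt_le_trans stiff_ge1.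
apply: powR_gt0; rewrite subr_gt0; case: j j0 jM => // j _ jM /=.
by case: rm => _ h _ _ _; exact: h.
Qed.

(** [row_top] settles the indices m, m-1 and m-2. Below them kappa_j = a_j + beta kappa_(j+1) with
    a_j <= 0 by [row_coef_le_next], so nonpositivity propagates downwards. In the last condition the
    stiffnesses of adjacent steps differ by a factor of at most (400/399)^alpha, within the one
    percent reserved in [top_R2]. *)
Lemma row_kappa_signs m : (K + 4 <= m <= M)%N ->
  [/\ 0 < row_kappa m m, row_kappa m m <= stiffness m,
      forall j, (j < m)%N -> row_kappa m j <= 0 &
      (al / 2) ^+ 2 * (stiffness m * stiffness m.-1) <= row_kappa m m.-1 ^+ 2].
Proof.
move=> /andP[Km mM].
case: m Km mM => [|[|[|[|n]]]] Km mM; try by move: Km; rewrite addnC.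
have nK : (K <= n)%N by move: Km; rewrite addnC.
have inc j : (j < n.+4)%N -> t j < t j.+1.
  by case: rm => _ inc _ _ _ jm; apply: inc; exact: leq_trans mM.
have hm j : (j.+1 < n.+4)%N -> t j.+1 - t j <= t j.+2 - t j.+1.
  by case: rm => _ _ h _ _ jm; apply: h; exact: leq_trans mM.
have c1 : (1 - 1 / 20 / 20) * (t n.+4 - t n.+3) <= t n.+3 - t n.+2.
  by apply: (@close n.+4) => //; rewrite mM andbT ltnS (leq_trans nK)// leqW// leqW.
have c2 : (1 - 1 / 20 / 20) * (t n.+3 - t n.+2) <= t n.+2 - t n.+1.
  by apply: (@close n.+3) => //; rewrite (ltnW mM) andbT ltnS (leq_trans nK)// leqW.
have [] := row_top al0 al1 inc hm c1 c2.
set X := (t n.+4 - t n.+3) `^ (- al); set G := row_coef al t n.+4 => G0 GX R2 R3.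
have kE : row_kappa n.+4 n.+4 = G n.+3.
  by rewrite /row_kappa kappa_last /row_diff ltnn subr0.
have k3 : row_kappa n.+4 n.+3 = G n.+2 - G n.+3 + al / 2 * G n.+3.
  by rewrite /row_kappa kappa_rec// -/(row_kappa _ _) kE /row_diff ltnS leqnn.
have k2 : row_kappa n.+4 n.+2 = G n.+1 - G n.+2 + al / 2 * (G n.+2 - G n.+3 + al / 2 * G n.+3).
  by rewrite /row_kappa kappa_rec// -/(row_kappa _ _) k3 /row_diff !ltnS leqnSn.
have a2 : 0 <= al / 2 by move: (al0) => ?; lra.
have X0 : 0 < X by apply: powR_gt0; rewrite subr_gt0 inc.
have sX0 : 0 < stiff al * X by rewrite mulr_gt0//; exact: lt_le_trans stiff_ge1.
have lowR2 : 0 <= al / 2 * (101 / 100) * (stiff al * X).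
  by apply: mulr_ge0; [apply: mulr_ge0 => //; lra|exact: ltW].
have k3n : row_kappa n.+4 n.+3 <= - (al / 2 * (101 / 100) * (stiff al * X)) by rewrite k3; lra.
have signs j : (j < n.+4)%N -> row_kappa n.+4 j <= 0.
  move=> jn; have [d ->] : exists d, j = (n.+3 - d)%N.
    by exists (n.+3 - j)%N; rewrite subKn.
  elim: d {j jn} => [|d IH]; first by rewrite subn0; apply: (le_trans k3n); rewrite oppr_le0.
  have [dn|nd] := ltnP d n.+3; last first.
    by move: nd; rewrite -subn_eq0 => /eqP h; move: IH; rewrite subnS h.
  have E : (n.+3 - d = (n.+3 - d.+1).+1)%N by rewrite subnSK.
  case: d dn IH E => [|d] dn IH E; first by rewrite subn1 /= k2; lra.
  set j := (n.+3 - d.+2)%N in E *.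
  have jn : (j < n.+4)%N by rewrite ltnS leq_subr.
  rewrite /row_kappa kappa_rec// -/(row_kappa _ _) -E.
  have jn2 : (j < n.+2)%N by rewrite /j ltn_subLR// ?addSn ?ltnS ?leq_addl// ltnW.
  have h1 : al / 2 * row_kappa n.+4 (n.+3 - d.+1) <= 0 by rewrite mulr_ge0_le0.
  suff : row_diff al t n.+4 j <= 0 by lra.
  rewrite /row_diff; case: (j) jn2 => [//|i] ij.
  rewrite ifT; last by rewrite ltnW// ltnW.
  by rewrite subr_le0; apply: row_coef_le_next.
split=> //.
- by rewrite kE.
- by rewrite kE /stiffness mM.
- rewrite /stiffness mM (ltnW mM) /= -/X.
  have h0 : 0 < t n.+4 - t n.+3 by rewrite subr_gt0 inc.
  have hX : (t n.+3 - t n.+2) `^ (- al) <= (101 / 100) ^+ 2 * X.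
    apply: (@le_trans _ _ (((1 - 1 / 20 / 20) * (t n.+4 - t n.+3)) `^ (- al))).
      by apply: powR_antimono => //; [rewrite oppr_le0 ltW|rewrite mulr_gt0//; lra].
    have q0 : 0 <= 1 - 1 / 20 / 20 :> R by lra.
    rewrite powRM ?(ltW h0)//; apply: ler_wpM2r; first exact: ltW.
    have s0 : 0 <= 400 / 399 :> R by lra.
    have -> : (1 - 1 / 20 / 20 : R) = (400 / 399) `^ (-1) by rewrite powR_inv1// invf_div; lra.
    rewrite -powRrM mulN1r opprK.
    apply: (@le_trans _ _ ((400 / 399) `^ 1)); last by rewrite powRr1//; lra.
    by apply: ler_powR; [lra|exact: ltW].
  have sq : (al / 2 * (101 / 100) * (stiff al * X)) ^+ 2 <= row_kappa n.+4 n.+3 ^+ 2.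
    by rewrite -[leRHS]sqrrN lerXn2r// ?nnegrE//; lra.
  apply: le_trans sq.
  have s1 : 0 <= stiff al by exact: le_trans stiff_ge1.
  have c0 : 0 <= (al / 2) ^+ 2 * (stiff al * X * stiff al).
    by rewrite mulr_ge0 ?sqr_ge0// mulr_ge0// ltW.
  have := ler_wpM2l c0 hX.
  rewrite -!mulrA => h; apply: (le_trans h); rewrite le_eqVlt; apply/orP; left; apply/eqP; ring.
Qed.

End row_signs.

Lemma node_power_le (R : realType) (al q a b : R) : 0 < al -> al < 1 -> 1 <= q ->
  0 < a -> 0 < b -> b <= q * a -> a `^ (al - 1) <= q * b `^ (al - 1).
Proof.
move=> al0 al1 q1 a0 b0 bqa; have q0 : 0 < q by lra.
have a10 : al - 1 <= 0 by lra.
have h := powR_antimono a10 b0 bqa.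
rewrite powRM ?(ltW q0) ?(ltW a0)// in h.
have hq : 1 <= q * q `^ (al - 1).
  rewrite -{1}(powRr1 (ltW q0)) -powRD_pos// subrKC.
  by have := powR_mono (ltW al0) ler01 q1; rewrite powR1.
apply: (@le_trans _ _ (q * (q `^ (al - 1) * a `^ (al - 1)))).
  by rewrite mulrA ler_peMl ?powR_ge0.
by apply: ler_wpM2l => //; exact: ltW.
Qed.

(** * The error bound for abstract forms *)

Section error_estimate.
Context {R : realType} {E : lmodType R}.
Variables (D : E -> Prop) (dot frm : E -> E -> R).
Hypothesis D_lin : forall (a : R) x y, D x -> D y -> D (a *: x + y).
Hypothesis dot_lin : forall (a : R) x y z, D x -> D y -> D z ->
  dot (a *: x + y) z = a * dot x z + dot y z.
Hypothesis dot_sym : forall x y, D x -> D y -> dot x y = dot y x.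
Hypothesis dot_ge0 : forall x, D x -> 0 <= dot x x.
Hypothesis frm_lin : forall (a : R) x y z, D x -> D y -> D z ->
  frm (a *: x + y) z = a * frm x z + frm y z.
Hypothesis frm_sym : forall x y, D x -> D y -> frm x y = frm y x.
Hypothesis frm_ge0 : forall x, D x -> 0 <= frm x x.
Local Notation nrm x := (Num.sqrt (dot x x)).

Variables (al C r dl A : R) (K m0 M : nat) (t : nat -> R) (e : nat -> E) (rho : nat -> R).
Hypotheses (al0 : 0 < al) (al1 : al < 1) (C1 : 1 <= C) (r1 : 1 <= r) (A0 : 0 <= A).
Hypotheses (rm : regular_mesh C r M t) (close : steps_close K M t).
Hypotheses (e0 : e 0%N = 0) (De : forall j, D (e j)).
Hypothesis rho0 : forall m, 0 <= rho m.
Hypothesis rhoA : forall m, (1 <= m <= M)%N -> rho m <= A.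
Hypothesis error_row : forall m v, (1 <= m <= M)%N -> D v ->
  \sum_(i < m) row_coef al t m i * (dot (e i.+1) v - dot (e i) v) + frm (e m) v <=
  rho m * nrm v.

Let D0 : D 0. Proof. by rewrite -e0. Qed.

Let dot0 v : D v -> dot 0 v = 0.
Proof.
move=> Dv; have := dot_lin (-1) D0 D0 Dv.
by rewrite scaler0 addr0 mulN1r addNr.
Qed.

Let error_row_diff m v : (1 <= m <= M)%N -> D v ->
  \sum_(1 <= j < m.+1) row_diff al t m j * dot (e j) v + frm (e m) v <= rho m * nrm v.
Proof.
move=> mM Dv; have := error_row mM Dv.
rewrite (@row_diff_sum R al t m (fun j => dot (e j) v)) ?e0 ?dot0//.
by case/andP: mM.
Qed.

Section crude.
Variable Kc : R.
Hypothesis Kc1 : 1 <= Kc.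
Hypothesis row_bounds : forall m, (1 <= m <= M)%N -> (m < m0)%N ->
    [/\ forall i, (i < m)%N -> `|row_coef al t m i| <= Kc * t 1%N `^ (- al),
        t 1%N `^ (- al) <= Kc * row_coef al t m m.-1,
        t 1%N `^ (- al) <= Kc * (t m - t m.-1) `^ (- al) & t m <= Kc * t 1%N].

(** The constant propagated by the induction over the first rows; it is nondecreasing in n, so its
    value at [m0] serves them all. *)
Fixpoint crude_const (Kc A : R) n : R :=
  if n is k.+1 then crude_const Kc A k + Kc * (2 * Kc * k%:R * crude_const Kc A k + A) else 0.

Lemma crude_const_ge0 (n : nat) : 0 <= crude_const Kc A n.
Proof.
have Kc0 : 0 <= Kc by exact: le_trans Kc1.
elim: n => [//|n IH] /=.
by rewrite addr_ge0// mulr_ge0// addr_ge0// mulr_ge0// !mulr_ge0.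
Qed.

Lemma crude_const_mono k n : (k <= n)%N -> crude_const Kc A k <= crude_const Kc A n.
Proof.
have Kc0 : 0 <= Kc by exact: le_trans Kc1.
elim: n => [|n IH]; first by rewrite leqn0 => /eqP ->.
rewrite leq_eqVlt => /predU1P[-> //|kn]; apply: (le_trans (IH kn)) => /=.
by rewrite lerDl mulr_ge0// addr_ge0// mulr_ge0 ?crude_const_ge0// !mulr_ge0.
Qed.

(** By [row_crude] the diagonal entry is at least t_1^(-alpha)/Kc and the others at most 2 Kc
    t_1^(-alpha), so earlier errors of size t_1^alpha and a residual of size A give again an error
    of size t_1^alpha. *)
Lemma crude_estimate m : (m <= M)%N -> (m < m0)%N ->
  nrm (e m) <= crude_const Kc A m * t 1%N `^ al /\
  frm (e m) (e m) <= crude_const Kc A m ^+ 2 * t 1%N `^ al.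
Proof.
have Kc0 : 0 <= Kc by exact: le_trans Kc1.
have frm00 : frm 0 0 = 0.
  have := frm_lin (-1) D0 D0 D0; by rewrite scaler0 addr0 mulN1r addNr.
elim/ltn_ind: m => m IH mM mm0.
case: m IH mM mm0 => [|m] IH mM mm0.
  by rewrite e0 dot0// sqrtr0 frm00 expr2 !mul0r.
have mr : (1 <= m.+1 <= M)%N by [].
have [hG hGl _ _] := row_bounds mr mm0.
set tau := t 1%N in hG hGl IH *; set z := tau `^ (- al) in hG hGl.
have tau0 : 0 < tau by apply: (mesh_pos rm); rewrite (leq_trans _ mM).
have z0 : 0 < z by exact: powR_gt0.
have zt : z * tau `^ al = 1 by rewrite /z -powRD_pos// addNr powRr0.
have ta0 : 0 < tau `^ al by exact: powR_gt0.
have dE : row_diff al t m.+1 m.+1 = row_coef al t m.+1 m by rewrite /row_diff ltnn subr0.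
have G0 : 0 < row_coef al t m.+1 m.
  have := lt_le_trans z0 hGl; rewrite pmulr_rgt0//; exact: lt_le_trans Kc1.
have d0 : 0 < row_diff al t m.+1 m.+1 by rewrite dE.
have [] := crude_row D_lin dot_lin dot_sym dot_ge0 frm_ge0 De (rho0 m.+1) d0
  (error_row_diff mr (De m.+1)).
set S := \sum_(_ <= _ < _) _ + _.
have S0 : 0 <= S.
  by rewrite addr_ge0// sumr_ge0// => j _; rewrite mulr_ge0// sqrtr_ge0.
have inv : (row_diff al t m.+1 m.+1)^-1 <= Kc * tau `^ al.
  rewrite dE -[leLHS]mul1r ler_pdivrMr// -zt mulrAC [z * _]mulrC.
  by apply: le_trans (ler_wpM2l (ltW ta0) hGl) _; rewrite le_eqVlt; apply/orP; left; apply/eqP; ring.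
pose Q := crude_const Kc A m; have Q0 : 0 <= Q by exact: crude_const_ge0.
pose s := 2 * Kc * m%:R * Q + A.
have s0 : 0 <= s by rewrite addr_ge0// mulr_ge0// !mulr_ge0.
have Ss : S <= s.
  apply: lerD; last exact: rhoA.
  apply: (@le_trans _ _ (\sum_(1 <= j < m.+1) 2 * Kc * Q)); last first.
    by rewrite sumr_const_nat subn1 /= -[leLHS]mulr_natr; rewrite le_eqVlt; apply/orP; left; apply/eqP; ring.
  rewrite big_seq [leRHS]big_seq; apply: ler_sum => j; rewrite mem_index_iota => /andP[j1 jm].
  have [h1 _] := IH j jm (ltnW (leq_trans jm mM)) (ltn_trans jm mm0).
  have h2 : nrm (e j) <= Q * tau `^ al.
    by apply: (le_trans h1); apply: ler_wpM2r; [exact: ltW|exact: crude_const_mono].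
  have h3 : `|row_diff al t m.+1 j| <= 2 * Kc * z.
    case: j j1 jm {h1 h2} => [//|j] _ jm; rewrite /row_diff jm.
    apply: (le_trans (ler_normB _ _)).
    have := hG j (ltnW jm); have := hG j.+1 jm; lra.
  apply: (@le_trans _ _ (2 * Kc * z * (Q * tau `^ al))).
    by apply: ler_pM => //; exact: sqrtr_ge0.
  have -> : 2 * Kc * z * (Q * tau `^ al) = 2 * Kc * Q * (z * tau `^ al) by ring.
  by rewrite zt mulr1.
have Ks : Kc * s <= crude_const Kc A m.+1 by rewrite /= -/Q -/s lerDr.
have Ks0 : 0 <= Kc * s by exact: mulr_ge0.
move=> h1 h2; split.
- apply: (le_trans h1); apply: (@le_trans _ _ (s * (Kc * tau `^ al))).
    by apply: ler_pM => //; rewrite invr_ge0 ltW.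
  by rewrite mulrA [s * Kc]mulrC; apply: ler_wpM2r => //; exact: ltW.
- apply: (le_trans h2); apply: (@le_trans _ _ (s ^+ 2 * (Kc * tau `^ al))).
    by apply: ler_pM; rewrite ?sqr_ge0 ?invr_ge0 ?(ltW d0)// lerXn2r// nnegrE.
  rewrite mulrA; apply: ler_wpM2r; first exact: ltW.
  apply: (@le_trans _ _ ((Kc * s) ^+ 2)); last by rewrite lerXn2r// nnegrE ?crude_const_ge0.
  rewrite exprMn mulrC; apply: ler_wpM2r; first exact: sqr_ge0.
  by rewrite expr2 ler_peMr.
Qed.

Local Notation bt := (al / 2).
Let v j := - bt *: e j.-1 + e j.
Let N j := energy_norm dot frm (stiffness al M t j) (v j) (e j).

Let Dv j : D (v j). Proof. exact: D_lin. Qed.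
Let bt0 : 0 <= bt. Proof. by move: (al0) => ?; lra. Qed.
Let bt1 : bt <= 1. Proof. by move: (al1) => ?; lra. Qed.

Lemma crude_energy m : (1 <= m <= M)%N -> (m < m0)%N ->
  N m <= (2 + Kc) * crude_const Kc A m * t 1%N `^ al.
Proof.
move=> /andP[m1 mM] mm0; have mr : (1 <= m <= M)%N by rewrite m1.
have Kc0 : 0 <= Kc by exact: le_trans Kc1.
have [_ _ hz _] := row_bounds mr mm0.
have [n1 f1] := crude_estimate mM mm0.
have mm' : (m.-1 <= m)%N by exact: leq_pred.
have [n2 _] := crude_estimate (leq_trans mm' mM) (leq_ltn_trans mm' mm0).
set Q := crude_const Kc A m in n1 f1 *; have Q0 : 0 <= Q by exact: crude_const_ge0.
set tau := t 1%N in hz n1 n2 f1 *.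
have tau0 : 0 < tau by apply: (mesh_pos rm); rewrite (leq_trans m1 mM).
set T := tau `^ al in n1 n2 f1 *.
have T0 : 0 < T by exact: powR_gt0.
have {}n2 : nrm (e m.-1) <= Q * T.
  by apply: (le_trans n2); apply: ler_wpM2r; [exact: ltW|exact: crude_const_mono].
have nv : nrm (v m) <= 2 * Q * T.
  apply: (le_trans (psd_triangle D_lin dot_lin dot_sym dot_ge0 _ _ _)) => //.
  rewrite normrN (ger0_norm bt0).
  have : bt * nrm (e m.-1) <= 1 * (Q * T) by apply: ler_pM => //; exact: sqrtr_ge0.
  lra.
set kh := stiffness al M t m.
have kh0 : 0 < kh by exact: stiffness_gt0 rm _.
have khT : kh^-1 <= Kc * T.
  rewrite -[leLHS]mul1r ler_pdivrMr// /kh /stiffness mr.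
  have zT : tau `^ (- al) * T = 1 by rewrite /T -powRD_pos// addNr powRr0.
  rewrite -{1}zT; set h := (t m - t m.-1) `^ (- al).
  have h0 : 0 <= h by exact: powR_ge0.
  apply: (@le_trans _ _ (Kc * h * T)); first by apply: ler_wpM2r; [exact: ltW|].
  have := stiff_ge1 al0 al1; set s := stiff al => s1.
  have -> : Kc * T * (s * h) = s * (Kc * h * T) by ring.
  by apply: ler_peMl => //; rewrite mulr_ge0 ?(ltW T0)// mulr_ge0.
have fk : frm (e m) (e m) / kh <= (Q * Kc * T) ^+ 2.
  apply: (@le_trans _ _ (Q ^+ 2 * T * (Kc * T))).
    by apply: ler_pM => //; [exact: frm_ge0|rewrite invr_ge0 ltW].
  have -> : (Q * Kc * T) ^+ 2 = Kc * (Q ^+ 2 * T * (Kc * T)) by ring.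
  by rewrite ler_peMl// mulr_ge0 ?mulr_ge0 ?sqr_ge0// ltW.
have a0 : 0 <= 2 * Q * T by rewrite mulr_ge0 ?(ltW T0)// mulr_ge0.
have b0 : 0 <= Q * Kc * T by rewrite mulr_ge0 ?(ltW T0)// mulr_ge0.
have -> : (2 + Kc) * Q * T = 2 * Q * T + Q * Kc * T by ring.
have ab0 : 0 <= 2 * Q * T + Q * Kc * T by exact: addr_ge0.
rewrite /N /energy_norm -(ger0_norm ab0) -sqrtr_sqr ler_wsqrtr//.
have dv : dot (v m) (v m) <= (2 * Q * T) ^+ 2.
  by rewrite -[leLHS]sqr_sqrtr ?dot_ge0// lerXn2r// nnegrE ?sqrtr_ge0.
have : 0 <= (2 * Q * T) * (Q * Kc * T) by exact: mulr_ge0.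
rewrite sqrrD -/kh; set x := dot _ _ in dv *; set y := frm _ _ / _ in fk *.
move: dv fk; set a := 2 * Q * T; set b := Q * Kc * T; lra.
Qed.

Hypothesis Km0 : (K + 4 <= m0)%N.

Lemma energy_rows m : (m0 <= m <= M)%N ->
  row_kappa al t m m * N m <= \sum_(1 <= j < m) - row_kappa al t m j * N j + rho m.
Proof.
move=> /andP[mm0 mM].
have Km : (K + 4 <= m <= M)%N by rewrite mM andbT (leq_trans Km0).
have [k1 k2 k3 k4] := row_kappa_signs al0 al1 rm close Km.
have m1 : (1 <= m <= M)%N by rewrite mM andbT; apply: leq_trans mm0; apply: leq_trans Km0; rewrite addnC.
case: m mm0 mM Km k1 k2 k3 k4 m1 => [//|m] mm0 mM Km k1 k2 k3 k4 m1.
have kh0 j : 0 < stiffness al M t j by exact: stiffness_gt0 rm _.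
have m_gt0 : (0 < m)%N by rewrite -ltnS; apply: leq_trans mm0; apply: leq_trans Km0; rewrite addnC.
apply: (energy_row D_lin dot_lin dot_sym dot_ge0 frm_lin frm_sym frm_ge0 m_gt0 De bt0 (rho0 m.+1)
  kh0 k1 k2 (fun j jm => k3 j jm) k4).
rewrite -/(v m.+1); set w := v m.+1; have Dw : D w by exact: Dv.
suff -> : \sum_(1 <= j < m.+2) row_kappa al t m.+1 j * dot (- bt *: e j.-1 + e j) w =
    \sum_(1 <= j < m.+2) row_diff al t m.+1 j * dot (e j) w by exact: error_row_diff.
have x0 : dot (e 0%N) w = 0 by rewrite e0 dot0.
have := @kappa_sum R R^o bt (row_diff al t m.+1) m.+1 (fun j => dot (e j) w) x0.
move=> H; apply: (etrans _ H); apply: eq_bigr => j _.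
by rewrite dot_lin.
Qed.

Variables (p : nat) (cb : R).
Hypotheses (cb0 : 0 < cb) (p_gt0 : (0 < p)%N) (pC : 80 * C <= p%:R) (pm0 : (p < m0)%N).
Hypothesis barrier : forall m, (m0 <= m <= M)%N -> cb * m%:R `^ (- dl) <=
    t m * \sum_(i < m) row_coef al t m i * (bw al t dl p i.+1 - bw al t dl p i).
Hypothesis rho_rate : forall m, (m0 <= m <= M)%N -> rho m <= A * m%:R `^ (- (r + dl)).
Local Notation W := (bw al t dl p).
Let B j := W j - bt * W j.-1.

Let Kc0 : 0 <= Kc. Proof. exact: le_trans Kc1. Qed.

(** The first summand covers the rows below m0, the second is the ratio of the residual to the row
    of the barrier. *)
Definition final_const : R := 4 * Kc * ((2 + Kc) * crude_const Kc A m0) + A * (C / cb).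

Let fc_ge0 : 0 <= final_const.
Proof.
rewrite /final_const addr_ge0//; last by rewrite mulr_ge0// divr_ge0 ?(le_trans ler01 C1)// ltW.
by rewrite mulr_ge0 ?mulr_ge0// ?crude_const_ge0// addr_ge0.
Qed.

(** From m0 on, the barrier estimate and t_m <= C t_1 m^r bound m^(-(r+dl)) by a multiple of t_1
    times row m applied to B. Below m0, W_m is at least a multiple of t_1^(alpha-1), so the crude
    bound t_1^alpha is dominated by t_1 B_m as well. *)
Lemma energy_bound : (m0 <= M)%N -> forall m, (0 < m <= M)%N -> N m <= final_const * t 1%N * B m.
Proof.
move=> m0M.
have pM : (p <= M)%N by apply: leq_trans m0M; exact: ltnW.
have K4 : (0 < m0)%N by apply: leq_trans Km0; rewrite addnC.
set tau := t 1%N.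
have tau0 : 0 < tau by apply: (mesh_pos rm); rewrite (leq_trans K4 m0M).
have BW j : (1 <= j <= M)%N -> 0 < W j /\ W j / 4 <= B j.
  by move=> jr; exact: (barrier_diff dl al0 al1 C1 rm p_gt0 pC pM jr).
apply: (@comparison R m0 M (row_kappa al t) N B rho).
- move=> m /andP[mm0 mM].
  have Km : (K + 4 <= m <= M)%N by rewrite mM andbT (leq_trans Km0).
  by have [] := row_kappa_signs al0 al1 rm close Km.
- move=> m j /andP[mm0 mM] jm.
  have Km : (K + 4 <= m <= M)%N by rewrite mM andbT (leq_trans Km0).
  by have [_ _ h _] := row_kappa_signs al0 al1 rm close Km; exact: h.
- exact: energy_rows.
- move=> m mr m1; have /andP[mm0 mM] := mr.
  have -> : \sum_(1 <= j < m.+1) row_kappa al t m j * B j =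
      \sum_(i < m) row_coef al t m i * (W i.+1 - W i).
    rewrite row_diff_sum//.
    have := @kappa_sum R R^o bt (row_diff al t m) m W erefl.
    move=> H; apply: (etrans _ H); apply: eq_bigr => j _.
    by rewrite /B addrC -mulNr.
  set S := \sum_(i < m) _.
  have hb := barrier mr; rewrite -/S in hb.
  have mp : 0 < m%:R :> R by rewrite ltr0n.
  have tm : 0 < t m by apply: (mesh_pos rm); rewrite m1.
  have S0 : 0 <= S.
    rewrite -(pmulr_rge0 _ tm); apply: le_trans hb; rewrite mulr_ge0 ?powR_ge0//; exact: ltW.
  have [h1 _] : t m <= C * (t 1%N * m%:R `^ r) /\ t 1%N * m%:R `^ r <= C * t m.
    by case: rm => _ _ _ _; apply; rewrite m1.
  have h2 : cb * m%:R `^ (- dl) <= C * (tau * m%:R `^ r) * S.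
    by apply: (le_trans hb); exact: ler_wpM2r.
  have h3 : m%:R `^ (- (r + dl)) <= C / cb * tau * S.
    have z0 : 0 <= m%:R `^ (- r) :> R by exact: powR_ge0.
    have := ler_wpM2r z0 h2.
    have -> : m%:R `^ (- (r + dl)) = m%:R `^ (- dl) * m%:R `^ (- r) :> R.
      by rewrite -powRD_pos//; congr (_ `^ _); ring.
    have rr : m%:R `^ r * m%:R `^ (- r) = 1 :> R by rewrite -powRD_pos// subrr powRr0.
    have -> : C * (tau * m%:R `^ r) * S * m%:R `^ (- r) = C * tau * S * (m%:R `^ r * m%:R `^ (- r)) by ring.
    have -> : C / cb * tau * S = C * tau * S / cb by ring.
    by rewrite rr mulr1 ler_pdivlMr// [_ * cb]mulrC mulrA.
  apply: (le_trans (rho_rate mr)); apply: (le_trans (ler_wpM2l A0 h3)).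
  have -> : A * (C / cb * tau * S) = A * (C / cb) * tau * S by ring.
  apply: ler_wpM2r => //; apply: ler_wpM2r; first exact: ltW.
  rewrite /final_const lerDr mulr_ge0 ?mulr_ge0// ?crude_const_ge0// addr_ge0//.
- move=> m /andP[m1 mm0] mM; have mr : (1 <= m <= M)%N by rewrite m1.
  apply: (le_trans (crude_energy mr mm0)).
  have [W0 WB] := BW m mr.
  have B0 : 0 <= B m by apply: le_trans WB; rewrite divr_ge0// ltW.
  have Wlow : tau `^ (al - 1) <= Kc * W m.
    have -> : W m = t (maxn m p) `^ (al - 1) * bphi t dl (maxn m p) by case: (m) m1.
    set l := maxn m p.
    have lM : (l <= M)%N by rewrite geq_max mM.
    have l1 : (1 <= l)%N by rewrite leq_max m1.
    have lm0 : (l < m0)%N by rewrite gtn_max mm0.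
    have lr : (1 <= l <= M)%N by rewrite l1.
    have [_ _ _ tl] := row_bounds lr lm0.
    have tl0 : 0 < t l by exact: (mesh_pos rm lr).
    have phi1 : 1 <= bphi t dl l.
      apply: bphi_ge1 => i /andP[i1 il]; split; first by apply: (mesh_pos rm); rewrite i1 (leq_trans il).
      case: i i1 il => // i _ il; rewrite ltW//.
      by case: rm => _ h _ _ _; apply: h; exact: leq_trans lM.
    apply: (le_trans (node_power_le al0 al1 Kc1 tau0 tl0 tl)).
    apply: ler_wpM2l => //.
    by rewrite ler_peMr ?powR_ge0.
  have Q0 : 0 <= (2 + Kc) * crude_const Kc A m by rewrite mulr_ge0 ?crude_const_ge0// addr_ge0.
  have ta : tau `^ al = tau * tau `^ (al - 1).
    by rewrite -{2}(powRr1 (ltW tau0)) -powRD_pos//; congr (_ `^ _); ring.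
  have Qm : (2 + Kc) * crude_const Kc A m <= (2 + Kc) * crude_const Kc A m0.
    by apply: ler_wpM2l; [exact: addr_ge0|apply: crude_const_mono; exact: ltnW].
  apply: (@le_trans _ _ ((2 + Kc) * crude_const Kc A m0 * (tau * (Kc * (4 * B m))))).
    rewrite ta; apply: ler_pM => //; first by rewrite mulr_ge0 ?powR_ge0// ltW.
    apply: ler_wpM2l; first exact: ltW.
    apply: (le_trans Wlow); apply: ler_wpM2l => //; lra.
  have -> : (2 + Kc) * crude_const Kc A m0 * (tau * (Kc * (4 * B m))) =
    4 * Kc * ((2 + Kc) * crude_const Kc A m0) * tau * B m by ring.
  apply: ler_wpM2r => //; apply: ler_wpM2r; first exact: ltW.
  by rewrite /final_const lerDl mulr_ge0// divr_ge0 ?(le_trans ler01 C1)// ltW.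
Qed.

(** The recursion e_(m+1) = beta e_m + v_(m+1) is matched by W_(m+1) = beta W_m + B_(m+1), so the
    bound passes from v to e with the same constant. *)
Lemma error_bound_large : (m0 <= M)%N -> forall m, (0 < m <= M)%N ->
  nrm (e m) <= final_const * t 1%N * W m.
Proof.
move=> m0M.
have K4 : (0 < m0)%N by apply: leq_trans Km0; rewrite addnC.
have t1 : 0 < t 1%N by apply: (mesh_pos rm); rewrite (leq_trans K4 m0M).
elim=> [//|m IH] /andP[_ mM].
have kh0 : 0 < stiffness al M t m.+1 by exact: stiffness_gt0 rm _.
have nN : nrm (v m.+1) <= N m.+1 := energy_norm_ge_dot dot frm_ge0 _ kh0 (De m.+1).
have := le_trans nN (energy_bound m0M (mM : (0 < m.+1 <= M)%N)).
have eE : e m.+1 = bt *: e m + v m.+1 by rewrite /v /= scaleNr addrA subrr add0r.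
have := psd_triangle D_lin dot_lin dot_sym dot_ge0 bt (De m) (Dv m.+1).
rewrite -eE (ger0_norm bt0) /B /=.
have h : nrm (e m) <= final_const * t 1%N * W m.
  case: m {nN eE kh0} IH mM => [|m] IH mM; first by rewrite e0 dot0// sqrtr0 mulr0.
  by apply: IH; exact: ltnW.
have := ler_wpM2l bt0 h; lra.
Qed.

End crude.
End error_estimate.

(** The constant is chosen before the space, the mesh and the error, hence is uniform in all of
    them. The domain predicate is present because the elements will be pairs of a function and its
    gradient, on which integrals are linear only under square integrability. *)
Theorem abstract_error_estimate {R : realType} (al C r dl A : R) (K : nat) :
  0 < al -> al < 1 -> 1 <= C -> 1 <= r -> dl <= al / 4 -> 0 <= A ->
  exists2 Kf : R, 0 <= Kf & forall (E : lmodType R) (D : E -> Prop) (dot frm : E -> E -> R),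
  (forall (a : R) x y, D x -> D y -> D (a *: x + y)) ->
  (forall (a : R) x y z, D x -> D y -> D z -> dot (a *: x + y) z = a * dot x z + dot y z) ->
  (forall x y, D x -> D y -> dot x y = dot y x) ->
  (forall x, D x -> 0 <= dot x x) ->
  (forall (a : R) x y z, D x -> D y -> D z -> frm (a *: x + y) z = a * frm x z + frm y z) ->
  (forall x y, D x -> D y -> frm x y = frm y x) ->
  (forall x, D x -> 0 <= frm x x) ->
  forall (M : nat) (t : nat -> R) (e : nat -> E) (rho : nat -> R),
  regular_mesh C r M t -> steps_close K M t ->
  e 0%N = 0 -> (forall j, D (e j)) -> (forall m, 0 <= rho m) ->
  (forall m, (1 <= m <= M)%N -> rho m <= A) ->
  (forall m, (3 <= m <= M)%N -> rho m <= A * m%:R `^ (- (r + dl))) ->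
  (forall m v, (1 <= m <= M)%N -> D v ->
    \sum_(i < m) row_coef al t m i * (dot (e i.+1) v - dot (e i) v) + frm (e m) v <=
    rho m * Num.sqrt (dot v v)) ->
  forall m, (1 <= m <= M)%N ->
    Num.sqrt (dot (e m) (e m)) <= Kf * (t 1%N * t m `^ (al - 1) * bphi t dl m).
Proof.
move=> al0 al1 C1 r1 dla A0.
have [p [m1 [cb cb0 [p0 pC pm1 bar]]]] := barrier_row al0 al1 C1 r1 dla.
pose m0 := (m1 + (K + 4))%N.
have m1m0 : (m1 <= m0)%N by exact: leq_addr.
have Km0 : (K + 4 <= m0)%N by exact: leq_addl.
have m03 : (3 <= m0)%N by apply: leq_trans Km0; rewrite addnC.
have [Kc Kc1 hKc] := row_crude m0 al0 al1 C1 r1.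
have Kc0 : 0 <= Kc by exact: le_trans Kc1.
have C0 : 0 <= C by exact: le_trans C1.
pose Q := crude_const Kc A m0; pose F := final_const C A m0 Kc cb.
have Q0 : 0 <= Q by exact: crude_const_ge0.
have F0 : 0 <= F.
  rewrite /F /final_const addr_ge0//; last by rewrite mulr_ge0// divr_ge0// ltW.
  by rewrite mulr_ge0 ?mulr_ge0// addr_ge0.
exists (Q * Kc + F); first by rewrite addr_ge0// mulr_ge0.
move=> E D dot frm D_lin dot_lin dot_sym dot_ge0 frm_lin frm_sym frm_ge0 M t e rho rm close
  e0 De rho0 rhoA rho_rate row m /andP[m_gt0 mM].
have mr : (1 <= m <= M)%N by rewrite m_gt0.
have t1 : 0 < t 1%N by apply: (mesh_pos rm); rewrite (leq_trans m_gt0 mM).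
have tm : 0 < t m by exact: (mesh_pos rm).
have phi1 : 1 <= bphi t dl m.
  apply: bphi_ge1 => i /andP[i1 il]; split; first by apply: (mesh_pos rm); rewrite i1 (leq_trans il).
  case: i i1 il => // i _ il; rewrite ltW//.
  by case: rm => _ h _ _ _; apply: h; exact: leq_trans mM.
have tw0 : 0 <= t 1%N * t m `^ (al - 1) by rewrite mulr_ge0 ?powR_ge0// ltW.
have twp0 : 0 <= t 1%N * t m `^ (al - 1) * bphi t dl m by rewrite mulr_ge0//; exact: le_trans phi1.
have [mm0|m0m] := ltnP m m0.
- have [h _] := crude_estimate D_lin dot_lin dot_sym dot_ge0 frm_lin frm_ge0 A0 rm e0 De rho0
    rhoA row Kc1 (hKc M t rm) mM mm0.
  have [_ _ _ hK] := hKc M t rm m mr mm0.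
  have hp := node_power_le al0 al1 Kc1 t1 tm hK.
  have ta : t 1%N `^ al = t 1%N * t 1%N `^ (al - 1).
    by rewrite -{2}(powRr1 (ltW t1)) -powRD_pos//; congr (_ `^ _); ring.
  apply: (le_trans h); apply: (@le_trans _ _ (Q * (t 1%N * (Kc * t m `^ (al - 1))))).
    rewrite ta; apply: ler_pM.
    + exact: crude_const_ge0.
    + by rewrite mulr_ge0 ?powR_ge0// ltW.
    + by apply: crude_const_mono => //; exact: ltnW.
    + by apply: ler_wpM2l => //; exact: ltW.
  have -> : Q * (t 1%N * (Kc * t m `^ (al - 1))) = Q * Kc * (t 1%N * t m `^ (al - 1)) by ring.
  rewrite mulrDl; apply: ler_wpDr; first exact: mulr_ge0.
  by apply: ler_wpM2l; [exact: mulr_ge0|exact: ler_peMr].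
- have m0M : (m0 <= M)%N by exact: leq_trans mM.
  have pm0 : (p < m0)%N by exact: leq_trans m1m0.
  have bar' j : (m0 <= j <= M)%N -> cb * j%:R `^ (- dl) <=
      t j * \sum_(i < j) row_coef al t j i * (bw al t dl p i.+1 - bw al t dl p i).
    by move=> /andP[j0 jM]; apply: (bar M) => //; rewrite jM (leq_trans m1m0).
  have rate j : (m0 <= j <= M)%N -> rho j <= A * j%:R `^ (- (r + dl)).
    by move=> /andP[j0 jM]; apply: rho_rate; rewrite jM (leq_trans m03).
  have h := error_bound_large D_lin dot_lin dot_sym dot_ge0 frm_lin frm_sym frm_ge0 al0 al1 C1 A0
    rm close e0 De rho0 rhoA row Kc1 (hKc M t rm) Km0 cb0 p0 pC pm0 bar' rate m0M mr.
  have WE : bw al t dl p m = t m `^ (al - 1) * bphi t dl m.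
    by case: (m) m_gt0 m0m => // n _ nm; rewrite /bw (maxn_idPl _)// ltnW// (leq_trans pm0).
  apply: (le_trans h); rewrite WE -/F.
  have -> : F * t 1%N * (t m `^ (al - 1) * bphi t dl m) =
    F * (t 1%N * t m `^ (al - 1) * bphi t dl m) by rewrite !mulrA.
  by apply: ler_wpM2r => //; rewrite lerDr; exact: mulr_ge0 Q0 Kc0.
Qed.

(** * Measurability of open sets and continuous functions in R^d *)

Section euclidean_measurability.
Context {R : realType} {d : nat}.
Local Notation V := 'rV[R]_d.
Local Notation mu := (lebesgue_rV R d).

Lemma measurable_ball_rV (x : V) (e : R) : measurable (ball x e : set V).
Proof.
have [e0|e0] := ltP 0 e; last first.
  rewrite (_ : ball x e = set0) //; apply/seteqP; split=> // y [h _].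
  by move: (lt_le_trans h e0); rewrite ltxx.
rewrite (_ : ball x e = \bigcap_(i in [set: 'I_d]) ((fun y : V => y 0 i) @^-1` ball (x 0 i) e)).
  apply: fin_bigcap_measurable => // i _.
  rewrite -[X in measurable X]setTI; apply: (@measurable_rV_coord R d i) => //.
  exact: measurable_ball.
apply/seteqP; split=> y /=.
  by move=> [_ h] i _; exact: h.
by move=> h; split=> // i j; rewrite (ord1 i); exact: h.
Qed.

(** An open set is the countable union of the balls with rational centre and radius 1/(n+1)
    contained in it, and balls in the maximum norm are finite intersections of coordinate
    conditions. *)
Lemma open_measurable_rV (U : set V) : open U -> measurable U.
Proof.
move=> oU.
pose q (p : 'rV[rat]_d * nat) : V := map_mx ratr p.1.
pose B (p : 'rV[rat]_d * nat) : set V :=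
  if pselect (ball (q p) (p.2.+1%:R^-1) `<=` U) then ball (q p) (p.2.+1%:R^-1) else set0.
have -> : U = \bigcup_p B p.
  apply/seteqP; split=> x; last by case=> p _; rewrite /B; case: pselect => // h /h.
  move=> Ux; have /nbhs_ballP[e /= e0 xeU] : nbhs x U by exact: open_nbhs_nbhs.
  pose n := Num.truncn (2 / e).
  have [w [w0 we wE]] : exists w : R, [/\ 0 < w, w < e / 2 & n.+1%:R^-1 = w].
    exists n.+1%:R^-1; split=> //.
    rewrite -(invf_div 2 e) ltf_pV2 ?posrE ?divr_gt0//; exact: truncnS_gt.
  have /choice[y hy] : forall i : 'I_d, exists y : rat, ball (ratr y : R) w (x 0 i).
    move=> i; have lt : x 0 i - w < x 0 i + w by lra.
    have [y hy] := rat_in_itvoo lt; exists y.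
    by move: hy; rewrite in_itv/= => /andP[h1 h2]; rewrite /ball/= ltr_norml; apply/andP; split; lra.
  have qE i : q (\row_i y i, n) 0 i = ratr (y i) by rewrite /q !mxE.
  have bx : ball (q (\row_i y i, n)) w x.
    by split=> // i j; rewrite (ord1 i) qE; exact: hy.
  exists (\row_i y i, n) => //; rewrite /B /= wE; case: pselect => //= h; exfalso; apply: h => z bz.
  apply: xeU; split=> // i j.
  have : ball x (w + w) z by exact: ball_triangle (ball_sym bx) bz.
  by move=> [_ /(_ i j)]; apply: le_ball; lra.
apply: countable_bigcupT_measurable; first exact: countableP.
by move=> p; rewrite /B; case: pselect => h /=; [exact: measurable_ball_rV|exact: measurable0].
Qed.

Lemma open_continuous_measurable_rV (Om : set V) (f : V -> R) : open Om ->
  {within Om, continuous f} -> measurable_fun Om f.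
Proof.
move=> oO; rewrite continuous_open_subspace// => cf.
apply: (measurability _ (RGenOpens.measurableE R)) => _ [_ [a [b ->]] <-].
apply: open_measurable_rV; rewrite openE => x [Ox fx].
apply: filterI; first exact: open_nbhs_nbhs.
by apply: cf; [rewrite inE|exact: open_nbhs_nbhs].
Qed.

End euclidean_measurability.

                              

(** * Square-integrable functions on the domain *)

Section square_integrable.
Context {R : realType} {d : nat}.
Local Notation V := 'rV[R]_d.
Local Notation mu := (lebesgue_rV R d).
Variable Om : set V.
Implicit Types (f g h v w b : V -> R).

Lemma restrict_lin (a : R) f g :
  (fun x => a * f x + g x) \_ Om = (fun x => a * (f \_ Om) x + (g \_ Om) x).
Proof. by apply/funext => x; rewrite !patchE; case: ifPn => // _; rewrite mulr0 addr0. Qed.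

Lemma restrict_mul f g : (fun x => f x * g x) \_ Om = (f \_ Om) \* (g \_ Om).
Proof. by apply/funext => x; rewrite /= !patchE; case: ifPn => // _; rewrite mulr0. Qed.

Lemma in_L2_measurable f : in_L2 Om f -> measurable_fun setT (f \_ Om).
Proof. by rewrite /in_L2 => /andP[]; rewrite inE. Qed.

Lemma in_L2P f : in_L2 Om f <-> measurable_fun setT (f \_ Om) /\
  mu.-integrable setT (EFin \o (fun x => (f \_ Om) x ^+ 2)).
Proof.
split; first by move=> fL; split; [exact: in_L2_measurable|exact: Lfun2_integrable_sqr].
move=> [mf /integrableP[_ fi]]; rewrite /in_L2 inE; apply/andP; split; rewrite inE//=.
rewrite /finite_norm unlock poweR_lty//; apply: le_lt_trans fi; apply: ge0_le_integral => //.
- by move=> x _; exact: poweR_ge0.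
- apply/measurable_EFinP; apply: (@measurableT_comp _ _ _ _ _ _ (fun x : R => x `^ 2)) => //.
  exact: measurableT_comp.
- apply: measurableT_comp => //; apply/measurable_EFinP; exact: measurable_funX.
- by move=> x _ /=; rewrite lee_fin normrX powR_mulrn.
Qed.

Lemma in_L2_lin (a : R) f g : in_L2 Om f -> in_L2 Om g -> in_L2 Om (fun x => a * f x + g x).
Proof.
move=> fL gL; rewrite /in_L2 restrict_lin.
have [_ h] : submod_closed (Lfun mu 2%:E) by apply: Lfun_submod_closed; rewrite lee_fin ler1n.
exact: (h a (f \_ Om) (g \_ Om)).
Qed.

Lemma in_L2_cst0 : in_L2 Om (fun=> 0).
Proof.
rewrite /in_L2 (_ : _ \_ _ = fun=> 0); last by apply/funext => x; rewrite patchE; case: ifP.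
by have [] : submod_closed (Lfun mu 2%:E) by apply: Lfun_submod_closed; rewrite lee_fin ler1n.
Qed.

Lemma L2_mul_integrable f g : in_L2 Om f -> in_L2 Om g ->
  mu.-integrable setT (EFin \o ((f \_ Om) \* (g \_ Om))).
Proof. by move=> fL gL; apply/Lfun1_integrable; exact: Lfun2_mul_Lfun1. Qed.

Lemma L2dotE f g : L2dot Om f g = \int[mu]_x ((f \_ Om) x * (g \_ Om) x).
Proof.
rewrite /L2dot /Rintegral integral_mkcond; congr fine; apply: eq_integral => x _.
by rewrite /= !patchE; case: ifPn => // _; rewrite mulr0.
Qed.

Lemma L2dot_lin (a : R) f g h : in_L2 Om f -> in_L2 Om g -> in_L2 Om h ->
  L2dot Om (fun x => a * f x + g x) h = a * L2dot Om f h + L2dot Om g h.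
Proof.
move=> fL gL hL; rewrite !L2dotE.
have i1 := L2_mul_integrable fL hL; have i2 := L2_mul_integrable gL hL.
rewrite -RintegralZl// -RintegralD//; last first.
  rewrite (_ : EFin \o _ = (fun x => a%:E * (EFin \o ((f \_ Om) \* (h \_ Om))%R) x)%E); last exact/funext.
  exact: integrableZl.
by apply: eq_Rintegral => x _; rewrite restrict_lin mulrDl mulrA.
Qed.

Lemma L2dot_sym f g : L2dot Om f g = L2dot Om g f.
Proof. by rewrite /L2dot; apply: eq_Rintegral => x _; rewrite mulrC. Qed.

Lemma L2dot_ge0 f : 0 <= L2dot Om f f.
Proof. by apply: Rintegral_ge0 => x _; rewrite -expr2 sqr_ge0. Qed.

Lemma eq_in_L2 f g : (forall x, Om x -> f x = g x) -> in_L2 Om f -> in_L2 Om g.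
Proof.
move=> fg; rewrite /in_L2 (_ : f \_ Om = g \_ Om)//; apply/funext => x.
by rewrite !patchE; case: ifPn => //; rewrite inE => /fg.
Qed.

Lemma L2norm_sqrt f : in_L2 Om f -> L2norm Om f = (Num.sqrt (L2dot Om f f))%:E.
Proof.
move=> fL; rewrite L2dotE /L2norm unlock poweR12_sqrt; last first.
  by apply: integral_ge0 => x _; rewrite lee_fin powR_ge0.
have i := L2_mul_integrable fL fL.
rewrite (_ : \int[mu]_x _ = (\int[mu]_x ((f \_ Om) x * (f \_ Om) x))%:E)%E//.
rewrite /Rintegral fineK; last exact: integrable_fin_num.
by apply: eq_integral => x _ /=; rewrite powR_mulrn// real_normK ?num_real// expr2.
Qed.

Lemma L2_cauchy_schwarz f g : in_L2 Om f -> in_L2 Om g ->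
  `|L2dot Om f g| <= Num.sqrt (L2dot Om f f) * Num.sqrt (L2dot Om g g).
Proof.
move=> fL gL.
rewrite -sqrtrM ?L2dot_ge0// -sqrtr_sqr ler_wsqrtr//.
exact: (@psd_cauchy_schwarz_sq R (V -> R) (in_L2 Om) (L2dot Om) in_L2_lin
  (fun a x y z => @L2dot_lin a x y z) (fun x y _ _ => L2dot_sym x y) (fun x _ => L2dot_ge0 x) f g fL gL).
Qed.

(** Minkowski for extended-real norms: it applies to approximating sequences without first knowing
    that their norms are finite. *)
Lemma L2norm_lin (a : R) f g : measurable_fun setT (f \_ Om) -> measurable_fun setT (g \_ Om) ->
  (L2norm Om (fun x => (a * f x + g x)%R) <= `|a|%:E * L2norm Om f + L2norm Om g)%E.
Proof.
move=> mf mg; rewrite /L2norm restrict_lin.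
have maf : measurable_fun setT (fun x => a * (f \_ Om) x) by exact: measurable_funM.
apply: le_trans (eminkowski _ maf mg _) _; first by rewrite lee_fin ler1n.
apply: leeD => //; rewrite unlock.
have mf2 : measurable_fun setT (fun x => (`|(f \_ Om) x|%:E `^ 2)%E).
  apply/measurable_EFinP; apply: (@measurableT_comp _ _ _ _ _ _ (fun x : R => x `^ 2)) => //.
  exact: measurableT_comp.
rewrite (_ : \int[mu]_x _ = (`|a| `^ 2)%:E * \int[mu]_x (`|(f \_ Om) x|%:E `^ 2))%E; last first.
  rewrite -ge0_integralZl ?lee_fin ?powR_ge0//; last by move=> x _; exact: poweR_ge0.
  by apply: eq_integral => x _ /=; rewrite normrM powRM// EFinM.
have h1 : (0 <= (`|a| `^ 2)%:E)%E by rewrite lee_fin powR_ge0.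
have h2 : (0 <= \int[mu]_x (`|(f \_ Om) x|%:E `^ 2))%E.
  by apply: integral_ge0 => x _; exact: poweR_ge0.
by rewrite (poweRM _ h1 h2) poweR_EFin -powRrM mulfV// powRr1.
Qed.

Definition bounded_weight b : Prop :=
  measurable_fun setT (b \_ Om) /\ exists A : R, forall x, Om x -> `|b x| <= A.

Lemma in_L2_weight b f : bounded_weight b -> in_L2 Om f -> in_L2 Om (fun x => b x * f x).
Proof.
move=> [mb [A bA]] /in_L2P[mf fi]; apply/in_L2P; rewrite restrict_mul; split.
  exact: measurable_funM.
have i2 : mu.-integrable setT (fun x => (A ^+ 2)%:E * (EFin \o (fun x => ((f \_ Om) x ^+ 2)%R)) x)%E.
  exact: integrableZl.
apply: le_integrable i2 => //.
  by apply/measurable_EFinP; apply: measurable_funX; exact: measurable_funM.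
move=> x _; rewrite /= lee_fin (ger0_norm (sqr_ge0 _)) (ger0_norm (mulr_ge0 (sqr_ge0 _) (sqr_ge0 _))) exprMn.
rewrite !patchE; case: ifPn; last by rewrite expr2 !mul0r expr2 !mulr0.
rewrite inE => Ox; apply: ler_wpM2r; first exact: sqr_ge0.
by rewrite -(real_normK (num_real (b x))) lerXn2r ?nnegrE//; [exact: le_trans (bA x Ox)|exact: bA].
Qed.

End square_integrable.

(** * Coefficients and the space H^1_0 *)

Section sobolev_space.
Context {R : realType} {d : nat}.
Local Notation V := 'rV[R]_d.
Local Notation mu := (lebesgue_rV R d).
Variable Om : set V.
Hypothesis oOm : open Om.

Let mOm : measurable Om. Proof. exact: open_measurable_rV. Qed.

Lemma continuous_restrict_measurable (f : V -> R) :
  {within Om, continuous f} -> measurable_fun setT (f \_ Om).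
Proof.
move=> cf; apply/measurable_restrict => //; rewrite setTI.
exact: open_continuous_measurable_rV.
Qed.

Lemma differentiable_restrict_measurable (f : V -> R) :
  (forall x, differentiable f x) -> measurable_fun setT (f \_ Om).
Proof.
move=> df; apply: continuous_restrict_measurable.
by apply: continuous_subspaceT => x; exact: differentiable_continuous.
Qed.

Lemma test_function_measurable (f : V -> R) (s : seq 'I_d) : test_function Om f ->
  measurable_fun setT ((foldr (@partial R d) f s) \_ Om).
Proof. by move=> [df _]; exact: differentiable_restrict_measurable (df s). Qed.

Lemma closure_weight (b : V -> R) : bounded_set Om -> {within closure Om, continuous b} ->
  bounded_weight Om b.
Proof.
move=> bO cb; split.
  apply: continuous_restrict_measurable; apply: continuous_subspaceW cb.
  exact: subset_closure.
have cO : compact (closure Om).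
  apply: bounded_closed_compact; last exact: closed_closure.
  have [A [_ hA]] := bO; exists (`|A| + 2); split; first exact: num_real.
  move=> B hB x cx.
  have [y [Oy xy]] := cx _ (nbhsx_ballx x _ ltr01).
  have hy : `|y| <= `|A| + 1 by apply: (hA (`|A| + 1)) => //; apply: le_lt_trans (ler_norm A) _; rewrite ltrDl.
  move: xy; rewrite -ball_normE /= => xy.
  have : `|x| <= `|x - y| + `|y| by rewrite -{1}(subrK y x) ler_normD.
  move: hB xy hy; lra.
have [A [_ hA]] := compact_bounded (continuous_compact cb cO).
exists (`|A| + 1) => x Ox; apply: (hA (`|A| + 1)).
  by apply: le_lt_trans (ler_norm A) _; rewrite ltrDl.
by exists x => //; exact: subset_closure.
Qed.

Lemma partial_lin (k : 'I_d) (a : R) (f g : V -> R) :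
  (forall x, differentiable f x) -> (forall x, differentiable g x) ->
  partial k (fun x => a * f x + g x) = fun x => a * partial k f x + partial k g x.
Proof.
move=> df dg; apply/funext => x; rewrite /partial.
have df' : derivable f x (delta_mx 0 k) by exact: diff_derivable.
have dg' : derivable g x (delta_mx 0 k) by exact: diff_derivable.
rewrite (_ : (fun x => a * f x + g x) = a *: f + g)//.
by rewrite deriveD ?deriveZ//; exact: derivableZ.
Qed.

Lemma foldr_partial_lin (s : seq 'I_d) (a : R) (f g : V -> R) :
  (forall s x, differentiable (foldr (@partial R d) f s) x) ->
  (forall s x, differentiable (foldr (@partial R d) g s) x) ->
  foldr (@partial R d) (fun x => a * f x + g x) s =
  fun x => a * foldr (@partial R d) f s x + foldr (@partial R d) g s x.
Proof.
by move=> df dg; elim: s => [//|k s IH] /=; rewrite IH partial_lin.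
Qed.

Lemma test_function_lin (a : R) (f g : V -> R) : test_function Om f -> test_function Om g ->
  test_function Om (fun x => a * f x + g x).
Proof.
move=> [df [Kf [cKf KfO f0]]] [dg [Kg [cKg KgO g0]]]; split.
  move=> s x; rewrite foldr_partial_lin//.
  rewrite (_ : (fun x => _) = a *: foldr (@partial R d) f s + foldr (@partial R d) g s)//.
  by apply: differentiableD => //; exact: differentiableZ.
exists (Kf `|` Kg); split; first exact: compactU.
- by move=> x [/KfO|/KgO].
- by move=> x nK; rewrite f0 ?g0 ?mulr0 ?addr0// => Kx; apply: nK; [right|left].
Qed.

Lemma L2norm_cvg_lin (a : R) (p q : nat -> V -> R) (v w : V -> R) :
  (forall n, measurable_fun setT (p n \_ Om)) -> (forall n, measurable_fun setT (q n \_ Om)) ->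
  measurable_fun setT (v \_ Om) -> measurable_fun setT (w \_ Om) ->
  L2norm Om (p n \- v) @[n --> \oo] --> 0%E ->
  L2norm Om (q n \- w) @[n --> \oo] --> 0%E ->
  L2norm Om ((fun x => a * p n x + q n x) \- (fun x => a * v x + w x)) @[n --> \oo] --> 0%E.
Proof.
move=> mp mq mv mw cp cq.
have ms (f g : V -> R) : measurable_fun setT (f \_ Om) -> measurable_fun setT (g \_ Om) ->
    measurable_fun setT ((f \- g) \_ Om).
  move=> mf mg; rewrite (_ : (f \- g) \_ Om = fun x => (f \_ Om) x - (g \_ Om) x).
    exact: measurable_funB.
  by apply/funext => x; rewrite !patchE; case: ifPn => // _; rewrite subrr.
have bnd n : (0 <= L2norm Om ((fun x => a * p n x + q n x) \- (fun x => a * v x + w x))%R <=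
    `|a|%:E * L2norm Om (p n \- v)%R + L2norm Om (q n \- w)%R)%E.
  rewrite Lnorm_ge0 /=.
  rewrite (_ : _ \- _ = fun x => a * (p n \- v) x + (q n \- w) x); last first.
    by apply/funext => x /=; ring.
  by apply: L2norm_lin; exact: ms.
have c1 : (`|a|%:E * L2norm Om (p n \- v)%R)%E @[n --> \oo] --> 0%E.
  by rewrite -[X in _ --> X](mule0 `|a|%:E); apply: cvgeZl.
have c2 : (`|a|%:E * L2norm Om (p n \- v)%R + L2norm Om (q n \- w)%R)%E @[n --> \oo] --> 0%E.
  by rewrite -[X in _ --> X](adde0 0%E); apply: cvgeD.
apply: (squeeze_cvge _ (cvg_cst _) c2).
by apply: nearW => n; exact: bnd.
Qed.

Lemma H10_lin (a : R) v w g h : H10 Om v g -> H10 Om w h ->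
  H10 Om (fun x => a * v x + w x) (fun k x => a * g k x + h k x).
Proof.
move=> [vL gL [p [tp cp cpk]]] [wL hL [q [tq cq cqk]]]; split.
- exact: in_L2_lin.
- by move=> k; exact: in_L2_lin.
exists (fun n x => a * p n x + q n x); split.
- by move=> n; exact: test_function_lin.
- apply: L2norm_cvg_lin => //; try exact: in_L2_measurable.
  + by move=> n; exact: (test_function_measurable [::] (tp n)).
  + by move=> n; exact: (test_function_measurable [::] (tq n)).
- move=> k.
  have E n : partial k (fun x => a * p n x + q n x) =
      fun x => a * partial k (p n) x + partial k (q n) x.
    have [dp _] := tp n; have [dq _] := tq n.
    by apply: partial_lin; [exact: (dp [::])|exact: (dq [::])].
  under eq_fun do rewrite E.
  apply: L2norm_cvg_lin => //; try exact: in_L2_measurable.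
  + by move=> n; exact: (test_function_measurable [:: k] (tp n)).
  + by move=> n; exact: (test_function_measurable [:: k] (tq n)).
Qed.

End sobolev_space.

(** * Time derivatives tested against a fixed function *)

Section pairing.
Context {R : realType} {d : nat}.
Local Notation V := 'rV[R]_d.
Variables (Om : set V) (T : R) (v w : R -> V -> R) (z : V -> R).
Hypothesis zL : in_L2 Om z.
Hypothesis vL : forall s, 0 < s <= T -> in_L2 Om (v s).
Hypothesis vw : L2_deriv Om T v w.
Let phi s := L2dot Om (v s) z.

Let L2norm_near0 (F : set_system R) (q : R -> V -> R) (e : R) : Filter F -> 0 < e ->
  L2norm Om (q s) @[s --> F] --> 0%E -> \forall s \near F, (L2norm Om (q s) < e%:E)%E.
Proof.
move=> FF e0 /(_ [set y | (y < e%:E)%E]); apply.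
by apply: open_nbhs_nbhs; split; [exact: open_ereal_lt_ereal|rewrite /= lte_fin].
Qed.

(** Cauchy-Schwarz transfers the norm convergence of the difference quotients to the pairing;
    dividing by Z + 1 includes the case Z = 0. *)
Lemma pairing_quotient t (e : R) : 0 < t <= T -> 0 < e ->
  exists2 dt : R, 0 < dt & forall s, `|s - t| < dt -> s != t -> 0 < s <= T ->
    `|(s - t)^-1 * (phi s - phi t) - L2dot Om (w t) z| <= e.
Proof.
move=> tT e0; have [wL cw] := vw tT.
set Z := Num.sqrt (L2dot Om z z); have Z0 : 0 <= Z by exact: sqrtr_ge0.
have eZ : 0 < e / (Z + 1) by rewrite divr_gt0// ltr_wpDl.
have FF : Filter (within `]0, T] t^') by exact: within_filter.
have := L2norm_near0 FF eZ cw.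
rewrite near_withinE /dnbhs near_withinE => /nbhs_ballP[dt /= dt0 h].
exists dt => // s st sn sT.
have hs : ball t dt s by rewrite /ball/= distrC.
have ins : s \in `]0, T] by rewrite in_itv/=.
have {h} := h s hs sn ins.
set q := fun x => _ => hq.
have qL : in_L2 Om q.
  have -> : q = (fun x => (s - t)^-1 * (fun x => (-1) * v t x + v s x) x + (fun x => (-1) * w t x + 0) x).
    by apply/funext => x; rewrite /q; ring.
  apply: in_L2_lin; first by apply: in_L2_lin; exact: vL.
  by apply: in_L2_lin => //; exact: in_L2_cst0.
have -> : (s - t)^-1 * (phi s - phi t) - L2dot Om (w t) z = L2dot Om q z.
  have -> : q = (fun x => (s - t)^-1 * (fun x => (-1) * v t x + v s x) x + (fun x => (-1) * w t x + 0) x).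
    by apply/funext => x; rewrite /q; ring.
  have z0L := in_L2_cst0 Om.
  rewrite L2dot_lin//; [|by apply: in_L2_lin; exact: vL|by apply: in_L2_lin].
  rewrite !L2dot_lin//; [|exact: vL|exact: vL].
  have -> : L2dot Om (fun=> 0) z = 0.
    have := L2dot_lin (-1) z0L z0L zL.
    rewrite (_ : (fun x => _) = fun=> 0); last by apply/funext => x; rewrite mulr0 addr0.
    by lra.
  by rewrite /phi; ring.
apply: (le_trans (L2_cauchy_schwarz qL zL)).
move: hq; rewrite (L2norm_sqrt qL) lte_fin -/Z => hq.
apply: (@le_trans _ _ (e / (Z + 1) * Z)); first by apply: ler_wpM2r => //; exact: ltW.
by rewrite mulrAC ler_pdivrMr ?ltr_wpDl// ler_pM2l// lerDl.
Qed.

Lemma pairing_is_derive (t : R) : t \in `]0, T[ -> is_derive t 1 phi (L2dot Om (w t) z).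
Proof.
rewrite in_itv/= => /andP[t0 tT]; have tT' : 0 < t <= T by rewrite t0 ltW.
have lim : h^-1 *: (phi (h *: 1 + t) - phi t) @[h --> 0^'] --> L2dot Om (w t) z.
  apply/cvgrPdist_le => e e0; have [dt dt0 h] := pairing_quotient tT' e0.
  rewrite /dnbhs near_withinE; apply/nbhs_ballP.
  exists (Num.min dt (Num.min t (T - t))) => /=; first by rewrite !lt_min dt0 t0 subr_gt0.
  move=> x; rewrite /ball/= sub0r normrN !lt_min => /and3P[x1 x2 x3] xn.
  have [x2a x2b] : - t < x /\ x < t by move: x2; rewrite ltr_norml => /andP[].
  have x3b : x < T - t by apply: le_lt_trans x3; exact: ler_norm.
  have := h (x + t); rewrite addrK => /(_ x1) H.
  rewrite distrC /GRing.scale /= mulr1; apply: H; first by rewrite -subr_eq0 addrK.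
  by apply/andP; split; lra.
apply: DeriveDef; first by apply/cvg_ex; exists (L2dot Om (w t) z).
exact: (cvg_lim _ lim).
Qed.

Lemma pairing_left_continuous : 0 < T -> phi @ T^'- --> phi T.
Proof.
move=> T0; have TT : 0 < T <= T by rewrite T0 lexx.
have [dt dt0 h] := pairing_quotient TT ltr01.
set l := L2dot Om (w T) z in h.
apply/cvgrPdist_le => e e0.
have l1 : 0 < `|l| + 1 by rewrite ltr_wpDl.
have q0 : 0 < Num.min dt (Num.min T (e / (`|l| + 1))) by rewrite !lt_min dt0 T0 divr_gt0.
rewrite /at_left near_withinE; apply/nbhs_ballP.
exists (Num.min dt (Num.min T (e / (`|l| + 1)))) => //= s.
rewrite /ball/= !lt_min => /and3P[s1 s2 s3] sT.
have sn : s != T by rewrite lt_eqF.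
have s0 : 0 < s by move: s2; rewrite ltr_norml => /andP[]; lra.
have sT' : 0 < s <= T by rewrite s0 ltW.
rewrite distrC in s1; have := h s s1 sn sT'.
have st0 : s - T != 0 by rewrite subr_eq0.
move=> H.
have E : phi s - phi T = (s - T) * ((s - T)^-1 * (phi s - phi T)) by rewrite mulVKf.
rewrite distrC E normrM.
have H2 : `|(s - T)^-1 * (phi s - phi T)| <= `|l| + 1.
  by rewrite -[X in `|X|](subrK l); apply: le_trans (ler_normD _ _) _; rewrite addrC lerD2l.
rewrite distrC in s3; rewrite ltr_pdivlMr// in s3.
by apply: le_trans (ltW s3); apply: ler_pM.
Qed.

End pairing.

Lemma pairing_right_continuous (R : realType) (d : nat) (Om : set 'rV[R]_d) (T : R)
    (u : R -> 'rV[R]_d -> R) (z : 'rV[R]_d -> R) : 0 < T -> in_L2 Om z -> in_L2 Om (u 0) ->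
  (forall s, 0 < s <= T -> in_L2 Om (u s)) ->
  L2norm Om (u s \- u 0) @[s --> 0^'+] --> 0%E ->
  L2dot Om (u s) z @[s --> 0^'+] --> L2dot Om (u 0) z.
Proof.
move=> T0 zL u0L uL cu; apply/cvgrPdist_le => e e0.
set Z := Num.sqrt (L2dot Om z z); have Z0 : 0 <= Z by exact: sqrtr_ge0.
have eZ : 0 < e / (Z + 1) by rewrite divr_gt0// ltr_wpDl.
have n1 : \forall s \near 0^'+, (L2norm Om (u s \- u 0)%R < (e / (Z + 1))%:E)%E.
  apply: (cu [set y | (y < (e / (Z + 1))%:E)%E]).
  by apply: open_nbhs_nbhs; split; [exact: open_ereal_lt_ereal|rewrite /= lte_fin].
near=> s.
have s0 : 0 < s by near: s; exact: nbhs_right_gt.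
have sT : s < T by near: s; exact: nbhs_right_lt.
have sL : in_L2 Om (u s) by apply: uL; rewrite s0 ltW.
have : (L2norm Om (u s \- u 0)%R < (e / (Z + 1))%:E)%E by near: s; exact: n1.
have E : u s \- u 0 = fun x => (-1) * u 0 x + u s x by apply/funext => x /=; ring.
have qL : in_L2 Om (u s \- u 0) by rewrite E; exact: in_L2_lin.
rewrite (L2norm_sqrt qL) lte_fin => hq.
have -> : L2dot Om (u 0) z - L2dot Om (u s) z = - L2dot Om (u s \- u 0) z.
  by rewrite E L2dot_lin//; ring.
rewrite normrN; apply: (le_trans (L2_cauchy_schwarz qL zL)); rewrite -/Z.
apply: (@le_trans _ _ (e / (Z + 1) * Z)); first by apply: ler_wpM2r => //; exact: ltW.
by rewrite mulrAC ler_pdivrMr ?ltr_wpDl// ler_pM2l// lerDl.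
Unshelve. all: by end_near.
Qed.

(** The integrand is dominated by exp(-s) plus s^(z-1) on the unit interval, and on that interval it
    is at least 1/e because z <= 1. Integrability is needed first: an infinite integral would be
    read as the real number 0. *)
Lemma Gamma_gt0 (R : realType) (z : R) : 0 < z <= 1 -> 0 < Gamma z.
Proof.
move=> /andP[z0 z1].
set g := fun s : R => s `^ (z - 1) * expR (- s).
set p := exponential_pdf (1 : R).
have pE (s : R) : 0 <= s -> p s = expR (- s).
  by move=> s0; rewrite /p exponential_pdfE// !mul1r mulN1r.
have mpw : measurable_fun `](0:R), +oo[ (@powR R ^~ (z - 1)).
  apply: open_continuous_measurable_fun; first exact: interval_open.
  by move=> x; rewrite inE/= in_itv/= andbT => x0; exact: powR_continuous_pos.
have mg : measurable_fun `](0:R), +oo[ g.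
  apply: measurable_funM => //; apply: measurable_funTS.
  by apply: measurableT_comp => //; exact: oppr_measurable.
have ge0 (s : R) : 0 <= g s by rewrite mulr_ge0 ?powR_ge0 ?expR_ge0.
have i1 : (@lebesgue_measure R).-integrable `]0, +oo[ (EFin \o p).
  by apply: (@integrableS _ _ _ _ setT) => //; exact: integrable_exponential_pdf.
have i2 : (@lebesgue_measure R).-integrable `]0, +oo[
    (EFin \o ((@powR R ^~ (z - 1)) \_ `]0, 1[)).
  rewrite -restrict_EFin; apply: (@integrableS _ _ _ _ setT) => //.
  rewrite -integrable_mkcond//; apply: powR_integrable => //; lra.
have ig : (@lebesgue_measure R).-integrable `]0, +oo[ (EFin \o g).
  apply: (le_integrable _ _ _ (integrableD _ i1 i2)) => //.
    by apply/measurable_EFinP.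
  move=> s /=; rewrite in_itv/= andbT => s0.
  have p0 : 0 <= p s by rewrite pE ?expR_ge0// ltW.
  rewrite /patch; case: ifPn => /=; rewrite mem_setE in_itv/= s0/=.
    move=> s1; rewrite lee_fin ger0_norm// ger0_norm ?addr_ge0 ?powR_ge0//.
    apply: (@le_trans _ _ (s `^ (z - 1))); last by rewrite lerDr.
    by rewrite -[leRHS]mulr1 ler_wpM2l ?powR_ge0// -expR0 ler_expR; lra.
  rewrite -leNgt => s1; rewrite addr0 lee_fin !ger0_norm// pE ?(ltW s0)//.
  rewrite -[leRHS]mul1r ler_wpM2r ?expR_ge0//.
  by rewrite -[leRHS](powRr0 s) ler_powR//; lra.
apply: (@lt_le_trans _ _ (\int[lebesgue_measure]_(s in `]0, 1[) (expR (-1) : R))).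
  rewrite Rintegral_cst//= lebesgue_measure_itv/= lte_fin ltr01/= oppr0 addr0 mulr1.
  exact: expR_gt0.
have ig1 : (@lebesgue_measure R).-integrable `]0, 1[ (EFin \o g).
  by apply: integrableS ig => //; apply: subset_itvl; rewrite bnd_simp.
apply: (@le_trans _ _ (\int[lebesgue_measure]_(s in `]0, 1[) g s)).
  apply: le_Rintegral => //.
    apply/integrableP; split; first exact: measurable_cst.
    rewrite integral_cst//= lebesgue_measure_itv/= lte_fin ltr01/= oppr0 adde0 mule1.
    exact: ltry.
  move=> s /=; rewrite in_itv/= => /andP[s0 s1].
  rewrite -[leLHS]mul1r ler_pM ?expR_ge0// ?ler_expR; last lra.
  by rewrite -[leLHS](powRr0 s) ger_powR ?s0 ?(ltW s1)//; lra.
apply: fine_le; [exact: integrable_fin_num|exact: integrable_fin_num|].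
apply: ge0_subset_integral => //; first exact/measurable_EFinP.
- by move=> s _; rewrite lee_fin.
- by apply: subset_itvl; rewrite bnd_simp.
Qed.

(** * From the mesh hypotheses to regular meshes *)

Lemma graded_regular (R : realType) (T r C0 C : R) M t : 1 <= C -> C0 <= C ->
  graded_mesh T r C0 M t -> sigma_monotone M t -> regular_mesh C r M t.
Proof.
move=> C1 C0C [t0 tM st _ h] [sg _].
have inc j : (j < M)%N -> t j < t j.+1.
  by move=> jM; rewrite -subr_gt0; exact: st.
have tp j : (1 <= j <= M)%N -> 0 < t j.
  move=> /andP[j1 jM]; rewrite -t0; apply: (@lt_le_trans _ _ (t 1%N)).
    by apply: inc; exact: leq_trans jM.
  exact: (increasing_le inc).
split=> // j.
- move=> jM; have jM' : (j.+2 <= M)%N by [].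
  have := sg j.+2; rewrite /= jM => /(_ isT); rewrite /mesh_sigma.
  have s1 := st j.+2 jM'; have s2 := st j.+1 (ltnW jM').
  by rewrite /mesh_step/= in s1 s2 *; rewrite pmulr_lge0 ?invr_gt0 ?subr_ge0// addr_gt0.
- move=> jM; have [[h1 _] _] := h j.+1 jM.
  apply: (le_trans h1); rewrite ler_wpM2r// divr_ge0 ?ler0n//.
  by apply: ltW; exact: tp.
- move=> jM; have [_ [h1 h2]] := h j jM.
  have tj := tp j jM; have M1 : (0 < M)%N by case/andP: jM; exact: leq_trans.
  have t1 : 0 < t 1%N by apply: tp; rewrite M1.
  rewrite /mesh_step/= t0 subr0 in h1 h2; split.
    by apply: (le_trans h1); rewrite ler_wpM2r// mulr_ge0 ?powR_ge0// ltW.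
  by apply: (le_trans h2); rewrite ler_wpM2r// ltW.
Qed.

(** The bound 1/1000 on sigma_j means that a step is at least 999/1001 of the next one, more than
    the 399/400 required. *)
Lemma sigma_steps_close (R : realType) (T r C0 : R) K M t :
  graded_mesh T r C0 M t ->
  (forall j, (K.+1 <= j <= M)%N -> 0 <= mesh_sigma t j <= 1 / 1000) ->
  steps_close K M t.
Proof.
move=> [_ _ st _ _] sg j KjM j1; have /andP[Kj jM] := KjM.
have := sg j KjM; rewrite /mesh_sigma => /andP[_].
have s1 : 0 < mesh_step t j by apply: st; rewrite (ltnW j1).
have s2 : 0 < mesh_step t j.-1.
  by apply: st; rewrite (leq_trans (leq_pred _) jM) andbT; case: j j1 {KjM Kj jM s1} => [|[]].
rewrite /mesh_step in s1 s2 *.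
move: s1 s2; move: (t j - t j.-1) (t j.-1 - t j.-2) => x y s1 s2.
by rewrite (ler_pdivrMr _ _ (addr_gt0 s1 s2)) => h; lra.
Qed.

(** * Growth of Phi and the resulting error rate *)

Section barrier_rates.
Context {R : realType}.
Variables (C r : R) (M : nat) (t : nat -> R).
Hypothesis C1 : 1 <= C.
Hypothesis rm : regular_mesh C r M t.

Lemma bphi_bounded (dl : R) m : 0 < dl -> (m <= M)%N -> bphi t dl m <= 1 + C * (1 + dl^-1).
Proof.
move=> dl0 mM; rewrite /bphi lerD2l.
apply: le_trans (_ : C * \sum_(1 <= i < m.+1) i%:R `^ (-1 - dl) <= _); last first.
  by rewrite ler_wpM2l ?sum_powR_le// (le_trans ler01).
rewrite mulr_sumr big_nat_cond [leRHS]big_nat_cond; apply: ler_sum => i.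
rewrite andbT => /andP[i1 im]; case: i i1 im => // i _ im.
have iM : (i < M)%N by exact: leq_trans mM.
have ti : 0 < t i.+1 by apply: (mesh_pos rm).
have ip : 0 < i.+1%:R :> R by rewrite ltr0n.
have [_ _ _ h _] := rm.
rewrite powRD_pos// powR_inv1 ?ler0n// mulrA ler_wpM2r ?powR_ge0//= ler_pdivrMr//.
by rewrite mulrAC -mulrA; exact: h.
Qed.

(** With x = t_j/t_(j+1) the summand is 1 - x <= -ln x, and the logarithms telescope. The constant 2
    is the initial 1 plus the first summand, which equals 1. *)
Lemma bphi_log m : (1 <= m <= M)%N -> bphi t 0 m <= 2 + ln (t m / t 1%N).
Proof.
case: m => // m; elim: m => [|m IH] mM.
  have t1 : 0 < t 1%N by apply: (mesh_pos rm).
  case: rm => t0 _ _ _ _.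
  by rewrite /bphi big_nat1/= t0 subr0 divff ?gt_eqF// ln1 powR1; lra.
have t1 : 0 < t 1%N by apply: (mesh_pos rm); rewrite (leq_trans _ mM).
have tm : 0 < t m.+1 by apply: (mesh_pos rm); exact: ltnW mM.
have tm1 : 0 < t m.+2 by apply: (mesh_pos rm).
rewrite bphi_succ oppr0 powRr0 mulr1.
have h2 := @le_ln1Dx R (t m.+1 / t m.+2 - 1).
have x0 : 0 < t m.+1 / t m.+2 by rewrite divr_gt0.
have {}h2 : ln (1 + (t m.+1 / t m.+2 - 1)) <= t m.+1 / t m.+2 - 1.
  by apply: h2; move: x0; set x := _ / _; lra.
rewrite subrKC in h2.
have E : ln (t m.+2 / t 1%N) = ln (t m.+1 / t 1%N) - ln (t m.+1 / t m.+2).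
  by rewrite !ln_div ?posrE//; ring.
have := IH (ltnW mM); rewrite E mulrBl divff ?gt_eqF//; lra.
Qed.

(** With p = q/r < 1, the weight i^q is at most a multiple of (t_i/t_1)^p, and by Bernoulli
    tau_i/t_i times this power is at most 1/p times its increment; the sum telescopes. *)
Lemma bphi_growth (q : R) m : 1 <= r -> 0 < q < r -> (1 <= m <= M)%N ->
  bphi t (- q) m <= (1 + C `^ (q / r) / (q / r)) * (t m / t 1%N) `^ (q / r).
Proof.
move=> r1 /andP[q0 qr] /andP[m1 mM]; set p := q / r.
have r0 : 0 < r by lra.
have p0 : 0 < p by rewrite divr_gt0.
have p1 : p <= 1 by rewrite ler_pdivrMr// mul1r ltW.
have t1 : 0 < t 1%N by apply: (mesh_pos rm); rewrite (leq_trans m1 mM).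
have C0 : 0 <= C `^ p / p by rewrite divr_ge0 ?powR_ge0// ltW.
have [t0 inc _ _ hr] := rm.
have sumb : forall k, (k <= m)%N -> bphi t (- q) k <= 1 + C `^ p / p * (t k / t 1%N) `^ p.
  elim=> [|k IH] km.
    by rewrite /bphi big_geq// addr0 t0 mul0r powR0 ?gt_eqF// mulr0 addr0.
  have kM : (k < M)%N by exact: leq_trans mM.
  have tk1 : 0 < t k.+1 by apply: (mesh_pos rm).
  have tk : 0 <= t k.
    by case: (posnP k) => [->|k0]; rewrite ?t0//; apply/ltW/(mesh_pos rm); rewrite k0 ltnW.
  rewrite bphi_succ opprK.
  apply: (@le_trans _ _ (1 + C `^ p / p * (t k / t 1%N) `^ p +
      C `^ p / p * ((t k.+1 / t 1%N) `^ p - (t k / t 1%N) `^ p))); last lra.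
  apply: lerD; first by apply: IH; exact: ltnW.
  have k1 : k.+1%:R `^ q <= C `^ p * (t k.+1 / t 1%N) `^ p.
    rewrite -powRM ?divr_ge0 ?(ltW tk1) ?(ltW t1) ?(le_trans ler01)//.
    have -> : (k.+1%:R : R) `^ q = (k.+1%:R `^ r) `^ p.
      by rewrite -powRrM; congr (_ `^ _); rewrite /p; field; rewrite gt_eqF.
    apply: powR_mono; [exact: ltW|exact: powR_ge0|].
    by rewrite mulrA ler_pdivlMr// mulrC; case: (hr k.+1 kM).
  have k2 : (t k.+1 - t k) / t k.+1 * p <= 1 - (t k / t k.+1) `^ p.
    have [tk0|tkp] := eqVneq (t k) 0.
      by rewrite tk0 subr0 mul0r powR0 ?gt_eqF// subr0 divff ?gt_eqF// mul1r.
    have tkp' : 0 < t k by rewrite lt_neqAle eq_sym tkp.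
    have := @bernoulli_concave R (t k / t k.+1) p.
    rewrite divr_gt0// => /(_ isT); rewrite (ltW p0) p1 => /(_ isT).
    rewrite mulrBl divff ?gt_eqF//; lra.
  have -> : (t k / t 1%N) `^ p = (t k.+1 / t 1%N) `^ p * (t k / t k.+1) `^ p.
    rewrite -powRM ?divr_ge0 ?(ltW tk1) ?(ltW t1)//; congr (_ `^ _).
    by field; rewrite !gt_eqF.
  have h0 : 0 <= (t k.+1 - t k) / t k.+1.
    by rewrite divr_ge0 ?(ltW tk1)// subr_ge0 ltW// inc.
  apply: (le_trans (ler_wpM2l h0 k1)).
  set X := _ `^ p in k1 *; set Y := (t k.+1 / t 1%N) `^ p.
  set Z := (t k / t k.+1) `^ p in k2 *.
  have -> : C `^ p / p * (Y - Y * Z) = (C `^ p * Y) * ((1 - Z) / p) by field; rewrite gt_eqF.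
  rewrite mulrC ler_wpM2l ?mulr_ge0 ?powR_ge0// ler_pdivlMr//.
apply: (le_trans (sumb m (leqnn m))).
have X1 : 1 <= (t m / t 1%N) `^ p.
  rewrite -(powRr0 (t m / t 1%N)); apply: ler_powR; last exact: ltW.
  by rewrite ler_pdivlMr// mul1r; exact: (increasing_le inc).
by rewrite mulrDl mul1r lerD2r.
Qed.

End barrier_rates.

(** For r > 3-alpha one has dl = -q with q = r - (3-alpha), and t_1 times t_1^(-q/r) equals
    t_1^((3-alpha)/r), of order M^(alpha-3). In the other two cases t_1 is of order M^(-r) and Phi
    is bounded or logarithmic. *)
Lemma barrier_error_rate (R : realType) (al r C : R) : 0 < al -> al < 1 -> 1 <= r ->
  1 <= C ->
  let dl := Num.min (3 - al - r) (al / 4) in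
  exists2 B : R, 0 < B & forall M t m, t 1%N <= C * M%:R `^ (- r) ->
    regular_mesh C r M t -> (1 <= m <= M)%N ->
    t 1%N * t m `^ (al - 1) * bphi t dl m <= B * error_rate al r M t m.
Proof.
move=> al0 al1 r1 C1 dl.
have C0 : 0 < C by lra.
have r0 : 0 < r by lra.
rewrite /error_rate; have [r3|r3|r3] := ltgtP r (3 - al).
- have dl0 : 0 < dl by rewrite lt_min subr_gt0 r3 divr_gt0.
  have b0 : 0 < 1 + C * (1 + dl^-1).
    by rewrite addr_gt0// mulr_gt0// addr_gt0// invr_gt0.
  exists (C * (1 + C * (1 + dl^-1))); first exact: mulr_gt0.
  move=> M t m gm rm /andP[m1 mM].
  rewrite [leRHS](_ : _ = C * M%:R `^ (- r) * t m `^ (al - 1) * (1 + C * (1 + dl^-1))); last ring.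
  have t1 : 0 < t 1%N by apply: (mesh_pos rm); rewrite (leq_trans m1 mM).
  apply: ler_pM => //.
  + by rewrite mulr_ge0 ?powR_ge0// ltW.
  + apply: le_trans ler01 _; rewrite /bphi lerDl big_nat_cond sumr_ge0// => i.
    rewrite andbT => /andP[i1 im]; rewrite mulr_ge0 ?powR_ge0// divr_ge0//.
      rewrite subr_ge0; case: i i1 im => // i _ im; apply: ltW.
      by case: rm => _ h _ _ _; apply: h; exact: leq_trans mM.
    by apply/ltW/(mesh_pos rm); rewrite i1 (leq_trans _ mM).
  + by rewrite ler_wpM2r ?powR_ge0//; exact: gm.
  + exact: (bphi_bounded C1 rm dl0 mM).
- have dlE : dl = - (r - (3 - al)).
    by rewrite /dl min_l//; [ring|lra].
  set q := r - (3 - al) in dlE.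
  have q0 : 0 < q < r by rewrite /q; apply/andP; split; lra.
  have pE : 1 - q / r = (3 - al) / r by rewrite /q; field; rewrite gt_eqF.
  set b := 1 + C `^ (q / r) / (q / r).
  have b0 : 0 < b.
    by rewrite ltr_pwDl// divr_ge0 ?powR_ge0// divr_ge0 ?(ltW r0)//; case/andP: q0; move/ltW.
  exists (C `^ ((3 - al) / r) * b); first by rewrite mulr_gt0 ?powR_gt0.
  move=> M t m gm rm m1M.
  have h := bphi_growth C1 rm r1 q0 m1M; rewrite -dlE in h.
  have t1 : 0 < t 1%N.
    by apply: (mesh_pos rm); case/andP: m1M => *; rewrite (leq_trans _ (_ : m <= M)%N).
  have tm := mesh_pos rm m1M.
  have w0 : 0 <= t 1%N * t m `^ (al - 1) by rewrite mulr_ge0 ?powR_ge0// ltW.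
  apply: (le_trans (ler_wpM2l w0 h)); rewrite -/b.
  have E1 : t 1%N `^ ((3 - al) / r) = t 1%N * t 1%N `^ (- (q / r)).
    by rewrite -pE powRD_pos// powRr1// ltW.
  have E2 : t m `^ (al - (3 - al) / r) = t m `^ (al - 1) * t m `^ (q / r).
    by rewrite -powRD_pos//; congr (_ `^ _); rewrite -pE; ring.
  have -> : (t m / t 1%N) `^ (q / r) = t m `^ (q / r) * t 1%N `^ (- (q / r)).
    by rewrite powRM ?invr_ge0 ?(ltW t1) ?(ltW tm)// -(powR_inv1 (ltW t1)) -powRrM mulN1r.
  rewrite [leLHS](_ : _ = t 1%N `^ ((3 - al) / r) * (b * t m `^ (al - (3 - al) / r))); last first.
    by rewrite E1 E2; ring.
  rewrite [leRHS](_ : _ = C `^ ((3 - al) / r) * M%:R `^ (al - 3) *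
     (b * t m `^ (al - (3 - al) / r))); last ring.
  rewrite ler_wpM2r ?mulr_ge0 ?powR_ge0 ?(ltW b0)//.
  have e0 : 0 <= (3 - al) / r by rewrite divr_ge0 ?(ltW r0)//; lra.
  apply: (le_trans (powR_mono e0 (ltW t1) gm)).
  rewrite powRM ?powR_ge0 ?(ltW C0)// -powRrM.
  by rewrite (_ : - r * ((3 - al) / r) = al - 3)//; field; rewrite gt_eqF.
- have dlE : dl = 0 by rewrite /dl min_l r3; [ring|lra].
  exists (C * 2); first by rewrite mulr_gt0.
  move=> M t m gm rm m1M.
  have h := bphi_log rm m1M; rewrite -dlE in h.
  have M1 : (0 < M)%N by case/andP: m1M; exact: leq_trans.
  have t1 : 0 < t 1%N by apply: (mesh_pos rm); rewrite M1.
  have w0 : 0 <= t 1%N * t m `^ (al - 1) by rewrite mulr_ge0 ?powR_ge0// ltW.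
  apply: (le_trans (ler_wpM2l w0 h)).
  have L0 : 0 <= ln (t m / t 1%N).
    apply: ln_ge0; rewrite ler_pdivlMr// mul1r.
    by case/andP: m1M => m1 mM; case: rm => _ inc _ _ _; exact: (increasing_le inc).
  rewrite [leRHS](_ : _ = C * M%:R `^ (al - 3) * t m `^ (al - 1) *
    (2 + 2 * ln (t m / t 1%N))); last ring.
  apply: ler_pM => //; [lra| |lra].
  rewrite ler_wpM2r ?powR_ge0//; by move: gm; rewrite r3 opprB.
Qed.

(** * The exact solution as a family of real functions of time *)

Section solution_paths.
Context {R : realType} {d : nat}.
Local Notation V := 'rV[R]_d.
Local Notation mu := (lebesgue_rV R d).
Variables (Om : set V) (T : R).
Implicit Types (u v w : R -> V -> R).

Lemma eq_L2_deriv u v w : (forall t : R, 0 < t <= T -> forall x, Om x -> u t x = v t x) ->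
  L2_deriv Om T v w -> L2_deriv Om T u w.
Proof.
move=> uv vw t tT; have [wL cw] := vw t tT; split=> //.
apply: cvg_trans cw; apply: near_eq_cvg; rewrite near_withinE; apply: nearW => s.
rewrite /= in_itv/= => sT; rewrite /L2norm; congr (Lnorm _ _ (EFin \o _)).
apply/funext => x; rewrite !patchE; case: ifPn => //; rewrite inE => Ox.
by rewrite (uv s sT)// (uv t tT).
Qed.

Lemma L2_deriv_n1 u w : L2_deriv_n Om T 1 u w ->
  (forall t : R, 0 < t <= T -> in_L2 Om (u t)) /\ L2_deriv Om T u w.
Proof.
move=> [v hv vw]; split.
  move=> t tT; have [vL uv] := hv t tT.
  by apply: eq_in_L2 vL => x Ox; rewrite uv.
by apply: eq_L2_deriv vw => t tT; case: (hv t tT).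
Qed.

Lemma L2_deriv_n3 u w3 : L2_deriv_n Om T 3 u w3 -> exists w1 w2,
  [/\ L2_deriv Om T u w1, L2_deriv Om T w1 w2 & L2_deriv Om T w2 w3].
Proof.
move=> [w2 [w1 h1 h2] h3]; exists w1, w2; split=> //.
by have [] : (forall t : R, 0 < t <= T -> in_L2 Om (u t)) /\ L2_deriv Om T u w1 by exact: L2_deriv_n1.
Qed.

Lemma L2_deriv_in_L2 v w t : L2_deriv Om T v w -> 0 < t <= T -> in_L2 Om (w t).
Proof. by move=> h /h[]. Qed.

Lemma ae_eq_L2dot f g h : measurable Om -> in_L2 Om f -> in_L2 Om g -> in_L2 Om h ->
  f = g %[ae mu in Om] -> L2dot Om f h = L2dot Om g h.
Proof.
move=> mOm fL gL hL fg; rewrite !L2dotE /Rintegral; congr fine.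
apply: ae_eq_integral => //.
- by apply/measurable_EFinP; apply: measurable_funM; exact: in_L2_measurable.
- by apply/measurable_EFinP; apply: measurable_funM; exact: in_L2_measurable.
- apply: filterS fg => x fgx _ /=; rewrite !patchE; case: ifPn => //.
  by rewrite inE => /fgx ->.
Qed.

Variables (al Cu : R) (u du w1 w3 : R -> V -> R).
Hypotheses (al0 : 0 < al) (al1 : al < 1) (T0 : 0 < T).
Hypothesis u0L : in_L2 Om (u 0).
Hypothesis cu0 : L2norm Om (u s \- u 0) @[s --> 0^'+] --> 0%E.
Hypothesis udu : L2_deriv_n Om T 1 u du.
Hypothesis uw1 : L2_deriv_n Om T 1 u w1.
Hypothesis uw3 : L2_deriv_n Om T 3 u w3.
Hypothesis w1b : forall t : R, 0 < t <= T -> (L2norm Om (w1 t) <= (Cu * (1 + t `^ (al - 1%:R)))%:E)%E.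
Hypothesis w3b : forall t : R, 0 < t <= T -> (L2norm Om (w3 t) <= (Cu * (1 + t `^ (al - 3%:R)))%:E)%E.

(** On ]0, T] the sum 1 + x^(alpha-l) is at most (1 + T^(l-alpha)) x^(alpha-l); the constant serves
    l = 1 and l = 3 at once. *)
Definition regularity_const : R := `|Cu| * (2 + T `^ (1 - al) + T `^ (3 - al)).

Lemma regularity_const_ge0 : 0 <= regularity_const.
Proof. by rewrite mulr_ge0// !addr_ge0 ?powR_ge0. Qed.

Let pairing_rate (w : R -> V -> R) (z : V -> R) (l x : R) : in_L2 Om z ->
  l = 1 \/ l = 3 -> 0 < x <= T -> in_L2 Om (w x) ->
  (L2norm Om (w x) <= (Cu * (1 + x `^ (al - l)))%:E)%E ->
  `|L2dot Om (w x) z| <= regularity_const * Num.sqrt (L2dot Om z z) * x `^ (al - l).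
Proof.
move=> zL l13 /andP[x0 xT] wL; rewrite (L2norm_sqrt wL) lee_fin => wb.
apply: (le_trans (L2_cauchy_schwarz wL zL)).
rewrite mulrAC ler_wpM2r ?sqrtr_ge0//; apply: (le_trans wb).
apply: (@le_trans _ _ (`|Cu| * (1 + x `^ (al - l)))).
  by rewrite ler_wpM2r ?ler_norm// addr_ge0 ?powR_ge0.
rewrite -mulrA ler_wpM2l// 2!mulrDl.
have xl : 0 < x `^ (al - l) by rewrite powR_gt0.
have h : 1 <= T `^ (l - al) * x `^ (al - l).
  have l0 : 0 <= l - al by move: (al1) => ?; case: l13 => ->; lra.
  have := powR_mono l0 (ltW x0) xT => h.
  have E : x `^ (l - al) * x `^ (al - l) = 1 by rewrite -powRD_pos// (_ : _ + _ = 0) ?powRr0//; ring.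
  by rewrite -E ler_wpM2r// ltW.
have h1 : 0 <= T `^ (1 - al) * x `^ (al - l) by rewrite mulr_ge0 ?powR_ge0.
have h3 : 0 <= T `^ (3 - al) * x `^ (al - l) by rewrite mulr_ge0 ?powR_ge0.
by case: l13 h xl h1 h3 => ->; lra.
Qed.

(** The derivative [du] in the equation, the bounded [w1] and the first derivative in the chain
    ending with [w3] are given separately; their pairings with z are derivatives of one real
    function and therefore coincide. *)
Lemma solution_path (z : V -> R) : in_L2 Om z ->
  let f := fun s => L2dot Om (u s) z in
  let A := regularity_const * Num.sqrt (L2dot Om z z) in
  exists f1 f2 f3 : R -> R,
  [/\ f @ 0^'+ --> f 0 /\ f @ T^'- --> f T,
      [/\ forall x : R, x \in `]0, T[ -> is_derive x 1 f (f1 x),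
          forall x : R, x \in `]0, T[ -> is_derive x 1 f1 (f2 x) &
          forall x : R, x \in `]0, T[ -> is_derive x 1 f2 (f3 x)],
      forall x : R, x \in `]0, T[ -> `|f1 x| <= A * x `^ (al - 1),
      forall x : R, x \in `]0, T[ -> `|f3 x| <= A * x `^ (al - 3) &
      forall x : R, x \in `]0, T[ -> f1 x = L2dot Om (du x) z].
Proof.
move=> zL f A.
have [uL ud] := L2_deriv_n1 udu; have [_ u1] := L2_deriv_n1 uw1.
have [v1 [v2 [uv1 v12 v23]]] := L2_deriv_n3 uw3.
have inT (x : R) : x \in `]0, T[ -> 0 < x <= T.
  by rewrite in_itv/= => /andP[-> /ltW].
have D (x : R) : x \in `]0, T[ -> is_derive x 1 f (L2dot Om (v1 x) z).
  by move=> xI; exact: (pairing_is_derive zL uL uv1).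
exists (fun x => L2dot Om (v1 x) z), (fun x => L2dot Om (v2 x) z), (fun x => L2dot Om (w3 x) z).
have uniq w : L2_deriv Om T u w -> forall x, x \in `]0, T[ -> L2dot Om (v1 x) z = L2dot Om (w x) z.
  move=> uw x xI; have d1 := D x xI; have d2 := pairing_is_derive zL uL uw xI.
  by rewrite -(@derive_val _ _ _ _ _ _ _ d1) -(@derive_val _ _ _ _ _ _ _ d2).
split.
- split; first exact: pairing_right_continuous T0 zL u0L uL cu0.
  exact: (pairing_left_continuous zL uL uv1).
- split=> // x xI.
  + by apply: (pairing_is_derive zL _ v12 xI) => s; exact: L2_deriv_in_L2 uv1.
  + by apply: (pairing_is_derive zL _ v23 xI) => s; exact: L2_deriv_in_L2 v12.
- move=> x xI; rewrite (uniq _ u1 x xI).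
  apply: (pairing_rate zL (or_introl (erefl _)) (inT x xI)); last exact: w1b (inT x xI).
  exact: L2_deriv_in_L2 u1 (inT x xI).
- move=> x xI.
  apply: (pairing_rate zL (or_intror (erefl _)) (inT x xI)); last exact: w3b (inT x xI).
  exact: L2_deriv_in_L2 v23 (inT x xI).
- exact: uniq ud.
Qed.

End solution_paths.

(** Extends [truncation_bound] to the rows m = 1, 2, where boundedness suffices: there the Caputo
    integral and each discrete increment are estimated separately. *)
Lemma truncation_residual {R : realType} (al C r dl : R) :
  0 < al -> al < 1 -> 1 <= C -> 1 <= r -> dl <= al / 4 -> r + dl <= 3 - al ->
  exists2 K : R, 0 <= K & forall M m t (A T : R) (f f1 f2 f3 : R -> R),
  regular_mesh C r M t -> (1 <= m <= M)%N -> t m <= T -> 0 <= A ->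
  f @ 0^'+ --> f 0 -> f @ T^'- --> f T ->
  (forall x : R, x \in `]0, T[ -> is_derive x 1 f (f1 x)) ->
  (forall x : R, x \in `]0, T[ -> is_derive x 1 f1 (f2 x)) ->
  (forall x : R, x \in `]0, T[ -> is_derive x 1 f2 (f3 x)) ->
  (forall x : R, x \in `]0, T[ -> `|f1 x| <= A * x `^ (al - 1)) ->
  (forall x : R, x \in `]0, T[ -> `|f3 x| <= A * x `^ (al - 3)) ->
  (@lebesgue_measure R).-integrable `]0, t m[ (EFin \o (fun s => (t m - s) `^ (- al) * f1 s)) ->
  `|\int[@lebesgue_measure R]_(s in `]0, t m[) ((t m - s) `^ (- al) * f1 s)
     - \sum_(i < m) row_coef al t m i * (f (t i.+1) - f (t i))| <=
  K * (if (m < 3)%N then 1 else m%:R `^ (- (r + dl))) * A.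
Proof.
move=> al0 al1 C1 r1 dla rdl.
have [K1 K10 H1] := truncation_bound al0 al1 C1 r1 dla rdl.
have [K2 K21 H2] := row_crude 3 al0 al1 C1 r1.
have K20 : 0 <= K2 by lra.
have a0 : 0 <= al^-1 by rewrite invr_ge0 ltW.
have b0 : 0 <= (1 - al)^-1 by rewrite invr_ge0 subr_ge0 ltW.
pose K3 := al^-1 + (1 - al)^-1 + 2 * (K2 * (al^-1 + K2)).
have K30 : 0 <= K3 by rewrite /K3 !addr_ge0// !mulr_ge0// addr_ge0.
exists (K1 + K3); first exact: addr_ge0.
move=> M m t A T f f1 f2 f3 rm /andP[m1 mM] tT A0 c0 cT d1 d2 d3 b1 b3 ig.
have t1 : 0 < t 1%N by apply: (mesh_pos rm); rewrite (leq_trans m1 mM).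
case: ltnP => m3; last first.
  have m3M : (3 <= m <= M)%N by rewrite m3.
  apply: (le_trans (H1 M m t A T f f1 f2 f3 rm m3M tT A0 c0 cT d1 d2 d3 b1 b3 ig)).
  by rewrite mulrAC; do 2 (apply: ler_wpM2r; rewrite ?powR_ge0//); rewrite lerDl.
rewrite mulr1.
have m1M : (1 <= m <= M)%N by rewrite m1.
have [rc _ _ tmK] := H2 M t rm m m1M m3.
have tm0 : 0 < t m by exact: (mesh_pos rm).
have h1 := caputo_integral_bound al0 al1 A0 b1 tm0 tT ig.
have inc j : (j < M)%N -> t j < t j.+1 by case: rm => _ + _ _ _; exact.
have tz : t 0%N = 0 by case: rm.
have h2 (i : 'I_m) : `|row_coef al t m i * (f (t i.+1) - f (t i))| <= K2 * (al^-1 + K2) * A.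
  rewrite normrM.
  have hf : `|f (t i.+1) - f (t i)| <= A * (al^-1 + K2) * t 1%N `^ al.
    case: i => -[|[|i]] im /=; last by have := leq_trans im m3.
      rewrite tz; have t1T : t 1%N <= T.
        by apply: le_trans tT; apply: (increasing_le inc).
      apply: (le_trans (path_increment0 al0 c0 cT d1 d2 b1 t1 t1T)).
      by rewrite ler_wpM2r ?powR_ge0// ler_wpM2l// lerDl.
    have E : m = 2%N by apply/eqP; rewrite eqn_leq im andbT.
    have t12 : t 1%N < t 2%N by apply: inc; rewrite -E.
    have t2T : t 2%N <= T by rewrite -E.
    apply: (le_trans (path_increment al1 A0 c0 cT d1 b1 t1 t12 t2T)).
    rewrite E in tmK.
    apply: (@le_trans _ _ (A * t 1%N `^ (al - 1) * (K2 * t 1%N))).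
      by rewrite ler_wpM2l ?mulr_ge0 ?powR_ge0//; lra.
    have -> : t 1%N `^ al = t 1%N `^ (al - 1) * t 1%N.
      by rewrite -{3}(powRr1 (ltW t1)) -powRD_pos// subrK.
    rewrite [leLHS](_ : _ = A * K2 * (t 1%N `^ (al - 1) * t 1%N)); last ring.
    by rewrite ler_wpM2r ?mulr_ge0 ?powR_ge0 ?(ltW t1)// ler_wpM2l// lerDr.
  have := ler_pM (normr_ge0 _) (normr_ge0 _) (rc i (ltn_ord i)) hf.
  have E : t 1%N `^ (- al) * t 1%N `^ al = 1 by rewrite -powRD_pos// addNr powRr0.
  move=> h; apply: (le_trans h); rewrite le_eqVlt; apply/orP; left; apply/eqP.
  by rewrite -[RHS]mulr1 -E; ring.
apply: (le_trans (ler_normB _ _)).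
have h3 : `|\sum_(i < m) row_coef al t m i * (f (t i.+1) - f (t i))| <=
    2 * (K2 * (al^-1 + K2) * A).
  apply: (le_trans (ler_norm_sum _ _ _)).
  apply: (le_trans (ler_sum _ (fun i _ => h2 i))).
  rewrite sumr_const card_ord -[leLHS]mulr_natl ler_wpM2r//; first by rewrite !mulr_ge0// addr_ge0.
  by rewrite ler_nat.
apply: (le_trans (lerD h1 h3)).
have : 0 <= K1 * A by rewrite mulr_ge0.
by rewrite /K3; lra.
Qed.

(** * The elliptic form and the error equation *)

Section elliptic_form.
Context {R : realType} {d : nat}.
Local Notation V := 'rV[R]_d.
Local Notation mu := (lebesgue_rV R d).
Local Notation E := ((V -> R) * ('I_d -> V -> R))%type.
Variables (Om : set V) (a : 'I_d -> V -> R) (c : V -> R).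
Hypothesis wa : forall k, bounded_weight Om (a k).
Hypothesis wc : bounded_weight Om c.
Hypothesis a0 : forall k x, Om x -> 0 <= a k x.
Hypothesis c0 : forall x, Om x -> 0 <= c x.

Definition elliptic_form (x y : E) : R :=
  \sum_(k < d) \int[mu]_(z in Om) (a k z * x.2 k z * y.2 k z)
  + \int[mu]_(z in Om) (c z * x.1 z * y.1 z).

Lemma elliptic_form_lin (b : R) (x y z : E) :
  H10 Om x.1 x.2 -> H10 Om y.1 y.2 -> H10 Om z.1 z.2 ->
  elliptic_form (fun p => b * x.1 p + y.1 p, fun k p => b * x.2 k p + y.2 k p) z =
  b * elliptic_form x z + elliptic_form y z.
Proof.
move=> [x1 x2 _] [y1 y2 _] [z1 z2 _]; rewrite /elliptic_form.
have lin w f g h : bounded_weight Om w -> in_L2 Om f -> in_L2 Om g -> in_L2 Om h ->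
    \int[mu]_(p in Om) (w p * (b * f p + g p) * h p) =
    b * (\int[mu]_(p in Om) (w p * f p * h p)) + \int[mu]_(p in Om) (w p * g p * h p).
  move=> bw fL gL hL.
  have := @L2dot_lin _ _ Om b (fun p => w p * f p) (fun p => w p * g p) h
    (in_L2_weight bw fL) (in_L2_weight bw gL) hL.
  rewrite /L2dot => <-; apply: eq_Rintegral => p _; ring.
rewrite (lin c)// mulrDr addrACA; congr (_ + _).
rewrite mulr_sumr -big_split/=; apply: eq_bigr => k _; exact: lin.
Qed.

Lemma elliptic_form_sym (x y : E) : elliptic_form x y = elliptic_form y x.
Proof.
rewrite /elliptic_form; congr (_ + _).
  by apply: eq_bigr => k _; apply: eq_Rintegral => p _; ring.
by apply: eq_Rintegral => p _; ring.
Qed.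

Lemma elliptic_form_ge0 (x : E) : 0 <= elliptic_form x x.
Proof.
apply: addr_ge0; last first.
  by apply: Rintegral_ge0 => p Op; rewrite -mulrA mulr_ge0 ?c0// -expr2 sqr_ge0.
apply: sumr_ge0 => k _; apply: Rintegral_ge0 => p Op.
by rewrite -mulrA mulr_ge0 ?a0// -expr2 sqr_ge0.
Qed.

End elliptic_form.

Lemma L2dot0l {R : realType} {d : nat} (Om : set 'rV[R]_d) (w : 'rV[R]_d -> R) :
  in_L2 Om w -> L2dot Om (fun=> 0) w = 0.
Proof.
move=> wL; have := L2dot_lin (-1) (in_L2_cst0 Om) (in_L2_cst0 Om) wL.
rewrite (_ : (fun x => _) = fun=> 0); last by apply/funext => x; rewrite mulr0 addr0.
lra.
Qed.

Lemma L2dot_sum {R : realType} {d : nat} (Om : set 'rV[R]_d) (n : nat)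
    (b : nat -> R) (F : nat -> 'rV[R]_d -> R) (w : 'rV[R]_d -> R) :
  (forall i, (i < n)%N -> in_L2 Om (F i)) -> in_L2 Om w ->
  in_L2 Om (fun x => \sum_(i < n) b i * F i x) /\
  L2dot Om (fun x => \sum_(i < n) b i * F i x) w = \sum_(i < n) b i * L2dot Om (F i) w.
Proof.
move=> FL wL; elim: n FL => [|n IH] FL.
  have -> : (fun x => \sum_(i < 0) b i * F i x) = fun=> 0.
    by apply/funext => x; rewrite big_ord0.
  split; first exact: in_L2_cst0.
  by rewrite big_ord0 L2dot0l.
have [L1 E1] := IH (fun i h => FL i (leqW h)).
have -> : (fun x => \sum_(i < n.+1) b i * F i x) =
    fun x => b n * F n x + (fun x => \sum_(i < n) b i * F i x) x.
  by apply/funext => x; rewrite big_ord_recr/= addrC.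
split; first by apply: in_L2_lin => //; exact: FL.
rewrite (L2dot_lin _ (FL n (ltnSn n)) L1 wL) E1 big_ord_recr/= addrC//.
Qed.

Section error_row.
Context {R : realType} {d : nat}.
Local Notation V := 'rV[R]_d.
Variables (Om : set V) (a : 'I_d -> V -> R) (c : V -> R).
Variables (al : R) (f : R -> V -> R).
Hypotheses (al0 : 0 < al) (al1 : al < 1).
Let Gam := Gamma (1 - al).

                                                                           
                                                                     
(** Subtracting the two weak formulations cancels f. Applied pointwise in x, [delta_t] is a finite
    linear combination of the U^i, so it commutes with the pairing against w. *)
Lemma error_row_identity t (U : nat -> V -> R) (u du : R -> V -> R) (g : 'I_d -> V -> R)
    (G : 'I_d -> V -> R) m D w h :
  t 0%N = 0 -> (forall j, (j < m)%N -> t j < t j.+1) -> (1 <= m)%N ->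
  (forall j, (j <= m)%N -> in_L2 Om (U j)) ->
  L2_caputo Om al du (t m) D ->
  (forall w h, H10 Om w h ->
     L2dot Om D w + elliptic_form Om a c (u (t m), g) (w, h) = L2dot Om (f (t m)) w) ->
  (forall w h, H10 Om w h ->
     L2dot Om (fun x => delta_t al t (U ^~ x) m) w + elliptic_form Om a c (U m, G) (w, h)
     = L2dot Om (f (t m)) w) ->
  H10 Om w h ->
  Gam * (elliptic_form Om a c (u (t m), g) (w, h) - elliptic_form Om a c (U m, G) (w, h)) =
  \sum_(i < m) row_coef al t m i * (L2dot Om (U i.+1) w - L2dot Om (U i) w) -
  \int[@lebesgue_measure R]_(s in `]0, t m[) ((t m - s) `^ (- al) * L2dot Om (du s) w).
Proof.
move=> t0 inc m0 UL [_ cap] wu wU wh.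
have wL : in_L2 Om w by case: wh.
have [_ capw] := cap w wL.
have G0 : 0 < Gam by apply: Gamma_gt0; rewrite subr_gt0 al1 gerBl ltW.
have al01 : 0 < al < 1 by rewrite al0.
have := wU w h wh; have := wu w h wh; rewrite capw -/Gam => <-.
have dL (i : nat) : (i < m)%N -> in_L2 Om (fun x => (-1) * U i x + U i.+1 x).
  by move=> im; apply: in_L2_lin; apply: UL => //; exact: ltnW.
have [sL sE] := @L2dot_sum R d Om m (row_coef al t m) (fun i x => (-1) * U i x + U i.+1 x) w dL wL.
have -> : (fun x => delta_t al t (U ^~ x) m) =
    (fun x => Gam^-1 * (fun x => \sum_(i < m) row_coef al t m i * ((-1) * U i x + U i.+1 x)) x + 0).
  apply/funext => x; rewrite addr0 (delta_t_coef (U ^~ x) al01 m0 t0 inc); congr (_ * _).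
  by apply: eq_bigr => i _; ring.
rewrite (L2dot_lin _ sL (in_L2_cst0 Om) wL) (L2dot0l wL) addr0 sE.
have -> : \sum_(i < m) row_coef al t m i * L2dot Om (fun x => -1 * U i x + U i.+1 x) w =
    \sum_(i < m) row_coef al t m i * (L2dot Om (U i.+1) w - L2dot Om (U i) w).
  apply: eq_bigr => i _; congr (_ * _).
  rewrite (L2dot_lin _ (UL _ (ltnW (ltn_ord i))) (UL _ (ltn_ord i)) wL); ring.
set S := \sum_(i < m) _; set I := Rintegral _ _ _; set X := elliptic_form _ _ _ _ _.
set Y := elliptic_form _ _ _ _ _ => h1.
have -> : Y - X = Gam^-1 * (S - I) by rewrite mulrBr; lra.
by rewrite mulrA divff ?mul1r// gt_eqF.
Qed.

End error_row.

(** * Assembling the error estimate *)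

Theorem theorem5p2 (R : realType) (alpha : R) (halpha : 0 < alpha < 1) :
  exists2 sigma_star : R, 0 < sigma_star < 1 &
  forall (d : nat) (Om : set 'rV[R]_d) (a : 'I_d -> 'rV[R]_d -> R)
    (c : 'rV[R]_d -> R) (T : R) (f : R -> 'rV[R]_d -> R) (u0 : 'rV[R]_d -> R)
    (u : R -> 'rV[R]_d -> R) (r : R) (K : nat) (Cmesh Cu : R),
  (1 <= d <= 3)%N ->
  bounded_lipschitz_domain Om ->
  (forall k, {within closure Om, continuous (a k)}) ->
  {within closure Om, continuous c} ->
  (forall k x, closure Om x -> 0 < a k x) ->
  (forall x, closure Om x -> 0 <= c x) ->
  0 < T ->
  in_L2 Om u0 ->
  (forall t, 0 < t <= T -> in_L2 Om (f t)) ->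
  unique_parabolic_solution Om a c alpha T f u0 u ->
  (forall l : nat, l = 1%N \/ l = 3%N ->
     exists2 w, L2_deriv_n Om T l u w &
       forall t, 0 < t <= T ->
         (L2norm Om (w t) <= (Cu * (1 + t `^ (alpha - l%:R)))%:E)%E) ->
  1 <= r -> (1 <= K)%N ->
  exists2 C : R, 0 < C &
  forall (M : nat) (t : nat -> R) (U : nat -> 'rV[R]_d -> R),
    (1 <= M)%N ->
    graded_mesh T r Cmesh M t ->
    sigma_monotone M t ->
    (forall j, (K.+1 <= j <= M)%N -> 0 <= mesh_sigma t j <= sigma_star) ->
    discrete_solution Om a c alpha f u0 M t U ->
    forall m, (1 <= m <= M)%N ->
      (L2norm Om (fun x => u (t m) x - U m x)%R
         <= (C * error_rate alpha r M t m)%:E)%E.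
Proof.
have /andP[al0 al1] := halpha.
exists (1 / 1000); first by apply/andP; split; lra.
move=> d Om a c T f u0 u r K Cmesh Cu _ [oOm _ _ bOm _] ca cc a_gt0 c_ge0 T0 _ _
  [[u0L u0E cu0 [du udu equ]] _] reg r1 _.
have subO x : Om x -> closure Om x by exact: subset_closure.
have mOm : measurable Om by exact: open_measurable_rV.
have wa k : bounded_weight Om (a k) by exact: closure_weight.
have wc : bounded_weight Om c by exact: closure_weight.
have a0 k x : Om x -> 0 <= a k x by move=> /subO /a_gt0 h; exact: ltW.
have c0 x : Om x -> 0 <= c x by move=> /subO /c_ge0.
have [w1 uw1 w1b] := reg 1%N (or_introl (erefl _)).
have [w3 uw3 w3b] := reg 3%N (or_intror (erefl _)).
have [uL _] := L2_deriv_n1 udu.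
pose C := 1 + `|Cmesh|.
have C1 : 1 <= C by rewrite lerDl.
have CC : Cmesh <= C by rewrite (le_trans (ler_norm _))// lerDr.
(* The truncation order is r + dl = min(3-alpha, r + alpha/4), and dl has the sign of 3-alpha-r,
   which separates the three rates. *)
pose dl := Num.min (3 - alpha - r) (alpha / 4).
have dla : dl <= alpha / 4 by rewrite /dl ge_min lexx orbT.
have rdl : r + dl <= 3 - alpha.
  have : dl <= 3 - alpha - r by rewrite /dl ge_min lexx.
  lra.
have rdl0 : 0 <= r + dl.
  have : - r <= dl by rewrite /dl le_min; apply/andP; split; lra.
  lra.
have [K1 K10 hK1] := truncation_residual al0 al1 C1 r1 dla rdl.
pose A0 := regularity_const T alpha Cu.
have A00 : 0 <= A0 by exact: regularity_const_ge0.
have A1 : 0 <= K1 * A0 by exact: mulr_ge0.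
have [Kf Kf0 hKf] := @abstract_error_estimate R alpha C r dl (K1 * A0) K al0 al1 C1 r1 dla A1.
have [B B0 hB] := barrier_error_rate al0 al1 r1 C1.
have G0 : 0 < Gamma (1 - alpha) by apply: Gamma_gt0; rewrite subr_gt0 al1 gerBl ltW.
exists ((Kf + 1) * B); first by rewrite mulr_gt0// ltr_wpDl.
move=> M t U M1 gm sm sb [U0L U0E eqU] m mM.
have rm := graded_regular C1 CC gm sm.
have close := sigma_steps_close gm sb.
have t0 : t 0%N = 0 by case: gm.
have tM : t M = T by case: gm.
have inc j : (j < M)%N -> t j < t j.+1 by case: rm => _ + _ _ _; exact.
have tT j : (1 <= j <= M)%N -> 0 < t j <= T.
  move=> jM; rewrite (mesh_pos rm jM)/= -tM.
  by case/andP: jM => _ jM; exact: (increasing_le inc).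
pose form := elliptic_form Om a c.
(* The Caputo derivatives and gradients are given only existentially at each time; they are chosen
   once for all, with a dummy value outside ]0, T]. *)
have [S hS] : {S : R -> ('rV[R]_d -> R) * ('I_d -> 'rV[R]_d -> R) &
    forall s : R, 0 < s <= T -> [/\ L2_caputo Om alpha du s (S s).1, H10 Om (u s) (S s).2 &
      forall w h, H10 Om w h ->
        L2dot Om (S s).1 w + form (u s, (S s).2) (w, h) = L2dot Om (f s) w]}.
  apply: (@boolp.choice R _ (fun s p => 0 < s <= T -> [/\ L2_caputo Om alpha du s p.1,
      H10 Om (u s) p.2 & forall w h, H10 Om w h ->
        L2dot Om p.1 w + form (u s, p.2) (w, h) = L2dot Om (f s) w])) => s; have [sT|nT] := pselect (0 < s <= T); last first.
    by exists (fun=> 0, fun _ _ => 0) => /nT.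
  by have [D capD [g gH gw]] := equ s sT; exists (D, g).
have [G hG] : {G : nat -> 'I_d -> 'rV[R]_d -> R &
    forall j, (1 <= j <= M)%N -> H10 Om (U j) (G j) /\
      forall w h, H10 Om w h ->
        L2dot Om (fun x => delta_t alpha t (U ^~ x) j) w + form (U j, G j) (w, h) =
        L2dot Om (f (t j)) w}.
  apply: (@boolp.choice nat _ (fun j g => (1 <= j <= M)%N -> H10 Om (U j) g /\
      forall w h, H10 Om w h ->
        L2dot Om (fun x => delta_t alpha t (U ^~ x) j) w + form (U j, g) (w, h) =
        L2dot Om (f (t j)) w)) => j; have [jM|nM] := pselect (1 <= j <= M)%N; last first.
    by exists (fun _ _ => 0) => /nM.
  by have [g gH gw] := eqU j jM; exists g.
have UL j : (j <= M)%N -> in_L2 Om (U j).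
  case: j => [//|j] jM; have [[] //] := hG j.+1 jM.
pose E := (('rV[R]_d -> R) * ('I_d -> 'rV[R]_d -> R))%type.
(* The error paired with its gradient. At j = 0 it is zero by definition, since u(0) and U^0 agree
   only almost everywhere; [dotE] shows that the inner products do not notice the difference. *)
pose e (j : nat) : E := if (1 <= j <= M)%N then
  (fun x => (-1) * U j x + u (t j) x, fun k x => (-1) * G j k x + (S (t j)).2 k x) else 0.
pose D (x : E) := H10 Om x.1 x.2.
pose dot (x y : E) := L2dot Om x.1 y.1.
(* The factor Gamma(1-alpha) clears the one in [delta_t], so that the rows carry the bare
   [row_coef]. *)
pose frm (x y : E) := Gamma (1 - alpha) * form x y.
pose rho (j : nat) := K1 * A0 * (if (j < 3)%N then 1 else j%:R `^ (- (r + dl))).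
have D_lin (b : R) x y : D x -> D y -> D (b *: x + y) by exact: H10_lin.
have DL2 x : D x -> in_L2 Om x.1 by case.
have D0 : D 0.
  have D1 : D (U 1%N, G 1%N) by have [|] := hG 1%N; rewrite ?M1.
  by rewrite -(addNr (U 1%N, G 1%N)) -scaleN1r; exact: D_lin.
have DE j : (1 <= j <= M)%N -> D (fun x => (-1) * U j x + u (t j) x,
    fun k x => (-1) * G j k x + (S (t j)).2 k x).
  by move=> jM; have [HU _] := hG j jM; have [_ Hu _] := hS _ (tT j jM); exact: H10_lin.
have De j : D (e j) by rewrite /e; case: ifPn => // jM; exact: DE.
have dotE j v : (j <= M)%N -> D v ->
    dot (e j) v = L2dot Om (u (t j)) v.1 - L2dot Om (U j) v.1.
  move=> jM vD; have vL := DL2 _ vD.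
  case: j jM => [_|j jM].
    rewrite /dot /e/= (L2dot0l vL) t0; apply/esym/eqP; rewrite subr_eq0; apply/eqP.
    apply: ae_eq_L2dot => //.
    by apply: filterS2 u0E U0E => x h1 h2 Ox; rewrite h1// h2.
  have jM' : (1 <= j.+1 <= M)%N by rewrite jM.
  rewrite /dot /e jM' /= (L2dot_lin _ (UL _ jM) (uL _ (tT _ jM')) vL); ring.
have row j v : (1 <= j <= M)%N -> D v ->
    \sum_(i < j) row_coef alpha t j i * (dot (e i.+1) v - dot (e i) v) + frm (e j) v <=
    rho j * Num.sqrt (dot v v).
  move=> jM vD; have vL := DL2 _ vD; have /andP[j1 jM'] := jM.
  have [capj Hu wu] := hS _ (tT j jM); have [HU wU] := hG j jM.
  have incj i : (i < j)%N -> t i < t i.+1 by move=> ij; apply: inc; exact: leq_trans jM'.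
  have ULj i : (i <= j)%N -> in_L2 Om (U i) by move=> ij; apply: UL; exact: leq_trans jM'.
  have := error_row_identity al0 al1 t0 incj j1 ULj capj wu wU (vD : H10 Om v.1 v.2).
  have -> : frm (e j) v = Gamma (1 - alpha) * (form (u (t j), (S (t j)).2) (v.1, v.2) -
      form (U j, G j) (v.1, v.2)).
    rewrite /frm /e jM; congr (_ * _).
    have := @elliptic_form_lin R d Om a c wa wc (-1) (U j, G j) (u (t j), (S (t j)).2) (v.1, v.2) HU Hu vD.
    rewrite -/form; case: (v) => v1 v2 /= ->; ring.
  move=> ->.
  have [f1 [f2 [f3 [[p0 pT] [d1 d2 d3] b1 b3 f1E]]]] :=
    solution_path al1 T0 u0L cu0 udu uw1 uw3 w1b w3b vL.
  have tjT : t j <= T by case/andP: (tT j jM).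
  have f1d s : s \in `]0, t j[ -> f1 s = L2dot Om (du s) v.1.
    rewrite in_itv/= => /andP[s0 sj]; apply: f1E.
    by rewrite in_itv/= s0 (lt_le_trans sj).
  have [igd _] := capj.2 v.1 vL.
  have ig : (@lebesgue_measure R).-integrable `]0, t j[
      (EFin \o (fun s => (t j - s) `^ (- alpha) * f1 s)).
    apply: eq_integrable igd => // s; rewrite inE/= => sI.
    by rewrite f1d.
  have IE : \int[lebesgue_measure]_(s in `]0, t j[) ((t j - s) `^ (- alpha) * L2dot Om (du s) v.1) =
      \int[lebesgue_measure]_(s in `]0, t j[) ((t j - s) `^ (- alpha) * f1 s).
    by apply: eq_Rintegral => s; rewrite inE/= => sI; rewrite f1d.
  rewrite IE.
  have AN0 : 0 <= regularity_const T alpha Cu * Num.sqrt (L2dot Om v.1 v.1).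
    by rewrite mulr_ge0 ?sqrtr_ge0.
  have := hK1 M j t _ T _ f1 f2 f3 rm jM tjT AN0 p0 pT d1 d2 d3 b1 b3 ig.
  set I := Rintegral _ _ _ => h.
  have -> : \sum_(i < j) row_coef alpha t j i * (dot (e i.+1) v - dot (e i) v) =
      \sum_(i < j) row_coef alpha t j i * (L2dot Om (u (t i.+1)) v.1 - L2dot Om (u (t i)) v.1) -
      \sum_(i < j) row_coef alpha t j i * (L2dot Om (U i.+1) v.1 - L2dot Om (U i) v.1).
    rewrite -sumrB; apply: eq_bigr => i _.
    have iM : (i.+1 <= M)%N by exact: leq_trans (ltn_ord i) jM'.
    by rewrite !dotE//; [ring|exact: ltnW].
  rewrite addrA subrK; apply: le_trans (ler_norm _) _; rewrite distrC.
  apply: (le_trans h); rewrite /rho -/A0 /dot le_eqVlt; apply/orP; left; apply/eqP; ring.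
have pow1 j : (3 <= j)%N -> j%:R `^ (- (r + dl)) <= 1 :> R.
  move=> j3; rewrite -[leRHS](powRr0 j%:R); apply: ler_powR; last by rewrite oppr_le0.
  by rewrite ler1n (leq_trans _ j3).
have est := hKf E D dot frm D_lin
  (fun b x y z xD yD zD => L2dot_lin b (DL2 x xD) (DL2 y yD) (DL2 z zD))
  (fun x y _ _ => L2dot_sym Om x.1 y.1) (fun x _ => L2dot_ge0 Om x.1).
have frm_lin (b : R) x y z : D x -> D y -> D z -> frm (b *: x + y) z = b * frm x z + frm y z.
  move=> xD yD zD; have h := @elliptic_form_lin R d Om a c wa wc b x y z xD yD zD.
  have {}h : form (b *: x + y) z = b * form x z + form y z by exact: h.
  by rewrite /frm h; ring.
have frm_sym x y : D x -> D y -> frm x y = frm y x.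
  by move=> _ _; rewrite /frm /form elliptic_form_sym.
have frm_ge0 x : D x -> 0 <= frm x x.
  by move=> _; rewrite mulr_ge0 ?(ltW G0)//; exact: elliptic_form_ge0.
have rho0 j : 0 <= rho j.
  by rewrite /rho mulr_ge0//; case: ifP => // _; exact: powR_ge0.
have rhoA j : (1 <= j <= M)%N -> rho j <= K1 * A0.
  move=> _; rewrite /rho -[leRHS]mulr1 ler_wpM2l//; case: ltnP => // j3; exact: pow1.
have rho_rate j : (3 <= j <= M)%N -> rho j <= K1 * A0 * j%:R `^ (- (r + dl)).
  by move=> /andP[j3 _]; rewrite /rho ltnNge j3.
have {est} est := est frm_lin frm_sym frm_ge0 M t e rho rm close (erefl _) De rho0 rhoA rho_rate row m mM.
have hm := DE m mM; have hmL := DL2 _ hm.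
have -> : (fun x => u (t m) x - U m x) = fun x => (-1) * U m x + u (t m) x.
  by apply/funext => x; ring.
rewrite (L2norm_sqrt hmL) lee_fin.
move: est; rewrite /dot /e mM /= => est; apply: (le_trans est).
have t1 : 0 < t 1%N by apply: (mesh_pos rm); rewrite M1.
have first_step : t 1%N <= C * M%:R `^ (- r).
  case: gm => _ _ _ [h _] _; move: h; rewrite /mesh_step/= t0 subr0 => h.
  by apply: (le_trans h); rewrite ler_wpM2r ?powR_ge0.
have X0 : 0 <= t 1%N * t m `^ (alpha - 1) * bphi t dl m.
  rewrite !mulr_ge0 ?powR_ge0 ?(ltW t1)//; apply: (le_trans ler01); apply: bphi_ge1 => i /andP[i1 im].
  have iM : (i <= M)%N by case/andP: mM => _; exact: leq_trans.
  split; first by apply: (mesh_pos rm); rewrite i1.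
  by apply: (increasing_le inc) => //; exact: leq_pred.
rewrite -(mulrA (Kf + 1) B); apply: (@le_trans _ _ ((Kf + 1) * (t 1%N * t m `^ (alpha - 1) * bphi t dl m))).
  by rewrite ler_wpM2r// lerDl.
by rewrite ler_wpM2l ?addr_ge0//; exact: hB.
Qed.
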